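(* Suppose $N^2\chi_N^{\min(1,\alpha/2)}$ is bounded as $N\to\infty$, and let $\mathbb P$ be a probability measure under which, for each $N$, $\eta^N_\bullet$ is the rescaled zero-range process with initial data satisfying $$\limsup_N\frac{\chi_N}{N^d}\log\mathbb E\Big[\exp\Big(\frac{N^d}{\chi_N}\gamma\,\mathcal H(\eta^N_0)\Big)\Big]<\infty\qquad\text{for all }\gamma<\alpha.$$ Then the following hold. (i) For any $u_\bullet\in\mathbb D\cap\mathcal R\subset L^\alpha([0,t_{\rm f}]\times\mathbb T^d)$, any open neighbourhood $\mathcal V$ of $u_\bullet$ in the norm topology of $L^\alpha([0,t_{\rm f}]\times\mathbb T^d)$ and any $z<\infty$, there exists an open neighbourhood $\mathcal U\ni u_\bullet$ in the topology of $\mathbb D$ such that $$\limsup_N\frac{\chi_N}{N^d}\log\mathbb P(\eta^N_\bullet\in\mathcal U\setminus\mathcal V)\le-z.$$ If instead $u_\bullet\in\mathbb D\setminus\mathcal R$, then for all $z<\infty$ there exists a $\mathbb D$-open set $\mathcal U\ni u_\bullet$ such that $$\limsup_N\frac{\chi_N}{N^d}\log\mathbb P(\eta^N_\bullet\in\mathcal U)\le-z.$$ (ii) Let $\mathbb Q$ be a probability measure with $$\limsup_N\frac{\chi_N}{N^d}H\big(\mathrm{Law}_{\mathbb Q}[\eta^N_\bullet]\,\big|\,\mathrm{Law}_{\mathbb P}[\eta^N_\bullet]\big)<\infty,$$ where $H(\cdot|\cdot)$ is the relative entropy of probability measures on $\mathbb D$. Suppose further that, $\mathbb Q$-almost surely,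 on a subsequence $N_k\to\infty$, $\eta^{N_k}_\bullet$ converges to a random variable $\eta_\bullet$ in the topology of $\mathbb D$. Then there exists a further subsequence $N'_k$ such that $\eta^{N'_k}_\bullet\to\eta_\bullet$ $\mathbb Q$-almost surely in the norm topology of $L^\alpha([0,t_{\rm f}]\times\mathbb T^d)$.
   Context: Fix $d\in\mathbb N$, $\alpha>1$, a time horizon $t_{\rm f}\in(0,\infty)$ and a sequence $\chi_N>0$. $\mathbb T^d$ is the unit torus, $\mathbb T^d_N=\{0,N^{-1},\dots,1-N^{-1}\}^d$ with periodic boundary conditions. For $x\in\mathbb T^d_N$, $c^N_x$ is the (half-open) box of side length $N^{-1}$ centred at $x$, and $e^N_x$ its indicator function. Functions on $\mathbb T^d_N$ are identified with functions on $\mathbb T^d$ constant on each $c^N_x$. The subscript $\ge0$ denotes nonnegative functions. State space: $X_N$ is the set of functions $\eta^N$ on $\mathbb T^d_N$ with values in $\{0,\chi_N,2\chi_N,\dots\}$, viewed in $L^1_{\ge0}(\mathbb T^d)$. Let $p^N(x,y)=\frac1{2d}$ if $y=x\pm e_i/N$ (mod 1), and $0$ otherwise. The rescaled zero-range process is the Markov jump process on $X_N$ with generator $$\mathcal L_NF(\eta^N)=\frac{dN^2}{\chi_N}\sum_{x,y\in\mathbb T^d_N}p^N(x,y)(\eta^N(x))^\alpha\big(F(\eta^{N,x,y})-F(\eta^N)\big),\qquad \eta^{N,x,y}=\eta^N-\chi_Ne^N_x+\chi_Ne^N_y .$$ Entropy: $\mathcal H(u)=\int_{\mathbb T^d}(u\log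 u-u+1)dx\in[0,\infty]$. Path space: let $\mathsf d$ be a metric on $L^1_{\ge0}(\mathbb T^d)$ inducing the weak-$\star$ topology (convergence of $\int\varphi u$ for all $\varphi\in C(\mathbb T^d)$). $\mathbb D=\mathbb D([0,t_{\rm f}],(L^1_{\ge0}(\mathbb T^d),\mathsf d))$ is the Skorokhod space; $\mathcal C\subset\mathbb D$ the continuous paths; $\mathcal R=\{u_\bullet\in\mathcal C: u^{\alpha/2}\in L^2([0,t_{\rm f}],\dot H^1(\mathbb T^d))\}$, which is contained in $L^\alpha([0,t_{\rm f}]\times\mathbb T^d)$. *)

(* Defs.v *)
From HB Require Import structures.
From mathcomp Require Import all_boot all_order all_algebra.
From mathcomp Require Import all_classical all_reals all_analysis.
From mathcomp Require Import measurable_realfun.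

Set Implicit Arguments.
Unset Strict Implicit.
Unset Printing Implicit Defensive.

Import Order.TTheory GRing.Theory Num.Theory.
Import numFieldNormedType.Exports.

Local Open Scope classical_set_scope.
Local Open Scope ring_scope.

(* Openness for the topology generated by the balls [set v | dist u v < e]. *)
Definition metric_open (R : realType) (T : Type) (dist : T -> T -> R)
    (U : set T) : Prop :=
  forall u, U u -> exists2 e : R, 0 < e & forall v, dist u v < e -> U v.

(* [fine] is harmless when [f] and [g] are in L^p, the norm being finite then. *)
Definition Lp_dist d (T : measurableType d) (R : realType)
    (mu : {measure set T -> \bar R}) (p : \bar R) (f g : T -> R) : R :=
  fine 'N[mu]_p [EFin \o (fun x => (f x - g x)%R)]%E.

Definition relative_entropy d (T : measurableType d) (R : realType)
    (nu mu : probability T R) : \bar R :=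
  if pselect (nu `<< mu) then
    (\int[nu]_x lne (Radon_Nikodym (charge_of_finite_measure nu) mu x))%E
  else +oo%E.

Section torus.
Variable R : realType.

(* The torus T^d = R^d / Z^d is represented by the fundamental domain [0, 1]^d:
   [torus_measure d], the d-fold product of the uniform law on [0, 1], lives on
   all of R^d but does not charge the complement of the cube, nor its
   boundary. *)
Notation torus_point d := (d.-tuple (measurableTypeR R)).

Definition cons_point d (x : measurableTypeR R * torus_point d) :
    torus_point d.+1 :=
  [the d.+1.-tuple _ of x.1 :: x.2].

Lemma measurable_cons_point d : measurable_fun [set: _] (@cons_point d).
Proof. exact: measurable_cons. Qed.

HB.instance Definition _ d := isMeasurableFun.Build _ _ _ _ (@cons_point d)
  (@measurable_cons_point d).

Fixpoint torus_measure (d : nat) : probability (torus_point d) R :=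
  match d with
  | 0 => \d_([tuple] : torus_point 0)
  | d'.+1 => distribution
      (uniform_prob (@ltr01 R) \x torus_measure d')%E (@cons_point d')
  end.

Definition row_of_point d (x : torus_point d) : 'rV[R]_d := \row_i tnth x i.

Definition periodic d (phi : 'rV[R]_d -> R) : Prop :=
  forall x i, phi (x + delta_mx 0 i) = phi x.

(* C(T^d) *)
Record torus_cont d := TorusCont {
  torus_cont_fun :> 'rV[R]_d -> R ;
  torus_cont_continuous : continuous torus_cont_fun ;
  torus_cont_periodic : periodic torus_cont_fun }.

Fixpoint iter_partial d (s : seq 'I_d) (phi : 'rV[R]_d -> R) : 'rV[R]_d -> R :=
  if s is i :: s' then fun x => 'D_(delta_mx 0 i) (iter_partial s' phi) x
  else phi.

Definition smooth d (phi : 'rV[R]_d -> R) : Prop :=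
  forall s : seq 'I_d, continuous (iter_partial s phi) /\
    forall i x, derivable (iter_partial s phi) x (delta_mx 0 i).

(* [g] is the weak i-th partial derivative of [f] on the torus. *)
Definition weak_partial d (i : 'I_d) (f g : torus_point d -> R) : Prop :=
  forall phi : 'rV[R]_d -> R, smooth phi -> periodic phi ->
    \int[torus_measure d]_x
      (f x * 'D_(delta_mx 0 i) phi (row_of_point x)) =
    - \int[torus_measure d]_x (g x * phi (row_of_point x)).

(* Nonnegative elements of L^1(T^d), as classes of functions up to a.e.
   equality; [u x] evaluates a chosen representative of [u]. *)
Record L1nn d := mkL1nn {
  L1nn_val :> LspaceType (torus_measure d) (@lexx _ _ (1%E : \bar R)) ;
  L1nn_ge0 : {ae torus_measure d, forall x, 0 <= L1nn_val x} }.

HB.instance Definition _ d := gen_eqMixin (L1nn d).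
HB.instance Definition _ d := gen_choiceMixin (L1nn d).

(* The weak-star topology is the initial topology of all maps u |-> int phi u,
   phi in C(T^d). *)
Definition pairing d (u : L1nn d) : {ptws torus_cont d -> R} :=
  fun phi => \int[torus_measure d]_x (phi (row_of_point x) * u x).

Definition weak_star_open d (U : set (L1nn d)) : Prop :=
  @open (initial_topology (@pairing d)) U.

Record weak_star_metric d := WeakStarMetric {
  wdist :> L1nn d -> L1nn d -> R ;
  wdist_refl : forall u, wdist u u = 0 ;
  wdist_eq0 : forall u v, wdist u v = 0 -> u = v ;
  wdist_sym : forall u v, wdist u v = wdist v u ;
  wdist_triangle : forall u v w, wdist u w <= wdist u v + wdist v w ;
  wdist_open : forall U, metric_open wdist U <-> weak_star_open U }.

Definition entropy d (u : L1nn d) : \bar R :=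
  (\int[torus_measure d]_x (u x * ln (u x) - u x + 1)%:E)%E.

End torus.
Notation torus_point R d := (d.-tuple (measurableTypeR R)).


(* The spaces of classes and of paths must be inhabited to be measurable types;
   the point is the class of the zero function, resp. the constant path. *)
Section L1nn_zero.
Variables (R : realType) (d : nat).
Let mu := torus_measure R d.
Let f0 : {mfun torus_point R d >-> measurableTypeR R} := cst 0.

Definition L1nn0_class : {mfun_ mu, torus_point R d >-> measurableTypeR R} :=
  \pi_({mfun_ mu, torus_point R d >-> measurableTypeR R})%qT f0.

Let class0_ae : (L1nn0_class : _ -> R) = cst 0 %[ae mu].
Proof.
have /eqmodP/asboolP// : repr L1nn0_class = f0
  %[mod {mfun_ mu, torus_point R d >-> measurableTypeR R}]%qT by rewrite reprK.
Qed.

Let class0_finite : finite_norm mu 1%E (L1nn0_class : _ -> R).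
Proof.
rewrite /finite_norm Lnorm1 (ae_eq_integral (cst 0%E)) ?integral0//.
- apply: measurableT_comp => //; apply/measurable_EFinP.
  exact: (@measurable_funPT _ _ _ _ (repr L1nn0_class)).
- move: class0_ae; rewrite /ae_eq; apply: filterS => x /= /[apply] ->.
  by rewrite normr0.
Qed.

HB.instance Definition _ :=
  isFinLebesgue.Build _ _ _ mu _ (@lexx _ _ (1%E : \bar R)) L1nn0_class
    class0_finite.

Let class0_ge0 : {ae mu, forall x, 0 <= (L1nn0_class : _ -> R) x}.
Proof. by move: class0_ae; apply: filterS => x /= /(_ I) ->. Qed.

Definition L1nn0 : L1nn R d :=
  @mkL1nn R d L1nn0_class class0_ge0.

HB.instance Definition _ := isPointed.Build (L1nn R d) L1nn0.

End L1nn_zero.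

Section path_space.
Variables (R : realType) (d : nat) (tf : {posnum R}).

(* The time interval [0, tf] *)
Definition time := {t : R | 0 <= t <= tf%:num}.

Lemma time0_subproof : 0 <= (0 : R) <= tf%:num.
Proof. by rewrite lexx /=. Qed.
Definition time0 : time := exist _ 0 time0_subproof.

Variable delta : weak_star_metric R d.

Definition cadlag (u : time -> L1nn R d) : Prop :=
  (forall (t : time) (e : R), 0 < e -> exists2 h : R, 0 < h &
    forall s : time, val t <= val s < val t + h -> delta (u t) (u s) < e) /\
  (forall t : time, exists l : L1nn R d, forall e : R, 0 < e ->
    exists2 h : R, 0 < h &
      forall s : time, val t - h < val s < val t -> delta l (u s) < e).

Record cadlag_path := CadlagPath {
  path_fun :> time -> L1nn R d ;
  path_cadlag : cadlag path_fun }.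

Definition continuous_path (u : cadlag_path) : Prop :=
  forall (t : time) (e : R), 0 < e -> exists2 h : R, 0 < h &
    forall s : time, `|val s - val t| < h -> delta (u t) (u s) < e.

Definition time_change (lam : time -> time) : Prop :=
  bijective lam /\ forall s t, val s < val t -> val (lam s) < val (lam t).

(* Skorokhod's J1 distance *)
Definition skorokhod_dist (u v : cadlag_path) : R :=
  inf [set e : R | 0 <= e /\ exists lam, [/\ time_change lam,
    forall t, `|val (lam t) - val t| <= e &
    forall t, delta (u t) (v (lam t)) <= e]].

Definition skorokhod_open : set (set cadlag_path) :=
  metric_open skorokhod_dist.

HB.instance Definition _ := gen_eqMixin cadlag_path.
HB.instance Definition _ := gen_choiceMixin cadlag_path.

Let cst_path_cadlag : cadlag (fun=> L1nn0 R d).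
Proof.
split=> [t e e0|t]; first by exists 1 => // s _; rewrite wdist_refl.
by exists (L1nn0 R d) => e e0; exists 1 => // s _; rewrite wdist_refl.
Qed.

HB.instance Definition _ :=
  isPointed.Build cadlag_path (CadlagPath cst_path_cadlag).

(* D([0, tf], (L^1_{>=0}, delta)) with its Borel sigma-algebra *)
Definition skorokhod_space := g_sigma_algebraType skorokhod_open.

End path_space.

Section Lalpha.
Variables (R : realType) (d : nat) (tf : {posnum R}).

Definition time_measure : {measure set (measurableTypeR R) -> \bar R} :=
  mrestr (@lebesgue_measure R) (measurable_itv `[0, tf%:num]).

Definition spacetime_measure :
    {measure set (measurableTypeR R * torus_point R d) -> \bar R} :=
  (time_measure \x torus_measure R d)%E.

(* The path [u], a function of time valued in classes of functions of space, is
   identified with a class of functions of (t, x) through any jointly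
   measurable version. *)
Definition version (u : time tf -> L1nn R d)
    (v : measurableTypeR R * torus_point R d -> R) : Prop :=
  measurable_fun [set: measurableTypeR R * torus_point R d] v /\
  {ae time_measure, forall s : R, forall t : time tf, val t = s ->
    (fun x => v (s, x)) = u t %[ae torus_measure R d]}.

Variables (alpha : R) (alpha_gt1 : 1 < alpha).

Lemma Lalpha_subproof : (1 <= alpha%:E)%E.
Proof. by rewrite lee_fin ltW. Qed.

Definition Lalpha := LspaceType spacetime_measure Lalpha_subproof.

Definition Lalpha_dist (f g : Lalpha) : R :=
  Lp_dist spacetime_measure alpha%:E f g.

Definition Lalpha_open : set (set Lalpha) := metric_open Lalpha_dist.

Variable delta : weak_star_metric R d.

(* The class R of continuous paths with u^(alpha/2) in L^2([0, tf], H), where H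
   is the homogeneous Sobolev space of integrable functions with a weak
   gradient in L^2; [g i] is the weak i-th spatial derivative. *)
Definition regular_path (u : cadlag_path tf delta) : Prop :=
  continuous_path u /\
  exists (v : measurableTypeR R * torus_point R d -> R)
         (g : 'I_d -> measurableTypeR R * torus_point R d -> R),
    [/\ version u v,
        forall i, g i \in Lfun spacetime_measure 2%:E &
        {ae time_measure, forall s : R,
          (torus_measure R d).-integrable setT
            (fun x => (v (s, x) `^ (alpha / 2))%:E) /\
          forall i, weak_partial i (fun x => v (s, x) `^ (alpha / 2))
                                   (fun x => g i (s, x))}].

End Lalpha.

Section zero_range.
Variables (R : realType) (d N : nat).

(* [x : lattice] stands for the point x / N of the discrete torus. *)
Definition lattice := {ffun 'I_d -> 'I_N}.

Definition step_up (i : 'I_d) (x : lattice) : lattice :=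
  [ffun j => if j == i then ordS (x j) else x j].
Definition step_down (i : 'I_d) (x : lattice) : lattice :=
  [ffun j => if j == i then ord_pred (x j) else x j].

Definition jump_prob (x y : lattice) : R :=
  if [exists i, (y == step_up i x) || (y == step_down i x)]
  then (2 * d%:R)^-1 else 0.

(* [a : config] stands for the element eta = chi * a of the state space. *)
Definition config := {ffun lattice -> nat}.
HB.instance Definition _ := Choice.on config.
HB.instance Definition _ := isPointed.Build config [ffun=> 0%N].
HB.instance Definition _ := @isMeasurable.Build default_measure_display
  config discrete_measurable discrete_measurable0
  discrete_measurableC discrete_measurableU.

(* Truncated subtraction is harmless, the jump rate being 0 if [a x = 0]. *)
Definition jump (a : config) (x y : lattice) : config :=
  [ffun z => (a z - (z == x) + (z == y))%N].

Variables (alpha chi : R).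

Definition zr_generator (F : config -> R) (a : config) : R :=
  d%:R * N%:R ^+ 2 / chi *
  \sum_(x : lattice) \sum_(y : lattice)
    jump_prob x y * (chi * (a x)%:R) `^ alpha * (F (jump a x y) - F a).

(* The box of side 1/N centred at x/N, modulo 1 *)
Definition box (x : lattice) : set (torus_point R d) :=
  [set y | forall i : 'I_d, exists k : int,
    (x i)%:R / N%:R - (2 * N%:R)^-1 <= tnth y i + k%:~R
      < (x i)%:R / N%:R + (2 * N%:R)^-1].

Definition config_fun (a : config) (y : torus_point R d) : R :=
  \sum_(x : lattice) chi * (a x)%:R * \1_(box x) y.

(* [u] is the class of the step function equal to chi * a x on each box. *)
Definition is_config (a : config) (u : L1nn R d) : Prop :=
  u = config_fun a %[ae torus_measure R d].

Definition markov_semigroup (p : R -> config -> probability config R) : Prop :=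
  (forall a A, p 0 a A = \d_a A) /\
  (forall s t a A, 0 <= s -> 0 <= t ->
    p (s + t) a A = (\int[p s a]_b p t b A)%E).

Definition has_generator (p : R -> config -> probability config R) : Prop :=
  forall (F : config -> R) (a : config), (exists M, forall b, `|F b| <= M) ->
    h^-1 * (\int[p h a]_b F b - F a) @[h --> 0^'+] --> zr_generator F a.

(* The last clause prescribes all finite-dimensional distributions: [eta] is a
   Markov process with transition function [p]. Mass being conserved, the state
   space splits into finite closed classes, so that the generator determines
   [p]. Paths are cadlag with values in the state space, on which the weak-star
   topology is discrete: they are pure jump paths. *)
Definition zero_range_process (tf : {posnum R}) (delta : weak_star_metric R d)
    (disp : measure_display) (Omega : measurableType disp)
    (P : probability Omega R) (eta : Omega -> cadlag_path tf delta) : Prop :=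
  (forall omega t, exists a, is_config a (eta omega t)) /\
  exists p : R -> config -> probability config R,
  [/\ markov_semigroup p, has_generator p &
   forall (n : nat) (t : nat -> time tf) (a : nat -> config),
    (forall i, val (t i) <= val (t i.+1)) ->
    (P [set omega | forall i, (i <= n.+1)%N ->
                      is_config (a i) (eta omega (t i))] =
     P [set omega | forall i, (i <= n)%N ->
                      is_config (a i) (eta omega (t i))] *
     p (val (t n.+1) - val (t n))%R (a n) [set a n.+1])%E].

End zero_range.

(* Main.v *)
(** Sampling the process on finer and finer time grids, an exponential
    supermartingale bound with the weight [expR (alpha / 2 * entropy)] shows that,
    up to probability [expR (- z N^d / chi)], the path makes single jumps only and
    has bounded mass and bounded integrated Dirichlet energy of [eta `^ (alpha / 2)];
    the condition on [N^2 chi^min(1, alpha/2)] absorbs the discretization error of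
    the chain rule.  On such good events a lattice Poincare inequality compares
    [eta] with local averages at a fixed scale, uniformly in [N].  The averages
    converge along any Skorokhod-convergent sequence, so the sequence is Cauchy in
    L^alpha.  Its limit is continuous in time because the jumps vanish, and
    minimizing the gradient energy over approximants (the parallelogram identity)
    produces a weak gradient of the [alpha / 2]-th power: the limit is regular.  Both
    parts of (i) follow by contradiction along sequences of good configurations.
    That a regular path lies in L^alpha uses a Poincare inequality on the torus,
    proved by duality against trigonometric polynomials, which are dense.  For (ii),
    bounded relative entropy keeps the good events likely under [Q], so the sequence
    is Cauchy in probability and a Borel-Cantelli argument extracts the subsequence. *)
Require Import Defs.
From HB Require Import structures.
From mathcomp Require Import all_boot all_order all_algebra.
From mathcomp Require Import all_classical all_reals all_analysis.
From mathcomp Require Import measurable_realfun.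
From mathcomp Require Import ring lra zify.

Set Implicit Arguments.
Unset Strict Implicit.
Unset Printing Implicit Defensive.

Import Order.TTheory GRing.Theory Num.Theory.
Import numFieldNormedType.Exports.

Local Open Scope classical_set_scope.
Local Open Scope ring_scope.

(* [periodic] is also a name of MathComp-Analysis. *)
Import Defs.

(** The weight has exponent [alpha / 2] because a jump from x to y multiplies it by about (eta(y) /
    eta(x))^(alpha/2), which the rate eta(x)^alpha turns into the symmetric product (eta(x)
    eta(y))^(alpha/2). Summation by parts then yields minus the Dirichlet energy of eta^(alpha/2).
    The error of the chain rule is a power of eta of order below alpha; the lattice Poincare
    inequality at bounded mass absorbs it into half of that energy. Time grids are forced by what is
    given: finite-dimensional laws and a one-sided derivative at time 0 on bounded functions.
    Bounded mass leaves finitely many configurations, on which the o(h) terms are uniform. At fixed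
    N the weak-star topology is discrete on the state space. This is why evaluations, jumps and
    L^alpha distances are measurable, always on the trace of the paths with values in the state
    space. Compactness in time is not estimated: Skorokhod convergence to a continuous limit gives
    convergence of every spatial average at every time, so the energy only has to control
    oscillations in space. *)

(** * Elementary inequalities for real powers *)

Section powR_inequalities.
Variable R : realType.
Implicit Types a b e p q r s x y : R.

Lemma pow1R x : 1 `^ x = 1.
Proof. by rewrite powR1. Qed.

(* By homogeneity only [b / a] matters: either it is close to 1, and the left
   side is small relative to [a], or [a `^ q] and [b `^ q] are far apart. *)
Lemma powR_dist_interp p q r e : 0 < p -> 0 < q -> 0 < r -> 0 < e ->
  exists2 C, 0 <= C & forall a b, 0 <= a -> 0 <= b ->
    `|a `^ p - b `^ p| `^ (r / p) <=
      e * (a `^ r + b `^ r) + C * `|a `^ q - b `^ q| `^ (r / q).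
Proof.
move=> p0 q0 r0.
wlog e1 : e / e < 1.
  move=> H e0; have [|e1] := ltP e 1; first by move=> /H; apply.
  have [||C C0 CP] := H 2^-1; [lra|lra|].
  exists C => // a b a0 b0; apply: (le_trans (CP a b a0 b0)).
  by rewrite lerD2r ler_wpM2r ?addr_ge0 ?powR_ge0//; lra.
move=> e0.
have ep : 0 < e `^ (p / r) < 1.
  rewrite powR_gt0//= -[ltRHS](pow1R (p / r)) gt0_ltr_powR ?nnegrE ?divr_gt0//.
  exact: ltW.
(* The threshold ratio: for b > t a the difference of the [p]-th powers is at most e^(p/r) a^p,
   which gives the term e a^r; for b <= t a the [q]-th powers differ by at least (1 - t^q) a^q,
   which fixes the constant. *)
pose t := (1 - e `^ (p / r)) `^ p^-1.
have t0 : 0 <= t by rewrite powR_ge0.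
have tq : t `^ q < 1.
  rewrite -[ltRHS](pow1R q) gt0_ltr_powR ?nnegrE//.
  rewrite -[ltRHS](pow1R p^-1) gt0_ltr_powR ?nnegrE ?invr_gt0//; lra.
have tp : t `^ p = 1 - e `^ (p / r).
  by rewrite /t -powRrM mulVf ?gt_eqF// powRr1//; lra.
clearbody t.
exists (((1 - t `^ q) `^ (r / q))^-1); first by rewrite invr_ge0 powR_ge0.
move=> a b.
wlog ba : a b / b <= a.
  move=> H a0 b0; have [ab|/ltW ab] := leP b a; first exact: H.
  by rewrite distrC [X in e * X]addrC (distrC (a `^ q)); exact: H.
rewrite le_eqVlt => /predU1P[a0|a0] b0.
  have b00 : b = 0 by lra.
  rewrite -a0 b00.
  rewrite !powR0 ?gt_eqF// subrr normr0 powR0 ?gt_eqF ?divr_gt0//.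
  by rewrite addr_ge0 ?mulr_ge0 ?addr_ge0 ?invr_ge0 ?powR_ge0// ltW.
have bap : b `^ p <= a `^ p by rewrite ge0_ler_powR ?nnegrE// ltW.
have baq : b `^ q <= a `^ q by rewrite ge0_ler_powR ?nnegrE// ltW.
rewrite (ger0_norm (x := a `^ p - _)) ?subr_ge0//.
rewrite (ger0_norm (x := a `^ q - _)) ?subr_ge0//.
have aE u : 0 < u -> a `^ r = (a `^ u) `^ (r / u).
  by move=> u0; rewrite -powRrM mulrCA divff ?gt_eqF// mulr1.
have [bt|bt] := leP b (t * a).
- apply: (@le_trans _ _ (a `^ r)).
    rewrite (aE p)//; apply: ge0_ler_powR; rewrite ?nnegrE ?subr_ge0 ?powR_ge0//.
      by rewrite divr_ge0 ?ltW.
    by rewrite gerBl powR_ge0.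
  rewrite -[leLHS]add0r lerD//; first by rewrite mulr_ge0 ?addr_ge0 ?powR_ge0 ?(ltW e0)//.
  have tq0 : 0 <= 1 - t `^ q by rewrite subr_ge0 ltW.
  have tq1 : 0 < (1 - t `^ q) `^ (r / q) by apply: powR_gt0; rewrite subr_gt0.
  rewrite (ler_pdivlMl _ _ tq1).
  rewrite (aE q q0) -(powRM _ tq0 (powR_ge0 _ _)).
  apply: ge0_ler_powR; rewrite ?nnegrE ?subr_ge0 ?mulr_ge0 ?powR_ge0
    ?invr_ge0 ?(ltW r0) ?(ltW q0)//.
  rewrite mulrBl mul1r lerB// -powRM// ?(ltW a0)//.
  by apply: ge0_ler_powR; rewrite ?nnegrE ?mulr_ge0 ?(ltW q0) ?(ltW a0).
- apply: (@le_trans _ _ (e * a `^ r)); last first.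
    rewrite -[leLHS]addr0 lerD ?mulr_ge0 ?invr_ge0 ?powR_ge0//.
    by rewrite ler_wpM2l ?lerDl ?powR_ge0 ?(ltW e0).
  have -> : e * a `^ r = (e `^ (p / r) * a `^ p) `^ (r / p).
    rewrite powRM ?powR_ge0// -aE// -powRrM.
    by rewrite mulrA mulfVK ?gt_eqF// divff ?gt_eqF// powRr1// ltW.
  apply: ge0_ler_powR; rewrite ?nnegrE ?subr_ge0 ?mulr_ge0 ?powR_ge0
    ?invr_ge0 ?(ltW r0) ?(ltW p0)//.
  have : (t * a) `^ p <= b `^ p.
    by apply: ge0_ler_powR; rewrite ?nnegrE ?mulr_ge0 ?(ltW p0) ?(ltW a0) ?(ltW bt).
  by rewrite powRM ?(ltW a0)// tp; lra.
Qed.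

(** Above the threshold [Y], where Y^(s - q) = 1 / e, the higher power dominates; below it Y^q is an
    upper bound. *)
Lemma powR_young q s e : 0 < q -> q < s -> 0 < e ->
  exists2 C, 0 <= C & forall y, 0 <= y -> y `^ q <= e * y `^ s + C.
Proof.
move=> q0 qs e0; pose Y := e `^ (- (s - q)^-1).
exists (Y `^ q) => [|y y0]; first exact: powR_ge0.
have [yY|yY] := leP y Y.
  rewrite -[leLHS]add0r lerD ?mulr_ge0 ?powR_ge0 ?(ltW e0)//.
  by apply: ge0_ler_powR; rewrite ?nnegrE ?powR_ge0// ltW.
rewrite -[leLHS]addr0 lerD ?powR_ge0//.
have y1 : 0 < y by rewrite (le_lt_trans _ yY)// powR_ge0.
have -> : y `^ s = y `^ q * y `^ (s - q).
  by rewrite -powRD ?(gt_eqF y1) ?implybT// addrC subrK.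
rewrite mulrCA -[leLHS]mulr1 ler_wpM2l ?powR_ge0//.
rewrite -ler_pdivrMl// mulr1.
have -> : e^-1 = Y `^ (s - q).
  by rewrite /Y -powRrM mulNr mulVf ?powR_inv1 ?(ltW e0)// subr_eq0 gt_eqF.
by apply: ge0_ler_powR; rewrite ?nnegrE ?powR_ge0 ?subr_ge0 ?ltW.
Qed.

(** Convexity, read off from Young's inequality [conjugate_powR] for y and m^(p - 1) with the
    exponents p and p / (p - 1). *)
Lemma powR_tangent p y m : 1 <= p -> 0 <= y -> 0 <= m ->
  m `^ p + p * m `^ (p - 1) * (y - m) <= y `^ p.
Proof.
rewrite le_eqVlt => /predU1P[<-|p1] y0 m0.
  by rewrite subrr powRr0 !powRr1//; lra.
have p0 : 0 < p by lra.
have q0 : 0 < p / (p - 1) by rewrite divr_gt0//; lra.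
have := conjugate_powR y0 (powR_ge0 m (p - 1)) p0 q0.
rewrite -powRrM mulrCA divff ?mulr1; last by rewrite subr_eq0 gt_eqF.
have pp : p^-1 + (p / (p - 1))^-1 = 1 by field; apply/andP; split; lra.
move=> /(_ pp) H.
have {H} := ler_wpM2l (ltW p0) H.
have -> : p * (y `^ p / p + m `^ p / (p / (p - 1))) = y `^ p + (p - 1) * m `^ p.
  by field; apply/andP; split; lra.
have := mulr_powRB1 m0 p0.
by nra.
Qed.

(** For p > 1 this is the tangent at [b]. For p <= 1 it is subadditivity: [key], a chord below a
    concave power, is applied to [a] and to [b - a], and the two chords add up to b^p. *)
Lemma powR_sub_le p a b : 0 < p -> 0 <= a -> a <= b ->
  b `^ p - a `^ p <= if p <= 1 then (b - a) `^ p else p * b `^ (p - 1) * (b - a).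
Proof.
move=> p0 a0 ab; case: ifPn => [p1|]; last first.
  rewrite -ltNge => p1.
  by have := powR_tangent (ltW p1) a0 (le_trans a0 ab); nra.
have [b0|b0] := leP b 0.
  have -> : b = 0 by apply/le_anti; rewrite b0 (le_trans a0).
  by rewrite powR0 ?gt_eqF// sub0r (le_trans _ (powR_ge0 _ _))// oppr_le0 powR_ge0.
rewrite lerBlDr.
have key x : 0 <= x <= b -> x / b * b `^ p <= x `^ p.
  move=> /andP[x0 xb]; have [->|xn0] := eqVneq x 0.
    by rewrite !mul0r powR_ge0.
  have {2}-> : x = x / b * b by rewrite divfK ?gt_eqF.
  rewrite powRM ?divr_ge0 ?(ltW b0)// ler_wpM2r ?powR_ge0// ger1_powR//.
  by rewrite ler_pdivrMr// mul1r xb andbT divr_gt0// lt0r xn0.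
have H1 := key a; have H2 := key (b - a).
have E : b `^ p = (b - a) / b * b `^ p + a / b * b `^ p.
  by field; rewrite gt_eqF.
rewrite [leLHS]E lerD//; [apply: H2|apply: H1]; lra.
Qed.

Lemma powRD_le p a b : 0 <= p -> 0 <= a -> 0 <= b ->
  (a + b) `^ p <= 2 `^ p * (a `^ p + b `^ p).
Proof.
move=> p0 a0 b0; have H (x y : R) : 0 <= x -> 0 <= y -> x <= y -> (x + y) `^ p <= 2 `^ p * (x `^ p + y `^ p).
  move=> x0 y0 xy; apply: (@le_trans _ _ ((2 * y) `^ p)).
    by rewrite ge0_ler_powR ?nnegrE ?mulr_ge0 ?addr_ge0//; lra.
  by rewrite powRM// ler_wpM2l ?powR_ge0// lerDr powR_ge0.
have [ab|/ltW ab] := leP a b; first exact: H.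
by rewrite addrC [X in _ * X]addrC; exact: H.
Qed.

Lemma ler_norm_powRD p a b : 0 <= p ->
  `|a + b| `^ p <= 2 `^ p * (`|a| `^ p + `|b| `^ p).
Proof.
move=> p0; apply: le_trans (powRD_le p0 (normr_ge0 a) (normr_ge0 b)).
by rewrite ge0_ler_powR ?nnegrE ?addr_ge0// ler_normD.
Qed.

(** The tangent inequality at the mean of the [|x i|], averaged with the weights [w]; the linear
    terms cancel. *)
Lemma powR_jensen (I : finType) (w x : I -> R) p : 1 <= p ->
  (forall i, 0 <= w i) -> \sum_i w i = 1 ->
  `|\sum_i w i * x i| `^ p <= \sum_i w i * `|x i| `^ p.
Proof.
move=> p1 w0 w1; pose m := \sum_i w i * `|x i|.
have m0 : 0 <= m by apply: sumr_ge0 => i _; rewrite mulr_ge0.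
apply: (@le_trans _ _ (m `^ p)).
  rewrite ge0_ler_powR ?nnegrE//; first lra.
  apply: (le_trans (ler_norm_sum _ _ _)); apply: ler_sum => i _.
  by rewrite normrM (ger0_norm (w0 i)).
have -> : m `^ p = \sum_i w i * (m `^ p + p * m `^ (p - 1) * (`|x i| - m)).
  under eq_bigr do rewrite mulrDr mulrCA.
  rewrite big_split/= -mulr_suml w1 mul1r -mulr_sumr.
  under [X in _ + _ * X]eq_bigr do rewrite mulrBr.
  by rewrite sumrB -mulr_suml w1 mul1r subrr mulr0 addr0.
by apply: ler_sum => i _; rewrite ler_wpM2l// powR_tangent.
Qed.

Lemma expR_le1Dx x : 0 <= x <= 1 -> expR x <= 1 + expR 1 * x.
Proof.
move=> /andP[x0 x1].
have e1 : expR x <= expR 1 by rewrite ler_expR.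
have := expR_ge1Dx (- x); have := expR_gt0 x; have := expRxMexpNx_1 x.
by nra.
Qed.

(* [r * expR (k / r) <= r + c * k] for [k <= r] turns the left side into a
   difference of [p]-th powers of products. *)
Lemma jump_rate_error p M e : 0 < p -> 0 < e -> exists2 C, 0 <= C &
  forall n k r s, 0 < n -> 0 < k -> k <= r -> 0 <= s ->
    n * k `^ Num.min 1 p <= M ->
    n * (r `^ p * ((s + k) `^ p * expR (p * (k / r)) - s `^ p)) <=
      e * (r `^ (2 * p) + s `^ (2 * p)) + C.
Proof.
move=> p0 e0; pose c : R := expR 1.
have c0 : 0 < c by exact: expR_gt0.
pose K := `|M| * (1 + c) `^ p * (if p <= 1 then 1 else p).
(* Order of the remainder: with y = r + s, the difference B^p - A^p is at most a multiple of
   k^min(1, p) y^q, by subadditivity when p <= 1 and by the mean value bound otherwise. Since q < 2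
   p, [powR_young] absorbs it. *)
pose q := if p <= 1 then p else 2 * p - 1.
have q0 : 0 < q by rewrite /q; case: ifPn => //; rewrite -ltNge; lra.
have q2p : q < 2 * p by rewrite /q; case: ifPn => //; lra.
have K0 : 0 <= K by rewrite !mulr_ge0 ?powR_ge0//; case: ifPn => // _; exact: ltW.
have e'0 : 0 < e / ((K + 1) * 2 `^ (2 * p)).
  by rewrite divr_gt0// mulr_gt0 ?powR_gt0//; lra.
have [C C0 CP] := powR_young q0 q2p e'0.
exists (K * C); first exact: mulr_ge0.
move=> n k r s n0 k0 kr s0 nM.
have r0 : 0 < r by lra.
pose y := r + s; have y0 : 0 < y by rewrite /y; lra.
have y0' := ltW y0; have k0' := ltW k0; have r0' := ltW r0; have c0' := ltW c0.
have c1 : 0 <= 1 + c by lra.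
pose A := s * r; pose B := (s + k) * (r + c * k).
have A0 : 0 <= A by rewrite mulr_ge0// ltW.
have BAE : B - A = k * (c * s + r + c * k) by rewrite /A /B; ring.
have AB : A <= B by rewrite -subr_ge0 BAE; apply: mulr_ge0; have := mulr_ge0 (ltW c0) s0; have := mulr_gt0 c0 k0; lra.
have BA : B - A <= (1 + c) * k * y.
  rewrite BAE -mulrA mulrCA ler_wpM2l ?(ltW k0)// /y.
  have := ler_wpM2l (ltW c0) kr; lra.
have By : B <= (1 + c) * (y * y).
  rewrite (_ : (1 + c) * (y * y) = y * ((1 + c) * y)); last ring.
  have ck := ler_wpM2l (ltW c0) kr; have cs := mulr_ge0 (ltW c0) s0.
  have ck0 := mulr_gt0 c0 k0.
  by rewrite /B /y ler_pM//; lra.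
have MB : n * (B `^ p - A `^ p) <= K * y `^ q.
  have := powR_sub_le p0 A0 AB; rewrite /K /q; case: ifPn => p1 H.
  - have kM : n * k `^ p <= `|M|.
      by move: nM; rewrite (min_idPr p1) => /le_trans; apply; exact: ler_norm.
    apply: (@le_trans _ _ (n * (((1 + c) * k * y) `^ p))).
      rewrite ler_wpM2l ?(ltW n0)//; apply: (le_trans H).
      by rewrite ge0_ler_powR ?nnegrE ?(ltW p0) ?subr_ge0//; nra.
    have -> : ((1 + c) * k * y) `^ p = (1 + c) `^ p * k `^ p * y `^ p.
      by rewrite !powRM ?mulr_ge0.
    rewrite [leLHS](_ : _ = n * k `^ p * ((1 + c) `^ p * y `^ p)); last ring.
    by rewrite mulr1 -[leRHS]mulrA ler_wpM2r ?mulr_ge0 ?powR_ge0.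
  - have {}p1 : 1 < p by rewrite ltNge.
    have kM : n * k <= `|M|.
      move: nM; rewrite (min_idPl (ltW p1)) powRr1 ?(ltW k0)// => /le_trans; apply.
      exact: ler_norm.
    apply: (@le_trans _ _ (n * (p * ((1 + c) * (y * y)) `^ (p - 1) * ((1 + c) * k * y)))).
      rewrite ler_wpM2l ?(ltW n0)//; apply: (le_trans H).
      have := powR_ge0 B (p - 1).
      have : B `^ (p - 1) <= ((1 + c) * (y * y)) `^ (p - 1).
        by rewrite ge0_ler_powR ?nnegrE//; [lra|lra|nra].
      move=> h1 h2; rewrite ler_pM//; [nra|lra|].
      by rewrite ler_wpM2l// ltW.
    rewrite !powRM ?mulr_ge0//.
    have -> : (1 + c) `^ p = (1 + c) * (1 + c) `^ (p - 1).
      by rewrite mulr_powRB1//; lra.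
    have -> : y `^ (2 * p - 1) = y `^ (p - 1) * y `^ (p - 1) * y.
      rewrite (_ : 2 * p - 1 = (p - 1) + (p - 1) + 1); last by ring.
      by rewrite !powRD ?(gt_eqF y0) ?implybT// powRr1.
    rewrite [leLHS](_ : _ = n * k * ((1 + c) * (1 + c) `^ (p - 1) * p * (y `^ (p - 1) * y `^ (p - 1) * y))); last by ring.
    rewrite [leRHS](_ : _ = `|M| * ((1 + c) * (1 + c) `^ (p - 1) * p * (y `^ (p - 1) * y `^ (p - 1) * y))); last by ring.
    by rewrite ler_wpM2r ?mulr_ge0 ?powR_ge0// ltW.
have -> : r `^ p * ((s + k) `^ p * expR (p * (k / r)) - s `^ p) =
    ((s + k) * (r * expR (k / r))) `^ p - A `^ p.
  have -> : expR (p * (k / r)) = expR (k / r) `^ p.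
    by rewrite /powR gt_eqF ?expR_gt0// expRK.
  by rewrite /A !powRM ?mulr_ge0 ?expR_ge0 ?addr_ge0//; ring.
apply: (@le_trans _ _ (n * (B `^ p - A `^ p))).
  rewrite ler_wpM2l ?(ltW n0)// lerD2r; apply: ge0_ler_powR; rewrite ?nnegrE ?(ltW p0) ?mulr_ge0 ?expR_ge0 ?addr_ge0 ?mulr_ge0//.
  rewrite ler_wpM2l ?addr_ge0//.
  have kr1 : 0 <= k / r <= 1.
    by rewrite ler_pdivrMr// mul1r kr andbT divr_ge0.
  have := ler_wpM2l (ltW r0) (expR_le1Dx kr1).
  by rewrite mulrDr mulr1 [in X in _ + X]mulrCA [r * (k / r)]mulrC divfK ?gt_eqF.
apply: (le_trans MB).
have := CP y (ltW y0) => H.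
apply: (le_trans (ler_wpM2l K0 H)); rewrite mulrDr lerD2r.
have y2 : y `^ (2 * p) <= 2 `^ (2 * p) * (r `^ (2 * p) + s `^ (2 * p)).
  by apply: powRD_le => //; lra.
have z0 : 0 < 2 `^ (2 * p) :> R by rewrite powR_gt0.
have K1 : K / (K + 1) <= 1 by rewrite ler_pdivrMr; lra.
apply: (@le_trans _ _ (K / (K + 1) * (e * (y `^ (2 * p) / 2 `^ (2 * p))))).
  rewrite le_eqVlt (_ : (_ == _) = true)//; apply/eqP; field.
  by rewrite gt_eqF//= gt_eqF//; lra.
apply: (@le_trans _ _ (e * (y `^ (2 * p) / 2 `^ (2 * p)))).
  by rewrite ler_piMl// mulr_ge0 ?divr_ge0 ?powR_ge0 ?(ltW e0).
by rewrite ler_wpM2l ?(ltW e0)// ler_pdivrMr// [leRHS]mulrC.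
Qed.

End powR_inequalities.

(** * The entropy density *)

Section entropy_density.
Variable R : realType.
Implicit Types b r s k : R.

Definition ent r : R := r * ln r - r + 1.

(** Convexity, the slope at [b] being [ln b]. The case s = 0 is treated apart because [ln 0] is a
    default value. *)
Lemma ent_tangent b s : 0 < b -> 0 <= s -> ent b - ent s <= (b - s) * ln b.
Proof.
move=> b0; rewrite /ent le_eqVlt => /predU1P[<-|s0].
  by rewrite mul0r !subr0; lra.
have : s * (ln b - ln s) <= b - s.
  rewrite -ln_div ?posrE//.
  have -> : b / s = 1 + (b / s - 1) by ring.
  have h : -1 < b / s - 1 by rewrite ltrBrDl subrr divr_gt0.
  have := ler_wpM2l (ltW s0) (le_ln1Dx h).
  by rewrite mulrBr mulrCA divff ?gt_eqF// !mulr1.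
by lra.
Qed.

Lemma ent_ge0 r : 0 <= r -> 0 <= ent r.
Proof.
move=> r0; have := @ent_tangent 1 r ltr01 r0; rewrite /ent ln1; lra.
Qed.

(** Tangent at [expR 1], where the slope is 1. It converts an entropy bound into a mass bound. *)
Lemma le_ent r : 0 <= r -> r <= ent r + expR 1.
Proof.
move=> r0; have := @ent_tangent (expR 1) r (expR_gt0 _) r0.
by rewrite /ent expRK; have := expR_gt0 (1 : R); lra.
Qed.

(** The slope is wanted at [r] and not at [r - k], which may be 0; the bound ln(1 - k / r) <= - k /
    r leaves the second-order term k^2 / r. *)
Lemma ent_sub_le r k : 0 < k -> k <= r ->
  ent (r - k) - ent r <= - (k * ln r) + k * (k / r).
Proof.
move=> k0 kr; have r0 : 0 < r by lra.
rewrite /ent.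
have -> : k * (k / r) = k - (r - k) * (k / r) by field; rewrite gt_eqF.
have [rk|rk] := leP (r - k) 0.
  have -> : r - k = 0 by lra.
  by rewrite !mul0r (_ : k = r); lra.
have : (r - k) * (ln (r - k) - ln r) <= - ((r - k) * (k / r)).
  rewrite -ln_div ?posrE// -mulrN ler_wpM2l ?(ltW rk)//.
  have -> : (r - k) / r = 1 + - (k / r) by field; rewrite gt_eqF.
  apply: le_ln1Dx; rewrite ltrN2 ltr_pdivrMr//; lra.
by lra.
Qed.

End entropy_density.

(** * Walks and energies on the discrete torus *)

Section lattice_walks.
Variables (R : realType) (d N : nat).
Local Notation L := (lattice d N).
Implicit Types (v : L -> R) (x p q : L) (s : seq 'I_d) (z : 'I_d -> nat).

Lemma step_upK i : cancel (@step_up d N i) (step_down i).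
Proof.
move=> x; apply/ffunP => j; rewrite !ffunE; case: eqP => // _.
exact: ordSK.
Qed.

Lemma step_downK i : cancel (@step_down d N i) (step_up i).
Proof.
move=> x; apply/ffunP => j; rewrite !ffunE; case: eqP => // _.
exact: ord_predK.
Qed.

Definition bond_energy v : R :=
  \sum_(i < d) \sum_x (v (step_up i x) - v x) ^+ 2.

Lemma bond_energy_ge0 v : 0 <= bond_energy v.
Proof. by apply: sumr_ge0 => i _; apply: sumr_ge0 => x _; exact: sqr_ge0. Qed.

Definition walk s x : L := foldr (@step_up d N) x s.

Lemma walk_inj s : injective (walk s).
Proof.
elim: s => [//|i s IHs] x y /= /(can_inj (step_upK i)); exact: IHs.
Qed.

(** Cauchy-Schwarz along the walk, step by step: a further step costs (a + b)^2 <= (1 + 1/n) a^2 +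
    (1 + n) b^2, and these weights turn n^2 into (n + 1)^2. Walks being injective, each step sees
    every bond of its direction once. *)
Lemma walk_energy v s :
  \sum_x (v (walk s x) - v x) ^+ 2 <= (size s)%:R ^+ 2 * bond_energy v.
Proof.
elim: s => [|i s IHs] /=.
  by rewrite big1 ?mul0r ?expr0n ?mul0r// => x _; rewrite subrr expr0n.
have Ei : \sum_x (v (step_up i (walk s x)) - v (walk s x)) ^+ 2 <= bond_energy v.
  rewrite -(reindex_inj (P := xpredT) (F := fun x => (v (step_up i x) - v x) ^+ 2)
    (@walk_inj s)).
  rewrite /bond_energy (bigD1 i)//= lerDl.
  by apply: sumr_ge0 => j _; apply: sumr_ge0 => x _; exact: sqr_ge0.
case: s IHs Ei => [|j s] IHs Ei.
  by move: Ei => /=; rewrite expr1n mul1r.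
set s' := j :: s in IHs Ei *.
have n0 : 0 < (size s')%:R :> R by rewrite ltr0n.
move: n0 IHs; set n := (size s')%:R => n0 IHs.
have -> : (size s').+1%:R = n + 1 :> R by rewrite -natr1.
have -> : (n + 1) ^+ 2 * bond_energy v =
    (1 + n^-1) * (n ^+ 2 * bond_energy v) + (1 + n) * bond_energy v.
  by field; rewrite gt_eqF.
apply: (@le_trans _ _ ((1 + n^-1) * (\sum_x (v (walk s' x) - v x) ^+ 2) +
    (1 + n) * \sum_x (v (step_up i (walk s' x)) - v (walk s' x)) ^+ 2)).
  rewrite !mulr_sumr -big_split/=; apply: ler_sum => x _.
  have -> : v (step_up i (step_up j (walk s x))) - v x =
      (v (step_up i (walk s' x)) - v (walk s' x)) + (v (walk s' x) - v x).
    by rewrite addrA subrK.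
  move: (_ - v (walk s' x)) (_ - v x) => b a.
  rewrite -subr_ge0 (_ : _ - _ = n^-1 * (a - n * b) ^+ 2).
    by rewrite mulr_ge0 ?sqr_ge0// invr_ge0 ltW.
  by field; rewrite gt_eqF.
rewrite lerD// ler_wpM2l//; last by rewrite addr_ge0// ltW.
by rewrite addr_ge0// invr_ge0 ltW.
Qed.

Definition steps z : seq 'I_d := flatten [seq nseq (z i) i | i <- enum 'I_d].

Lemma size_steps z : size (steps z) = (\sum_i z i)%N.
Proof.
rewrite size_flatten sumnE /shape big_map big_map big_enum/=.
by apply: eq_bigr => i _; rewrite size_nseq.
Qed.

Lemma walk_val s x j : walk s x j = ((x j + count_mem j s) %% N)%N :> nat.
Proof.
elim: s => [|i s IHs] /=; first by rewrite addn0 modn_small.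
rewrite ffunE eq_sym; case: eqVneq => [_|_] /=.
  by rewrite IHs -addn1 modnDml -addnA addn1 add1n.
by rewrite IHs add0n.
Qed.

Lemma count_steps z j : count_mem j (steps z) = z j.
Proof.
rewrite count_flatten -map_comp sumnE big_map big_enum/= (bigD1 j)//= big1.
  by rewrite count_nseq/= eqxx mul1n addn0.
by move=> i /negPf ij; rewrite count_nseq/= ij mul0n.
Qed.

Lemma walk_steps z x j : walk (steps z) x j = ((x j + z j) %% N)%N :> nat.
Proof. by rewrite walk_val count_steps. Qed.

(* [p] and [q] differ by at most [r] in every coordinate, modulo [N]. *)
Definition near r p q : bool :=
  [exists z : {ffun 'I_d -> 'I_(2 * r).+1},
    walk (steps (fun i => z i : nat)) p == walk (steps (fun=> r)) q].

Lemma near_dist r p q :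
  (forall i, exists n : int, `|(p i)%:Z - (q i)%:Z + N%:Z * n| <= r%:Z) ->
  near r p q.
Proof.
move=> /choice[n nP].
pose m i : int := (r%:Z - ((p i)%:Z - (q i)%:Z + N%:Z * n i)).
have mb i : (`|m i| < (2 * r).+1)%N by move: (nP i); rewrite /m; lia.
have mE i : `|m i|%N%:Z = m i by move: (nP i); rewrite /m; lia.
apply/existsP; exists [ffun i => Ordinal (mb i)]; apply/eqP/ffunP => j.
apply/val_inj => /=; rewrite !walk_steps ffunE/=.
apply/eqP; rewrite -eqz_nat -!modz_nat !PoszD mE /m.
by rewrite (_ : _ + _ = (- n j) * N + ((q j)%:Z + r%:Z)) ?modzMDl//; ring.
Qed.

Lemma near_all p q : near N p q.
Proof.
apply: near_dist => i; exists 0; rewrite mulr0 addr0.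
have := ltn_ord (p i); have := ltn_ord (q i); lia.
Qed.

(** [p] is moved by [z] and [q] by [r] in every coordinate, so that offsets between -r and r become
    natural numbers. Each [z] determines [q] from [p]; on a small lattice several [z] may give the
    same [q], hence an inequality. *)
Lemma near_sum_le r (f : L -> L -> R) : (forall p q, 0 <= f p q) ->
  \sum_p \sum_(q | near r p q) f p q <=
  \sum_(z : {ffun 'I_d -> 'I_(2 * r).+1}) \sum_p
    f p (invF (walk_inj (s := steps (fun=> r))) (walk (steps (fun i => z i : nat)) p)).
Proof.
move=> f0; rewrite exchange_big/=; apply: ler_sum => p _.
apply: (@le_trans _ _ (\sum_(z : {ffun 'I_d -> 'I_(2 * r).+1})
   \sum_(q | walk (steps (fun i => z i : nat)) p == walk (steps (fun=> r)) q) f p q)).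
  rewrite (exchange_big_dep (near r p))/=; last first.
    by move=> z q _ zq; apply/existsP; exists z.
  apply: ler_sum => q /existsP[z zq]; rewrite (bigD1 z)//= lerDl.
  by apply: sumr_ge0 => *.
apply: ler_sum => z _; rewrite (big_pred1 (invF (walk_inj (s := steps (fun=> r)))
  (walk (steps (fun i => z i : nat)) p)))// => q /=.
apply/eqP/eqP => [->|->]; first by rewrite invF_f.
by rewrite f_invF.
Qed.

Lemma card_boxes r : #|{: {ffun 'I_d -> 'I_(2 * r).+1}}|%:R = (2 * r + 1)%:R ^+ d :> R.
Proof. by rewrite card_ffun !card_ord natrX addn1. Qed.

(** Walks of at most 2 d r and of d r steps lead from [p] and [q] to a common site; with (a - b)^2
    <= 2 a^2 + 2 b^2 they give 10 = 2 (4 + 1). *)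
Lemma near_energy r v :
  \sum_p \sum_(q | near r p q) (v p - v q) ^+ 2 <=
  (2 * r + 1)%:R ^+ d * (10 * d%:R ^+ 2 * r%:R ^+ 2 * bond_energy v).
Proof.
apply: le_trans (near_sum_le _ _) _; first by move=> *; exact: sqr_ge0.
rewrite -card_boxes [leRHS]mulr_natl -sumr_const; apply: ler_sum => z _.
set W := walk (steps (fun=> r)); set Z := walk (steps (fun i => z i : nat)).
set g := invF _.
have gi : injective (fun p => g (Z p)).
  by apply: inj_comp; [exact: (can_inj (f_invF _))|exact: walk_inj].
have sz : (size (steps (fun i => z i : nat)) <= d * (2 * r))%N.
  rewrite size_steps -[X in (_ <= X * _)%N]card_ord -sum_nat_const.
  by apply: leq_sum => i _; rewrite -ltnS.
have sr : size (steps (fun=> r)) = (d * r)%N.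
  by rewrite size_steps sum_nat_const card_ord.
have E0 := bond_energy_ge0 v.
apply: (@le_trans _ _ (2 * (\sum_p (v (Z p) - v p) ^+ 2) +
    2 * (\sum_p (v (W p) - v p) ^+ 2))).
  rewrite [X in _ + 2 * X](reindex_inj gi)/= !mulr_sumr -big_split/=.
  apply: ler_sum => p _; rewrite f_invF -/Z.
  have : 0 <= ((v (Z p) - v p) + (v (Z p) - v (g (Z p)))) ^+ 2 by exact: sqr_ge0.
  rewrite !expr2; lra.
apply: (@le_trans _ _ (2 * ((d * (2 * r))%:R ^+ 2 * bond_energy v) +
    2 * ((d * r)%:R ^+ 2 * bond_energy v))).
  rewrite lerD// ler_wpM2l//; apply: (le_trans (walk_energy _ _)).
    by rewrite ler_wpM2r// lerXn2r ?nnegrE ?ler0n// ler_nat.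
  by rewrite sr.
by rewrite !natrM; lra.
Qed.

Lemma near_count r (F : L -> R) : (forall p, 0 <= F p) ->
  \sum_p \sum_(q | near r p q) (F p + F q) <=
  (2 * r + 1)%:R ^+ d * (2 * \sum_p F p).
Proof.
move=> F0; apply: le_trans (near_sum_le _ _) _.
  by move=> p q; rewrite addr_ge0.
rewrite -card_boxes [leRHS]mulr_natl -sumr_const; apply: ler_sum => z _.
rewrite big_split/= mulr_natl mulr2n lerD2l.
set g := invF _; set Z := walk _.
have gi : injective (fun p => g (Z p)).
  by apply: inj_comp; [exact: (can_inj (f_invF _))|exact: walk_inj].
by rewrite -(reindex_inj (P := xpredT) (F := F) gi).
Qed.

End lattice_walks.

(** * A Poincare inequality on the lattice *)

Section lattice_powR.
Variable R : realType.

(** The energy controls increments of rho^(alpha/2) only. [powR_dist_interp] with q = alpha / 2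
    trades them for increments of [rho], at the price of a small multiple of the alpha-th powers. *)
Lemma near_powR (alpha e : R) : 0 < alpha -> 0 < e ->
  exists2 C, 0 <= C & forall (d N r : nat) (rho : lattice d N -> R),
    (forall p, 0 <= rho p) ->
    \sum_p \sum_(q | near r p q) `|rho p - rho q| `^ alpha <=
    (2 * r + 1)%:R ^+ d * (e * \sum_p rho p `^ alpha +
      C * d%:R ^+ 2 * r%:R ^+ 2 * bond_energy (fun p => rho p `^ (alpha / 2))).
Proof.
move=> a0 e0; have e20 : 0 < e / 2 by lra.
have a20 : 0 < alpha / 2 by lra.
have [C C0 CP] := powR_dist_interp ltr01 a20 a0 e20.
exists (10 * C); first exact: mulr_ge0.
move=> d N r rho rho0.
apply: (@le_trans _ _ (\sum_p \sum_(q | near r p q)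
   (e / 2 * (rho p `^ alpha + rho q `^ alpha) +
    C * (rho p `^ (alpha / 2) - rho q `^ (alpha / 2)) ^+ 2))).
  apply: ler_sum => p _; apply: ler_sum => q _.
  have := CP _ _ (rho0 p) (rho0 q).
  rewrite !powRr1// divr1 (_ : alpha / (alpha / 2) = 2%:R).
    by rewrite powR_mulrn// real_normK// num_real.
  by field; lra.
under eq_bigr do rewrite big_split/= -!mulr_sumr.
rewrite big_split/= -!mulr_sumr mulrDr lerD//.
  have := near_count r (fun p => powR_ge0 (rho p) alpha).
  move=> /(ler_wpM2l (ltW e20))/le_trans; apply.
  by rewrite le_eqVlt; apply/orP; left; apply/eqP; field.
have := near_energy r (fun p => rho p `^ (alpha / 2)).
move=> /(ler_wpM2l C0)/le_trans; apply.
by rewrite mulrCA !mulrA -!(mulrC C) !mulrA.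
Qed.

(** The factor N^2 belongs to difference quotients at mesh 1/N, the factor N^-d to the volume of a
    box. *)
Definition dirichlet d N (v : lattice d N -> R) : R :=
  N%:R ^+ 2 / N%:R ^+ d * bond_energy v.

Lemma dirichlet_ge0 d N (v : lattice d N -> R) : 0 <= dirichlet v.
Proof. by rewrite mulr_ge0 ?divr_ge0 ?exprn_ge0 ?bond_energy_ge0. Qed.

Lemma card_lattice d N : #|{: lattice d N}| = (N ^ d)%N.
Proof. by rewrite card_ffun !card_ord. Qed.

Lemma sumr_const_lattice d N (c : R) :
  \sum_(p : lattice d N) c = c * N%:R ^+ d.
Proof. by rewrite sumr_const card_lattice -[LHS]mulr_natr natrX. Qed.

(** At radius [N] every two sites are near, so the distance to the mean is bounded by the energy
    plus a small multiple of the left side itself; [e] is chosen for this multiple to be 1/2. *)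
Lemma lattice_poincare (d : nat) (alpha : R) : 1 < alpha ->
  exists2 C, 0 <= C & forall (N : nat) (rho : lattice d N -> R), (0 < N)%N ->
    (forall p, 0 <= rho p) ->
    (\sum_p rho p `^ alpha) / N%:R ^+ d <=
    C * (dirichlet (fun p => rho p `^ (alpha / 2)) +
         ((\sum_p rho p) / N%:R ^+ d) `^ alpha).
Proof.
move=> a1; have a0 : 0 < alpha by lra.
have z0 : 0 < 2 `^ alpha :> R by rewrite powR_gt0.
pose e := (2 `^ alpha * 3 ^+ d * 2)^-1 : R.
have e0 : 0 < e by rewrite invr_gt0 !mulr_gt0.
have [C C0 CP] := near_powR a0 e0.
exists (2 * 2 `^ alpha * (3 ^+ d * C * d%:R ^+ 2 + 1)).
  by rewrite !mulr_ge0 ?addr_ge0 ?mulr_ge0 ?exprn_ge0 ?powR_ge0.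
move=> N rho N0 rho0.
have N3 : (2 * N + 1 <= 3 * N)%N by clear -N0; lia.
have n0 : 0 < N%:R ^+ d :> R by rewrite exprn_gt0 ?ltr0n.
pose m := (\sum_p rho p) / N%:R ^+ d.
have m0 : 0 <= m by rewrite divr_ge0 ?sumr_ge0// ltW.
set S := (\sum_p _) / _.
pose E := dirichlet (fun p => rho p `^ (alpha / 2)).
have E0 : 0 <= E by exact: dirichlet_ge0.
have step1 : S <= 2 `^ alpha * ((\sum_p `|rho p - m| `^ alpha) / N%:R ^+ d + m `^ alpha).
  rewrite /S ler_pdivrMr// -mulrA mulrDl divfK ?gt_eqF//.
  have -> : m `^ alpha * N%:R ^+ d = \sum_(p : lattice d N) m `^ alpha.
    by rewrite sumr_const_lattice.
  rewrite -big_split mulr_sumr; apply: ler_sum => p _ /=.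
  have := ler_norm_powRD (rho p - m) m (ltW a0).
  by rewrite subrK (ger0_norm m0) (ger0_norm (rho0 p)).
have step2 : (\sum_p `|rho p - m| `^ alpha) / N%:R ^+ d <=
    (\sum_p \sum_(q | near N p q) `|rho p - rho q| `^ alpha) / N%:R ^+ d / N%:R ^+ d.
  rewrite ler_wpM2r ?invr_ge0 ?(ltW n0)// mulr_suml; apply: ler_sum => p _.
  rewrite (eq_bigl xpredT); last by move=> q; rewrite near_all.
  have := @powR_jensen R (lattice d N) (fun=> (N%:R ^+ d)^-1)
    (fun q => rho p - rho q) alpha (ltW a1).
  rewrite mulr_suml [X in _ -> _ <= X](_ : _ =
      \sum_q (N%:R ^+ d)^-1 * `|rho p - rho q| `^ alpha); last first.
    by apply: eq_bigr => q _; rewrite mulrC.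
  have -> : \sum_(q : lattice d N) (N%:R ^+ d)^-1 * (rho p - rho q) = rho p - m.
    rewrite -mulr_sumr sumrB sumr_const_lattice mulrBr /m mulrC.
    by rewrite mulfK ?gt_eqF// mulrC.
  apply; first by move=> _; rewrite invr_ge0 ltW.
  by rewrite sumr_const_lattice mulVf ?gt_eqF.
have step3 : (\sum_p \sum_(q | near N p q) `|rho p - rho q| `^ alpha) / N%:R ^+ d / N%:R ^+ d
    <= 3 ^+ d * (e * S + C * d%:R ^+ 2 * E).
  rewrite ler_pdivrMr// ler_pdivrMr//; apply: (le_trans (CP d N N rho rho0)).
  have -> : 3 ^+ d * (e * S + C * d%:R ^+ 2 * E) * N%:R ^+ d * N%:R ^+ d =
     (3 * N%:R) ^+ d * (e * (S * N%:R ^+ d) + C * d%:R ^+ 2 * (E * N%:R ^+ d)).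
    by rewrite exprMn; ring.
  have -> : S * N%:R ^+ d = \sum_p rho p `^ alpha by rewrite divfK ?gt_eqF.
  have -> : E * N%:R ^+ d = N%:R ^+ 2 * bond_energy (fun p => rho p `^ (alpha / 2)).
    by rewrite /E /dirichlet mulrAC divfK ?gt_eqF.
  have := bond_energy_ge0 (fun p => rho p `^ (alpha / 2)).
  move: (bond_energy _) => b b0.
  have -> : C * d%:R ^+ 2 * (N%:R ^+ 2 * b) = C * d%:R ^+ 2 * N%:R ^+ 2 * b by ring.
  apply: ler_wpM2r.
    rewrite addr_ge0 ?mulr_ge0 ?exprn_ge0// ?(ltW e0)//.
    by rewrite sumr_ge0// => p _; exact: powR_ge0.
  by rewrite -natrM; apply: lerXn2r; rewrite ?nnegrE ?ler0n ?ler_nat.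
have step4 : S <= 2 `^ alpha * (3 ^+ d * (e * S + C * d%:R ^+ 2 * E) + m `^ alpha).
  apply: (le_trans step1); rewrite ler_wpM2l ?(ltW z0)// lerD2r.
  exact: (le_trans step2).
have He : 2 `^ alpha * (3 ^+ d * (e * S + C * d%:R ^+ 2 * E) + m `^ alpha) =
    S / 2 + 2 `^ alpha * (3 ^+ d * C * d%:R ^+ 2 * E + m `^ alpha).
  by rewrite /e; field; rewrite !gt_eqF.
rewrite He in step4.
have : S <= 2 * (2 `^ alpha * (3 ^+ d * C * d%:R ^+ 2 * E + m `^ alpha)) by lra.
move=> /le_trans; apply; rewrite mulrA -[leRHS]mulrA ler_wpM2l ?mulr_ge0 ?(ltW z0)//.
have ma := powR_ge0 m alpha.
have : 0 <= 3 ^+ d * C * d%:R ^+ 2 by rewrite !mulr_ge0// ?ltW// exprn_ge0.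
by rewrite -/E -/m; nra.
Qed.

End lattice_powR.

(** * Translation invariance of the torus measure *)

Section circle.
Variable R : realType.
Local Notation leb := (@lebesgue_measure R).
Local Notation unif := (uniform_prob (@ltr01 R)).

Lemma lebesgue_shift (t : R) (A : set (measurableTypeR R)) : measurable A ->
  leb ((fun x => x + t) @^-1` A) = leb A.
Proof.
have mt : measurable_fun [set: measurableTypeR R]
  ((fun x => x + t) : measurableTypeR R -> measurableTypeR R).
  exact: measurable_funD.
pose m : {measure set (measurableTypeR R) -> \bar R} :=
  measure_function_pushforward__canonical__measure_function_Measure leb mt.
move=> mA; symmetry; apply: (lebesgue_measure_unique (mu := m)) => //.
move=> _ [[a b] /= _ <-].
rewrite [RHS]/pushforward /=.
rewrite (_ : _ @^-1` _ = `]a - t, b - t]%classic); last first.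
  by apply/seteqP; split => x /=; rewrite !in_itv/= ltrBlDr lerBrDr.
rewrite !lebesgue_measure_itv/= !lte_fin ltrD2r; case: ifPn => // _.
by rewrite -!EFinB; congr EFin; ring.
Qed.

Lemma ge0_integral_lebesgue_shift (t : R) (D : set (measurableTypeR R)) (f : measurableTypeR R -> \bar R) :
  measurable D -> measurable_fun [set: _] f -> (forall x, 0 <= f x)%E ->
  (\int[leb]_(x in (fun x => x + t)%R @^-1` D) f (x + t)%R = \int[leb]_(x in D) f x)%E.
Proof.
move=> mD mf f0.
have mt : measurable_fun [set: measurableTypeR R]
  ((fun x => x + t) : measurableTypeR R -> measurableTypeR R).
  exact: measurable_funD.
rewrite -(@ge0_integral_pushforward _ _ _ _ R _ mt leb D f)//; last 1 first.
  exact: measurable_funTS.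
apply: eq_measure_integral => A mA _; rewrite /pushforward/=.
exact: lebesgue_shift.
Qed.

Lemma ge0_integral_unif (f : measurableTypeR R -> \bar R) :
  measurable_fun [set: _] f -> (forall x, 0 <= f x)%E ->
  (\int[unif]_x f x = \int[leb]_(x in `]0%R, 1%R]) f x)%E.
Proof.
move=> mf f0; rewrite integral_uniform// subr0 invr1 mul1e.
rewrite integral_itv_obnd_cbnd//; exact: measurable_funTS.
Qed.

(** The part of the translated interval that lies beyond 1 is moved back by one period. *)
Lemma circle_shift (t : R) (f : measurableTypeR R -> \bar R) : 0 <= t <= 1 ->
  measurable_fun [set: _] f -> (forall x, 0 <= f x)%E ->
  (forall x, f (x + 1)%R = f x) ->
  (\int[unif]_x f (x + t)%R = \int[unif]_x f x)%E.
Proof.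
move=> /andP[t0 t1] mf f0 fp; rewrite !ge0_integral_unif//; last first.
  by apply: measurableT_comp => //; exact: measurable_funD.
rewrite (_ : `]0%R, 1%R]%classic = (fun x : R => x + t) @^-1` `]t, (1 + t)%R]); last first.
  by apply/seteqP; split => x /=; rewrite !in_itv/= lerD2r ltrDr.
rewrite (@ge0_integral_lebesgue_shift t `]t, (1 + t)%R])//.
rewrite (_ : `]t, (1 + t)%R]%classic = `]t, 1] `|` `]1, (1 + t)%R]); last first.
  apply/seteqP; split => x /=; rewrite !in_itv/=.
    by case: (leP x 1) => x1 /andP[tx xt]; [left; rewrite tx|right; rewrite xt].
  by case=> /andP[h1 h2]; apply/andP; split; lra.
rewrite ge0_integral_setU//=; last 2 first.
  exact: measurable_funTS.
  by apply/disj_setPLR => x /=; rewrite !in_itv/= => /andP[? ?] /andP[? ?]; lra.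
rewrite (_ : (fun x : R => x + t) @^-1` (`]t, 1] `|` `]1, (1 + t)%R]) = `]0, t] `|` `]t, 1]); last first.
  apply/seteqP; split => x /=; rewrite !in_itv/=.
    by move=> xx; case: (leP x t) => xt; [left|right]; case: xx => /andP[h1 h2]; apply/andP; split; lra.
  case=> /andP[h1 h2].
    case: (leP (x + t) 1) => xt; [left|right]; apply/andP; split; lra.
  by case: (leP (x + t) 1) => xt; [left|right]; apply/andP; split; lra.
rewrite ge0_integral_setU//=; last 2 first.
  exact: measurable_funTS.
  by apply/disj_setPLR => x /=; rewrite !in_itv/= => /andP[? ?] /andP[? ?]; lra.
rewrite addeC; congr (_ + _)%E.
rewrite -(@ge0_integral_lebesgue_shift 1 `]1, (1 + t)%R])//.
under eq_integral do rewrite fp.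
congr (integral _ _ _); apply/seteqP; split => x /=; rewrite !in_itv/=; lra.
Qed.

End circle.

Section torus_shift.
Variable R : realType.
Local Notation mu d := (torus_measure R d).
Local Notation point d := (torus_point R d).

Lemma ge0_integral_torusS d (f : point d.+1 -> \bar R) :
  measurable_fun [set: _] f -> (forall x, 0 <= f x)%E ->
  (\int[mu d.+1]_x f x =
   \int[(uniform_prob (@ltr01 R) \x mu d)%E]_z f (cons_point z))%E.
Proof. by move=> mf f0; rewrite ge0_integral_distribution. Qed.

Lemma tnth_cons_lift d s (y : point d) (l : 'I_d) :
  tnth (cons_point (s, y)) (lift ord0 l) = tnth y l.
Proof. by rewrite !(tnth_nth 0)/=. Qed.

Definition shift d (i : 'I_d) (t : R) (y : point d) : point d :=
  [tuple tnth y j + (if j == i then t else 0) | j < d].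

Lemma tnth_shift d (i j : 'I_d) t (y : point d) :
  tnth (shift i t y) j = tnth y j + (if j == i then t else 0).
Proof. by rewrite tnth_mktuple. Qed.

Lemma measurable_shift d (i : 'I_d) t :
  measurable_fun [set: point d] (shift i t : point d -> point d).
Proof.
apply/measurable_fun_tnthP => j.
rewrite (_ : _ \o _ = fun y => tnth y j + (if j == i then t else 0)).
  by apply: measurable_funD => //; exact: measurable_tnth.
by apply/funext => y /=; rewrite tnth_shift.
Qed.

(** Induction on the dimension by Tonelli: the shift acts either on the first coordinate, which is
    [circle_shift], or on the remaining ones. [shift] does not wrap around the cube; the periodicity
    of [f] takes that role. *)
Lemma torus_shift d (i : 'I_d) t (f : point d -> \bar R) : 0 <= t <= 1 ->
  measurable_fun [set: _] f -> (forall x, 0 <= f x)%E ->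
  (forall y, f (shift i 1 y) = f y) ->
  (\int[mu d]_y f (shift i t y) = \int[mu d]_y f y)%E.
Proof.
move=> t01; elim: d i f => [[]//|d IHd] i f mf f0 fp.
have mfs : measurable_fun [set: _] (fun y => f (shift i t y)).
  by apply: measurableT_comp => //; exact: measurable_shift.
rewrite !ge0_integral_torusS//.
have mc : measurable_fun [set: _] (fun z => f (@cons_point R d z)).
  by apply: measurableT_comp => //; exact: measurable_cons_point.
have mcs : measurable_fun [set: _] (fun z => f (shift i t (@cons_point R d z))).
  exact: (measurableT_comp mfs (@measurable_cons_point R d)).
case: (unliftP ord0 i) => [j|] ij; last first.
  rewrite !fubini_tonelli2//; apply: eq_integral => y _.
  rewrite /fubini_G/=.
  pose g (s : measurableTypeR R) := f (cons_point (s, y)).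
  have sE s u : shift i u (cons_point (s, y)) = cons_point (s + u, y).
    apply: eq_from_tnth => k; rewrite tnth_shift ij.
    case: (unliftP ord0 k) => [l|] ->; rewrite ?eqxx /=.
      by rewrite addr0 !(tnth_nth 0)/=.
    by rewrite !(tnth_nth 0)/=.
  under eq_integral do rewrite sE.
  apply: (@circle_shift R t g t01) => //.
    exact: (measurableT_comp mc (measurable_pair2 y)).
    by move=> s; exact: f0.
  by move=> s; rewrite /g -sE fp.
rewrite !fubini_tonelli1//; apply: eq_integral => s _.
rewrite /fubini_F/=.
have sE y u : shift i u (cons_point (s, y)) = cons_point (s, shift j u y).
  apply: eq_from_tnth => k; rewrite tnth_shift ij.
  case: (unliftP ord0 k) => [l|] ->; rewrite /=.
    by rewrite (inj_eq lift_inj) !tnth_cons_lift tnth_shift.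
  by rewrite addr0 !(tnth_nth 0)/=.
under eq_integral do rewrite sE.
apply: (IHd j (fun y => f (cons_point (s, y)))) => //.
  exact: (measurableT_comp mc (measurable_pair1 s)).
by move=> y; rewrite -sE fp.
Qed.

End torus_shift.

(** * Measurability and integration over countable partitions *)

Section countable_fibers.
Context d (T : measurableType d) (C : countType) (g : T -> C).
Hypothesis mg : forall c, measurable (g @^-1` [set c]).

Lemma measurable_countable_preimage (A : set C) : measurable (g @^-1` A).
Proof.
rewrite (_ : _ @^-1` _ = \bigcup_c ((g @^-1` [set c]) `&` [set _ | A c])); last first.
  by apply/seteqP; split => [x Ax|x [c _ [/= <-]]//]; exists (g x).
apply: countable_bigcupT_measurable => // c; apply: measurableI => //.
have [Ac|nAc] := pselect (A c).
  by rewrite (_ : [set _ | _] = setT)//; apply/seteqP; split.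
by rewrite (_ : [set _ | _] = set0)//; apply/seteqP; split.
Qed.

Lemma measurable_countable_comp d' (T' : measurableType d') (h : C -> T') :
  measurable_fun [set: T] (h \o g).
Proof. by move=> _ Y _; rewrite setTI; exact: (measurable_countable_preimage (h @^-1` Y)). Qed.

End countable_fibers.

Lemma measurable_forall_ord d (T : measurableType d) n (P : 'I_n -> T -> Prop) :
  (forall i, measurable [set x | P i x]) -> measurable [set x | forall i, P i x].
Proof.
move=> mP; rewrite (_ : mkset _ = \bigcap_(i in [set: 'I_n]) [set x | P i x]).
  exact: fin_bigcap_measurable.
by apply/seteqP; split => x Px i; [move=> _; exact: Px|exact: (Px i)].
Qed.

Lemma measurable_floor_fiber d (T : measurableType d) (R : realType) (g : T -> R) (m : int) :
  measurable_fun [set: T] g -> measurable ((fun x => Num.floor (g x)) @^-1` [set m]).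
Proof.
move=> mg; rewrite (_ : _ @^-1` _ = g @^-1` `[m%:~R, (m + 1)%:~R[%classic).
  by rewrite -[X in measurable X]setTI; exact: mg.
apply/seteqP; split => x /=; rewrite in_itv/=; last by move=> /floor_def.
by move=> <-; rewrite floor_itv.
Qed.

Section finite_partition.
Context d (T : measurableType d) (R : realType) (mu : {measure set T -> \bar R}).
Context (I : finType) (g : T -> I).
Hypothesis mg : forall i, measurable (g @^-1` [set i]).

Lemma ge0_integral_partition (f : T -> \bar R) :
  measurable_fun [set: T] f -> (forall x, 0 <= f x)%E ->
  (\int[mu]_x f x = \sum_i \int[mu]_(x in g @^-1` [set i]) f x)%E.
Proof.
move=> mf f0; have TE : [set: T] = \big[setU/set0]_i (g @^-1` [set i]).
  apply/seteqP; split => // x _.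
  by rewrite -bigcup_seq/=; exists (g x); rewrite //= mem_index_enum.
rewrite [in LHS]TE ge0_integral_bigsetU//.
- exact: index_enum_uniq.
- by move=> i j _ _ [x [/= <- <-]].
- by rewrite -TE.
Qed.

Lemma ge0_integral_finite_comp (F : I -> R) : (forall i, 0 <= F i) ->
  (\int[mu]_x (F (g x))%:E = \sum_i (F i)%:E * mu (g @^-1` [set i]))%E.
Proof.
move=> F0; rewrite ge0_integral_partition//; last 2 first.
- by apply/measurable_EFinP; exact: (measurable_countable_comp mg F).
- by move=> x; rewrite lee_fin.
apply: eq_bigr => i _; rewrite -integral_cst//.
by apply: eq_integral => x; rewrite inE/= => ->.
Qed.

End finite_partition.

(** * The boxes of the lattice as a partition of the torus *)

Section boxes.
Variables (R : realType) (d : nat).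
Local Notation mu := (torus_measure R d).
Local Notation point := (torus_point R d).

Section fixed_scale.
Variables (N : nat) (N0 : (0 < N)%N).
Local Notation L := (lattice d N).

(** The summand 1/2 accounts for boxes centred at lattice points: modulo [N] this is the coordinate
    of the site whose box contains [s]. *)
Definition cell (s : R) : int := Num.floor (N%:R * s + 2^-1).

Let n0 : 0 < N%:R :> R. Proof. by rewrite ltr0n. Qed.

Lemma cellP (s : R) (j k : int) :
  (j%:~R / N%:R - (2 * N%:R)^-1 <= s + k%:~R < j%:~R / N%:R + (2 * N%:R)^-1) <->
  cell s + k * N%:Z = j.
Proof.
have E1 : (j%:~R / N%:R - (2 * N%:R)^-1 <= s + k%:~R) =
    ((j - k * N%:Z)%:~R <= N%:R * s + 2^-1).
  rewrite -(ler_pM2r n0) mulrBl divfK ?gt_eqF//.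
  rewrite (_ : (2 * N%:R)^-1 * N%:R = 2^-1); last by field; rewrite gt_eqF.
  by rewrite intrB intrM -pmulrn; apply/idP/idP; lra.
have E2 : (s + k%:~R < j%:~R / N%:R + (2 * N%:R)^-1) =
    (N%:R * s + 2^-1 < (j - k * N%:Z + 1)%:~R).
  rewrite -(ltr_pM2r n0) [X in _ < X]mulrDl divfK ?gt_eqF//.
  rewrite (_ : (2 * N%:R)^-1 * N%:R = 2^-1); last by field; rewrite gt_eqF.
  by rewrite intrD intrB intrM -pmulrn; apply/idP/idP; lra.
rewrite E1 E2 -floor_eq -/(cell s); split=> [/eqP ->|<-]; first by ring.
by apply/eqP; ring.
Qed.

Lemma cellD1 (s : R) : cell (s + N%:R^-1) = cell s + 1.
Proof.
rewrite /cell mulrDr divff ?gt_eqF// addrAC floorDrz ?rpred1//.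
by rewrite floor1.
Qed.

Lemma boxP (x : L) (y : point) :
  box x y <-> forall i, (cell (tnth y i) = x i %[mod N])%Z.
Proof.
split=> [xy i|xy i].
  have [k] := xy i; rewrite pmulrn => /(cellP _ (x i)%:Z) <-.
  by rewrite addrC modzMDl.
exists (- (cell (tnth y i) %/ N)%Z); rewrite pmulrn.
apply/(cellP _ (x i)%:Z).
have /eqP := xy i; rewrite (modz_small (m := (x i)%:Z)); last first.
  by have := ltn_ord (x i); lia.
move=> /eqP H; rewrite mulNr {1}(divz_eq (cell (tnth y i)) N) addrAC subrr add0r.
exact: H.
Qed.

Lemma cell_ord (s : R) : (`|(cell s %% N)%Z|%N < N)%N.
Proof.
have h := modz_ge0 (cell s) (_ : N%:Z != 0).
have : (cell s %% N)%Z < N%:Z by rewrite ltz_pmod// ltz_nat.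
by move: h; rewrite (_ : N%:Z != 0) ?eqz_nat -?lt0n//; lia.
Qed.

Definition boxidx (y : point) : L := [ffun i => Ordinal (cell_ord (tnth y i))].

Lemma box_boxidx (x : L) (y : point) : box x y <-> boxidx y = x.
Proof.
have c0 i : 0 <= (cell (tnth y i) %% N)%Z.
  by rewrite modz_ge0// eqz_nat -lt0n.
rewrite boxP; split => [xy|<- i].
  apply/ffunP => i; apply/val_inj; rewrite ffunE/=.
  have := xy i; rewrite (modz_small (m := (x i)%:Z)) => [->//|].
  by have := ltn_ord (x i); lia.
by rewrite ffunE/= gez0_abs// modz_mod.
Qed.

Lemma box_preimage (x : L) : box x = boxidx @^-1` [set x].
Proof. by apply/seteqP; split => y; rewrite /= box_boxidx. Qed.

Lemma measurable_box (x : L) : measurable (box x : set point).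
Proof.
rewrite (_ : box x = [set y | forall i, (cell (tnth y i) = x i %[mod N])%Z]).
  apply: measurable_forall_ord => i.
  apply: (measurable_countable_preimage (g := fun y => cell (tnth y i)) _
    [set m | (m = x i %[mod N])%Z]) => m.
  apply: measurable_floor_fiber; apply: measurable_funD => //.
  by apply: measurable_funM => //; exact: measurable_tnth.
by apply/seteqP; split => y; rewrite /= boxP.
Qed.

Lemma measurable_boxidx (x : L) : measurable (boxidx @^-1` [set x]).
Proof. by rewrite -box_preimage; exact: measurable_box. Qed.

Lemma boxidx_shift i (y : point) : boxidx (shift i N%:R^-1 y) = step_up i (boxidx y).
Proof.
apply/ffunP => j; apply/val_inj; rewrite !ffunE/= tnth_shift.
case: eqP => [_|_] /=; last by rewrite addr0.
rewrite cellD1 -[in LHS]modzDml.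
have -> : (cell (tnth y j) %% N)%Z = `|(cell (tnth y j) %% N)%Z|%N%:Z by lia.
by rewrite absz_nat -PoszD addn1 modz_nat absz_nat.
Qed.

Lemma boxidx_shift1 i (y : point) : boxidx (shift i 1 y) = boxidx y.
Proof.
apply/ffunP => j; apply/val_inj; rewrite !ffunE/= tnth_shift.
case: eqP => [_|_] /=; last by rewrite addr0.
have fN : Num.floor (N%:R : R) = N%:Z by rewrite pmulrn intrKfloor.
by rewrite /cell mulrDr mulr1 addrAC floorDrz ?natr_int// fN modzDr.
Qed.

Lemma inv_N01 : (0 : R) <= (N%:R : R)^-1 <= (1 : R).
Proof. by rewrite invr_ge0 ler0n/= invf_le1// ler1n. Qed.

Lemma box_step_up (i : 'I_d) (p : L) : mu (box (step_up i p)) = mu (box p).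
Proof.
have muE (q : L) : mu (box q) = (\int[mu]_y (\1_(box q : set point) y)%:E)%E.
  by rewrite integral_indic ?setIT//; exact: measurable_box.
rewrite !muE.
have mb (q : L) : measurable_fun [set: point] (fun y => (\1_(box q : set point) y)%:E : \bar R).
  by apply/measurable_EFinP; apply: measurable_indic; exact: measurable_box.
rewrite -[LHS](@torus_shift R d i N%:R^-1)//; last 2 first.
- exact: inv_N01.
- move=> y; rewrite !indicE !box_preimage; congr ((_ : bool)%:R%:E).
  by apply/idP/idP; rewrite !inE/= boxidx_shift1.
apply: eq_integral => y _; rewrite !indicE !box_preimage.
congr ((_ : bool)%:R%:E); apply/idP/idP; rewrite !inE/= boxidx_shift.
  by move/(can_inj (step_upK i)).
by move=> ->.
Qed.

Lemma box_walk s (p : L) : mu (box (walk s p)) = mu (box p).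
Proof. by elim: s => //= i s IHs; rewrite box_step_up. Qed.

(** All boxes have the same measure, since a step is a translation by 1/N and walks join any two
    sites; there are N^d boxes. *)
Lemma torus_box (p : L) : mu (box p) = (N%:R ^- d)%:E.
Proof.
have muE (q : L) : mu (box q) = mu (box p).
  have /existsP[z /eqP zE] := near_all p q.
  by rewrite -(box_walk (steps (fun=> N)) q) -zE box_walk.
have mfin : mu (box p) \is a fin_num by exact: fin_num_measure (measurable_box p).
have : (\int[mu]_x (1%R)%:E = 1)%E.
  by rewrite integral_cst// mul1e; exact: (@probability_setT _ _ R mu).
rewrite (ge0_integral_finite_comp mu measurable_boxidx (F := fun=> 1))//.
rewrite (eq_bigr (fun=> (fine (mu (box p)))%:E)); last first.
  by move=> q _; rewrite mul1e -box_preimage fineK//; exact: muE.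
rewrite sumEFin sumr_const_lattice -(fineK mfin) => -[H].
congr EFin.
by apply: (mulIf (_ : N%:R ^+ d != 0)); rewrite ?H ?mulVf// gt_eqF// exprn_gt0.
Qed.

Lemma ge0_integral_boxidx (F : L -> R) : (forall p, 0 <= F p) ->
  (\int[mu]_y (F (boxidx y))%:E = ((\sum_p F p) / N%:R ^+ d)%:E)%E.
Proof.
move=> F0; rewrite (ge0_integral_finite_comp mu measurable_boxidx)//.
rewrite (eq_bigr (fun p => (F p / N%:R ^+ d)%:E)) ?sumEFin ?mulr_suml// => p _.
by rewrite -box_preimage [RHS]EFinM; congr (_ * _)%E; exact: torus_box.
Qed.

End fixed_scale.
End boxes.

(** * Calculus of real-valued integrals *)

Section integrable_EFin.
Context d (T : measurableType d) (R : realType) (mu : {measure set T -> \bar R}).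
Implicit Types f g : T -> R.

Lemma integrableD_EFin f g : mu.-integrable [set: T] (EFin \o f) ->
  mu.-integrable [set: T] (EFin \o g) ->
  mu.-integrable [set: T] (EFin \o (fun x => f x + g x)).
Proof. by move=> fi gi; exact: (integrableD measurableT fi gi). Qed.

Lemma integrableB_EFin f g : mu.-integrable [set: T] (EFin \o f) ->
  mu.-integrable [set: T] (EFin \o g) ->
  mu.-integrable [set: T] (EFin \o (fun x => f x - g x)).
Proof. by move=> fi gi; exact: (integrableB measurableT fi gi). Qed.

Lemma integrableZ_EFin (k : R) f : mu.-integrable [set: T] (EFin \o f) ->
  mu.-integrable [set: T] (EFin \o (fun x => k * f x)).
Proof. by move=> fi; exact: (integrableZl measurableT k fi). Qed.

End integrable_EFin.

Section Rintegral_extra.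
Context d (T : measurableType d) (R : realType).
Variable mu : {finite_measure set T -> \bar R}.
Implicit Types f g : T -> R.

Lemma bounded_integrable f B : measurable_fun [set: T] f ->
  (forall x, `|f x| <= B) -> mu.-integrable [set: T] (EFin \o f).
Proof.
move=> mf fB; apply: measurable_bounded_integrable => //.
  by rewrite -ge0_fin_numE// fin_num_measure.
by exists B; split; [exact: num_real|move=> M BM x _ /=; rewrite (le_trans (fB x))// ltW].
Qed.

Lemma bounded_integrableM f g B : measurable_fun [set: T] f ->
  (forall x, `|f x| <= B) -> mu.-integrable [set: T] (EFin \o g) ->
  mu.-integrable [set: T] (EFin \o (fun x => f x * g x)).
Proof.
move=> mf fB ig; have mg := measurable_int mu ig.
apply: (@le_integrable _ _ _ mu _ measurableT _ (fun x => B%:E * (g x)%:E)%E).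
- apply/measurable_EFinP; apply: measurable_funM => //; exact/measurable_EFinP.
- move=> x _ /=; rewrite lee_fin !normrM ler_wpM2r//.
  by rewrite (le_trans (fB x))// ler_norm.
- exact: integrableZl.
Qed.

Lemma integrable_indicM (A : set T) g : measurable A ->
  mu.-integrable [set: T] (EFin \o g) ->
  mu.-integrable [set: T] (EFin \o (fun x => \1_A x * g x)).
Proof.
move=> mA ig; apply: (@bounded_integrableM _ _ 1) => //.
by move=> x; rewrite indicE; case: (_ \in _); rewrite ?normr0 ?normr1.
Qed.

Lemma Rintegral_sum I (s : seq I) (F : I -> T -> R) :
  (forall i, mu.-integrable [set: T] (EFin \o F i)) ->
  \int[mu]_x (\sum_(i <- s) F i x) = \sum_(i <- s) \int[mu]_x F i x.
Proof.
move=> iF; elim: s => [|i s IHs].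
  rewrite big_nil; under eq_Rintegral do rewrite big_nil.
  by rewrite Rintegral_cst// mul0r.
under eq_Rintegral do rewrite big_cons.
rewrite big_cons RintegralD// ?IHs//.
rewrite (_ : _ \o _ = fun x => \sum_(j <- s) (F j x)%:E)%E.
  by apply: integrable_sum => // j _; exact: iF.
by apply/funext => x /=; rewrite sumEFin.
Qed.

Lemma Rintegral_partition (I : finType) (g : T -> I) (F : I -> R) f :
  (forall i, measurable (g @^-1` [set i])) -> mu.-integrable [set: T] (EFin \o f) ->
  \int[mu]_x (F (g x) * f x) = \sum_i F i * \int[mu]_(x in g @^-1` [set i]) f x.
Proof.
move=> mg ig.
transitivity (\int[mu]_x (\sum_i (F i * (\1_(g @^-1` [set i]) x * f x)))).
  apply: eq_Rintegral => x _; rewrite (bigD1 (g x))//= big1 ?addr0.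
    by rewrite indicE mem_set// mul1r.
  by move=> i ix; rewrite indicE memNset ?mul0r ?mulr0//= => /esym/eqP; apply/negP.
rewrite Rintegral_sum; last first.
  move=> i; rewrite (_ : _ \o _ =
    (fun x => (F i)%:E * ((\1_(g @^-1` [set i]) x : R) * f x)%:E)%E)//.
  by apply: integrableZl => //; exact: integrable_indicM.
apply: eq_bigr => i _; rewrite RintegralZl//; last exact: integrable_indicM.
congr (_ * _); rewrite [RHS]Rintegral_mkcond; apply: eq_Rintegral => x _.
by rewrite patchE indicE; case: (_ \in _); rewrite ?mul1r ?mul0r.
Qed.

End Rintegral_extra.

(** * Periodic continuous test functions *)

Section distance_to_integers.
Variable R : realType.
Implicit Types s t c : R.

Definition distZ s : R :=
  Num.min (s - (Num.floor s)%:~R) (1 - (s - (Num.floor s)%:~R)).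

Lemma distZ_le s (n : int) : distZ s <= `|s - n%:~R|.
Proof.
have /andP[f1 f2] := floor_itv s; rewrite intrD in f2.
rewrite /distZ; have [nf|nf] := leP n (Num.floor s).
  have : n%:~R <= (Num.floor s)%:~R :> R by rewrite ler_int.
  move=> h; rewrite ger0_norm; last lra.
  by rewrite ge_min; apply/orP; left; lra.
have : ((Num.floor s) + 1)%:~R <= n%:~R :> R by rewrite ler_int; lia.
rewrite intrD => h; rewrite ler0_norm; last lra.
by rewrite ge_min; apply/orP; right; lra.
Qed.

Lemma distZ_ex s : exists n : int, distZ s = `|s - n%:~R|.
Proof.
have /andP[f1 f2] := floor_itv s; rewrite intrD in f2.
rewrite /distZ minElt; case: ifPn => _.
  by exists (Num.floor s); rewrite ger0_norm//; lra.
by exists (Num.floor s + 1); rewrite intrD ler0_norm; lra.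
Qed.

Lemma distZ_lip s t : `|distZ s - distZ t| <= `|s - t|.
Proof.
have H (x y : R) : distZ x <= distZ y + `|x - y|.
  have [n ->] := distZ_ex y; apply: (le_trans (distZ_le x n)).
  by rewrite (_ : x - n%:~R = y - n%:~R + (x - y)) ?ler_normD//; ring.
have := H s t; have := H t s; rewrite (distrC t s) ler_norml; lra.
Qed.

Lemma distZD1 s : distZ (s + 1) = distZ s.
Proof.
rewrite /distZ floorDrz ?rpred1// floor1 intrD.
by congr Num.min; ring.
Qed.

Definition tent (k : nat) c s : R := Num.max 0 (1 - k%:R * distZ (s - c)).

Lemma tent01 k c s : 0 <= tent k c s <= 1.
Proof.
rewrite /tent le_max lexx/= ge_max ler01 gerBl mulr_ge0//.
by have [n ->] := distZ_ex (s - c).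
Qed.

Lemma tentD1 k c s : tent k c (s + 1) = tent k c s.
Proof. by rewrite /tent addrAC distZD1. Qed.

Lemma tent_lip k c s t : `|tent k c s - tent k c t| <= k%:R * `|s - t|.
Proof.
have := distZ_lip (s - c) (t - c).
have -> : s - c - (t - c) = s - t by ring.
move=> /(ler_wpM2l (ler0n R k)).
set a := distZ _; set b := distZ _; rewrite -{1}[k%:R]ger0_norm// -normrM mulrBr.
rewrite /tent -/a -/b; move: (k%:R * a) (k%:R * b) => x y xy.
apply: le_trans xy; rewrite ler_norml; have := ler_norm (x - y).
have := ler_norm (y - x); rewrite (distrC y x).
by case: (leP 0 (1 - x)); case: (leP 0 (1 - y)); lra.
Qed.

Lemma tent_continuous k c : continuous (tent k c).
Proof.
move=> s; apply/cvgrPdist_le => e e0; near=> t.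
apply: (le_trans (tent_lip k c s t)).
have st : `|s - t| <= e / (k%:R + 1).
  by near: t; apply: cvgr_dist_le => //; rewrite divr_gt0.
apply: (@le_trans _ _ ((k%:R + 1) * `|s - t|)).
  by rewrite ler_wpM2r// lerDl.
by rewrite mulrC -ler_pdivlMr.
Unshelve. all: by end_near. Qed.

End distance_to_integers.

Section torus_functions.
Variables (R : realType) (d : nat).
Local Notation mu := (torus_measure R d).
Local Notation point := (torus_point R d).

Lemma row_of_pointE (y : point) i : row_of_point y 0 i = tnth y i.
Proof. by rewrite mxE. Qed.

(** The sigma-algebra on tuples is the product one, whereas [phi] is continuous for the matrix
    topology. Rounding the coordinates down to multiples of 1 / (n + 1) gives functions with
    countably many values, which converge pointwise. *)
Lemma measurable_row_comp (phi : 'rV[R]_d -> R) : continuous phi ->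
  measurable_fun [set: point] (phi \o @row_of_point R d).
Proof.
move=> cphi.
pose g (n : nat) (y : point) : {ffun 'I_d -> int} :=
  [ffun i => Num.floor (n.+1%:R * tnth y i)].
pose h (n : nat) (c : {ffun 'I_d -> int}) : R :=
  phi (\row_i ((c i)%:~R / n.+1%:R)).
apply: (@measurable_fun_cvg _ _ _ _ (fun n => h n \o g n)).
  move=> n; apply: measurable_countable_comp => c.
  rewrite (_ : _ @^-1` _ = [set y | forall i, Num.floor (n.+1%:R * tnth y i) = c i]).
    apply: measurable_forall_ord => i; apply: measurable_floor_fiber.
    by apply: measurable_funM => //; exact: measurable_tnth.
  apply/seteqP; split => y /=; first by move=> <- i; rewrite ffunE.
  by move=> H; apply/ffunP => i; rewrite ffunE.
move=> y _.
suff cv : (\row_i ((g n y i)%:~R / n.+1%:R)) @[n --> \oo] --> row_of_point y.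
  exact: (cvg_comp _ _ cv (cphi _)).
apply/cvgrPdist_lt => e e0; near=> n.
rewrite /Num.Def.normr/= mx_normrE; apply/bigmax_ltP; split => // -[i j] _ /=.
rewrite !mxE ffunE; set s := tnth y j.
have /andP[f1 f2] := floor_itv (n.+1%:R * s); rewrite intrD in f2.
have n0 : 0 < n.+1%:R :> R by rewrite ltr0n.
have -> : s - (Num.floor (n.+1%:R * s))%:~R / n.+1%:R =
   (n.+1%:R * s - (Num.floor (n.+1%:R * s))%:~R) / n.+1%:R.
  by rewrite mulrBl mulrAC divff ?mul1r// gt_eqF.
rewrite ger0_norm; last by rewrite divr_ge0 ?(ltW n0)// subr_ge0.
rewrite ltr_pdivrMr//; apply: (@lt_trans _ _ 1); first lra.
rewrite -ltr_pdivrMr// div1r.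
near: n; exact: (near_infty_natSinv_lt (PosNum e0)).
Unshelve. all: by end_near. Qed.

Lemma periodic_int (phi : 'rV[R]_d -> R) (c : 'I_d -> int) x : periodic phi ->
  phi (x + \row_i (c i)%:~R) = phi x.
Proof.
move=> pphi.
have pn i n y : phi (y + n%:R *: delta_mx 0 i) = phi y.
  elim: n => [|n IHn]; first by rewrite scale0r addr0.
  by rewrite -natr1 scalerDl scale1r addrA pphi.
have pz i (m : int) y : phi (y + m%:~R *: delta_mx 0 i) = phi y.
  case: m => n; first by rewrite -pmulrn pn.
  rewrite NegzE mulrNz scaleNr -pmulrn -[in RHS](subrK (n.+1%:R *: delta_mx 0 i) y).
  by rewrite pn.
have -> : \row_i (c i)%:~R = \sum_i (c i)%:~R *: (delta_mx 0 i : 'rV[R]_d).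
  by rewrite [LHS]row_sum_delta; apply: eq_bigr => i _; rewrite mxE.
elim/big_ind : _ x => [|u v IHu IHv|i _] x; first by rewrite addr0.
  by rewrite addrA IHv IHu.
exact: pz.
Qed.

Lemma periodic_bounded (phi : 'rV[R]_d -> R) : continuous phi -> periodic phi ->
  exists2 B, 0 < B & forall x, `|phi x| <= B.
Proof.
move=> cphi pphi; pose K : set 'rV[R]_d := [set x | forall i, `[0, 1]%classic (x 0 i)].
have cK : compact K.
  exact: (@rV_compact R d (fun=> `[0, 1]%classic) (fun=> @segment_compact R 0 1)).
have cfK : compact (phi @` K).
  by apply: continuous_compact => //; exact: continuous_subspaceT.
have [M [_ HM]] := compact_bounded cfK.
exists (`|M| + 1) => [|x]; first by rewrite ltr_pwDr.
rewrite -(periodic_int (fun i => - Num.floor (x 0 i)) x pphi).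
apply: (HM (`|M| + 1)); first by rewrite (le_lt_trans (ler_norm M))// ltrDl.
exists (x + \row_i (- Num.floor (x 0 i))%:~R) => // i; rewrite /= in_itv/= !mxE.
have /andP[f1 f2] := floor_itv (x 0 i); rewrite intrD in f2.
by rewrite mulrNz; apply/andP; split; lra.
Qed.

Lemma row_shift (y : point) i t :
  row_of_point (shift i t y) = row_of_point y + t *: delta_mx 0 i.
Proof.
apply/rowP => j; rewrite !mxE tnth_shift eqxx/=.
by case: eqP => _; rewrite ?mulr1 ?mulr0.
Qed.

Lemma continuous_prod I (s : seq I) (f : I -> 'rV[R]_d -> R) :
  (forall i, continuous (f i)) -> continuous (fun x => \prod_(i <- s) f i x).
Proof.
move=> cf; elim: s => [|i s IHs] x.
  have -> : (fun x : 'rV[R]_d => \prod_(j <- [::]) f j x) = cst 1.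
    by apply/funext => y; rewrite big_nil.
  exact: cst_continuous.
have -> : (fun x : 'rV[R]_d => \prod_(j <- i :: s) f j x) =
    f i * (fun x => \prod_(j <- s) f j x).
  by apply/funext => y; rewrite big_cons.
by apply: continuousM; [exact: cf|exact: IHs].
Qed.

Section bump.
Variables (k : nat) (b : lattice d k).

(** A continuous periodic substitute for the indicator of a box at scale [k]: weak-star convergence
    tests continuous functions only. *)
Definition bump_fun (x : 'rV[R]_d) : R :=
  \prod_i tent k ((b i)%:R / k%:R) (x 0 i).

Lemma bump_continuous : continuous bump_fun.
Proof.
apply: continuous_prod => i x.
apply: (@continuous_comp _ _ _ (fun x : 'rV[R]_d => x 0 i) (tent k _)).
  exact: coord_continuous.
exact: tent_continuous.
Qed.

Lemma bump_periodic : periodic bump_fun.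
Proof.
move=> x i; apply: eq_bigr => j _; rewrite !mxE eqxx/=.
by case: eqP => _; rewrite ?tentD1 ?addr0.
Qed.

Definition bump : torus_cont R d := TorusCont bump_continuous bump_periodic.

Lemma bump01 x : 0 <= bump x <= 1.
Proof.
apply/andP; split.
  by apply: prodr_ge0 => i _; have /andP[] := tent01 k ((b i)%:R / k%:R) (x 0 i).
by apply: prodr_ile1 => i _; exact: tent01.
Qed.

(** In the box each coordinate is within 1 / (2 k) of the centre, so every tent is at least 1/2. *)
Lemma bump_ge (k0 : (0 < k)%N) y : box b y -> 2 ^- d <= bump (row_of_point y).
Proof.
move=> by_; have kR : 0 < k%:R :> R by rewrite ltr0n.
rewrite -exprVn -[X in _ ^+ X]card_ord -prodr_const; apply: ler_prod => i _.
rewrite invr_ge0 ler0n/= /tent le_max; apply/orP; right.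
have [n /andP[h1 h2]] := by_ i; rewrite row_of_pointE.
set s := tnth y i in h1 h2 *; set c := (b i)%:R / k%:R in h1 h2 *.
have : distZ (s - c) <= (2 * k%:R)^-1.
  apply: (le_trans (distZ_le _ (- n))); rewrite mulrNz opprK ler_norml.
  by apply/andP; split; lra.
move=> /(ler_wpM2l (ltW kR)); rewrite invfM mulrCA divff ?gt_eqF//; lra.
Qed.

Lemma bump_supp x i : 0 < bump x -> k%:R * distZ (x 0 i - (b i)%:R / k%:R) < 1.
Proof.
move=> b0; rewrite ltNge; apply/negP => H; move: b0.
rewrite /= /bump_fun (bigD1 i)//= {1}/tent (max_idPl _) ?mul0r ?ltxx//.
by rewrite subr_le0.
Qed.

End bump.
End torus_functions.

Notation integrableR mu f := (mu.-integrable setT (EFin \o f)).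

(** * Local averages at a fixed scale *)

Section smoothing.
Variables (R : realType) (d : nat).
Local Notation mu := (torus_measure R d).
Local Notation point := (torus_point R d).

Section weights.
Variables (k : nat) (k0 : (0 < k)%N) (b : lattice d k).

Lemma bump_integrable : integrableR mu (fun y => bump R b (row_of_point y)).
Proof.
apply: (@bounded_integrable _ _ _ _ _ 1).
  exact: measurable_row_comp (@bump_continuous R d k b).
by move=> y; have /andP[b0 b1] := bump01 b (row_of_point y); rewrite ger0_norm.
Qed.

Definition bump_mass : R := \int[mu]_y bump R b (row_of_point y).

Lemma bump_mass_ge : (2 * k%:R) ^- d <= bump_mass.
Proof.
have mb := @measurable_box R d k k0 b.
have iB : integrableR mu (fun y => 2 ^- d * \1_(box b : set point) y).
  apply: (@bounded_integrable _ _ _ _ _ (2 ^- d)).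
    by apply: measurable_funM => //.
  move=> y; rewrite indicE normrM ger0_norm ?invr_ge0 ?exprn_ge0//.
  by case: (_ \in _); rewrite ?normr0 ?normr1 ?mulr0 ?mulr1// invr_ge0 exprn_ge0.
apply: (@le_trans _ _ (\int[mu]_y (2 ^- d * \1_(box b : set point) y))).
  rewrite RintegralZl//; last first.
    by apply: (@bounded_integrable _ _ _ _ _ 1) => // y; rewrite indicE; case: (_ \in _); rewrite ?normr0 ?normr1.
  rewrite /Rintegral integral_indic// setIT.
  rewrite exprMn invfM le_eqVlt; apply/orP; left; apply/eqP; congr (_ * _).
  exact: (esym (congr1 fine (@torus_box R d k k0 b))).
apply: le_Rintegral => //; first exact: bump_integrable.
move=> y _; rewrite indicE; have [yb|yb] := boolP (y \in _).
  by rewrite mulr1; apply: bump_ge => //; move: yb; rewrite inE.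
by rewrite mulr0; have /andP[] := bump01 b (row_of_point y).
Qed.

Lemma bump_mass_gt0 : 0 < bump_mass.
Proof.
by apply: lt_le_trans bump_mass_ge; rewrite invr_gt0 exprn_gt0// mulr_gt0// ltr0n.
Qed.

End weights.

Section lattice_smoothing.
Variables (k N : nat) (k0 : (0 < k)%N) (N0 : (0 < N)%N) (kN : (k <= N)%N).
Local Notation LN := (lattice d N).
Local Notation Lk := (lattice d k).

Definition bump_weight (b : Lk) (q : LN) : R :=
  \int[mu]_(y in box q) bump R b (row_of_point y).

Lemma bump_weight_ge0 b q : 0 <= bump_weight b q.
Proof.
by apply: Rintegral_ge0 => y _; have /andP[] := bump01 b (row_of_point y).
Qed.

Lemma sum_bump_weight b : \sum_q bump_weight b q = bump_mass b.
Proof.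
have := @Rintegral_partition _ _ R mu LN (@boxidx R d N N0) (fun=> 1)
  (fun y => bump R b (row_of_point y)) (measurable_boxidx N0) (bump_integrable b).
under eq_Rintegral do rewrite mul1r; rewrite -/(bump_mass b) => ->.
by apply: eq_bigr => q _; rewrite mul1r /bump_weight box_preimage.
Qed.

Lemma bump_weight_le b q : bump_weight b q <= N%:R ^- d.
Proof.
have mb := @measurable_box R d N N0 q.
have -> : N%:R ^- d = \int[mu]_(y in box q) 1.
  rewrite Rintegral_cst// mul1r.
  exact: (esym (congr1 fine (@torus_box R d N N0 q))).
apply: le_Rintegral => //.
- by apply: (integrableS measurableT) => //; exact: bump_integrable.
- apply: (integrableS measurableT) => //.
  by apply: (@bounded_integrable _ _ _ _ _ 1) => // y; rewrite normr1.
- by move=> y _; have /andP[] := bump01 b (row_of_point y).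
Qed.

Lemma bump_weight_supp b q : bump_weight b q != 0 ->
  exists2 y, box q y & 0 < bump R b (row_of_point y).
Proof.
apply: contra_neqP => H; rewrite /bump_weight.
transitivity (\int[mu]_(y in box q) 0); last first.
  by rewrite Rintegral_cst ?mul0r//; exact: measurable_box.
apply: eq_Rintegral => y; rewrite inE => qy /=; apply/eqP; apply: contra_notT H => bn0.
by exists y => //; rewrite lt0r bn0; have /andP[] := bump01 b (row_of_point y).
Qed.

Definition smoothing (rho : LN -> R) (b : Lk) : R :=
  (\sum_q rho q * bump_weight b q) / bump_mass b.

(** From [p] to [q] one passes through a point of both boxes, the centre of the coarse box and a
    point of the support of the bump. The distances 1/(2N), 1/(2k), 1/k and 1/(2N) add up to less
    than 5/k because k <= N. *)
Lemma bump_near (p q : LN) (b : Lk) : (box p `&` box b : set point) !=set0 ->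
  bump_weight b q != 0 -> near ((5 * N) %/ k) p q.
Proof.
move=> [x [px bx]] /bump_weight_supp[y qy b0]; apply: near_dist => i.
have kR : 0 < k%:R :> R by rewrite ltr0n.
have NR : 0 < N%:R :> R by rewrite ltr0n.
have [n1 /andP[p1 p2]] := px i; have [n2 /andP[b1 b2]] := bx i.
have [n3 /andP[q1 q2]] := qy i.
have := bump_supp i b0; have [n4 ->] := distZ_ex (row_of_point y 0 i - (b i)%:R / k%:R).
rewrite -ltr_pdivlMl// mulr1 ltr_norml row_of_pointE => /andP[s1 s2].
exists (n2 - n1 + n3 + n4).
move: p1 p2 b1 b2 q1 q2 s1 s2; rewrite !invfM.
move=> p1 p2 b1 b2 q1 q2 s1 s2.
set m := _ - _ + _.
have mE : m%:~R / N%:R = (p i)%:R / N%:R - (q i)%:R / N%:R + (n2%:~R - n1%:~R + n3%:~R + n4%:~R) :> R.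
  rewrite /m !(intrD, intrB, intrM) -!pmulrn.
  by field; rewrite gt_eqF.
have Nk : N%:R^-1 <= k%:R^-1 :> R by rewrite lef_pV2 ?posrE// ler_nat.
have mb : `|m%:~R| <= 5 * N%:R / k%:R :> R.
  have -> : m%:~R = m%:~R / N%:R * N%:R :> R by rewrite divfK ?gt_eqF.
  rewrite normrM (ger0_norm (ltW NR)) mulrAC ler_wpM2r ?(ltW NR)// mE ler_norml.
  have ? : 0 < k%:R^-1 :> R by rewrite invr_gt0.
  by apply/andP; split; lra.
have : (`|m|%N * k <= 5 * N)%N.
  rewrite -(ler_nat R) !natrM -ler_pdivlMr//.
  by rewrite natr_absz intr_norm.
by rewrite -leq_divRL// => h; lia.
Qed.

Lemma smoothing_jensen (alpha : R) rho (p : LN) (b : Lk) : 1 <= alpha ->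
  `|rho p - smoothing rho b| `^ alpha <=
  \sum_q bump_weight b q / bump_mass b * `|rho p - rho q| `^ alpha.
Proof.
move=> a1; have m0 := bump_mass_gt0 k0 b.
have w1 : \sum_q bump_weight b q / bump_mass b = 1.
  by rewrite -mulr_suml sum_bump_weight divff// gt_eqF.
have -> : rho p - smoothing rho b =
    \sum_q bump_weight b q / bump_mass b * (rho p - rho q).
  under eq_bigr do rewrite mulrBr; rewrite sumrB -mulr_suml w1 mul1r.
  congr (_ - _); rewrite /smoothing mulr_suml; apply: eq_bigr => q _.
  by rewrite -mulrA mulrC.
apply: powR_jensen => // q; rewrite divr_ge0 ?bump_weight_ge0//.
exact: ltW.
Qed.

(** The integral is a sum over pairs of a fine and a coarse box. Jensen compares [rho p] with the
    average, whose weights are at most (2 k)^d N^-d by the lower bound on the mass of a bump; the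
    coarse boxes then sum out. *)
Lemma smoothing_error_near (alpha : R) rho : 1 <= alpha ->
  (\int[mu]_y (`|rho (boxidx N0 y) - smoothing rho (boxidx k0 y)| `^ alpha)%:E <=
   ((2 * k%:R) ^+ d * N%:R ^- d * N%:R ^- d *
    \sum_p \sum_(q | near ((5 * N) %/ k) p q) `|rho p - rho q| `^ alpha)%:E)%E.
Proof.
move=> a1; pose g (y : point) : LN * Lk := (boxidx N0 y, boxidx k0 y).
have mg c : measurable (g @^-1` [set c]).
  rewrite (_ : _ @^-1` _ = box c.1 `&` box c.2).
    by apply: measurableI; exact: measurable_box.
  apply/seteqP; split => y; rewrite /g !box_preimage/=; first by move=> <-.
  by case: c => c1 c2 /= [-> ->].
pose m c := fine (mu (g @^-1` [set c])).
have m0 c : 0 <= m c by rewrite /m fine_ge0.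
have mE c : mu (g @^-1` [set c]) = (m c)%:E.
  by rewrite fineK//; apply: fin_num_measure.
have sumE (F : LN -> Lk -> R) :
    \sum_c F c.1 c.2 * m c = \sum_p \sum_b F p b * m (p, b).
  by rewrite pair_bigA/=; apply: eq_bigr => -[p b].
have mp p : \sum_b m (p, b) = N%:R ^- d.
  have := ge0_integral_boxidx N0 (F := fun q => (q == p)%:R : R) (fun=> ler0n _ _).
  rewrite (bigD1 p)//= eqxx big1 ?addr0; last by move=> q /negPf ->.
  rewrite div1r (_ : (fun x => _) = (fun y => ((g y).1 == p)%:R%:E))//.
  rewrite (ge0_integral_finite_comp mu mg (F := fun c => (c.1 == p)%:R))//.
  rewrite (eq_bigr (fun c => ((c.1 == p)%:R * m c)%:E)); last first.
    by move=> c _; rewrite [RHS]EFinM; congr (_ * _)%E; exact: mE.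
  rewrite sumEFin => -[<-].
  rewrite (sumE (fun q b => (q == p)%:R)) (bigD1 p)//= eqxx.
  rewrite [X in _ = X + _](eq_bigr (fun b => m (p, b))); last by move=> b _; rewrite mul1r.
  by rewrite [X in _ + X]big1 ?addr0// => q /negPf ->; rewrite big1// => b _; rewrite mul0r.
rewrite (ge0_integral_finite_comp mu mg (F := fun c => `|rho c.1 - smoothing rho c.2| `^ alpha)); last first.
  by move=> c; exact: powR_ge0.
rewrite (eq_bigr (fun c => (`|rho c.1 - smoothing rho c.2| `^ alpha * m c)%:E)); last first.
  by move=> c _; rewrite [RHS]EFinM; congr (_ * _)%E; exact: mE.
rewrite sumEFin lee_fin.
rewrite (sumE (fun p b => `|rho p - smoothing rho b| `^ alpha)).
rewrite mulr_sumr; apply: ler_sum => p _.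
have K0 : 0 <= (2 * k%:R) ^+ d * N%:R ^- d :> R.
  by rewrite mulr_ge0 ?invr_ge0 ?exprn_ge0// mulr_ge0.
apply: (@le_trans _ _ (\sum_b (\sum_(q | near ((5 * N) %/ k) p q)
    (2 * k%:R) ^+ d * N%:R ^- d * `|rho p - rho q| `^ alpha) * m (p, b))); last first.
  by rewrite -mulr_sumr mp -mulr_sumr mulrAC.
apply: ler_sum => b _; have [->|mn0] := eqVneq (m (p, b)) 0; first by rewrite !mulr0.
rewrite ler_wpM2r//; apply: (le_trans (smoothing_jensen _ _ _ a1)).
have pb : (box p `&` box b : set point) !=set0.
  apply/set0P/negP => /eqP pb0; move: mn0; rewrite /m (_ : _ @^-1` _ = set0) ?measure0 ?eqxx//.
  rewrite -pb0; apply/seteqP; split => y; rewrite /g !box_preimage/=; first by case.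
  by move=> [-> ->].
rewrite [X in _ <= X]big_mkcond/=; apply: ler_sum => q _.
have [->|wn0] := eqVneq (bump_weight b q) 0.
  by rewrite !mul0r; case: ifP => // _; rewrite mulr_ge0 ?powR_ge0.
rewrite (bump_near pb wn0) ler_wpM2r ?powR_ge0//.
rewrite ler_pdivrMr ?bump_mass_gt0//.
apply: (@le_trans _ _ (N%:R ^- d)); first exact: bump_weight_le.
have := ler_wpM2l K0 (bump_mass_ge k0 b).
rewrite mulrAC divff ?mul1r// gt_eqF// exprn_gt0// mulr_gt0// ltr0n//.
Qed.

End lattice_smoothing.

(** The point is uniformity in [N]: for radius 5 N / k, the factor N^2 / k^2 from the walks matches
    the scaling of [dirichlet] and leaves 1 / k^2. The number 22 = 2 x 11 collects (2 k)^d and the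
    bound 11 N / k on the side of a neighbourhood. *)
Lemma smoothing_error (alpha e : R) : 1 < alpha -> 0 < e ->
  exists2 C, 0 <= C &
  forall (k N : nat) (k0 : (0 < k)%N) (N0 : (0 < N)%N) (rho : lattice d N -> R),
    (k <= N)%N -> (forall p, 0 <= rho p) ->
    (\int[mu]_y (`|rho (boxidx N0 y) - smoothing rho (boxidx k0 y)| `^ alpha)%:E <=
     (e * ((\sum_p rho p `^ alpha) / N%:R ^+ d) +
      C / k%:R ^+ 2 * dirichlet (fun p => rho p `^ (alpha / 2)))%:E)%E.
Proof.
move=> a1 e0; have a0 : 0 < alpha by lra.
have e'0 : 0 < e / 22 ^+ d by rewrite divr_gt0.
have [C C0 CP] := near_powR a0 e'0.
exists (22 ^+ d * (C * d%:R ^+ 2 * 25)); first by rewrite !mulr_ge0// ?exprn_ge0 ?ltW.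
move=> k N k0 N0 rho kN rho0.
have kR : 0 < k%:R :> R by rewrite ltr0n.
have NR : 0 < N%:R :> R by rewrite ltr0n.
have kd : 0 < k%:R ^+ d :> R by rewrite exprn_gt0.
have Nd : 0 < N%:R ^+ d :> R by rewrite exprn_gt0.
apply: (le_trans (smoothing_error_near k0 N0 kN rho (ltW a1))); rewrite lee_fin.
set r := ((5 * N) %/ k)%N.
have rN : r%:R <= 5 * N%:R / k%:R :> R.
  rewrite ler_pdivlMr// -!natrM ler_nat; exact: leq_divM.
have rN1 : (2 * r + 1)%:R <= 11 * N%:R / k%:R :> R.
  rewrite natrD natrM; have : 1 <= N%:R / k%:R :> R by rewrite ler_pdivlMr// mul1r ler_nat.
  by move: rN; rewrite -!mulrA; lra.
have S0 : 0 <= \sum_p rho p `^ alpha by apply: sumr_ge0 => p _; exact: powR_ge0.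
have E0 := bond_energy_ge0 (fun p => rho p `^ (alpha / 2)).
apply: (@le_trans _ _ ((2 * k%:R) ^+ d * N%:R ^- d * N%:R ^- d *
   ((11 * N%:R / k%:R) ^+ d * (e / 22 ^+ d * \sum_p rho p `^ alpha +
     C * d%:R ^+ 2 * (5 * N%:R / k%:R) ^+ 2 * bond_energy (fun p => rho p `^ (alpha / 2)))))).
  rewrite ler_wpM2l ?mulr_ge0 ?invr_ge0 ?exprn_ge0 ?mulr_ge0//.
  apply: (le_trans (CP d N r rho rho0)); rewrite ler_pM ?exprn_ge0//.
  - apply: addr_ge0; first exact: mulr_ge0 (ltW e'0) S0.
    by rewrite !mulr_ge0 ?exprn_ge0.
  - by apply: lerXn2r; rewrite ?nnegrE ?divr_ge0 ?mulr_ge0 ?(ltW NR) ?(ltW kR).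
  - rewrite lerD2l ler_wpM2r// ler_wpM2l ?mulr_ge0 ?exprn_ge0//.
    by apply: lerXn2r; rewrite ?nnegrE ?divr_ge0 ?mulr_ge0 ?(ltW NR) ?(ltW kR).
rewrite /dirichlet le_eqVlt; apply/orP; left; apply/eqP.
rewrite !exprMn exprVn.
have -> : 22 ^+ d = 2 ^+ d * 11 ^+ d :> R by rewrite -exprMn -natrM.
have h2 : 0 < 2 ^+ d :> R by rewrite exprn_gt0.
have h11 : 0 < 11 ^+ d :> R by rewrite exprn_gt0.
move: (bond_energy _) (\sum_p _) => E S.
move: h2 h11 kd Nd; move: (2 ^+ d) (11 ^+ d) (k%:R ^+ d) (N%:R ^+ d) => x1 x2 x3 x4 h2 h11 kd Nd.
by field; rewrite !gt_eqF.
Qed.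

End smoothing.

(** * Representatives of classes in L^p *)

Lemma measurable_powR_norm d (T : measurableType d) (R : realType) (f : T -> R) (r : R) :
  measurable_fun [set: T] f -> measurable_fun [set: T] (fun x => (`|f x| `^ r)%:E).
Proof.
move=> mf; apply/measurable_EFinP.
apply: (@measurableT_comp _ _ _ _ _ _ (@powR R ^~ r)); first exact: measurable_powR.
exact: (@measurableT_comp _ _ _ _ _ _ (@Num.norm R R)).
Qed.

Lemma measurable_powR_normB d (T : measurableType d) (R : realType) (f g : T -> R) (r : R) :
  measurable_fun setT f -> measurable_fun setT g ->
  measurable_fun setT (fun x => (`|f x - g x| `^ r)%:E).
Proof. by move=> mf mg; apply: measurable_powR_norm; exact: measurable_funB. Qed.

Section Lspace_representatives.
Context d (T : measurableType d) (R : realType) (mu : {measure set T -> \bar R}).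

Lemma Lnorm_powRE (r : R) (f : T -> R) : 0 < r ->
  (('N[mu]_(r%:E) [EFin \o f] < +oo) <-> (\int[mu]_x (`|f x| `^ r)%:E < +oo))%E.
Proof.
move=> r0; have E : ('N[mu]_(r%:E) [EFin \o f] = (\int[mu]_x (`|f x| `^ r)%:E) `^ r^-1)%E.
  by rewrite unlock.
rewrite E; have : (0 <= \int[mu]_x (`|f x| `^ r)%:E)%E.
  by apply: integral_ge0 => x _; rewrite lee_fin powR_ge0.
case: (\int[mu]_x _)%E => [s _|_|//] /=; first by split=> _; exact: ltry.
by rewrite invr_eq0 gt_eqF.
Qed.

Lemma Lspace_ex (r : R) (p1 : (1 <= r%:E)%E) (f : T -> R) :
  measurable_fun [set: T] f -> (\int[mu]_x (`|f x| `^ r)%:E < +oo)%E ->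
  exists w : LspaceType mu p1, w = f %[ae mu].
Proof.
move=> mf fint; have r0 : 0 < r by rewrite (lt_le_trans ltr01)// -lee_fin.
pose f0 : {mfun T >-> measurableTypeR R} :=
  HB.pack f (isMeasurableFun.Build _ _ T (measurableTypeR R) f mf).
pose c : {mfun_ mu, T >-> measurableTypeR R} :=
  \pi_({mfun_ mu, T >-> measurableTypeR R})%qT f0.
have cf : (c : _ -> _) = f %[ae mu].
  have /eqmodP/asboolP// : repr c = f0
    %[mod {mfun_ mu, T >-> measurableTypeR R}]%qT by rewrite reprK.
have mc : measurable_fun [set: T] (c : T -> R) by exact: (@measurable_funPT _ _ _ _ (repr c)).
have cfin : finite_norm mu r%:E (c : T -> R).
  apply/(Lnorm_powRE _ r0); apply: le_lt_trans fint.
  rewrite le_eqVlt; apply/orP; left; apply/eqP.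
  apply: ge0_ae_eq_integral.
  - exact: measurableT.
  - exact: measurable_powR_norm.
  - exact: measurable_powR_norm.
  - by move=> x _; rewrite lee_fin powR_ge0.
  - by move=> x _; rewrite lee_fin powR_ge0.
  - by move: cf; apply: filterS => x /= /[apply] ->.
pose w : LspaceType mu p1 := HB.pack c (isFinLebesgue.Build _ _ _ mu _ p1 c cfin).
by exists w.
Qed.

Lemma Lspace_measurable (r : R) (p1 : (1 <= r%:E)%E) (w : LspaceType mu p1) :
  measurable_fun [set: T] (w : T -> R).
Proof. exact: (@measurable_funPT _ _ _ _ (repr (w : {mfun_ mu, T >-> measurableTypeR R}))). Qed.

Lemma Lspace_finite (r : R) (p1 : (1 <= r%:E)%E) (w : LspaceType mu p1) :
  (\int[mu]_x (`|w x| `^ r)%:E < +oo)%E.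
Proof.
have r0 : 0 < r by rewrite (lt_le_trans ltr01)// -lee_fin.
by apply/Lnorm_powRE => //; exact: Lebesgue_finite.
Qed.

Lemma Rintegral_ae_eq (f g : T -> R) : measurable_fun [set: T] f ->
  measurable_fun [set: T] g -> f = g %[ae mu] ->
  \int[mu]_x f x = \int[mu]_x g x.
Proof.
move=> mf mg fg; congr fine; apply: ae_eq_integral => //.
- exact/measurable_EFinP.
- exact/measurable_EFinP.
- by move: fg; apply: filterS => x /= /[apply] ->.
Qed.

End Lspace_representatives.

(** * The weak-star topology and its metric *)

HB.instance Definition _ (R : realType) d := gen_eqMixin (torus_cont R d).

Section weak_star.
Variables (R : realType) (d : nat).
Local Notation mu := (torus_measure R d).
Local Notation point := (torus_point R d).
Implicit Types (u v : L1nn R d) (phi : torus_cont R d).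

Lemma L1nn_measurable u : measurable_fun [set: point] (u : point -> R).
Proof. exact: (@Lspace_measurable _ _ _ _ 1 (@lexx _ _ (1%E : \bar R)) (L1nn_val u)). Qed.

Lemma L1nn_integrable u : integrableR mu (u : point -> R).
Proof.
apply/integrableP; split; first by apply/measurable_EFinP; exact: L1nn_measurable.
have := @Lspace_finite _ _ _ _ 1 (@lexx _ _ (1%E : \bar R)) (L1nn_val u).
by under eq_integral do rewrite powRr1//.
Qed.

Lemma L1nn_ex (f : point -> R) : integrableR mu f ->
  (forall x, 0 <= f x) -> exists u, u = f %[ae mu].
Proof.
move=> /integrableP[/measurable_EFinP mf fint] f0.
have [|w wf] := @Lspace_ex _ _ _ mu 1 (@lexx _ _ (1%E : \bar R)) f mf.
  by under eq_integral do rewrite powRr1//.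
have w0 : {ae mu, forall x, 0 <= w x}.
  by move: wf; apply: filterS => x /= /(_ I) ->.
by exists (mkL1nn w0).
Qed.

Lemma torus_cont_measurable phi : measurable_fun [set: point] (fun y => phi (row_of_point y)).
Proof. exact: measurable_row_comp (@torus_cont_continuous _ _ phi). Qed.

Lemma torus_cont_bounded phi : exists2 B, 0 < B & forall x, `|phi x| <= B.
Proof.
by apply: periodic_bounded; [exact: torus_cont_continuous|exact: torus_cont_periodic].
Qed.

Lemma pairing_ae u (f : point -> R) phi : measurable_fun [set: point] f ->
  u = f %[ae mu] -> pairing u phi = \int[mu]_y (phi (row_of_point y) * f y).
Proof.
move=> mf uf; apply: Rintegral_ae_eq.
- apply: measurable_funM; [exact: torus_cont_measurable|exact: L1nn_measurable].
- apply: measurable_funM => //; exact: torus_cont_measurable.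
- by move: uf; apply: filterS => x /= /[apply] ->.
Qed.

Variable delta : weak_star_metric R d.

(** Separation comes from [delta]: a ball is weak-star open, hence the preimage of a set under
    [pairing], and cannot tell apart two elements with equal pairings. *)
Lemma pairing_inj u v : (forall phi, pairing u phi = pairing v phi) -> u = v.
Proof.
move=> uv; apply/(@wdist_eq0 _ _ delta)/eqP; rewrite eq_le; apply/andP; split; last first.
  have := wdist_triangle delta u v u; rewrite wdist_refl (wdist_sym delta v u); lra.
apply/ler_addgt0Pl => e e0; rewrite addr0 leNgt; apply/negP => H.
have : metric_open delta [set x | delta u x < e].
  move=> x /= ux; exists (e - delta u x) => [|y xy]; first by rewrite subr_gt0.
  by apply: (le_lt_trans (wdist_triangle delta u x y)); lra.
move=> /wdist_open[B oB BE].
have : [set x | delta u x < e] u by rewrite /= wdist_refl.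
rewrite -BE /= (_ : pairing u = pairing v); last exact/funext.
by rewrite -[_ _]/((@pairing R d @^-1` B) v) BE /= => ?; move: H; rewrite ltNge; lra.
Qed.

Lemma delta_pairing u phi (e : R) : 0 < e -> exists2 r : R, 0 < r &
  forall v, delta u v < r -> `|pairing v phi - pairing u phi| < e.
Proof.
move=> e0.
have : weak_star_open [set v | `|pairing v phi - pairing u phi| < e].
  exists [set h : {ptws torus_cont R d -> R} | `|h phi - pairing u phi| < e].
    rewrite (_ : mkset _ = (fun h : {ptws torus_cont R d -> R} => h phi) @^-1`
      [set x : R | `|x - pairing u phi| < e])//.
    apply: open_comp => [h _|]; first exact: (@proj_continuous (torus_cont R d) (fun=> R) phi).
    rewrite (_ : mkset _ = ball (pairing u phi) e); first exact: ball_open.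
    by apply/seteqP; split => x; rewrite /ball/= distrC.
  by [].
move=> /(wdist_open delta)/(_ u); apply.
by rewrite /= subrr normr0.
Qed.

Lemma delta_pairings u (I : finType) (phi : I -> torus_cont R d) (e : R) :
  0 < e -> exists2 r : R, 0 < r &
  forall v, delta u v < r -> forall i, `|pairing v (phi i) - pairing u (phi i)| < e.
Proof.
move=> e0.
have /choice[r rP] : forall i, exists r : R, 0 < r /\
    forall v, delta u v < r -> `|pairing v (phi i) - pairing u (phi i)| < e.
  by move=> i; have [r r0 rP] := delta_pairing u (phi i) e0; exists r.
exists (\big[Num.min/1]_i r i).
  by apply/bigmin_gtP; split => // i _; have [] := rP i.
move=> v uv i; have [_] := rP i; apply; apply: (lt_le_trans uv).
exact: bigmin_le.
Qed.

End weak_star.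

(** * Configurations as isolated points of the state space *)

Section config_classes.
Variables (R : realType) (d N : nat) (N0 : (0 < N)%N) (chi : R) (chi0 : 0 < chi).
Local Notation mu := (torus_measure R d).
Local Notation point := (torus_point R d).
Implicit Types (a b : config d N) (u v : L1nn R d) (x : lattice d N).

Lemma config_funE a (y : point) : config_fun chi a y = chi * (a (boxidx N0 y))%:R.
Proof.
rewrite /config_fun (bigD1 (boxidx N0 y))//= big1 ?addr0.
  by rewrite indicE mem_set ?mulr1//; exact/(box_boxidx N0).
move=> x xy; rewrite indicE memNset ?mulr0// => /(box_boxidx N0) yx.
by move: xy; rewrite yx eqxx.
Qed.

Lemma measurable_config_fun a : measurable_fun [set: point] (config_fun chi a).
Proof.
rewrite (_ : config_fun chi a = (fun x => chi * (a x)%:R) \o boxidx N0).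
  by apply: measurable_countable_comp; exact: measurable_boxidx.
by apply/funext => y; rewrite config_funE.
Qed.

Lemma boxidx_integrable (F : lattice d N -> R) :
  integrableR mu (F \o boxidx N0).
Proof.
apply: (@bounded_integrable _ _ _ _ _ (\sum_x `|F x|)).
  by apply: measurable_countable_comp; exact: measurable_boxidx.
by move=> y /=; rewrite (bigD1 (boxidx N0 y))//= lerDl sumr_ge0.
Qed.

Lemma config_fun_integrable a : mu.-integrable setT (EFin \o config_fun chi a).
Proof.
rewrite (_ : config_fun chi a = (fun x => chi * (a x)%:R) \o boxidx N0).
  exact: boxidx_integrable.
by apply/funext => y; rewrite config_funE.
Qed.

Lemma double_site_subproof x i : (2 * x i < 2 * N)%N.
Proof. by rewrite ltn_pmul2l. Qed.

Definition double_site x : lattice d (2 * N) :=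
  [ffun i => Ordinal (double_site_subproof x i)].

(** A bump at scale 2 N centred at the site vanishes outside the box of this site at scale N, so
    that its pairing with a configuration reads off one occupation number. *)
Definition probe x : torus_cont R d := bump R (double_site x).

Let N20 : (0 < 2 * N)%N. Proof. by rewrite muln_gt0. Qed.

Lemma probe_box x (y : point) : 0 < probe x (row_of_point y) -> boxidx N0 y = x.
Proof.
move=> p0; apply/(box_boxidx N0) => i.
have := bump_supp i p0; rewrite ffunE/= row_of_pointE !natrM.
have n0 : 0 < N%:R :> R by rewrite ltr0n.
have -> : 2 * (x i)%:R / (2 * N%:R) = (x i)%:R / N%:R :> R.
  by rewrite invfM mulrACA divff ?mul1r// pnatr_eq0.
have [n ->] := distZ_ex (tnth y i - (x i)%:R / N%:R).
rewrite -ltr_pdivlMl ?mulr_gt0// mulr1 ltr_norml => /andP[h1 h2].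
by exists (- n); rewrite mulrNz; apply/andP; split; lra.
Qed.

Lemma pairing_probe a u x : is_config chi a u ->
  pairing u (probe x) = chi * (a x)%:R * bump_mass R (double_site x).
Proof.
move=> /pairing_ae ->; last exact: measurable_config_fun.
rewrite /bump_mass -RintegralZl//; last exact: bump_integrable.
apply: eq_Rintegral => y _; rewrite config_funE mulrC.
have [p0|p0] := ltP 0 (probe x (row_of_point y)); first by rewrite (probe_box p0).
have p00 : probe x (row_of_point y) = 0.
  by apply/le_anti; rewrite p0/=; have /andP[] := bump01 (double_site x) (row_of_point y).
by move: p00; rewrite /probe => ->; rewrite !mulr0.
Qed.

(** A left inverse of [is_config], defined on all of L^1; on elements that are not configurations
    its value carries no information. *)
Definition conf u : config d N :=
  [ffun x => Num.truncn (pairing u (probe x) / (chi * bump_mass R (double_site x)))].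

Lemma confE a u : is_config chi a u -> conf u = a.
Proof.
move=> au; apply/ffunP => x; rewrite ffunE (pairing_probe _ au).
have m0 := bump_mass_gt0 R N20 (double_site x).
rewrite (_ : _ / _ = (a x)%:R) ?natrK//.
by field; rewrite !gt_eqF.
Qed.

Lemma is_config_inj (delta : weak_star_metric R d) a u v :
  is_config chi a u -> is_config chi a v -> u = v.
Proof.
move=> au av; apply: (pairing_inj delta) => phi.
by rewrite (pairing_ae phi (measurable_config_fun a) au)
  (pairing_ae phi (measurable_config_fun a) av).
Qed.

(** Two different configurations differ by at least [chi * c] on the probe of some site. The centre
    [l] may fail to be a configuration, so that the statement covers left limits of paths. *)
Lemma config_cluster (delta : weak_star_metric R d) (l : L1nn R d) :
  exists2 r : R, 0 < r & forall u v a b, is_config chi a u -> is_config chi b v ->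
    delta l u < r -> delta l v < r -> a = b.
Proof.
pose c : R := (2 * (2 * N)%:R) ^- d.
have c0 : 0 < c by rewrite invr_gt0 exprn_gt0// mulr_gt0// ltr0n.
have e0 : 0 < chi * c / 2 by rewrite divr_gt0// mulr_gt0.
have [r r0 rP] := delta_pairings delta l probe e0.
exists r => // u v a b au bv lu lv; apply/ffunP => x.
have := rP _ lu x; have := rP _ lv x.
rewrite (pairing_probe x au) (pairing_probe x bv).
have mc : c <= bump_mass R (double_site x) by exact: bump_mass_ge.
have := bump_mass_gt0 R N20 (double_site x).
move: (bump_mass R (double_site x)) mc => m mc m0 h1 h2.
have h : `|chi * (a x)%:R * m - chi * (b x)%:R * m| < chi * c.
  move: h1 h2; rewrite !ltr_norml => /andP[? ?] /andP[? ?]; apply/andP; split; lra.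
have : `|(a x)%:R - (b x)%:R| < 1 :> R.
  rewrite -mulrBl -mulrBr !normrM (gtr0_norm chi0) (gtr0_norm m0) -mulrA ltr_pM2l// in h.
  have [//|h'] := ltP `|(a x)%:R - (b x)%:R| (1 : R).
  have : c <= `|(a x)%:R - (b x)%:R| * m by rewrite -[c]mul1r ler_pM// ltW.
  by move=> /le_lt_trans/(_ h); rewrite ltxx.
rewrite -[X in _ < X]/(1%:R).
have [ab|ab] := leqP (a x) (b x).
  rewrite distrC -natrB// normr_nat ltr_nat ltnS leqn0 subn_eq0 => ba.
  by apply/eqP; rewrite eqn_leq ab ba.
rewrite -natrB ?(ltnW ab)// normr_nat ltr_nat ltnS leqn0 subn_eq0 => ba.
by move: ab; rewrite ltnNge ba.
Qed.

Lemma config_isolated (delta : weak_star_metric R d) a u : is_config chi a u ->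
  exists2 r : R, 0 < r & forall v b, is_config chi b v -> delta u v < r -> b = a.
Proof.
move=> au; have [r r0 rP] := config_cluster delta u.
by exists r => // v b bv uv; apply: (rP v u); rewrite ?wdist_refl.
Qed.

Definition adj a b : bool :=
  (b == a) || [exists x, exists y, (0 < a x)%N && (b == jump a x y)].

Definition total a : nat := (\sum_x a x)%N.

Lemma total_jump a x y : (0 < a x)%N -> total (jump a x y) = total a.
Proof.
move=> ax; rewrite /total.
transitivity ((\sum_z (a z - (z == x))) + \sum_z (z == y))%N.
  by rewrite -big_split; apply: eq_bigr => z _; rewrite ffunE.
rewrite (bigD1 x)//= [in RHS](bigD1 x)//= [X in (_ + X)%N](bigD1 y)//= eqxx.
rewrite (eq_bigr (fun z => a z)) => [|z /negPf ->]; last by rewrite subn0.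
rewrite [X in (_ + (_ + X))%N]big1 ?addn0 => [|z /negPf ->//].
by rewrite eqxx addnC addnA; congr addn; rewrite addnC subnK.
Qed.

Lemma total_adj a b : adj a b -> total b = total a.
Proof.
by move=> /orP[/eqP ->//|/existsP[x /existsP[y /andP[ax /eqP ->]]]]; exact: total_jump.
Qed.

Lemma config_fun_dist (phi : torus_cont R d) (B : R) a b u v :
  (forall z, `|phi z| <= B) -> is_config chi a u -> is_config chi b v ->
  `|pairing u phi - pairing v phi| <=
    B * (chi * (\sum_x `|(a x)%:R - (b x)%:R|) / N%:R ^+ d).
Proof.
move=> phiB au bv.
rewrite (pairing_ae phi (measurable_config_fun a) au)
  (pairing_ae phi (measurable_config_fun b) bv).
have iM f : integrableR mu f ->
    integrableR mu (fun y => phi (row_of_point y) * f y).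
  apply: (@bounded_integrableM _ _ _ _ _ _ B) => //; exact: torus_cont_measurable.
rewrite -RintegralB//; [|exact/iM/config_fun_integrable|exact/iM/config_fun_integrable].
apply: (le_trans (le_normr_Rintegral _ _)) => //.
  by apply: integrableB_EFin; exact/iM/config_fun_integrable.
pose F x : R := B * (chi * `|(a x)%:R - (b x)%:R|).
have B0 : 0 <= B by exact: le_trans (normr_ge0 _) (phiB 0).
have F0 x : 0 <= F x by rewrite !mulr_ge0 ?(ltW chi0).
have -> : B * (chi * (\sum_x `|(a x)%:R - (b x)%:R|) / N%:R ^+ d) =
    \int[mu]_y F (boxidx N0 y).
  by rewrite /Rintegral ge0_integral_boxidx//= /F -!mulr_sumr !mulrA.
have iF : integrableR mu (F \o boxidx N0) by exact: boxidx_integrable.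
apply: le_Rintegral => //.
  apply: integrable_norm => //.
  by apply: integrableB_EFin; exact/iM/config_fun_integrable.
move=> y _; rewrite -mulrBr normrM /F /= !config_funE -mulrBr normrM (gtr0_norm chi0).
by rewrite ler_wpM2r// mulr_ge0// ltW.
Qed.

Lemma adj_dist a b : adj a b -> \sum_x `|(a x)%:R - (b x)%:R| <= 2 :> R.
Proof.
move=> /orP[/eqP ->|/existsP[x /existsP[y /andP[ax /eqP ->]]]].
  by rewrite big1// => x _; rewrite subrr normr0.
apply: (@le_trans _ _ (\sum_z ((z == x)%:R + (z == y)%:R))).
  apply: ler_sum => z _; rewrite ffunE natrD natrB; last first.
    by case: eqP => // ->.
  rewrite opprD opprB addrA addrCA subrr addr0.
  by apply: (le_trans (ler_normB _ _)); rewrite !normr_nat.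
rewrite big_split/= (bigD1 x)//= [X in _ + X](bigD1 y)//= !eqxx.
by rewrite !big1 ?addr0// => z /negPf ->.
Qed.

End config_classes.

(** * The Skorokhod distance *)

Section skorokhod.
Variables (R : realType) (d : nat) (tf : {posnum R}) (delta : weak_star_metric R d).
Local Notation path := (cadlag_path tf delta).
Local Notation time := (time tf).
Implicit Types (u v w : path) (s t : time) (lam : time -> time).

Lemma wdist_ge0 (x y : L1nn R d) : 0 <= delta x y.
Proof.
by have := wdist_triangle delta x y x; rewrite wdist_refl (wdist_sym delta y x); lra.
Qed.

Lemma time_bounds t : 0 <= val t <= tf%:num.
Proof. exact: (valP t). Qed.

Lemma clamp_subproof (x : R) : 0 <= Num.min (Num.max 0 x) tf%:num <= tf%:num.
Proof. by rewrite le_min le_max lexx/= ltW//= ge_min lexx orbT. Qed.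

Definition clamp (x : R) : time :=
  exist (fun t : R => 0 <= t <= tf%:num) _ (clamp_subproof x).

Lemma val_clamp (x : R) : 0 <= x <= tf%:num -> val (clamp x) = x.
Proof. by move=> /andP[x0 xT] /=; rewrite (max_idPr x0) (min_idPl xT). Qed.

Lemma clampK t : clamp (val t) = t.
Proof. by apply/val_inj; rewrite val_clamp// time_bounds. Qed.

(** Compactness of the time interval in the one-sided form suited to cadlag functions: the supremum
    of the times up to which [F] is bounded can be passed unless it reaches [tf]. *)
Lemma locally_bounded_time (F : time -> R) :
  (forall t, exists2 h : R, 0 < h & exists B : R, forall s,
    val t <= val s < val t + h -> F s <= B) ->
  (forall t, exists2 h : R, 0 < h & exists B : R, forall s,
    val t - h < val s < val t -> F s <= B) ->
  exists B : R, forall t, F t <= B.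
Proof.
move=> FR FL.
pose A : set R := [set x | 0 <= x <= tf%:num /\
  exists B : R, forall t, val t <= x -> F t <= B].
have A0 : A 0.
  split; first by rewrite lexx/=.
  exists (F (time0 tf)) => t t0; rewrite (_ : t = time0 tf)//.
  by apply/val_inj/le_anti; rewrite t0/=; have /andP[] := time_bounds t.
have hA : has_sup A by split; [exists 0|exists tf%:num => x [/andP[]]].
pose z := sup A.
have z0 : 0 <= z by exact: ub_le_sup hA.2 _ A0.
have zT : z <= tf%:num by apply: ge_sup; [exists 0|move=> x [/andP[]]].
have zz : 0 <= z <= tf%:num by rewrite z0.
pose tz : time := exist _ z zz.
have [hr hr0 [Br HBr]] := FR tz; have [hl hl0 [Bl HBl]] := FL tz.
have [a [_ [B aB]] az] := sup_adherent hl0 hA.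
pose B' := Num.max (Num.max B Bl) Br.
have Az t : val t < z + hr -> F t <= B'.
  move=> tz'; rewrite !le_max; have [ta|ta] := leP (val t) a; first by rewrite aB.
  have [zt|tlt] := leP z (val t); first by rewrite HBr ?orbT//= zt tz'.
  by rewrite HBl ?orbT//= tlt andbT (lt_trans az).
have zE : tf%:num < z + hr.
  rewrite ltNge; apply/negP => zlt; pose z' := z + hr / 2.
  have zz' : z < z' by rewrite ltrDl divr_gt0.
  have z'r : z' < z + hr by rewrite /z'; lra.
  have : z' <= z.
    apply: (ub_le_sup hA.2); split; last first.
      by exists B' => t tz'; apply: Az; exact: le_lt_trans z'r.
    by rewrite (ltW (le_lt_trans z0 zz'))/= (le_trans _ zlt)// ltW.
  by rewrite leNgt zz'.
exists B' => t; apply: Az; apply: le_lt_trans zE.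
by have /andP[] := time_bounds t.
Qed.

Lemma cadlag_bounded u : exists B, forall t, delta (u (time0 tf)) (u t) <= B.
Proof.
have [uR uL] := path_cadlag u; apply: locally_bounded_time => t.
  have [h h0 H] := uR t 1 ltr01; exists h => //; exists (delta (u (time0 tf)) (u t) + 1).
  by move=> s /H ?; have := wdist_triangle delta (u (time0 tf)) (u t) (u s); lra.
have [l Hl] := uL t; have [h h0 H] := Hl 1 ltr01; exists h => //.
exists (delta (u (time0 tf)) l + 1) => s /H ?.
by have := wdist_triangle delta (u (time0 tf)) l (u s); lra.
Qed.

Lemma time_change_id : time_change (@id time).
Proof. by split; [exists id|]. Qed.

Lemma time_change_le lam : time_change lam -> forall s t, val s <= val t -> val (lam s) <= val (lam t).
Proof.
move=> [_ inc] s t; rewrite le_eqVlt => /predU1P[/val_inj ->//|/inc]; exact: ltW.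
Qed.

Lemma time_change_inv lam : time_change lam ->
  exists g, [/\ time_change g, cancel lam g & cancel g lam].
Proof.
move=> lamc; have [[g lamK gK] inc] := lamc; exists g; split => //; split; first by exists lam.
move=> s t st; rewrite ltNge; apply/negP => /(time_change_le lamc).
by rewrite !gK leNgt st.
Qed.

Lemma time_change_comp (l1 l2 : time -> time) : time_change l1 -> time_change l2 -> time_change (l2 \o l1).
Proof.
by move=> [b1 i1] [b2 i2]; split; [exact: bij_comp|move=> s t /i1/i2].
Qed.

Definition close_by lam (e : R) u v := [/\ time_change lam,
    forall t, `|val (lam t) - val t| <= e &
    forall t, delta (u t) (v (lam t)) <= e].

(** Cadlag paths are bounded for [delta], so the identity is an admissible time change for a large
    radius. On an empty set the infimum would be a default value. *)
Lemma skorokhod_set_neq0 u v :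
  [set e : R | 0 <= e /\ exists lam, close_by lam e u v] !=set0.
Proof.
have [B1 H1] := cadlag_bounded u; have [B2 H2] := cadlag_bounded v.
pose B := B1 + delta (u (time0 tf)) (v (time0 tf)) + B2.
have H t : delta (u t) (v t) <= B.
  have := wdist_triangle delta (u t) (u (time0 tf)) (v t).
  have := wdist_triangle delta (u (time0 tf)) (v (time0 tf)) (v t).
  by have := H1 t; have := H2 t; have := wdist_sym delta (u t) (u (time0 tf)); rewrite /B; lra.
have B0 : 0 <= B by exact: le_trans (wdist_ge0 _ _) (H (time0 tf)).
exists B; split => //; exists id; split => //; first exact: time_change_id.
by move=> t; rewrite subrr normr0.
Qed.

Lemma skorokhod_has_inf u v :
  has_inf [set e : R | 0 <= e /\ exists lam, close_by lam e u v].
Proof. by split; [exact: skorokhod_set_neq0|exists 0 => e []]. Qed.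

Lemma skorokhod_le u v lam e : 0 <= e -> close_by lam e u v -> skorokhod_dist u v <= e.
Proof.
move=> e0 c; apply: ge_inf; first by have [] := skorokhod_has_inf u v.
by split => //; exists lam.
Qed.

Lemma skorokhod_ge0 u v : 0 <= skorokhod_dist u v.
Proof. by apply: lb_le_inf; [exact: skorokhod_set_neq0|move=> e []]. Qed.

Lemma skorokhod_lt u v e : skorokhod_dist u v < e -> exists lam, close_by lam e u v.
Proof.
move=> uve; have e0 : 0 < e - skorokhod_dist u v by rewrite subr_gt0.
have [e' [_ [lam [lamc h1 h2]]] e'e] := inf_adherent e0 (skorokhod_has_inf u v).
exists lam; have {}e'e : e' <= e.
  by move: e'e; rewrite -/(skorokhod_dist u v) addrC subrK => /ltW.
by split => // t; [exact: le_trans (h1 t) _|exact: le_trans (h2 t) _].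
Qed.

Lemma skorokhod_refl u : skorokhod_dist u u = 0.
Proof.
apply/le_anti; rewrite skorokhod_ge0 andbT; apply: (@skorokhod_le _ _ id) => //.
by split => [|t|t]; [exact: time_change_id|rewrite subrr normr0|rewrite wdist_refl].
Qed.

Lemma close_by_sym lam e u v : close_by lam e u v -> exists lam', close_by lam' e v u.
Proof.
move=> [lamc h1 h2]; have [g [gc lamK gK]] := time_change_inv lamc.
exists g; split => // t; first by have := h1 (g t); rewrite gK distrC.
by have := h2 (g t); rewrite gK wdist_sym.
Qed.

Lemma skorokhod_sym u v : skorokhod_dist u v = skorokhod_dist v u.
Proof.
rewrite /skorokhod_dist; congr inf; apply/seteqP.
by split => e [e0 [lam /close_by_sym c]].
Qed.

Lemma skorokhod_triangle u v w :
  skorokhod_dist u w <= skorokhod_dist u v + skorokhod_dist v w.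
Proof.
apply/ler_addgt0Pl => e e0; have e20 : 0 < e / 2 by rewrite divr_gt0.
have [l1 [c1 h1 k1]] : exists lam, close_by lam (skorokhod_dist u v + e / 2) u v.
  by apply: skorokhod_lt; rewrite ltrDl.
have [l2 [c2 h2 k2]] : exists lam, close_by lam (skorokhod_dist v w + e / 2) v w.
  by apply: skorokhod_lt; rewrite ltrDl.
apply: (@skorokhod_le _ _ (l2 \o l1)).
  by have := skorokhod_ge0 u v; have := skorokhod_ge0 v w; lra.
split => [|t|t]; first exact: time_change_comp.
  change (`|val (l2 (l1 t)) - val t| <= e + (skorokhod_dist u v + skorokhod_dist v w)).
  have := h1 t; have := h2 (l1 t); rewrite !ler_norml => /andP[? ?] /andP[? ?].
  by apply/andP; split; lra.
rewrite [(l2 \o l1) t]/=.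
have := wdist_triangle delta (u t) (v (l1 t)) (w (l2 (l1 t))).
by have := k1 t; have := k2 (l1 t); lra.
Qed.

Lemma skorokhod_ball_open u e : skorokhod_open [set v | skorokhod_dist u v < e].
Proof.
move=> v /= uv; exists (e - skorokhod_dist u v); first by rewrite subr_gt0.
by move=> w vw; have := skorokhod_triangle u v w; lra.
Qed.

End skorokhod.

(** * Measurability of the configuration at a given time *)

Section config_paths.
Variables (R : realType) (d N : nat) (N0 : (0 < N)%N) (chi : R) (chi0 : 0 < chi).
Variables (tf : {posnum R}) (delta : weak_star_metric R d).
Local Notation path := (cadlag_path tf delta).
Local Notation time := (time tf).
Implicit Types (u v w : path) (s t : time) (a b : config d N).

Definition config_path u : Prop := forall t, exists a : config d N, is_config chi a (u t).

Definition path_conf u t : config d N := conf N chi (u t).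

Lemma path_confP u t : config_path u -> is_config chi (path_conf u t) (u t).
Proof. by move=> /(_ t)[a at_]; rewrite /path_conf (confE N0 chi0 at_). Qed.

Lemma path_confE u t a : is_config chi a (u t) -> path_conf u t = a.
Proof. exact: confE. Qed.

Lemma path_conf_right u t : config_path u ->
  exists2 h : R, 0 < h & forall s, val t <= val s < val t + h ->
    path_conf u s = path_conf u t.
Proof.
move=> cu; have [r r0 rP] := config_isolated N0 chi0 delta (path_confP t cu).
have [uR _] := path_cadlag u; have [h h0 hP] := uR t r r0.
by exists h => // s ts; apply: (rP (u s)); [exact: path_confP|exact: hP].
Qed.

Lemma path_conf_left u t : config_path u ->
  exists2 h : R, 0 < h & forall s s', val t - h < val s < val t ->
    val t - h < val s' < val t -> path_conf u s = path_conf u s'.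
Proof.
move=> cu; have [_ uL] := path_cadlag u; have [l lP] := uL t.
have [r r0 rP] := config_cluster N0 chi0 delta l.
have [h h0 hP] := lP r r0; exists h => // s s' ts ts'.
by apply: (rP (u s) (u s')); rewrite ?hP//; exact: path_confP.
Qed.

Definition rel_open (A : set path) : Prop := forall u, config_path u -> A u ->
  exists2 e : R, 0 < e & forall v, config_path v -> skorokhod_dist u v < e -> A v.

(** [A] itself may fail to be open. The union of the witnessing balls around its configuration paths
    is open and has the same trace on configuration paths. *)
Lemma rel_open_measurable (A : set path) : rel_open A ->
  exists2 B : set (skorokhod_space tf delta), measurable B &
    forall u, config_path u -> (B u <-> A u).
Proof.
move=> oA; pose B : set path := [set v | exists u (e : R),
  [/\ config_path u, A u, skorokhod_dist u v < e &
      forall w, config_path w -> skorokhod_dist u w < e -> A w]].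
exists B.
  apply: sub_sigma_algebra => v [u [e [cu Au uv H]]].
  have [r r0 rP] := @skorokhod_ball_open _ _ _ _ u e v uv.
  by exists r => // w vw; exists u, e; split => //; exact: rP.
move=> u cu; split => [[v [e [cv Av vu]]]|Au]; first exact.
have [e e0 eP] := oA u cu Au; exists u, e; split => //.
by rewrite skorokhod_refl.
Qed.

Lemma time_change_max (lam : time -> time) t : time_change lam -> val t = tf%:num ->
  lam t = t.
Proof.
move=> lamc tT; have [[g lamK gK] _] := lamc.
apply/val_inj/le_anti; rewrite tT (andP (time_bounds _)).2/=.
have gt : val (g t) <= val t by rewrite tT (andP (time_bounds _)).2.
by have := time_change_le lamc gt; rewrite gK tT.
Qed.

(** Every time change fixes the final time, so Skorokhod closeness compares the values there
    directly. *)
Lemma eval_end_open t a : val t = tf%:num -> rel_open [set u | path_conf u t = a].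
Proof.
move=> tT u cu /= ua; have [r r0 rP] := config_isolated N0 chi0 delta (path_confP t cu).
exists r => // v cv uv; have [e' uve' e'r] : exists2 e', skorokhod_dist u v < e' & e' < r.
  by exists ((skorokhod_dist u v + r) / 2); lra.
have [lam [lamc _ /(_ t)]] := skorokhod_lt uve'.
rewrite (time_change_max lamc tT) => uvt; rewrite -ua.
by apply: (rP (v t)); [exact: path_confP|exact: le_lt_trans e'r].
Qed.

(** Evaluation before the final time is not Skorokhod continuous. Being constant on some interval
    shortly after [t] is an open condition, and by right continuity its validity for all [n]
    characterizes the value at [t]. *)
Definition const_near t (n : nat) a : set path := [set u | exists s1 s2 : time,
  [/\ val t < val s1, val s1 < val s2, val s2 < val t + n.+1%:R^-1 &
      forall s, val s1 <= val s <= val s2 -> path_conf u s = a]].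

Lemma const_near_open t n a : rel_open (const_near t n a).
Proof.
move=> u cu [s1 [s2 [ts1 s12 s2t H]]].
have H1 : path_conf u s1 = a by apply: H; rewrite lexx ltW.
have [r r0 rP] := config_isolated N0 chi0 delta (path_confP s1 cu).
(* A time change within a third of the length of the interval maps the middle third into the
   interval. *)
pose e := Num.min (r / 2) ((val s2 - val s1) / 3).
have e0 : 0 < e by rewrite lt_min !divr_gt0//= subr_gt0.
have er : e < r by rewrite gt_min; apply/orP; left; lra.
have es : e <= (val s2 - val s1) / 3 by rewrite ge_min lexx orbT.
exists e => // v cv; rewrite skorokhod_sym => /skorokhod_lt[lam [_ h1 h2]].
have b1 := time_bounds s1; have b2 := time_bounds s2.
pose q1 := clamp tf (val s1 + (val s2 - val s1) / 3).
pose q2 := clamp tf (val s2 - (val s2 - val s1) / 3).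
have v1 : val q1 = val s1 + (val s2 - val s1) / 3 by rewrite val_clamp//; lra.
have v2 : val q2 = val s2 - (val s2 - val s1) / 3 by rewrite val_clamp//; lra.
have dd : 0 < (val s2 - val s1) / 3 by rewrite divr_gt0 ?subr_gt0.
exists q1, q2; split; rewrite ?v1 ?v2.
- by rewrite (lt_trans ts1)// ltrDl.
- by clear s2t; lra.
- by apply: lt_trans s2t; rewrite gtrBl.
move=> s /andP[q1s sq2]; rewrite -H1.
have ls : val s1 <= val (lam s) <= val s2.
  have := h1 s; rewrite ler_norml => /andP[A1 A2].
  clear s2t dd v1 v2 b1 b2 ts1 s12 q1 q2.
  by apply/andP; split; lra.
apply: (rP (v s)); first exact: path_confP.
have -> : u s1 = u (lam s).
  apply: (is_config_inj N0 delta (a := a)); first by rewrite -H1; exact: path_confP.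
  by rewrite -(H _ ls); exact: path_confP.
by rewrite wdist_sym; exact: le_lt_trans (h2 s) er.
Qed.

Lemma path_conf_const_near u t a : config_path u -> val t < tf%:num ->
  path_conf u t = a <-> forall n, const_near t n a u.
Proof.
move=> cu tT; have [h h0 hP] := path_conf_right t cu; split => [ta n|H].
  pose e := Num.min (Num.min h n.+1%:R^-1) (tf%:num - val t).
  have e0 : 0 < e by rewrite !lt_min h0 invr_gt0 ltr0n subr_gt0 tT.
  have e1 : e <= h by rewrite !ge_min lexx.
  have e2 : e <= n.+1%:R^-1 by rewrite !ge_min lexx orbT.
  have e3 : e <= tf%:num - val t by rewrite ge_min lexx orbT.
  have b := time_bounds t.
  have v1 : val (clamp tf (val t + e / 3)) = val t + e / 3 by rewrite val_clamp//; lra.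
  have v2 : val (clamp tf (val t + e / 2)) = val t + e / 2 by rewrite val_clamp//; lra.
  exists (clamp tf (val t + e / 3)), (clamp tf (val t + e / 2)).
  split; rewrite ?v1 ?v2.
  - by rewrite ltrDl divr_gt0.
  - by rewrite ltrD2l; clear e2; lra.
  - by rewrite ltrD2l; apply: lt_le_trans e2; rewrite ltr_pdivrMr// ltr_pMr// ltr1n.
  move=> s /andP[s1 s2]; rewrite -ta; apply: hP; apply/andP; split; lra.
have [n nh] : exists n : nat, n.+1%:R^-1 < h.
  by near \oo => n; exists n; near: n; exact: (near_infty_natSinv_lt (PosNum h0)).
have [s1 [s2 [ts1 s12 s2t /(_ s1) Hs]]] := H n.
rewrite -(hP s1); last first.
  rewrite (ltW ts1)/=; apply: (lt_trans s12); apply: (lt_trans s2t).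
  by rewrite ltrD2l.
by apply: Hs; rewrite lexx ltW.
Unshelve. all: by end_near. Qed.

Lemma eval_measurable t a :
  exists2 B : set (skorokhod_space tf delta), measurable B &
    forall u, config_path u -> (B u <-> path_conf u t = a).
Proof.
have [tT|tT] := ltP (val t) tf%:num; last first.
  have tE : val t = tf%:num by apply/le_anti; rewrite tT (andP (time_bounds t)).2.
  exact: rel_open_measurable (eval_end_open tE).
have /choice[B BP] : forall n, exists B : set (skorokhod_space tf delta),
    measurable B /\ forall u, config_path u -> (B u <-> const_near t n a u).
  by move=> n; have [B mB BP] := rel_open_measurable (@const_near_open t n a); exists B.
exists (\bigcap_n B n); first by apply: bigcapT_measurable => n; exact: (BP n).1.
move=> u cu; rewrite (path_conf_const_near a cu tT); split => H n.
  by apply/(BP n).2 => //; exact: H.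
by move=> _; apply/(BP n).2.
Qed.

End config_paths.

Lemma eq_ler (R : realType) (x y : R) : x = y -> x <= y.
Proof. by move=> ->. Qed.

(** * The generator acting on the exponential entropy weight *)

Section jump_rates.
Variables (R : realType) (d N : nat) (d0 : (0 < d)%N).
Local Notation L := (lattice d N).
Local Notation jp := (@jump_prob R d N).
Implicit Types (x y : L) (F : L -> R).

Lemma jump_prob_sym x y : jp x y = jp y x.
Proof.
rewrite /jump_prob (_ : [exists i, _] = [exists i, (x == step_up i y) || (x == step_down i y)])//.
apply: eq_existsb => i; rewrite orbC; congr (_ || _).
  by apply/eqP/eqP => ->; rewrite ?step_downK ?step_upK.
by apply/eqP/eqP => ->; rewrite ?step_downK ?step_upK.
Qed.

Lemma jump_prob_ge0 x y : 0 <= jp x y.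
Proof. by rewrite /jump_prob; case: ifP => // _; rewrite invr_ge0 mulr_ge0. Qed.

Lemma jump_prob_step i x : jp x (step_up i x) = (2 * d%:R)^-1.
Proof. by rewrite /jump_prob; case: ifPn => // /existsP[]; exists i; rewrite eqxx. Qed.

(** Only an inequality, because neighbours of a site coincide when N <= 2. *)
Lemma sum_jump_prob x : \sum_y jp x y <= 1.
Proof.
apply: (@le_trans _ _ (\sum_y \sum_(i < d)
    (2 * d%:R)^-1 * ((y == step_up i x)%:R + (y == step_down i x)%:R))).
  apply: ler_sum => y _; rewrite /jump_prob.
  case: ifP => [/existsP[i iP]|_]; last first.
    by apply: sumr_ge0 => i _; rewrite mulr_ge0 ?invr_ge0 ?mulr_ge0.
  rewrite (bigD1 i)//= ler_wpDr//; last first.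
    rewrite ler_pMr ?invr_gt0 ?mulr_gt0 ?ltr0n//.
    by move: iP => /orP[]->; rewrite ?lerDl ?lerDr.
  by apply: sumr_ge0 => j _; rewrite mulr_ge0 ?invr_ge0 ?mulr_ge0.
rewrite exchange_big/= (eq_bigr (fun=> (2 * d%:R)^-1 * 2)).
  rewrite sumr_const card_ord -[X in X <= _]mulr_natr invfM; apply: eq_ler.
  by field; rewrite pnatr_eq0 -lt0n.
move=> i _; rewrite -mulr_sumr big_split/=; congr (_ * _).
by rewrite (bigD1 (step_up i x))//= [X in _ + X](bigD1 (step_down i x))//= !eqxx
  !big1 ?addr0// => z /negPf ->.
Qed.

Lemma sum_jump_prob_le F : (forall x, 0 <= F x) ->
  \sum_x \sum_y jp x y * (F x + F y) <= 2 * \sum_x F x.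
Proof.
move=> F0; have H : \sum_x \sum_y jp x y * F x <= \sum_x F x.
  apply: ler_sum => x _; rewrite -mulr_suml; apply: ler_piMl => //.
  exact: sum_jump_prob.
under eq_bigr do (under eq_bigr do rewrite mulrDr; rewrite big_split/=).
rewrite big_split/= mulr_natl mulr2n lerD//.
rewrite exchange_big/=; apply: le_trans H; apply: ler_sum => x _.
by apply: ler_sum => y _; rewrite jump_prob_sym.
Qed.

(* Summing over all neighbours dominates summing over a single direction, hence
   the average over directions; this is insensitive to coincidences between
   neighbours when N <= 2. *)
Lemma bond_energy_le F :
  bond_energy F <= 2 * d%:R ^+ 2 * \sum_x \sum_y jp x y * (F x - F y) ^+ 2.
Proof.
rewrite /bond_energy.
have H i : \sum_x (F (step_up i x) - F x) ^+ 2 <=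
    2 * d%:R * \sum_x \sum_y jp x y * (F x - F y) ^+ 2.
  rewrite mulr_sumr; apply: ler_sum => x _.
  rewrite (bigD1 (step_up i x))//= jump_prob_step mulrDr mulrA divff ?mul1r.
    rewrite -[X in X <= _]addr0 lerD//.
      by rewrite -[X in X <= _]sqrrN opprB.
    rewrite mulr_ge0// ?mulr_ge0//; apply: sumr_ge0 => y _.
    by rewrite mulr_ge0 ?jump_prob_ge0 ?sqr_ge0.
  by rewrite mulf_neq0// pnatr_eq0 -lt0n.
apply: (le_trans (ler_sum _ (fun i _ => H i))).
rewrite sumr_const card_ord -[X in X <= _]mulr_natr; apply: eq_ler; ring.
Qed.

(** Exchanging [x] and [y] under the symmetric kernel; the sum of the two forms is minus a
    square. *)
Lemma sum_jump_prob_cross F :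
  \sum_x \sum_y jp x y * (F x * F y - F x ^+ 2) =
  - (2^-1 * \sum_x \sum_y jp x y * (F x - F y) ^+ 2).
Proof.
set S := LHS; have S1 : S = \sum_x \sum_y jp x y * (F x * F y - F y ^+ 2).
  rewrite /S exchange_big/=; apply: eq_bigr => x _; apply: eq_bigr => y _.
  by rewrite jump_prob_sym; congr (_ * _); ring.
suff : S + S = - \sum_x \sum_y jp x y * (F x - F y) ^+ 2 by move=> h; lra.
rewrite {1}S1 /S -big_split/= -sumrN; apply: eq_bigr => x _.
by rewrite -big_split/= -sumrN; apply: eq_bigr => y _; ring.
Qed.

End jump_rates.

Section entropy_weight.
Variables (R : realType) (d N : nat) (alpha chi : R).
Hypotheses (chi0 : 0 < chi) (alpha1 : 1 < alpha).
Local Notation L := (lattice d N).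
Implicit Types (a : config d N) (x y : L).

Definition root_conf a x : R := (chi * (a x)%:R) `^ (alpha / 2).

Definition conf_energy a : R := dirichlet (root_conf a).

Definition conf_entropy a : R := (\sum_x ent (chi * (a x)%:R)) / N%:R ^+ d.

Definition conf_mass a : R := (\sum_x chi * (a x)%:R) / N%:R ^+ d.

Definition ent_weight a : R := expR (alpha / 2 / chi * \sum_x ent (chi * (a x)%:R)).

(** Convexity bounds the entropy changes at the two sites by the slopes ln(eta(x)) and ln(eta(y) +
    chi); the exponential factor is the second-order cost in [ent_sub_le]. *)
Lemma jump_weight a x y : (0 < a x)%N -> x != y ->
  ent_weight (jump a x y) <= ent_weight a *
    (((chi * (a y)%:R + chi) / (chi * (a x)%:R)) `^ (alpha / 2) *
     expR (alpha / 2 * (chi / (chi * (a x)%:R)))).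
Proof.
move=> ax xy; have p0 : 0 < alpha / 2 by rewrite divr_gt0// (lt_trans _ alpha1).
have rx0 : chi <= chi * (a x)%:R by rewrite ler_pMr// ler1n.
have ry0 : 0 <= chi * (a y)%:R by rewrite mulr_ge0// ltW.
have S : \sum_z ent (chi * (jump a x y z)%:R) = \sum_z ent (chi * (a z)%:R) +
    ((ent (chi * (a x)%:R - chi) - ent (chi * (a x)%:R)) +
    (ent (chi * (a y)%:R + chi) - ent (chi * (a y)%:R))).
  rewrite (bigD1 x)// [in RHS](bigD1 x)//= (bigD1 y) 1?eq_sym//=.
  rewrite [in RHS](bigD1 y) 1?eq_sym//= !ffunE !eqxx (negPf xy) eq_sym (negPf xy).
  rewrite addn0 subn0 natrB// natrD mulrBr mulrDr mulr1.
  rewrite (eq_bigr (fun z => ent (chi * (a z)%:R))); first by ring.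
  by move=> z /andP[/negPf zx /negPf zy]; rewrite ffunE zx zy subn0 addn0.
rewrite /ent_weight S mulrDr expRD ler_wpM2l ?expR_ge0//.
set r := chi * (a x)%:R in rx0 *; set s := chi * (a y)%:R in ry0 *.
have r0 : 0 < r by exact: lt_le_trans rx0.
have sc : 0 < s + chi by rewrite ltr_wpDl.
rewrite /powR gt_eqF ?divr_gt0// -expRD ler_expR -mulrDr -mulrA ler_wpM2l ?(ltW p0)//.
rewrite -(ler_pM2l chi0) mulrA divff ?gt_eqF// mul1r.
have H1 := ent_sub_le chi0 rx0; have H2 := @ent_tangent _ (s + chi) s sc ry0.
rewrite (_ : s + chi - s = chi) in H2; last by ring.
rewrite ln_div ?posrE//; have -> : chi * (ln (s + chi) - ln r + chi / r) =
  - (chi * ln r) + chi * (chi / r) + chi * ln (s + chi) by ring.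
by rewrite lerD.
Qed.

(** Times the rate eta(x)^alpha, the ratio in [jump_weight] becomes a product of alpha/2-th powers
    at [x] and [y]; the hypothesis compares it with the same product without the increment [chi].
    Degenerate cases are an empty site, with rate 0, and x = y, where nothing moves. *)
Lemma pair_rate (n e C : R) a x y : 0 <= n -> 0 <= e -> 0 <= C ->
  (forall r s : R, chi <= r -> 0 <= s ->
    n * (r `^ (alpha / 2) * ((s + chi) `^ (alpha / 2) * expR (alpha / 2 * (chi / r))
      - s `^ (alpha / 2))) <= e * (r `^ alpha + s `^ alpha) + C) ->
  n * ((chi * (a x)%:R) `^ alpha * (ent_weight (jump a x y) - ent_weight a)) <=
  ent_weight a * (n * (root_conf a x * root_conf a y - root_conf a x ^+ 2) +
    (e * ((chi * (a x)%:R) `^ alpha + (chi * (a y)%:R) `^ alpha) + C)).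
Proof.
move=> n0 e0 C0 H; have a0 : alpha != 0 by rewrite gt_eqF// (lt_trans _ alpha1).
have rA z : root_conf a z ^+ 2 = (chi * (a z)%:R) `^ alpha.
  by rewrite -powR_mulrn ?powR_ge0// /root_conf -powRrM divfK.
have w0 := expR_ge0 (alpha / 2 / chi * \sum_x ent (chi * (a x)%:R)).
have E0 z : 0 <= e * ((chi * (a z)%:R) `^ alpha + (chi * (a y)%:R) `^ alpha) + C.
  by rewrite addr_ge0// mulr_ge0// addr_ge0// powR_ge0.
have [ax|] := posnP (a x).
  rewrite /root_conf ax mulr0 powR0// mul0r mulr0 powR0; last by rewrite mulf_neq0.
  have := E0 x; rewrite ax mulr0 powR0// => ?.
  by rewrite mul0r expr0n/= subr0 mulr0 add0r mulr_ge0.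
move=> ax; have [<-|xy] := eqVneq x y.
  have -> : jump a x x = a.
    by apply/ffunP => z; rewrite ffunE; case: eqP => [->|_] /=; rewrite ?subnK ?subn0 ?addn0.
  rewrite subrr !mulr0 mulr_ge0// addr_ge0//.
    by rewrite mulr_ge0// expr2 subrr.
  by rewrite addr_ge0// mulr_ge0// addr_ge0// powR_ge0.
have rx : chi <= chi * (a x)%:R by rewrite ler_pMr// ler1n.
have ry : 0 <= chi * (a y)%:R by rewrite mulr_ge0// ltW.
have r0 : 0 < chi * (a x)%:R by exact: lt_le_trans rx.
have := H _ _ rx ry; set r := chi * (a x)%:R in r0 *; set s := chi * (a y)%:R in ry *.
move=> Hrs; have J := jump_weight ax xy.
rewrite -/r -/s -/(ent_weight a) in J w0 *.
set w := ent_weight a in J w0 *; set q := expR (alpha / 2 * (chi / r)) in J Hrs.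
set g := (s + chi) `^ (alpha / 2) in Hrs *.
have J' : r `^ alpha * ent_weight (jump a x y) <= w * (r `^ (alpha / 2) * (g * q)).
  apply: (le_trans (ler_wpM2l (powR_ge0 _ _) J)).
  rewrite -rA -/(root_conf a x) powRM ?invr_ge0 ?(ltW r0)//; last first.
    by rewrite addr_ge0// ltW.
  rewrite -/g -powR_inv1 ?(ltW r0)// -powRrM mulN1r powRN /root_conf -/r.
  have v0 : 0 < r `^ (alpha / 2) by exact: powR_gt0.
  by apply: eq_ler; field; rewrite gt_eqF.
apply: (@le_trans _ _ (w * (n * (r `^ (alpha / 2) * (g * q) - root_conf a x ^+ 2)))).
  rewrite [X in _ <= X]mulrCA; apply: ler_wpM2l => //.
  by rewrite rA -/r !mulrBr lerB// mulrC.
rewrite ler_wpM2l//; apply: le_trans (lerD (lexx _) Hrs).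
by rewrite -mulrDr /root_conf -/r -/s; apply: eq_ler; ring.
Qed.

Lemma generator_weight n (e C : R) a : (0 < d)%N -> n = N%:R ^+ 2 -> 0 <= e -> 0 <= C ->
  (forall r s : R, chi <= r -> 0 <= s ->
    n * (r `^ (alpha / 2) * ((s + chi) `^ (alpha / 2) * expR (alpha / 2 * (chi / r))
      - s `^ (alpha / 2))) <= e * (r `^ alpha + s `^ alpha) + C) ->
  zr_generator alpha chi ent_weight a <= ent_weight a * (d%:R / chi * (
    - (n / (4 * d%:R ^+ 2) * bond_energy (root_conf a)) +
    2 * e * (\sum_x (chi * (a x)%:R) `^ alpha) + C * N%:R ^+ d)).
Proof.
move=> d0 nE e0 C0 H; have n0 : 0 <= n by rewrite nE exprn_ge0.
have k0 : 0 <= d%:R / chi by rewrite divr_ge0// ltW.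
set v := root_conf a; pose g x y : R := n * (v x * v y - v x ^+ 2) +
  (e * ((chi * (a x)%:R) `^ alpha + (chi * (a y)%:R) `^ alpha) + C).
apply: (@le_trans _ _ (d%:R / chi * (ent_weight a * \sum_x \sum_y jump_prob R x y * g x y))).
  rewrite /zr_generator -nE (_ : d%:R * n / chi = d%:R / chi * n); last by rewrite mulrAC.
  rewrite -[X in X <= _]mulrA; apply: ler_wpM2l => //.
  rewrite !mulr_sumr; apply: ler_sum => x _; rewrite !mulr_sumr; apply: ler_sum => y _.
  rewrite [X in X <= _](_ : _ = jump_prob R x y *
    (n * ((chi * (a x)%:R) `^ alpha * (ent_weight (jump a x y) - ent_weight a)))); last by ring.
  by rewrite [X in _ <= X]mulrCA ler_wpM2l ?jump_prob_ge0//; exact: pair_rate.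
rewrite [X in X <= _]mulrCA ler_wpM2l ?expR_ge0// ler_wpM2l//.
have -> : \sum_(x : L) \sum_(y : L) jump_prob R x y * g x y =
    n * (\sum_(x : L) \sum_(y : L) jump_prob R x y * (v x * v y - v x ^+ 2)) +
    e * (\sum_(x : L) \sum_(y : L) jump_prob R x y *
      ((chi * (a x)%:R) `^ alpha + (chi * (a y)%:R) `^ alpha)) +
    C * \sum_(x : L) \sum_(y : L) jump_prob R x y.
  rewrite !mulr_sumr -!big_split/=; apply: eq_bigr => x _.
  rewrite !mulr_sumr -!big_split/=; apply: eq_bigr => y _; rewrite /g; ring.
rewrite sum_jump_prob_cross; apply: lerD; first apply: lerD.
- rewrite mulrN lerN2 -mulrA ler_wpM2l// mulrC ler_pdivrMr; last first.
    by rewrite mulr_gt0// exprn_gt0// ltr0n.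
  apply: (le_trans (bond_energy_le d0 v)); apply: eq_ler; by field.
- rewrite [2 * e]mulrC -mulrA ler_wpM2l//.
  by apply: sum_jump_prob_le => // x; exact: powR_ge0.
- rewrite ler_wpM2l// -[X in _ <= X]mul1r -sumr_const_lattice.
  by apply: ler_sum => x _; exact: sum_jump_prob.
Qed.

End entropy_weight.

(** Summing [pair_rate] gives minus the energy up to a small multiple of the sum of eta^alpha, which
    [lattice_poincare] bounds by energy and mass. Hence the mass hypothesis, and a constant [C] that
    depends on [m] but not on [N]. *)
Lemma generator_bound (R : realType) (d : nat) (alpha M m : R) : (0 < d)%N -> 1 < alpha ->
  exists2 c : R, 0 < c & exists C : R, forall N (chi : R) (a : config d N),
    (0 < N)%N -> 0 < chi -> N%:R ^+ 2 * chi `^ Num.min 1 (alpha / 2) <= M ->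
    conf_mass chi a <= m ->
    zr_generator alpha chi (ent_weight alpha chi) a <=
    ent_weight alpha chi a * (N%:R ^+ d / chi * (C - c * conf_energy alpha chi a)).
Proof.
move=> d0 alpha1; have dR : 0 < d%:R :> R by rewrite ltr0n.
have [K K0 KP] := lattice_poincare d alpha1.
have p0 : 0 < alpha / 2 by rewrite divr_gt0// (lt_trans _ alpha1).
(* This makes 2 e K at most 1 / (8 d^2), half of the coefficient 1 / (4 d^2) of the energy in
   [generator_weight]. The other half, times d, is the constant 1 / (8 d). *)
pose e : R := (16 * d%:R ^+ 2 * (K + 1))^-1.
have e0 : 0 < e by rewrite invr_gt0 !mulr_gt0 ?exprn_gt0// ltr_wpDl.
have [C C0 CP] := jump_rate_error M p0 e0.
exists (8 * d%:R)^-1; first by rewrite invr_gt0 mulr_gt0.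
exists (d%:R * (2 * e * K * `|m| `^ alpha + C)) => N chi a N0 chi0 nM am.
have N0R : 0 < N%:R :> R by rewrite ltr0n.
have Nd : 0 < N%:R ^+ d :> R by rewrite exprn_gt0.
have n20 : 0 < N%:R ^+ 2 :> R by rewrite exprn_gt0.
have aE : 2 * (alpha / 2) = alpha by rewrite mulrC divfK.
have /= := @generator_weight _ _ N alpha chi chi0 alpha1 (N%:R ^+ 2) e C a d0 erefl (ltW e0) C0.
have H (r s : R) : chi <= r -> 0 <= s ->
  N%:R ^+ 2 * (r `^ (alpha / 2) * ((s + chi) `^ (alpha / 2) * expR (alpha / 2 * (chi / r))
      - s `^ (alpha / 2))) <= e * (r `^ alpha + s `^ alpha) + C.
  by move=> cr s0; have := CP _ _ r s n20 chi0 cr s0 nM; rewrite aE.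
move=> /(_ H) W; apply: (le_trans W); rewrite ler_wpM2l ?expR_ge0//.
have ra0 x : 0 <= chi * (a x)%:R by rewrite mulr_ge0// ltW.
have := KP N (fun x => chi * (a x)%:R) N0 ra0.
rewrite -/(root_conf alpha chi a) -/(conf_mass chi a) -/(conf_energy alpha chi a).
rewrite ler_pdivrMr// => P.
have m0 : 0 <= conf_mass chi a by rewrite divr_ge0 ?sumr_ge0// exprn_ge0.
have mM : conf_mass chi a `^ alpha <= `|m| `^ alpha.
  apply: ge0_ler_powR; rewrite ?nnegrE ?normr_ge0 ?(le_trans am) ?ler_norm//.
  by rewrite ltW// (lt_trans _ alpha1).
have D0 : 0 <= conf_energy alpha chi a by exact: dirichlet_ge0.
have -> : N%:R ^+ 2 / (4 * d%:R ^+ 2) * bond_energy (root_conf alpha chi a) =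
    N%:R ^+ d * (conf_energy alpha chi a / (4 * d%:R ^+ 2)).
  by rewrite /conf_energy /dirichlet; field; rewrite !gt_eqF.
set D := conf_energy alpha chi a in P D0 *.
set S := \sum_x _ in P *; set q := `|m| `^ alpha in mM *.
rewrite [X in X <= _]mulrAC [X in _ <= X]mulrAC ler_pM2r ?invr_gt0//.
have S1 : 2 * e * S <= 2 * e * (K * (D + q) * N%:R ^+ d).
  rewrite ler_wpM2l ?(mulr_ge0 _ (ltW e0))//; apply: (le_trans P).
  by rewrite ler_wpM2r ?(ltW Nd)// ler_wpM2l// lerD2l.
have eK : 2 * e * K <= (8 * d%:R ^+ 2)^-1.
  rewrite /e -[X in _ <= X]mulr1 (_ : 16 * _ * _ = 8 * d%:R ^+ 2 * (2 * (K + 1))); last by ring.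
  rewrite invfM -[2 * _ * _]mulrA [2 * _]mulrC -!mulrA ler_wpM2l ?invr_ge0 ?mulr_ge0 ?exprn_ge0//.
  by rewrite mulrC ler_pdivrMr ?mulr_gt0 ?ltr_wpDl//; lra.
have eKD := ler_wpM2r D0 eK.
have := ler_wpM2l (ltW dR) S1.
have := ler_wpM2l (ltW (mulr_gt0 dR Nd)) eKD.
have -> : (8 * d%:R)^-1 = d%:R / (8 * d%:R ^+ 2) :> R by field; rewrite gt_eqF.
have -> : (4 * d%:R ^+ 2)^-1 = 2 / (8 * d%:R ^+ 2) :> R by field; rewrite gt_eqF.
by move: (8 * d%:R ^+ 2)^-1 => z A1 A2; nra.
Qed.

(** * Real-valued probabilities and union bounds *)

Section level_sets.
Context d (T : measurableType d) (R : realType) (f : T -> R) (r : R).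
Hypothesis mf : measurable_fun [set: T] f.

Lemma measurable_ge_set : measurable [set x | r <= f x].
Proof.
rewrite (_ : mkset _ = f @^-1` `[r, +oo[%classic); first by rewrite -[X in measurable X]setTI; exact: mf.
by apply/seteqP; split => w /=; rewrite in_itv/= andbT.
Qed.

Lemma measurable_gt_set : measurable [set x | r < f x].
Proof.
rewrite (_ : mkset _ = f @^-1` `]r, +oo[%classic); first by rewrite -[X in measurable X]setTI; exact: mf.
by apply/seteqP; split => w /=; rewrite in_itv/= andbT.
Qed.

End level_sets.

Section real_probability.
Context d (T : measurableType d) (R : realType) (P : probability T R).
Implicit Types A B : set T.

Definition pr A : R := fine (P A).

Lemma pr_fin A : measurable A -> P A = (pr A)%:E.
Proof. by move=> mA; rewrite /pr fineK// fin_num_measure. Qed.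

Lemma prE A : measurable A -> pr A = \int[P]_w \1_A w.
Proof. by move=> mA; rewrite /Rintegral integral_indic// setIT. Qed.

Lemma pr_ge0 A : 0 <= pr A.
Proof. exact: fine_ge0. Qed.

Lemma indic_integrable A : measurable A -> P.-integrable [set: T] (EFin \o (\1_A : T -> R)).
Proof.
move=> mA; apply: (@bounded_integrable _ _ _ _ _ 1) => // x.
by rewrite indicE; case: (_ \in _); rewrite ?normr0 ?normr1.
Qed.

Lemma le_pr A B : measurable A -> measurable B -> A `<=` B -> pr A <= pr B.
Proof.
by move=> mA mB AB; rewrite /pr fine_le ?fin_num_measure//; apply: le_measure; rewrite ?inE.
Qed.

Lemma pr_le1 A : measurable A -> pr A <= 1.
Proof. by move=> mA; rewrite -lee_fin -pr_fin// probability_le1. Qed.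

Lemma sum_prE (I : finType) (Q : pred I) (B : I -> set T) (S := fun w => \sum_i (\1_(B i) w *+ Q i) : R) :
  (forall i, measurable (B i)) ->
  \sum_(i | Q i) pr (B i) = \int[P]_w S w /\ P.-integrable [set: T] (EFin \o S).
Proof.
move=> mB; rewrite big_mkcond/=; split; last first.
  apply: (@bounded_integrable _ _ _ _ _ #|I|%:R).
    apply: measurable_sum => i; case: (Q i) => //; exact: measurable_indic.
  move=> w; apply: (le_trans (ler_norm_sum _ _ _)).
  rewrite -sumr_const; apply: ler_sum => i _; rewrite indicE.
  by case: (Q i); case: (_ \in _); rewrite ?normr0 ?normr1.
rewrite (eq_bigr (fun i => \int[P]_w (\1_(B i) w *+ Q i))); last first.
  move=> i _; case: (Q i); first by rewrite prE.
  by rewrite Rintegral_cst// mul0r.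
have iB i : P.-integrable [set: T] (EFin \o (fun w => \1_(B i) w *+ Q i : R)).
  by case: (Q i); [exact: indic_integrable|exact: integrable0].
by rewrite -Rintegral_sum.
Qed.

Lemma pr_le_sum (I : finType) (Q : pred I) A (B : I -> set T) :
  measurable A -> (forall i, measurable (B i)) ->
  (forall w, A w -> exists2 i, Q i & B i w) -> pr A <= \sum_(i | Q i) pr (B i).
Proof.
move=> mA mB AB; have [-> iS] := sum_prE Q mB; rewrite prE//; apply: le_Rintegral => //; first exact: indic_integrable.
move=> w _; rewrite indicE; case: (boolP (w \in A)) => [|_].
  rewrite inE => /AB[i Qi Biw]; rewrite (bigD1 i)//= Qi indicE mem_set// ler_wpDr//.
  by apply: sumr_ge0 => j _; case: (Q j); rewrite ?mulr1n ?mulr0n.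
by apply: sumr_ge0 => j _; case: (Q j); rewrite ?mulr1n ?mulr0n.
Qed.

Lemma sum_pr_le (I : finType) (Q : pred I) A (B : I -> set T) :
  measurable A -> (forall i, measurable (B i)) ->
  (forall w i, Q i -> B i w -> A w) ->
  (forall w i j, Q i -> Q j -> B i w -> B j w -> i = j) ->
  \sum_(i | Q i) pr (B i) <= pr A.
Proof.
move=> mA mB BA Binj; have [-> iS] := sum_prE Q mB; rewrite prE//; apply: le_Rintegral => //; first exact: indic_integrable.
move=> w _; have [[i [Qi Biw]]|nB] := pselect (exists i, Q i /\ B i w).
  rewrite indicE mem_set; last exact: BA Biw.
  rewrite (bigD1 i)//= Qi indicE mem_set// big1 ?addr0// => j ji.
  case: (boolP (Q j)) => [Qj|//]; rewrite mulr1n indicE memNset// => Bjw.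
  by move: ji; rewrite (Binj w j i)// eqxx.
rewrite big1// => i _; case: (boolP (Q i)) => [Qi|//].
by rewrite mulr1n indicE memNset// => Biw; apply: nB; exists i.
Qed.

End real_probability.

(** * Markov chains with a conserved total *)

Section bounded_configs.
Variables (d N K : nat).

(** The configurations of total at most [K] are covered by a finite type, so that expectations over
    the next state become finite sums. *)
Definition bounded_conf (f : {ffun lattice d N -> 'I_K.+1}) : config d N :=
  [ffun x => f x : nat].

Lemma bounded_conf_inj : injective bounded_conf.
Proof.
by move=> f g /ffunP fg; apply/ffunP => x; have := fg x; rewrite !ffunE => /val_inj.
Qed.

Lemma bounded_conf_ex (a : config d N) : (total a <= K)%N -> exists f, bounded_conf f = a.
Proof.
move=> aK; exists [ffun x => inord (a x)]; apply/ffunP => x; rewrite !ffunE inordK//.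
by rewrite ltnS (leq_trans _ aK)// /total (bigD1 x)//= leq_addr.
Qed.

End bounded_configs.

Section markov_chain.
Context disp (Omega : measurableType disp) (R : realType) (P : probability Omega R).
Variables (d N : nat) (X : nat -> Omega -> config d N) (n K : nat).
Variable q : config d N -> probability (config d N) R.
Local Notation config := (config d N).
Implicit Types (a : nat -> config) (b : config).

Hypothesis mX : forall i b, measurable (X i @^-1` [set b]).

Definition history m a : set Omega := [set w | forall i, (i <= m)%N -> X i w = a i].

Hypothesis markovX : forall m a, (m < n)%N ->
  P (history m.+1 a) = (P (history m a) * q (a m) [set a m.+1])%E.

Definition adj_run m k : set Omega :=
  [set w | forall i, (m <= i < m + k)%N -> adj (X i w) (X i.+1 w)].

Definition set_next m a b : nat -> config := fun i => if i == m.+1 then b else a i.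

Lemma historyS m a b : history m.+1 (set_next m a b) =
  history m a `&` [set w | X m.+1 w = b].
Proof.
rewrite /set_next; apply/seteqP; split => w /=.
  move=> H; split => [i im|]; last by rewrite H// eqxx.
  by rewrite H ?leqW// ltn_eqF// ltnS.
move=> [H Hb] i; rewrite leq_eqVlt => /predU1P[->|]; first by rewrite eqxx.
by rewrite ltnS => im; rewrite ltn_eqF ?ltnS// H.
Qed.

Lemma measurable_history m a : measurable (history m a).
Proof.
rewrite /history (_ : mkset _ = \bigcap_(i in [set i | (i <= m)%N]) (X i @^-1` [set a i])).
  by apply: bigcap_measurable => [|i _]; [exists 0%N|exact: mX].
by apply/seteqP; split => w H i im; exact: H.
Qed.

Lemma measurable_adj_run m k : measurable (adj_run m k).
Proof.
rewrite /adj_run (_ : mkset _ = \bigcap_(i in [set i | (m <= i < m + k)%N])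
    [set w | adj (X i w) (X i.+1 w)]); last first.
  by apply/seteqP; split => w H i im; exact: H.
have [->|/set0P ne] := eqVneq [set i | (m <= i < m + k)%N] set0.
  by rewrite bigcap_set0.
apply: bigcap_measurable => // i _.
rewrite (_ : mkset _ = \bigcup_b (X i @^-1` [set b] `&` (X i.+1 @^-1` [set c | adj b c]))).
  apply: (countable_bigcupT_measurable (countableP _)) => b; apply: measurableI => //.
  exact: measurable_countable_preimage.
apply/seteqP; split => w; first by move=> /= H; exists (X i w).
by move=> [b _ [/= <-]].
Qed.

Lemma pr_history m a b : (m < n)%N ->
  pr P (history m.+1 (set_next m a b)) = pr P (history m a) * pr (q (a m)) [set b].
Proof.
move=> mn; apply: EFin_inj; rewrite EFinM -!pr_fin ?markovX//; try exact: measurable_history.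
rewrite /set_next eqxx ltn_eqF//; congr (P _ * _)%E.
by apply/seteqP; split => w H i im; have := H i im; rewrite ltn_eqF ?ltnS.
Qed.

Lemma total_set_next m a b : adj (a m) b -> (total (a m) <= K)%N ->
  (total (set_next m a b m.+1) <= K)%N.
Proof. by move=> ab; rewrite /set_next eqxx (total_adj ab). Qed.

Local Notation lift := (@bounded_conf d N K).

(** Induction on the number of remaining steps: the next state is either not adjacent, with
    conditional probability at most [eps], or adjacent and then of the same total, so that the
    induction hypothesis applies to the longer history. *)
Lemma adj_run_exit eps : 0 <= eps ->
  (forall b, (total b <= K)%N -> pr (q b) [set c | ~~ adj b c] <= eps) ->
  forall k m a, (m + k <= n)%N -> (total (a m) <= K)%N ->
  pr P (history m a `&` ~` adj_run m k) <= k%:R * eps * pr P (history m a).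
Proof.
move=> eps0 qeps; elim=> [|k IHk] m a mk aK.
  rewrite !mul0r (_ : _ `&` _ = set0) ?/pr ?measure0//.
  by apply/seteqP; split => // w [_]; apply => i; rewrite addn0; lia.
have mn : (m < n)%N by lia.
pose B f := history m.+1 (set_next m a (lift f)).
pose A0 := history m a `&` [set w | ~~ adj (a m) (X m.+1 w)].
pose A1 := history m a `&` [set w | adj (a m) (X m.+1 w)].
have mA0 : measurable A0.
  apply: measurableI; [exact: measurable_history|].
  exact: (measurable_countable_preimage (mX m.+1) [set c | ~~ adj (a m) c]).
have mA1 : measurable A1.
  apply: measurableI; [exact: measurable_history|].
  exact: (measurable_countable_preimage (mX m.+1) [set c | adj (a m) c]).
have mH := measurable_history m a.
have mB f : measurable (B f) by exact: measurable_history.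
have adj_lift c : adj (a m) c -> exists f, lift f = c.
  by move=> ac; apply: bounded_conf_ex; rewrite (total_adj ac).
have H1 : pr P A1 >= pr P (history m a) * (1 - eps).
  apply: (@le_trans _ _ (\sum_(f | adj (a m) (lift f)) pr P (B f))); last first.
    apply: sum_pr_le => // [w f fa|w f g _ _].
      by rewrite /B historyS => -[h /= Xf]; split => //=; rewrite Xf.
    by rewrite /B !historyS => -[_ /= ->] [_ /= /bounded_conf_inj].
  rewrite (eq_bigr (fun f => pr P (history m a) * pr (q (a m)) [set lift f])); last first.
    by move=> f _; rewrite /B pr_history.
  rewrite -mulr_sumr ler_wpM2l ?pr_ge0//.
  apply: (@le_trans _ _ (pr (q (a m)) [set c | adj (a m) c])); last first.
    by apply: pr_le_sum => // c /= ac; have [f fc] := adj_lift c ac; exists f; rewrite ?fc.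
  have := qeps _ aK; rewrite (_ : [set c | ~~ _] = ~` [set c | adj (a m) c]); last first.
    by apply/seteqP; split => c /=; [move/negP|move=> /negP].
  rewrite {1}/pr probability_setC// fineB ?fin_num_measure//=.
  by rewrite -/(pr _ _); lra.
have H0 : pr P A0 <= eps * pr P (history m a).
  have : pr P A0 + pr P A1 <= pr P (history m a).
    have := @sum_pr_le _ _ _ P bool predT (history m a) (fun c : bool => if c then A0 else A1) mH.
    rewrite big_bool/=; apply; first by case.
      by move=> w [] _ [].
    by move=> w [] [] _ _ // [_ h1] [_ h2]; move: h1 h2 => /=; case: (adj _ _).
  by lra.
pose E := history m a `&` ~` adj_run m k.+1.
have mE : measurable E.
  by apply: measurableI => //; apply: measurableC; exact: measurable_adj_run.
have mBk f : measurable (B f `&` ~` adj_run m.+1 k).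
  by apply: measurableI => //; apply: measurableC; exact: measurable_adj_run.
have E01 : pr P E <= pr P A0 + pr P (E `&` A1).
  have mEA (c : bool) : measurable (if c then A0 else E `&` A1).
    by case: c => //; exact: measurableI.
  have := @pr_le_sum _ _ _ P bool predT E (fun c : bool => if c then A0 else E `&` A1) mE mEA.
  rewrite big_bool/=; apply => w Ew.
  have [ad|nad] := boolP (adj (a m) (X m.+1 w)); last by exists true => //; case: Ew.
  by exists false => //; split => //; case: Ew.
apply: (le_trans E01); rewrite -natr1 mulrDl mul1r [X in _ <= X]mulrDl [X in _ <= X]addrC lerD//.
apply: (@le_trans _ _ (\sum_(f | adj (a m) (lift f)) pr P (B f `&` ~` adj_run m.+1 k))).
  apply: pr_le_sum => [|//|w [[h nr] [_ /= ad]]]; first exact: measurableI.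
  have [f fc] := adj_lift _ ad; exists f; first by rewrite fc.
  split; first by rewrite /B historyS; split => //=; rewrite fc.
  move=> r; apply: nr => i /andP[]; rewrite leq_eqVlt => /predU1P[<- _|mi ik].
    by rewrite h.
  by apply: r; rewrite mi; move: ik; rewrite addnS addSn.
apply: (@le_trans _ _ (\sum_(f | adj (a m) (lift f))
    k%:R * eps * (pr P (history m a) * pr (q (a m)) [set lift f]))).
  apply: ler_sum => f af; rewrite -pr_history//; apply: IHk; first by lia.
  exact: total_set_next.
rewrite -mulr_sumr ler_wpM2l ?mulr_ge0// -mulr_sumr ler_piMr ?pr_ge0//.
apply: (le_trans _ (pr_le1 (q (a m)) (@measurableT _ _))).
apply: sum_pr_le => // c f g _ _ /= ->; exact: bounded_conf_inj.
Qed.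

(** Exponential Chebyshev inequality for the supermartingale formed by [G] at the current state
    times the exponential of the accumulated [s * D - kappa]. It is run on histories by induction
    instead of conditional expectations; the base case uses that [G] is at least 1. *)
Lemma adj_run_energy (G D : config -> R) (s kappa : R) : 0 <= s -> 0 <= kappa ->
  (forall b, 1 <= G b) ->
  (forall b, (total b <= K)%N ->
    expR (s * D b - kappa) *
      (\sum_(f | adj b (lift f)) pr (q b) [set lift f] * G (lift f)) <= G b) ->
  forall k m a y, (m + k <= n)%N -> (total (a m) <= K)%N ->
  pr P (history m a `&` adj_run m k `&`
      [set w | y <= \sum_(m <= i < m + k) D (X i w)]) <=
  pr P (history m a) * (expR (kappa * k%:R - s * y) * G (a m)).
Proof.
move=> s0 kappa0 G1 HG.
have mS m k y : measurable [set w | y <= \sum_(m <= i < m + k) D (X i w)].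
  by apply: measurable_ge_set; apply: measurable_sum => i; exact: (measurable_countable_comp (mX i) D).
have mev m k a y : measurable (history m a `&` adj_run m k `&`
      [set w | y <= \sum_(m <= i < m + k) D (X i w)]).
  apply: measurableI => //; apply: measurableI; first exact: measurable_history.
  exact: measurable_adj_run.
elim=> [|k IHk] m a y mk aK.
  rewrite mulr0 sub0r; have [y0|y0] := leP y 0.
    apply: (@le_trans _ _ (pr P (history m a))).
      by apply: le_pr; [exact: mev|exact: measurable_history|move=> w [[]]].
    rewrite ler_peMr ?pr_ge0// mulr_ege1//.
    by rewrite -expR0 ler_expR oppr_ge0 mulr_ge0_le0.
  rewrite (_ : _ `&` _ = set0) ?/pr ?measure0//.
    by rewrite mulr_ge0 ?fine_ge0// mulr_ge0 ?expR_ge0// (le_trans ler01).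
  by apply/seteqP; split => // w [_ /=]; rewrite addn0 big_geq// leNgt y0.
have mn : (m < n)%N by lia.
pose B f := history m.+1 (set_next m a (lift f)) `&` adj_run m.+1 k `&`
  [set w | y - D (a m) <= \sum_(m.+1 <= i < m.+1 + k) D (X i w)].
apply: (@le_trans _ _ (\sum_(f | adj (a m) (lift f)) pr P (B f))).
  apply: pr_le_sum => [|f|w [[h r] /= yD]]; [exact: mev|exact: mev|].
  have ad : adj (a m) (X m.+1 w) by rewrite -h//; apply: r; lia.
  have [f fc] : exists f, lift f = X m.+1 w.
    by apply: bounded_conf_ex; rewrite (total_adj ad).
  exists f; first by rewrite fc.
  split; [split|] => /=.
  - by rewrite historyS; split => //=; rewrite fc.
  - by move=> i ik; apply: r; lia.
  - by move: yD; rewrite big_ltn ?h ?addnS ?addSn//; [lra|lia].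
apply: (@le_trans _ _ (\sum_(f | adj (a m) (lift f)) pr P (history m a) *
    (expR (kappa * k%:R - s * (y - D (a m))) *
     (pr (q (a m)) [set lift f] * G (lift f))))).
  apply: ler_sum => f af.
  have := IHk m.+1 (set_next m a (lift f)) (y - D (a m)).
  rewrite pr_history// /set_next eqxx => H; apply: (le_trans (H _ _)); first by lia.
    by rewrite (total_adj af).
  by apply: eq_ler; ring.
rewrite -mulr_sumr ler_wpM2l ?pr_ge0// -mulr_sumr.
have := HG _ aK; set S := \sum_(_ | _) _ => HS.
rewrite (_ : kappa * k%:R - s * (y - D (a m)) =
  (kappa * k.+1%:R - s * y) + (s * D (a m) - kappa)); last by rewrite -natr1; ring.
by rewrite expRD -mulrA ler_wpM2l ?expR_ge0.
Qed.

Lemma start_sum (C : pred config) : \sum_(f | C (lift f)) pr P (X 0%N @^-1` [set lift f]) <= 1.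
Proof.
apply: (le_trans _ (pr_le1 P (@measurableT _ _))).
by apply: sum_pr_le => // w f g _ _ /= ->; exact: bounded_conf_inj.
Qed.

Lemma chain_exit (C : pred config) eps : 0 <= eps -> (forall b, C b -> (total b <= K)%N) ->
  (forall b, (total b <= K)%N -> pr (q b) [set c | ~~ adj b c] <= eps) ->
  pr P ([set w | C (X 0%N w)] `&` ~` adj_run 0 n) <= n%:R * eps.
Proof.
move=> eps0 CK qeps; pose B f := history 0 (fun=> lift f) `&` ~` adj_run 0 n.
have mB f : measurable (B f).
  apply: measurableI; first exact: measurable_history.
  by apply: measurableC; exact: measurable_adj_run.
apply: (@le_trans _ _ (\sum_(f | C (lift f)) pr P (B f))).
  apply: pr_le_sum => //.
    apply: measurableI; last by apply: measurableC; exact: measurable_adj_run.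
    exact: (measurable_countable_preimage (mX 0) [set b | C b]).
  move=> w [/= Cw nr]; have [f fE] := bounded_conf_ex (CK _ Cw).
  by exists f; [rewrite fE|split => // i; rewrite leqn0 => /eqP ->].
apply: (@le_trans _ _ (\sum_(f | C (lift f)) n%:R * eps * pr P (X 0%N @^-1` [set lift f]))).
  apply: ler_sum => f Cf.
  have := @adj_run_exit eps eps0 qeps n 0 (fun=> lift f) (leqnn _) (CK _ Cf).
  rewrite /B (_ : history 0 _ = X 0%N @^-1` [set lift f])//.
  by apply/seteqP; split => w H; [exact: H|move=> i; rewrite leqn0 => /eqP ->].
by rewrite -mulr_sumr ler_piMr ?mulr_ge0// start_sum.
Qed.

Lemma chain_energy (C : pred config) (G D : config -> R) (s kappa B y : R) : 0 <= s -> 0 <= kappa ->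
  (forall b, C b -> (total b <= K)%N) -> (forall b, C b -> G b <= B) ->
  (forall b, 1 <= G b) ->
  (forall b, (total b <= K)%N ->
    expR (s * D b - kappa) *
      (\sum_(f | adj b (lift f)) pr (q b) [set lift f] * G (lift f)) <= G b) ->
  0 <= B ->
  pr P ([set w | C (X 0%N w)] `&` adj_run 0 n `&`
    [set w | y <= \sum_(0 <= i < n) D (X i w)]) <= expR (kappa * n%:R - s * y) * B.
Proof.
move=> s0 kappa0 CK GB G1 HG B0.
have mS : measurable [set w | y <= \sum_(0 <= i < n) D (X i w)].
  by apply: measurable_ge_set; apply: measurable_sum => i; exact: (measurable_countable_comp (mX i) D).
pose E f := history 0 (fun=> lift f) `&` adj_run 0 n `&` [set w | y <= \sum_(0 <= i < n) D (X i w)].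
have mr := measurable_adj_run 0 n.
apply: (@le_trans _ _ (\sum_(f | C (lift f)) pr P (E f))).
  apply: pr_le_sum => //.
  - apply: measurableI => //; apply: measurableI => //.
    exact: (measurable_countable_preimage (mX 0) [set b | C b]).
  - by move=> f; apply: measurableI => //; apply: measurableI => //; exact: measurable_history.
  - move=> w [[/= Cw nr] yS]; have [f fE] := bounded_conf_ex (CK _ Cw).
    by exists f; [rewrite fE|split => //; split => // i; rewrite leqn0 => /eqP ->].
apply: (@le_trans _ _ (\sum_(f | C (lift f)) pr P (X 0%N @^-1` [set lift f]) *
    (expR (kappa * n%:R - s * y) * B))).
  apply: ler_sum => f Cf.
  have := @adj_run_energy G D s kappa s0 kappa0 G1 HG n 0 (fun=> lift f) y (leqnn _) (CK _ Cf).
  rewrite /E (_ : history 0 _ = X 0%N @^-1` [set lift f]); last first.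
    by apply/seteqP; split => w H; [exact: H|move=> i; rewrite leqn0 => /eqP ->].
  rewrite add0n => /le_trans; apply; rewrite ler_wpM2l ?pr_ge0// ler_wpM2l ?expR_ge0//.
  exact: GB.
by rewrite -mulr_suml ler_piMl ?mulr_ge0 ?expR_ge0// start_sum.
Qed.

End markov_chain.

(** * Events determined by their trace on configuration paths *)

Section relative_events.
Variables (R : realType) (d N : nat) (N0 : (0 < N)%N) (chi : R) (chi0 : 0 < chi).
Variables (tf : {posnum R}) (delta : weak_star_metric R d).
Local Notation path := (cadlag_path tf delta).
Local Notation time := (time tf).
Local Notation config_path := (@config_path R d N chi tf delta).
Implicit Types (u v w : path) (s t : time) (A : set path).

(* Only the trace on the paths with values in the state space matters, since
   [eta] takes its values there. *)
Definition rel_measurable A : Prop :=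
  exists2 B : set (skorokhod_space tf delta), measurable B &
    forall u, config_path u -> (B u <-> A u).

Lemma rel_measurableC A : rel_measurable A -> rel_measurable (~` A).
Proof.
move=> [B mB BA]; exists (~` B); first exact: measurableC.
by move=> u cu; split=> h; apply: contra_not h => h; apply/(BA u cu).
Qed.

Lemma rel_measurable_bigcup (I : countType) (A : I -> set path) :
  (forall i, rel_measurable (A i)) -> rel_measurable (\bigcup_i A i).
Proof.
move=> mA; have /choice[B BP] : forall i, exists B : set (skorokhod_space tf delta),
    measurable B /\ forall u, config_path u -> (B u <-> A i u).
  by move=> i; have [B mB BA] := mA i; exists B.
exists (\bigcup_i B i).
  by apply: (countable_bigcupT_measurable (countableP _)) => i; exact: (BP i).1.
by move=> u cu; split => -[i _ /((BP i).2 u cu) ?]; exists i.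
Qed.

Lemma rel_measurable_bigcap (I : countType) (A : I -> set path) :
  (forall i, rel_measurable (A i)) -> rel_measurable (\bigcap_i A i).
Proof.
move=> mA; rewrite -[X in rel_measurable X]setCK setC_bigcap.
by apply/rel_measurableC/rel_measurable_bigcup => i; exact: rel_measurableC.
Qed.

Lemma rel_measurableI A B : rel_measurable A -> rel_measurable B -> rel_measurable (A `&` B).
Proof.
move=> mA mB; rewrite (_ : A `&` B = \bigcap_b (if b then A else B)).
  by apply: rel_measurable_bigcap => -[].
by apply/seteqP; split => [u [Au Bu] [] _//|u H]; split; [exact: (H true)|exact: (H false)].
Qed.

Lemma rel_measurable_prop (Q : Prop) : rel_measurable [set _ | Q].
Proof.
have [q|nq] := pselect Q; first by exists setT.
by exists set0 => // u _; split.
Qed.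

Lemma rel_measurable_map (s : seq time) (Q : set (seq (config d N))) :
  rel_measurable [set u | Q (map (path_conf N chi u) s)].
Proof.
elim: s Q => [|t s IHs] Q /=; first exact: rel_measurable_prop.
rewrite (_ : mkset _ = \bigcup_a ([set u | path_conf N chi u t = a] `&`
    [set u | Q (a :: map (path_conf N chi u) s)])); last first.
  apply/seteqP; split => u; first by move=> /= H; exists (path_conf N chi u t).
  by move=> [a _ [/= <-]].
apply: rel_measurable_bigcup => a; apply: rel_measurableI; last exact: (IHs (Q \o cons a)).
exact: eval_measurable.
Qed.

Lemma rel_measurable_fin n (t : nat -> time) (Q : set (nat -> config d N)) :
  (forall a b, (forall i, (i <= n)%N -> a i = b i) -> Q a -> Q b) ->
  rel_measurable [set u | Q (fun i => path_conf N chi u (t i))].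
Proof.
move=> Qab; have := rel_measurable_map (map t (iota 0 n.+1))
  [set s | Q (nth [ffun=> 0%N] s)].
have E u i : (i <= n)%N ->
    nth [ffun=> 0%N] (map (path_conf N chi u) (map t (iota 0 n.+1))) i = path_conf N chi u (t i).
  by move=> i_n; rewrite -map_comp (nth_map 0%N) ?size_iota ?ltnS// nth_iota.
move=> [B mB BP]; exists B => // u /BP ->; split; apply: Qab => i i_n; by rewrite (E u i i_n).
Qed.

Lemma rel_measurable_preimage disp (Omega : measurableType disp)
    (eta : {mfun Omega >-> skorokhod_space tf delta}) A :
  (forall o : Omega, config_path (eta o)) -> rel_measurable A -> measurable [set w | A (eta w)].
Proof.
move=> ceta [B mB BA]; rewrite (_ : mkset _ = eta @^-1` B).
  by rewrite -[X in measurable X]setTI; exact: measurable_funPT.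
by apply/seteqP; split => w /(BA _ (ceta w)).
Qed.

End relative_events.

(** * Good paths *)

Section good_paths.
Variables (R : realType) (d N : nat) (alpha chi : R).
Variables (tf : {posnum R}) (delta : weak_star_metric R d).
Local Notation path := (cadlag_path tf delta).

Definition grid (n k : nat) : time tf := clamp tf (k%:R * (tf%:num / n%:R)).

Definition good_grid (M1 : R) n (u : path) : Prop :=
  (forall k, (k < n)%N -> adj (path_conf N chi u (grid n k)) (path_conf N chi u (grid n k.+1))) /\
  tf%:num / n%:R * (\sum_(0 <= k < n) conf_energy alpha chi (path_conf N chi u (grid n k))) < M1.

(** Infinitely many grids rather than all: each fine grid fails with small probability, and failing
    on every late grid is an increasing union of events that obeys the same bound. *)
Definition good (M0 M1 : R) (u : path) : Prop :=
  conf_entropy chi (path_conf N chi u (time0 tf)) <= M0 /\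
  forall m, exists n, (m < n)%N /\ good_grid M1 n u.

End good_paths.

Section good_measurable.
Variables (R : realType) (d N : nat) (alpha chi : R) (tf : {posnum R}).
Variables (delta : weak_star_metric R d) (N0 : (0 < N)%N) (chi0 : 0 < chi).

Lemma good_grid_measurable (M1 : R) n :
  rel_measurable N chi (@good_grid R d N alpha chi tf delta M1 n).
Proof.
apply: (@rel_measurable_fin _ _ _ N0 _ chi0 _ _ n (grid tf n)
    [set a | (forall k, (k < n)%N -> adj (a k) (a k.+1)) /\
      tf%:num / n%:R * (\sum_(0 <= k < n) conf_energy alpha chi (a k)) < M1]) => //.
move=> a b ab [h1 h2]; split => [k kn|].
  by rewrite -!ab ?(ltnW kn)//; exact: h1.
rewrite big_nat_cond (eq_bigr (fun k => conf_energy alpha chi (a k))) -?big_nat_cond//.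
by move=> k /andP[/andP[_ kn] _]; rewrite ab// ltnW.
Qed.

Lemma good_measurable (M0 M1 : R) :
  rel_measurable N chi (@good R d N alpha chi tf delta M0 M1).
Proof.
rewrite (_ : good N alpha chi M0 M1 = [set u | conf_entropy chi (path_conf N chi u (time0 tf)) <= M0] `&`
    \bigcap_(m : nat) \bigcup_(n : nat) ([set _ | (m < n)%N] `&` @good_grid R d N alpha chi tf delta M1 n)); last first.
  apply/seteqP; split => u [h0 H]; split => // m.
    by move=> _; have [n [mn gn]] := H m; exists n.
  by have [n _ [mn gn]] := H m I; exists n.
apply: rel_measurableI => //.
  apply: (@rel_measurable_fin _ _ _ N0 _ chi0 _ _ 0 (fun=> time0 tf)
    [set a | conf_entropy chi (a 0%N) <= M0]) => a b ab /=.
  by rewrite ab.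
apply: rel_measurable_bigcap => // m; apply: rel_measurable_bigcup => // n.
by apply: rel_measurableI => //; [exact: rel_measurable_prop|exact: good_grid_measurable].
Qed.

End good_measurable.

(** * Short-time expansion and the probability of a good grid *)

Section short_time.
Variables (R : realType) (d N : nat) (N0 : (0 < N)%N) (alpha chi : R).
Hypotheses (chi0 : 0 < chi) (alpha1 : 1 < alpha).
Variables (p : R -> config d N -> probability (config d N) R).
Hypothesis genp : has_generator alpha chi p.
Implicit Types (F : config d N -> R) (a b : config d N).

Lemma generator_short F b (eps : R) : 0 < eps -> (exists M, forall a, `|F a| <= M) ->
  \forall h \near 0^'+,
    \int[p h b]_a F a <= F b + h * (zr_generator alpha chi F b + eps).
Proof.
move=> eps0 bF; have /cvgrPdist_lt/(_ _ eps0) H := @genp F b bF.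
near=> h.
have : `|zr_generator alpha chi F b - h^-1 * (\int[p h b]_a F a - F b)| < eps by near: h.
rewrite ltr_norml => /andP[+ _]; rewrite ltrBrDl addrC -ltrBrDl opprK.
rewrite mulrC ltr_pdivrMr// [_ * h]mulrC => ?; lra.
Unshelve. all: by end_near. Qed.

(** Every jump of positive rate leads to an adjacent configuration, so leaving the neighbourhood of
    [b] has rate zero and its probability in a time step h is o(h). *)
Lemma generator_exit b : zr_generator alpha chi (fun c => (~~ adj b c)%:R : R) b = 0.
Proof.
rewrite /zr_generator big1 ?mulr0// => x _; rewrite big1// => y _.
have -> : adj b b by rewrite /adj eqxx.
have [->|bx] := posnP (b x).
  by rewrite mulr0 powR0 ?mulr0 ?mul0r// gt_eqF// (lt_trans _ alpha1).
rewrite (_ : adj b (jump b x y)) ?subrr ?mulr0//.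
by apply/orP; right; apply/existsP; exists x; apply/existsP; exists y; rewrite bx eqxx.
Qed.

(** [has_generator] speaks of bounded functions, whereas the weight is unbounded. Cutting it off
    above total [K] changes nothing at [b], because jumps conserve the total. *)
Lemma generator_class F K b : (total b <= K)%N ->
  zr_generator alpha chi (fun c => F c * (total c <= K)%N%:R) b = zr_generator alpha chi F b.
Proof.
move=> bK; rewrite /zr_generator; congr (_ * _).
apply: eq_bigr => x _; apply: eq_bigr => y _.
have [->|bx] := posnP (b x).
  by rewrite mulr0 powR0 ?mulr0 ?mul0r// gt_eqF// (lt_trans _ alpha1).
by rewrite total_jump// bK !mulr1.
Qed.

Lemma class_bounded F K : exists M, forall c, `|F c * (total c <= K)%N%:R| <= M.
Proof.
exists (\sum_f `|F (@bounded_conf d N K f)|) => c.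
have [cK|_] := boolP (total c <= K)%N; last by rewrite mulr0 normr0 sumr_ge0.
have [f <-] := bounded_conf_ex cK.
by rewrite mulr1 (bigD1 f)//= lerDl sumr_ge0.
Qed.

Lemma class_integral F K b h : (total b <= K)%N -> (forall c, 0 <= F c) ->
  \sum_(f | adj b (@bounded_conf d N K f)) pr (p h b) [set bounded_conf f] * F (bounded_conf f)
  <= \int[p h b]_c (F c * (total c <= K)%N%:R).
Proof.
move=> bK F0; set q := p h b; rewrite big_mkcond/=.
have iI (f : {ffun lattice d N -> 'I_K.+1}) :
    integrableR q (fun c => if adj b (bounded_conf f)
      then F (bounded_conf f) * \1_[set bounded_conf f] c else 0 : R).
  case: (adj b (bounded_conf f)); last exact: integrable0.
  by apply: integrableZ_EFin; exact: indic_integrable.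
rewrite (eq_bigr (fun f => \int[q]_c (if adj b (bounded_conf f)
      then F (bounded_conf f) * \1_[set bounded_conf f] c else 0 : R))); last first.
  move=> f _; case: (adj b (bounded_conf f)); last by rewrite Rintegral_cst// mul0r.
  rewrite RintegralZl; [|by []|exact: indic_integrable].
  by rewrite -prE// mulrC.
have [M MP] := class_bounded F K.
rewrite -Rintegral_sum//; apply: le_Rintegral => //.
- apply: (@bounded_integrable _ _ _ _ _ (\sum_f `|F (@bounded_conf d N K f)|)) => // c.
  apply: (le_trans (ler_norm_sum _ _ _)); apply: ler_sum => f _; case: ifP => _.
    rewrite normrM ler_piMr// indicE; case: (_ \in _); rewrite ?normr0 ?normr1//.
  by rewrite normr0.
- exact: (bounded_integrable _ (B := M)).
move=> c _; have [[f [af fc]]|nf] :=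
    pselect (exists f, adj b (@bounded_conf d N K f) /\ bounded_conf f = c).
  rewrite (bigD1 f)//= af big1 ?addr0.
    by rewrite fc -fc (total_adj af) bK indicE mem_set.
  move=> g gf; case: ifP => // _; rewrite indicE memNset ?mulr0//= => gc.
  by move: gf; rewrite (bounded_conf_inj (etrans fc gc)) eqxx.
rewrite big1 ?mulr_ge0// => f _; case: ifP => // af.
by rewrite indicE memNset ?mulr0//= => cf; apply: nf; exists f.
Qed.

End short_time.

Lemma nbhs_right0_ex (R : realType) (Q : R -> Prop) :
  (\forall h \near 0^'+, Q h) -> exists2 h0 : R, 0 < h0 & forall h, 0 < h -> h < h0 -> Q h.
Proof.
move=> [e /= e0 H]; exists e => // h h_gt0 he; apply: H => //=.
by rewrite sub0r normrN gtr0_norm.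
Qed.

Section zero_range_paths.
Variables (R : realType) (d N : nat) (N0 : (0 < N)%N) (alpha chi : R).
Hypotheses (chi0 : 0 < chi) (alpha1 : 1 < alpha).
Variables (tf : {posnum R}) (delta : weak_star_metric R d).
Variables (disp : measure_display) (Omega : measurableType disp) (P : probability Omega R).
Variable eta : {mfun Omega >-> skorokhod_space tf delta}.
Hypothesis zrp : @zero_range_process R d N alpha chi tf delta disp Omega P eta.
Local Notation X n i o := (path_conf N chi (eta o) (grid tf n i)).
Local Notation W := (@ent_weight R d N alpha chi).
Local Notation D := (@conf_energy R d N alpha chi).
Local Notation lam := (N%:R ^+ d / chi).

Let ceta (o : Omega) : config_path N chi (eta o).
Proof. by have [H _] := zrp; exact: H. Qed.

Lemma val_grid n k : (0 < n)%N -> (k <= n)%N ->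
  val (grid tf n k) = k%:R * (tf%:num / n%:R).
Proof.
move=> n0 kn; have nR : 0 < n%:R :> R by rewrite ltr0n.
have k0 : 0 <= k%:R * (tf%:num / n%:R) by rewrite mulr_ge0// divr_ge0.
rewrite val_clamp// k0/= mulrA ler_pdivrMr// mulrC.
by rewrite ler_pM2l// ler_nat.
Qed.

Lemma clamp_le (x y : R) : x <= y -> val (clamp tf x) <= val (clamp tf y).
Proof.
move=> xy; change (Num.min (Num.max 0 x) tf%:num <= Num.min (Num.max 0 y) tf%:num).
by rewrite le_min !ge_min lexx orbT andbT ge_max !le_max lexx xy !orbT.
Qed.

Lemma grid_le n k : val (grid tf n k) <= val (grid tf n k.+1).
Proof.
have kk : k%:R * (tf%:num / n%:R) <= k.+1%:R * (tf%:num / n%:R).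
  by rewrite ler_wpM2r ?divr_ge0// ler_nat.
exact: clamp_le.
Qed.

Lemma ent_weight_ge1 (b : config d N) : 1 <= W b.
Proof.
have p0 : 0 < alpha / 2 by rewrite divr_gt0// (lt_trans _ alpha1).
rewrite -expR0 ler_expR mulr_ge0 ?(divr_ge0 (ltW p0) (ltW chi0))//.
by apply: sumr_ge0 => x _; rewrite ent_ge0// mulr_ge0// ltW.
Qed.

(** The steps have length h = tf / n. Uniformly over the finitely many configurations of total at
    most [K], a step goes to a non-adjacent state with probability at most h e / tf, which sums to
    [e], and the weight satisfies the one-step inequality of [chain_energy], which is used at the
    level M1 / h. *)
Lemma good_grid_probability (M0 M1 c C e : R) (K : nat) : 0 <= C -> 0 < c -> 0 < e ->
  (forall b : config d N, conf_entropy chi b <= M0 -> (total b <= K)%N) ->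
  (forall b : config d N, (total b <= K)%N ->
    zr_generator alpha chi W b <= W b * (lam * (C - c * D b))) ->
  \forall n \near \oo,
    pr P [set o | conf_entropy chi (path_conf N chi (eta o) (time0 tf)) <= M0 /\
                  ~ good_grid N alpha chi M1 n (eta o)] <=
    e + expR (lam * (tf%:num * (C + 1) + alpha / 2 * M0 - c * M1)).
Proof.
move=> C0 c0 e0 HK Hgen; have [_ [p [_ genp zP]]] := zrp.
have lam0 : 0 < lam by rewrite divr_gt0// exprn_gt0// ltr0n.
pose bc := @bounded_conf d N K.
have /nbhs_right0_ex[h0 h00 Hh] : \forall h \near 0^'+, forall f, (total (bc f) <= K)%N ->
    pr (p h (bc f)) [set a | ~~ adj (bc f) a] <= h * (e / tf%:num) /\
    \int[p h (bc f)]_a (W a * (total a <= K)%N%:R) <=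
      W (bc f) + h * (zr_generator alpha chi W (bc f) + lam).
  apply: filter_forall => f; have [fK|_] := boolP (total (bc f) <= K)%N; last first.
    by near=> h.
  have et0 : 0 < e / tf%:num by rewrite divr_gt0.
  have b1 : exists M : R, forall a, `|(~~ adj (bc f) a)%:R : R| <= M.
    by exists 1 => a; case: (~~ _); rewrite ?normr1 ?normr0.
  have H1 := generator_short genp (bc f) et0 b1.
  have H2 := generator_short genp (bc f) lam0 (class_bounded W K).
  near=> h => _; split.
    have : \int[p h (bc f)]_a (~~ adj (bc f) a)%:R <=
      (~~ adj (bc f) (bc f))%:R + h * (zr_generator alpha chi (fun a => (~~ adj (bc f) a)%:R) (bc f) + e / tf%:num).
      by near: h.
    have ff : adj (bc f) (bc f) by rewrite /adj eqxx.
    rewrite generator_exit// add0r {1}ff add0r prE//.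
    congr (_ <= _); apply: eq_Rintegral => a _; rewrite indicE.
    by congr ((_ : bool)%:R); apply/idP/idP; rewrite inE.
  have : \int[p h (bc f)]_a (W a * (total a <= K)%N%:R) <=
      W (bc f) * (total (bc f) <= K)%N%:R + h *
      (zr_generator alpha chi (fun a => W a * (total a <= K)%N%:R) (bc f) + lam).
    by near: h.
  by rewrite generator_class// fK mulr1.
near=> n.
have n0 : (0 < n)%N by near: n; exact: nbhs_infty_gt.
have nR : 0 < n%:R :> R by rewrite ltr0n.
pose h := tf%:num / n%:R.
have hpos : 0 < h by rewrite divr_gt0.
have hh0 : h < h0.
  rewrite ltr_pdivrMr// mulrC -ltr_pdivrMr//; near: n; exact: nbhs_infty_gtr.
have nh : n%:R * h = tf%:num by rewrite /h mulrC divfK// gt_eqF.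
have mX i b : measurable [set o | X n i o = b].
  apply: (rel_measurable_preimage ceta (A := [set u | path_conf N chi u (grid tf n i) = b])).
  exact: eval_measurable.
have markovX m (a : nat -> config d N) : (m < n)%N ->
    P (history (fun i o => X n i o) m.+1 a) =
    (P (history (fun i o => X n i o) m a) * p h (a m) [set a m.+1])%E.
  move=> mn; have := zP m (grid tf n) a (grid_le n).
  rewrite !val_grid ?(ltnW mn)// -mulrBl -natrB// subSnn mul1r.
  have E k : [set o | forall i, (i <= k)%N -> is_config chi (a i) (eta o (grid tf n i))] =
      history (fun i o => X n i o) k a.
    apply/seteqP; split => o H i ik; first exact: (path_confE N0 chi0 (H i ik)).
    by rewrite -(H i ik); exact: (path_confP N0 chi0 _ (ceta o)).
  by rewrite !E.
have lift_ex b : (total b <= K)%N -> exists f, bc f = b by exact: bounded_conf_ex.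
have He1 b : (total b <= K)%N -> pr (p h b) [set a | ~~ adj b a] <= h * (e / tf%:num).
  by move=> bK; have [f fE] := lift_ex b bK; rewrite -fE; apply: (Hh h hpos hh0 f _).1; rewrite fE.
pose CC : pred (config d N) := fun b => conf_entropy chi b <= M0.
pose J := adj_run (fun i o => X n i o) 0 n.
pose S o := \sum_(0 <= i < n) D (X n i o).
have he0 : 0 <= h * (e / tf%:num) by rewrite mulr_ge0 ?divr_ge0 ?(ltW hpos)// ltW.
have A1 := chain_exit mX markovX he0 (C := CC) HK He1.
have X0 o : X n 0 o = path_conf N chi (eta o) (time0 tf).
  by congr path_conf; apply/val_inj; rewrite val_grid// mul0r.
(* The rate is [C + 1] instead of [C]: the additional [lam] dominates the o(h) error in the
   expansion of the weight, since the weight is at least 1. *)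
have A2 : pr P ([set o | CC (X n 0 o)] `&` J `&` [set o | M1 / h <= S o]) <=
    expR (h * lam * (C + 1) * n%:R - h * lam * c * (M1 / h)) * expR (lam * (alpha / 2 * M0)).
  apply: (@chain_energy _ _ _ _ _ _ _ _ K _ mX markovX CC W D (h * lam * c) (h * lam * (C + 1))) => //.
  - by rewrite mulr_ge0 ?(ltW c0)// mulr_ge0 ?(ltW hpos)// ltW.
  - by rewrite mulr_ge0 ?addr_ge0// mulr_ge0 ?(ltW hpos)// ltW.
  - move=> b bM; rewrite /W ler_expR; set S' := \sum_x _.
    have -> : alpha / 2 / chi * S' = lam * (alpha / 2 * conf_entropy chi b).
      by rewrite /conf_entropy -/S'; field; rewrite !gt_eqF// exprn_gt0// ltr0n.
    rewrite ler_wpM2l ?(ltW lam0)// ler_wpM2l// divr_ge0// ltW// (lt_trans _ alpha1)//.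
  - exact: ent_weight_ge1.
  - move=> b bK; have [f fE] := lift_ex b bK.
    have := Hh h hpos hh0 f; rewrite fE => /(_ bK)[_ H].
    have := le_trans (class_integral p h bK (fun a => expR_ge0 _)) H; rewrite -/bc => H'.
    apply: (le_trans (ler_wpM2l (expR_ge0 _) H')).
    have g := Hgen b bK; have W1 := ent_weight_ge1 b.
    have step : W b + h * (zr_generator alpha chi W b + lam) <=
        W b * expR (h * lam * (C + 1) - h * lam * c * D b).
      apply: (@le_trans _ _ (W b * (1 + (h * lam * (C + 1) - h * lam * c * D b)))); last first.
        by rewrite ler_wpM2l ?expR_ge1Dx// (le_trans ler01).
      have : h * (zr_generator alpha chi W b + lam) <= h * (W b * (lam * (C - c * D b)) + W b * lam).
        by rewrite ler_wpM2l ?(ltW hpos)// lerD// ler_pMl.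
      by move/(lerD (lexx (W b)))/le_trans; apply; apply: eq_ler; ring.
    apply: (le_trans (ler_wpM2l (expR_ge0 _) step)).
    rewrite mulrCA -expRD; apply: eq_ler.
    by rewrite (_ : _ + _ = 0) ?expR0 ?mulr1//; ring.
have mC : measurable [set o | CC (X n 0 o)].
  exact: (measurable_countable_preimage (mX 0) [set b | CC b]).
have mJ : measurable J by exact: measurable_adj_run.
have mS : measurable [set o | M1 / h <= S o].
  by apply: measurable_ge_set; apply: measurable_sum => i; exact: (measurable_countable_comp (mX i) D).
pose B1 := [set o | CC (X n 0 o)] `&` ~` J.
pose B2 := [set o | CC (X n 0 o)] `&` J `&` [set o | M1 / h <= S o].
have mB1 : measurable B1 by apply: measurableI => //; exact: measurableC.
have mB2 : measurable B2 by apply: measurableI => //; exact: measurableI.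
have BE : [set o | conf_entropy chi (path_conf N chi (eta o) (time0 tf)) <= M0 /\
                  ~ good_grid N alpha chi M1 n (eta o)] = B1 `|` B2.
  apply/seteqP; split => o /=.
    rewrite -X0 => -[h1 ng]; have [Jo|nJ] := pselect (J o); last by left.
    right; split => //; rewrite /= leNgt; apply/negP => SM; apply: ng; split.
      by move=> k kn; apply: Jo; rewrite add0n.
    by rewrite mulrC -ltr_pdivlMr.
  rewrite -X0 => -[[h1 nJ]|[[h1 Jo] SM]]; split => // -[G1 G2].
    by apply: nJ => k; rewrite add0n => /andP[_]; exact: G1.
  by move: SM; rewrite /= leNgt ltr_pdivlMr// mulrC G2.
rewrite BE; apply: (@le_trans _ _ (pr P B1 + pr P B2)).
  have mB (b : bool) : measurable (if b then B1 else B2) by case: b.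
  have := @pr_le_sum _ _ _ P bool predT (B1 `|` B2) (fun b : bool => if b then B1 else B2)
    (measurableU _ _ mB1 mB2) mB.
  by rewrite big_bool; apply => o [?|?]; [exists true|exists false].
apply: lerD.
  by apply: (le_trans A1); rewrite mulrA nh mulrC divfK// gt_eqF.
apply: (le_trans A2); rewrite -expRD ler_expR; apply: eq_ler.
have -> : h * lam * (C + 1) * n%:R = lam * (C + 1) * tf%:num by rewrite -nh; ring.
by field; rewrite !gt_eqF.
Unshelve. all: by end_near. Qed.

End zero_range_paths.

(** * The probability of good paths *)

Lemma limn_esup_le (R : realType) (u : (\bar R)^nat) l :
  (\forall n \near \oo, (u n <= l)%E) -> (limn_esup u <= l)%E.
Proof.
move=> ul; apply: le_trans (_ : (ereal_sup (u @` [set n | (u n <= l)%E]) <= l)%E).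
  by apply: ereal_inf_lbound; exists [set n | (u n <= l)%E].
by apply: ub_ereal_sup => _ [n /= nl <-].
Qed.

Lemma limn_esup_lt (R : realType) (u : (\bar R)^nat) l :
  (limn_esup u < l)%E -> \forall n \near \oo, (u n <= l)%E.
Proof.
move=> /ereal_inf_lt[_ [A FA <-] Al]; apply: filterS FA => n An.
by apply: le_trans (ltW Al); apply: ereal_sup_ubound; exists n.
Qed.

Section good_probability.
Variables (R : realType) (d : nat) (d0 : (0 < d)%N) (alpha : R) (alpha1 : 1 < alpha).
Variables (tf : {posnum R}) (delta : weak_star_metric R d).
Variables (disp : measure_display) (Omega : measurableType disp) (P : probability Omega R).

Lemma config_path_zrp N (chi : R) (eta : Omega -> cadlag_path tf delta) :
  zero_range_process N alpha chi P eta -> forall o, config_path N chi (eta o).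
Proof. by move=> [H _] o; exact: H. Qed.

Lemma conf_entropy_mass N (chi : R) (b : config d N) : (0 < N)%N -> 0 < chi ->
  conf_mass chi b <= conf_entropy chi b + expR 1.
Proof.
move=> N0 chi0; have Nd : 0 < N%:R ^+ d :> R by rewrite exprn_gt0// ltr0n.
rewrite /conf_mass /conf_entropy ler_pdivrMr// mulrDl divfK ?gt_eqF//.
rewrite -sumr_const_lattice -big_split/=; apply: ler_sum => x _.
by apply: le_ent; rewrite mulr_ge0// ltW.
Qed.

Lemma conf_mass_total N (chi : R) (b : config d N) :
  conf_mass chi b = chi * (total b)%:R / N%:R ^+ d.
Proof. by rewrite /conf_mass -mulr_sumr natr_sum. Qed.

(** A bad path starts with high entropy or fails on all grids beyond some [m]. The latter events
    increase with [m], and each is contained in the failure of any single finer grid, where the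
    additive error [e] is arbitrary. *)
Lemma good_probability (M M0 : R) : 0 <= M0 ->
  exists2 c : R, 0 < c & exists C : R, forall N (chi : R)
    (eta : {mfun Omega >-> skorokhod_space tf delta}) (M1 : R),
  (0 < N)%N -> 0 < chi -> N%:R ^+ 2 * chi `^ Num.min 1 (alpha / 2) <= M ->
  zero_range_process N alpha chi P eta ->
  pr P [set o | ~ good N alpha chi M0 M1 (eta o)] <=
  pr P [set o | M0 < conf_entropy chi (path_conf N chi (eta o) (time0 tf))] +
  expR (N%:R ^+ d / chi * (C - c * M1)).
Proof.
move=> M00; have [c c0 [C gP]] := generator_bound M (M0 + expR 1) d0 alpha1.
exists c => //; exists (tf%:num * (`|C| + 1) + alpha / 2 * M0) => N chi eta M1 N0 chi0 NM zrp.
have ceta := config_path_zrp zrp.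
have Nd : 0 < N%:R ^+ d :> R by rewrite exprn_gt0// ltr0n.
have lam0 : 0 < N%:R ^+ d / chi by rewrite divr_gt0.
(* The number of particles allowed by the mass [M0 + expR 1], which bounds the mass when the entropy
   is at most [M0]. *)
pose K := Num.truncn (N%:R ^+ d / chi * (M0 + expR 1)).
have M0e : 0 <= M0 + expR 1 by rewrite addr_ge0 ?expR_ge0.
have KE (b : config d N) : (total b <= K)%N = (conf_mass chi b <= M0 + expR 1).
  rewrite /K truncn_ge_nat; last by rewrite mulr_ge0 ?(ltW lam0).
  rewrite conf_mass_total.
  rewrite ler_pdivrMr// [chi * _]mulrC -ler_pdivlMr// mulrAC; congr (_ <= _).
  by congr (_ / _); exact: mulrC.
have HK (b : config d N) : conf_entropy chi b <= M0 -> (total b <= K)%N.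
  by move=> bM; rewrite KE (le_trans (conf_entropy_mass _ N0 chi0))// lerD2r.
have HG (b : config d N) : (total b <= K)%N -> zr_generator alpha chi (ent_weight alpha chi) b <=
    ent_weight alpha chi b * (N%:R ^+ d / chi * (`|C| - c * conf_energy alpha chi b)).
  rewrite KE => bK; apply: (le_trans (gP N chi b N0 chi0 NM bK)).
  by rewrite ler_wpM2l ?expR_ge0// ler_wpM2l ?(ltW lam0)// lerD2r ler_norm.
set B := expR _; pose X0 o := path_conf N chi (eta o) (time0 tf).
pose C0 := [set o | conf_entropy chi (X0 o) <= M0].
pose F m := C0 `&` [set o | forall n, (m < n)%N -> ~ good_grid N alpha chi M1 n (eta o)].
have mX0 b : measurable (X0 @^-1` [set b]).
  apply: (rel_measurable_preimage ceta (A := [set u | path_conf N chi u (time0 tf) = b])).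
  exact: eval_measurable.
have mC0 : measurable C0.
  exact: (measurable_countable_preimage mX0 [set b | conf_entropy chi b <= M0]).
have mgg n : measurable [set o | good_grid N alpha chi M1 n (eta o)].
  exact: (rel_measurable_preimage ceta (good_grid_measurable alpha tf delta N0 chi0 M1 n)).
have mF m : measurable (F m).
  apply: measurableI => //.
  rewrite (_ : mkset _ = \bigcap_(n in [set n | (m < n)%N]) ~` [set o | good_grid N alpha chi M1 n (eta o)]).
    by apply: bigcap_measurable => [|n _]; [exists m.+1 => /=|exact: measurableC].
  by apply/seteqP; split => o H n mn; exact: H.
have prF m : pr P (F m) <= B.
  apply/ler_addgt0Pl => e e0.
  have [n _ nP] := good_grid_probability N0 chi0 alpha1 zrp M1 (normr_ge0 C) c0 e0 HK HG.
  have := nP (maxn n m.+1) (leq_maxl _ _); apply: le_trans.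
  have mE : measurable (C0 `&` ~` [set o | good_grid N alpha chi M1 (maxn n m.+1) (eta o)]).
    by apply: measurableI => //; exact: measurableC.
  by apply: le_pr => // o [h1 h2]; split => //; apply: h2; exact: leq_maxr.
have Fcvg : (P \o F) n @[n --> \oo] --> P (\bigcup_n F n).
  apply: nondecreasing_cvg_mu => //; first exact: bigcupT_measurable.
  apply/nondecreasing_seqP => m; apply/subsetPset => o [h1 h2]; split => // n mn.
  by apply: h2; exact: ltnW.
have mUF : measurable (\bigcup_n F n) by exact: bigcupT_measurable.
have prU : pr P (\bigcup_n F n) <= B.
  rewrite -lee_fin -pr_fin// -(cvg_lim _ Fcvg)//; apply: lime_le.
    by apply/cvg_ex; eexists; exact: Fcvg.
  by apply: nearW => m /=; rewrite pr_fin// lee_fin.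
have mg : measurable [set o | ~ good N alpha chi M0 M1 (eta o)].
  by apply: measurableC; exact: (rel_measurable_preimage ceta (good_measurable alpha tf delta N0 chi0 M0 M1)).
pose C1 := [set o | M0 < conf_entropy chi (X0 o)].
have mC1 : measurable C1.
  exact: (measurable_countable_preimage mX0 [set b | M0 < conf_entropy chi b]).
have mC (b : bool) : measurable (if b then C1 else \bigcup_n F n) by case: b.
have := @pr_le_sum _ _ _ P bool predT _ (fun b : bool => if b then C1 else \bigcup_n F n) mg mC.
rewrite big_bool/= => H; apply: (le_trans (H _)); last by rewrite lerD.
move=> o /= ng; have [h|h] := leP (conf_entropy chi (X0 o)) M0; last by exists true.
exists false => //; apply: contrapT => nF; apply: ng; split => // m.
apply: contrapT => ne; apply: nF; exists m => //; split => // n mn gn.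
by apply: ne; exists n.
Qed.

Lemma entropy_config N (chi : R) (a : config d N) (u : L1nn R d) : (0 < N)%N -> 0 < chi ->
  is_config chi a u -> entropy u = (conf_entropy chi a)%:E.
Proof.
move=> N0 chi0 au; rewrite /entropy.
have E : (\int[torus_measure R d]_y (ent (chi * (a (boxidx N0 y))%:R))%:E = (conf_entropy chi a)%:E)%E.
  apply: (@ge0_integral_boxidx _ _ _ N0 (fun p => ent (chi * (a p)%:R))) => p.
  by rewrite ent_ge0// mulr_ge0// ltW.
rewrite -E; apply: ae_eq_integral => //.
- have mu_ := L1nn_measurable u.
  apply/measurable_EFinP; apply: measurable_funD => //; apply: measurable_funB => //.
  by apply: measurable_funM => //; apply: measurableT_comp => //; exact: measurable_ln.
- apply/measurable_EFinP.
  by apply: (measurable_countable_comp (measurable_boxidx N0) (fun p => ent (chi * (a p)%:R))).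
- by move: au; apply: filterS => y /= /(_ I) ->; rewrite (config_funE N0).
Qed.

(** Exponential Chebyshev inequality. Rewriting the entropy through the configuration at time 0
    makes the integrand a function on a countable set, hence measurable. *)
Lemma entropy_tail N (chi : R) (eta : {mfun Omega >-> skorokhod_space tf delta}) (g M0 : R) :
  (0 < N)%N -> 0 < chi -> zero_range_process N alpha chi P eta -> 0 <= g ->
  ((expR (g * M0) * pr P [set o | (M0 < conf_entropy chi (path_conf N chi (eta o) (time0 tf)))%R])%:E <=
   \int[P]_o expeR (g%:E * entropy ((eta o : cadlag_path tf delta) (time0 tf))))%E.
Proof.
move=> N0 chi0 zrp g0; have ceta := config_path_zrp zrp.
pose X0 o := path_conf N chi (eta o) (time0 tf).
have mX0 b : measurable (X0 @^-1` [set b]).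
  apply: (rel_measurable_preimage ceta (A := [set u | path_conf N chi u (time0 tf) = b])).
  exact: eval_measurable.
have -> : (\int[P]_o expeR (g%:E * entropy ((eta o : cadlag_path tf delta) (time0 tf))) =
    \int[P]_o (expR (g * conf_entropy chi (X0 o)))%:E)%E.
  apply: eq_integral => o _.
  by rewrite (entropy_config N0 chi0 (path_confP N0 chi0 _ (ceta o))) -EFinM/=.
set A := [set o | _]; have mA : measurable A.
  exact: (measurable_countable_preimage mX0 [set b | M0 < conf_entropy chi b]).
have -> : ((expR (g * M0) * pr P A)%:E = \int[P]_o (expR (g * M0) * \1_A o)%:E)%E.
  rewrite EFinM -pr_fin// -[in LHS](setIT A) -integral_indic//.
  by rewrite -ge0_integralZl//= ?lee_fin ?expR_ge0//; apply/measurable_EFinP.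
apply: ge0_le_integral => //.
- by apply/measurable_EFinP; apply: measurable_funM => //; exact: measurable_indic.
- apply/measurable_EFinP.
  exact: (measurable_countable_comp mX0 (fun b => expR (g * conf_entropy chi b))).
- move=> o _; rewrite lee_fin indicE; case: (boolP (o \in A)) => [|_].
    by rewrite inE/= => h; rewrite mulr1 ler_expR ler_wpM2l// ltW.
  by rewrite mulr0 expR_ge0.
Qed.

End good_probability.

(** * Subsequences and completeness of L^p *)

Lemma strict_subsequence (Q : nat -> nat -> Prop) :
  (forall n, exists J, forall j, (J <= j)%N -> Q n j) ->
  exists2 k : nat -> nat, {homo k : m n / (m < n)%N} & forall n j, (k n <= j)%N -> Q n j.
Proof.
(* The partial sums of the thresholds plus one increase strictly and dominate each threshold. *)
move=> /choice[J JP]; exists (fun n => \sum_(i < n.+1) (J i).+1)%N.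
  by apply: homo_ltn => [a b c|n]; [exact: ltn_trans|rewrite [ltnRHS]big_ord_recr/= -addSnnS leq_addr].
move=> n j kj; apply: JP; apply: leq_trans kj.
by rewrite big_ord_recr/= (leq_trans (leqnSn _))// leq_addl.
Qed.

Lemma powR_cvg (R : realType) (r b : R) (a : nat -> R) : 0 < r -> (forall n, 0 <= a n) -> 0 <= b ->
  a n @[n --> \oo] --> b -> a n `^ r @[n --> \oo] --> b `^ r.
Proof.
move=> r0 a0 b0 ab; apply/cvgrPdist_le => e e0.
pose K := (b + 1) `^ r + b `^ r.
have K0 : 0 < K by rewrite ltr_pwDl ?powR_ge0// powR_gt0// ltr_wpDl.
have [C C0 CP] := powR_dist_interp r0 ltr01 r0 (divr_gt0 (divr_gt0 e0 (ltr0Sn R 1)) K0).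
pose s := (e / 2 / (C + 1)) `^ r^-1.
have C1 : 0 < C + 1 by rewrite ltr_wpDl.
have s0 : 0 < s by rewrite powR_gt0// divr_gt0// divr_gt0.
near=> n; have an1 : `|b - a n| <= 1 by near: n; move/cvgrPdist_le : ab; exact.
have ans : `|b - a n| <= s by near: n; move/cvgrPdist_le : ab; exact.
have := CP b (a n) b0 (a0 n); rewrite !divff ?gt_eqF// powRr1// !powRr1// divr1.
move=> /le_trans; apply; rewrite [leRHS]splitr lerD//.
  rewrite -[leRHS](@divfK _ K) ?gt_eqF// ler_wpM2l ?divr_ge0 ?(ltW e0) ?(ltW K0)//.
  rewrite addrC lerD2r ge0_ler_powR ?nnegrE ?(ltW r0) ?addr_ge0//.
  by move: an1; rewrite ler_norml; lra.
apply: (@le_trans _ _ (C * s `^ r)).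
  by rewrite ler_wpM2l// ge0_ler_powR ?nnegrE ?(ltW r0) ?(ltW s0).
rewrite -powRrM mulVf ?gt_eqF// powRr1 ?divr_ge0 ?(ltW e0) ?(ltW C1)//.
by rewrite mulrA ler_pdivrMr// mulrC ler_wpM2l ?divr_ge0 ?(ltW e0)// lerDl.
Unshelve. all: by end_near. Qed.

(** Convergence to 0 for nonnegative extended reals; finiteness of the first terms is not
    presupposed. *)
Definition evanescent (R : realType) (u : nat -> \bar R) : Prop :=
  forall e : R, 0 < e -> exists J, forall j, (J <= j)%N -> (u j <= e%:E)%E.

Lemma geometric_steps_cvg (R : realType) (b : nat -> R) (q : R) J : 0 < q -> q < 1 ->
  (forall n, (J <= n)%N -> `|b n.+1 - b n| <= q ^+ n) -> cvgn b.
Proof.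
move=> q0 q1 bq; pose b' n := b (n + J)%N.
have b'q n : `|telescope b' n| <= geometric 1 q n.
  rewrite /telescope/= /b' addSn mul1r (le_trans (bq _ (leq_addl _ _)))//.
  by rewrite exprD ler_piMr ?exprn_ge0 ?(ltW q0)// exprn_ile1// ltW.
have /normed_cvg c1 : cvgn [normed series (telescope b')].
  apply: series_le_cvg b'q _ => [n|n|]; first exact: normr_ge0.
    by rewrite /= mulr_ge0// exprn_ge0// ltW.
  by apply: is_cvg_geometric_series; rewrite gtr0_norm.
have c2 : cvgn b'.
  rewrite (_ : b' = (fun n => b' 0%N + series (telescope b') n)).
    by apply: is_cvgD => //; exact: is_cvg_cst.
  by apply/funext => n; exact: eq_sum_telescope.
by move/cvg_ex : c2 => [l c2]; apply/cvg_ex; exists l; move: c2; rewrite (cvg_shiftn J).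
Qed.

Section integration.
Context d (T : measurableType d) (R : realType) (mu : {measure set T -> \bar R}).

Lemma fatou_le (f : nat -> T -> R) (g : T -> R) (c : \bar R) :
  (forall n, measurable_fun [set: T] (f n)) -> measurable_fun [set: T] g ->
  (forall n x, 0 <= f n x) -> {ae mu, forall x, f n x @[n --> \oo] --> g x} ->
  (\forall n \near \oo, (\int[mu]_x (f n x)%:E <= c)%E) -> (\int[mu]_x (g x)%:E <= c)%E.
Proof.
move=> mf mg f0 fg fc.
have mf' n : measurable_fun [set: T] (fun x => (f n x)%:E) by exact/measurable_EFinP.
have -> : (\int[mu]_x (g x)%:E = \int[mu]_x limn_einf (fun n => (f n x)%:E))%E.
  apply: ae_eq_integral => //; first exact/measurable_EFinP.
    apply: measurableT_comp => //; apply: measurable_fun_limn_esup => n.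
    exact: measurableT_comp.
  apply: filterS fg => x fgx _.
  have : (f n x)%:E @[n --> \oo] --> (g x)%:E by apply/fine_cvgP; split => //; exact: nearW.
  by move/cvg_limn_einf_sup => -[-> _].
apply: le_trans (fatou mu measurableT mf' _) _; first by move=> n x _; rewrite lee_fin.
by apply: le_trans (limn_einf_sup _) _; exact: limn_esup_le.
Qed.

(** Beppo Levi: the sum of the [h n] has finite integral, so it is finite almost everywhere and its
    terms tend to 0. For indicators this is the Borel-Cantelli lemma. *)
Lemma summable_ae (h : nat -> T -> \bar R) :
  (forall n, measurable_fun [set: T] (h n)) -> (forall n x, (0 <= h n x)%E) ->
  (forall n, (\int[mu]_x h n x <= (1 / (2 ^ n.+1)%:R)%:E)%E) ->
  {ae mu, forall x, evanescent (h ^~ x)}.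
Proof.
move=> mh h0 hn; pose S x := (\sum_(0 <= n <oo) h n x)%E.
have S0 x : (0 <= S x)%E by apply: nneseries_ge0 => *.
have mS : measurable_fun [set: T] S.
  by apply: ge0_emeasurable_sum => // n x _ _; exact: h0.
have Sfin : (\int[mu]_x S x < +oo)%E.
  rewrite integral_nneseries//; apply: (@le_lt_trans _ _ (\sum_(0 <= n <oo) (0 + (1 / (2 ^ n.+1)%:R)%:E))%E).
    by apply: lee_nneseries => n *; rewrite ?add0e//; exact: integral_ge0.
  apply: le_lt_trans (@epsilon_trick R (fun=> 0%E) 1 xpredT _ _) _ => //.
  by rewrite eseries0// add0e ltry.
have Sint : mu.-integrable [set: T] S.
  apply/integrableP; split => //; rewrite (eq_integral S)// => x _.
  by rewrite gee0_abs.
apply: filterS (integrable_ae measurableT Sint) => x /(_ I) Sx e e0.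
have Slt : (\sum_(0 <= n <oo | xpredT n) h n x < +oo)%E.
  by move: Sx; rewrite ge0_fin_numE.
have /fine_cvgP[_ /cvgrPdist_le/(_ _ e0)[J1 _ H1]] := nneseries_tail_cvg Slt (fun n _ => h0 n x).
have [Jf _ Hf] : \forall N \near \oo, (\sum_(N <= n <oo) h n x)%E \is a fin_num.
  apply: nearW => N; rewrite ge0_fin_numE ?nneseries_ge0//; apply: le_lt_trans Slt.
  by rewrite (nneseries_split 0 N)//= leeDr// sume_ge0.
exists J1 => j Jj; have := H1 j Jj; rewrite /= sub0r normrN => H.
apply: (@le_trans _ _ (\sum_(j <= n <oo) h n x)%E).
  by rewrite (nneseries_split j 1)// addn1 big_nat1 leeDl// nneseries_ge0.
have fj : (\sum_(j <= n <oo) h n x)%E \is a fin_num.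
  rewrite ge0_fin_numE ?nneseries_ge0//; apply: le_lt_trans Slt.
  by rewrite [leRHS](nneseries_split 0 j)//= leeDr// sume_ge0.
rewrite -(fineK fj) lee_fin (le_trans _ H)// ler_norm//.
Qed.

Lemma evanescent_ae_subsequence (h : nat -> T -> \bar R) :
  (forall n, measurable_fun [set: T] (h n)) -> (forall n x, (0 <= h n x)%E) ->
  evanescent (fun n => \int[mu]_x h n x)%E ->
  exists2 k : nat -> nat, {homo k : m n / (m < n)%N} &
    {ae mu, forall x, evanescent (fun n => h (k n) x)}.
Proof.
move=> mh h0 hn.
have [|k kh kP] := @strict_subsequence (fun n j => (\int[mu]_x h j x <= (1 / (2 ^ n.+1)%:R)%:E)%E).
  by move=> n; apply: hn; rewrite divr_gt0// ltr0n expn_gt0.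
by exists k => //; apply: summable_ae => // n; exact: kP.
Qed.

End integration.

Section Lp_complete.
Context d (T : measurableType d) (R : realType) (mu : {measure set T -> \bar R}).
Variables (r : R) (r0 : 0 < r).
Implicit Types f g : T -> R.

Lemma Lp_triangle (f g h : T -> R) : measurable_fun [set: T] f -> measurable_fun [set: T] g ->
  measurable_fun [set: T] h ->
  (\int[mu]_x (`|f x - h x| `^ r)%:E <= (2 `^ r)%:E *
    (\int[mu]_x (`|f x - g x| `^ r)%:E + \int[mu]_x (`|g x - h x| `^ r)%:E))%E.
Proof.
move=> mf mg mh.
have m f1 f2 : measurable_fun [set: T] f1 -> measurable_fun [set: T] f2 ->
    measurable_fun [set: T] (fun x => (`|f1 x - f2 x| `^ r)%:E).
  by move=> *; exact: measurable_powR_normB.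
have p0 (f1 f2 : T -> R) x : [set: T] x -> (0 <= (`|f1 x - f2 x| `^ r)%:E)%E.
  by rewrite lee_fin powR_ge0.
rewrite -ge0_integralD//; [|exact: m..].
rewrite -ge0_integralZl//; last 2 first.
- by apply: emeasurable_funD; exact: m.
- by move=> x _; rewrite adde_ge0 ?p0.
apply: ge0_le_integral => //; [exact: m| |].
  by apply: measurable_funeM; apply: emeasurable_funD; exact: m.
move=> x _; rewrite -EFinD -EFinM lee_fin.
have -> : f x - h x = (f x - g x) + (g x - h x) by ring.
exact: ler_norm_powRD (ltW r0).
Qed.

(** Riesz-Fischer: a rapidly converging subsequence converges almost everywhere, and Fatou's lemma
    carries the Cauchy property over to the limit. *)
Lemma Lp_complete (f : nat -> T -> R) : (forall n, measurable_fun [set: T] (f n)) ->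
  (forall e : R, 0 < e -> exists J, forall i j, (J <= i)%N -> (J <= j)%N ->
    (\int[mu]_x (`|f i x - f j x| `^ r)%:E <= e%:E)%E) ->
  exists2 w : T -> R, measurable_fun [set: T] w &
    evanescent (fun j => \int[mu]_x (`|f j x - w x| `^ r)%:E)%E.
Proof.
move=> mf cf.
have [|k kh kP] := @strict_subsequence (fun n j => forall i, (j <= i)%N ->
    (\int[mu]_x (`|f i x - f j x| `^ r)%:E <= (1 / (2 ^ n.+1)%:R / (2 ^ n)%:R)%:E)%E).
  move=> n; have [|J JP] := cf (1 / (2 ^ n.+1)%:R / (2 ^ n)%:R).
    by rewrite !divr_gt0// ltr0n expn_gt0.
  by exists J => j Jj i ji; apply: JP => //; exact: leq_trans ji.
have kn n : (n <= k n)%N.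
  by elim: n => // n IHn; apply: (leq_ltn_trans IHn); exact: kh.
(* With the weight 2^n, [summable_ae] bounds the increments of the subsequence eventually by
   2^(-n/r), a summable geometric sequence. *)
pose h n x := ((2 ^ n)%:R * `|f (k n.+1) x - f (k n) x| `^ r)%:E : \bar R.
have mh n : measurable_fun [set: T] (h n).
  by apply/measurable_EFinP; apply: measurable_funM => //; apply/measurable_EFinP;
    exact: measurable_powR_normB.
have h0 n x : (0 <= h n x)%E by rewrite lee_fin mulr_ge0 ?powR_ge0.
have hi n : (\int[mu]_x h n x <= (1 / (2 ^ n.+1)%:R)%:E)%E.
  under eq_integral do rewrite /h EFinM.
  rewrite ge0_integralZl//; last exact: measurable_powR_normB.
  have := kP n (k n) (leqnn _) (k n.+1) (ltnW (kh _ _ (ltnSn n))).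
  move=> /(lee_wpmul2l (_ : 0 <= (2 ^ n)%:R%:E)%E) => /(_ _)/le_trans; apply; first by rewrite lee_fin.
  by rewrite -EFinM mulrC divfK// pnatr_eq0 -lt0n expn_gt0.
pose q : R := (2^-1) `^ r^-1.
have q0 : 0 < q by rewrite powR_gt0.
have q1 : q < 1.
  by rewrite /q -[ltRHS](@pow1R _ r^-1) gt0_ltr_powR ?invr_gt0 ?nnegrE//; lra.
have cvx : {ae mu, forall x, cvgn (fun n => f (k n) x)}.
  apply: filterS (summable_ae mh h0 hi) => x hx; have [J JP] := hx 1 ltr01.
  have aq n : (J <= n)%N -> `|f (k n.+1) x - f (k n) x| <= q ^+ n.
    move=> Jn; have := JP n Jn; rewrite lee_fin => H.
    have qn : q ^+ n = ((2 ^ n)%:R^-1) `^ r^-1.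
      by rewrite /q -powR_mulrn ?powR_ge0// -powRrM mulrC powRrM powR_mulrn// exprVn natrX.
    have -> : `|f (k n.+1) x - f (k n) x| = (`|f (k n.+1) x - f (k n) x| `^ r) `^ r^-1.
      by rewrite -powRrM mulfV ?gt_eqF// powRr1.
    rewrite qn.
    rewrite ge0_ler_powR ?nnegrE ?invr_ge0 ?powR_ge0 ?(ltW r0)//.
    by rewrite -[leRHS]mul1r ler_pdivlMr ?ltr0n ?expn_gt0// mulrC.
  exact: geometric_steps_cvg aq.
(* The limit superior is measurable without restricting to the set of convergence. *)
pose w x := fine (limn_esup (fun n => (f (k n) x)%:E)).
have mw : measurable_fun [set: T] w.
  apply: (@measurableT_comp _ _ _ _ _ _ (@fine R)); first exact: fine_measurable.
  by apply: measurable_fun_limn_esup => n; exact/measurable_EFinP.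
have fw : {ae mu, forall x, f (k n) x @[n --> \oo] --> w x}.
  apply: filterS cvx => x /cvg_ex[l fl]; rewrite (_ : w x = l)//.
  have : (f (k n) x)%:E @[n --> \oo] --> l%:E by apply/fine_cvgP; split => //; exact: nearW.
  by rewrite /w => /cvg_limn_einf_sup -[_ ->].
exists w => // e e0; have [J JP] := cf e e0; exists J => j Jj.
apply: (@fatou_le _ _ _ mu (fun n x => `|f j x - f (k n) x| `^ r) (fun x => `|f j x - w x| `^ r)).
- by move=> n; apply/measurable_EFinP; exact: measurable_powR_normB.
- by apply/measurable_EFinP; exact: measurable_powR_normB.
- by move=> n x; exact: powR_ge0.
- apply: filterS fw => x fx; apply: powR_cvg => //.
  by apply: cvg_norm; apply: cvgB => //; exact: cvg_cst.
- by exists J => // n Jn; apply: JP => //; exact: leq_trans (kn n).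
Qed.

End Lp_complete.

(** * Integration in time and joint measurability *)

Section time_measure.
Variables (R : realType) (tf : {posnum R}).

Lemma time_measure_le (A : set (measurableTypeR R)) :
  measurable A -> (time_measure tf A <= lebesgue_measure A)%E.
Proof.
move=> mA; rewrite /time_measure/= /mrestr; apply: le_measure; rewrite ?inE//.
exact: measurableI.
Qed.

Lemma time_measureT : time_measure tf setT = (tf%:num)%:E.
Proof.
by rewrite /time_measure/= /mrestr setTI lebesgue_measure_itv/= lte_fin gt0 oppr0 adde0.
Qed.

Lemma time_measure_finite : fin_num_fun (time_measure tf).
Proof.
move=> A mA; rewrite ge0_fin_numE ?measure_ge0//.
apply: (@le_lt_trans _ _ (time_measure tf setT)); first by apply: le_measure; rewrite ?inE.
by rewrite time_measureT ltry.
Qed.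

Definition time_fin : {finite_measure set (measurableTypeR R) -> \bar R} :=
  HB.pack_for {finite_measure set (measurableTypeR R) -> \bar R}
   (mrestr (@lebesgue_measure R) (measurable_itv `[0, tf%:num]))
   (@Measure_isFinite.Build _ (measurableTypeR R) R
     (mrestr (@lebesgue_measure R) (measurable_itv `[0, tf%:num])) time_measure_finite).

Lemma time_measure_ae (Q : R -> Prop) : (forall s : R, 0 <= s < tf%:num -> Q s) ->
  {ae time_measure tf, forall s, Q s}.
Proof.
move=> HQ; exists (~` `[0, tf%:num[%classic); split.
- exact: measurableC.
- apply/eqP; rewrite eq_le measure_ge0 andbT /time_measure/= /mrestr.
  apply: (@le_trans _ _ (lebesgue_measure [set tf%:num])); last by rewrite lebesgue_measure_set1.
  apply: le_measure; rewrite ?inE//; first by apply: measurableI => //; exact: measurableC.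
  move=> s [/= h]; rewrite in_itv/= => /andP[s0 sT]; apply/le_anti; rewrite sT leNgt.
  by apply/negP => st; apply: h; rewrite in_itv/= s0 st.
- by move=> s /= nQ; rewrite in_itv/= => /HQ.
Qed.

Lemma spacetime_fubini d (f : measurableTypeR R * torus_point R d -> R) :
  measurable_fun setT f -> (forall z, 0 <= f z) ->
  (\int[spacetime_measure d tf]_z (f z)%:E =
   \int[time_measure tf]_s \int[torus_measure R d]_y (f (s, y))%:E)%E.
Proof.
move=> mf f0; apply: (@fubini_tonelli1 _ _ _ _ _ time_fin (torus_measure R d) (EFin \o f)).
- exact/measurable_EFinP.
- by move=> z; rewrite /= lee_fin.
Qed.

Lemma measurable_slice_integral d (f : measurableTypeR R * torus_point R d -> R) :
  measurable_fun setT f -> (forall z, 0 <= f z) ->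
  measurable_fun setT (fun s => \int[torus_measure R d]_y (f (s, y))%:E)%E.
Proof.
move=> mf f0.
have := @measurable_fun_fubini_tonelli_F _ _ (measurableTypeR R) (torus_point R d) R
  (torus_measure R d) (EFin \o f) => H.
by apply: H; [exact/measurable_EFinP|move=> z; rewrite /= lee_fin].
Qed.

Lemma measurable_slice d (f : measurableTypeR R * torus_point R d -> R) s :
  measurable_fun setT f -> measurable_fun setT (fun y => f (s, y)).
Proof. by move=> mf; exact: measurableT_comp. Qed.

Lemma clamp_lip (x y : R) : x <= y -> val (clamp tf y) - val (clamp tf x) <= y - x.
Proof.
move=> xy; change (Num.min (Num.max 0 y) tf%:num - Num.min (Num.max 0 x) tf%:num <= y - x).
have t0 : 0 <= tf%:num by [].
have [x0|x0] := leP 0 x; have [y0|y0] := leP 0 y; rewrite ?(max_idPl (ltW x0)) ?(max_idPl (ltW y0));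
  have [xt|xt] := leP x tf%:num; have [yt|yt] := leP y tf%:num;
  rewrite ?(min_idPl t0); lra.
Qed.

Lemma grid_right n (t : time tf) : (0 < n)%N -> exists k, [/\ (k <= n)%N,
  val t <= val (grid tf n k), val (grid tf n k) < val t + tf%:num / n%:R &
  (0 < k)%N -> val (grid tf n k.-1) < val t].
Proof.
move=> n0; have nR : 0 < n%:R :> R by rewrite ltr0n.
have tn0 : 0 < tf%:num / n%:R by rewrite divr_gt0.
have ex : exists k, val t <= k%:R * (tf%:num / n%:R).
  by exists n; rewrite mulrC divfK ?gt_eqF//; have /andP[] := time_bounds t.
case: (ex_minnP ex) => k tk kmin.
have kn : (k <= n)%N.
  by apply: kmin; rewrite mulrC divfK ?gt_eqF//; have /andP[] := time_bounds t.
have kpred : (0 < k)%N -> k.-1%:R * (tf%:num / n%:R) < val t.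
  by move=> k0; rewrite ltNge; apply/negP => /kmin; lia.
exists k; split => //.
- by rewrite val_grid.
- rewrite val_grid//; case: k tk kmin kn kpred => [|k] tk kmin kn kpred.
    by rewrite mul0r; have /andP[? _] := time_bounds t; rewrite ltr_wpDl.
  by rewrite -natr1 mulrDl mul1r ltrD2r; exact: kpred.
- by move=> k0; rewrite val_grid ?kpred// (leq_trans (leq_pred _)).
Qed.

End time_measure.

Section random_config_paths.
Variables (R : realType) (d N : nat) (N0 : (0 < N)%N) (chi : R) (chi0 : 0 < chi).
Variables (tf : {posnum R}) (delta : weak_star_metric R d).
Variables (disp : measure_display) (Omega : measurableType disp).
Variables (eta : Omega -> cadlag_path tf delta) (ceta : forall o, config_path N chi (eta o)).
Local Notation X o t := (path_conf N chi (eta o) t).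
Hypothesis mX : forall t a, measurable [set o | X o t = a].

(** The grid times [sn n s] lie strictly to the right of [s] and tend to it, so by right continuity
    and discreteness the configurations there are eventually the one at [s]. For each [n] the event
    is a countable union of rectangles. *)
Lemma measurable_random_conf a :
  measurable [set w : Omega * measurableTypeR R | X w.1 (clamp tf w.2) = a].
Proof.
pose sn n (s : R) : R := (Num.floor (n.+1%:R * s) + 1)%:~R / n.+1%:R.
have snP n s : s < sn n s <= s + n.+1%:R^-1.
  have /andP[f1 f2] := floor_itv (n.+1%:R * s); rewrite /sn.
  rewrite ltr_pdivlMr// mulrC f2/= ler_pdivrMr// mulrDl mulVf ?gt_eqF// intrD.
  by rewrite lerD2r [leRHS]mulrC.
have msn n : measurable [set w : Omega * measurableTypeR R | X w.1 (clamp tf (sn n w.2)) = a].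
  have mf (m : int) : measurable ((fun s : measurableTypeR R => Num.floor (n.+1%:R * s)) @^-1` [set m]).
    by apply: measurable_floor_fiber; exact: measurable_funM.
  rewrite (_ : mkset _ = \bigcup_(m : int) ([set o | X o (clamp tf ((m + 1)%:~R / n.+1%:R)) = a] `*`
      ((fun s : measurableTypeR R => Num.floor (n.+1%:R * s)) @^-1` [set m]))).
    by apply: (countable_bigcupT_measurable (countableP _)) => m; exact: measurableX.
  apply/seteqP; split => -[om s] /=.
    by move=> H; exists (Num.floor (n.+1%:R * s)).
  by move=> [m _ [/= H E]]; rewrite /sn E.
rewrite (_ : mkset _ = \bigcup_m \bigcap_(n in [set n | (m <= n)%N])
    [set w : Omega * measurableTypeR R | X w.1 (clamp tf (sn n w.2)) = a]).
  apply: bigcupT_measurable => m; apply: bigcap_measurable => //; first by exists m => /=.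
have ev o s : exists m, forall n, (m <= n)%N -> X o (clamp tf (sn n s)) = X o (clamp tf s).
  have [h h0 hP] := path_conf_right N0 chi0 (clamp tf s) (ceta o).
  have [m _ mP] := near_infty_natSinv_lt (PosNum h0).
  exists m => n mn; apply: hP; have /andP[s1 s2] := snP n s.
  rewrite clamp_le ?(ltW s1)//=; have := clamp_lip tf (ltW s1); have := mP n mn => /=.
  move: s2; rewrite -lerBlDl => ? ? ?.
  by rewrite -ltrBlDl; apply: le_lt_trans (_ : n.+1%:R^-1 < h) => //; apply: le_trans; eassumption.
apply/seteqP; split => -[om s] /=; have [m mP] := ev om s.
  by move=> sa; exists m => // n mn /=; rewrite mP.
by move=> [m' _ H]; rewrite -(mP (maxn m m')) ?leq_maxl//; apply: H; rewrite /= leq_maxr.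
Qed.

End random_config_paths.

Section config_paths_in_time.
Variables (R : realType) (d N : nat) (N0 : (0 < N)%N) (chi : R) (chi0 : 0 < chi).
Variables (tf : {posnum R}) (delta : weak_star_metric R d).
Local Notation path := (cadlag_path tf delta).
Implicit Types (u : path).
Variables (u : path) (cu : config_path N chi u).
Local Notation X t := (path_conf N chi u t).

Lemma config_path_total : exists K, forall t, (total (X t) <= K)%N.
Proof.
have [|t|B BP] := @locally_bounded_time _ tf (fun t => (total (X t))%:R).
- move=> t; have [h h0 hP] := path_conf_right N0 chi0 t cu.
  by exists h => //; exists (total (X t))%:R => s /hP ->.
- have [h h0 hP] := path_conf_left N0 chi0 t cu; exists h => //.
  have [[s sP]|ns] := pselect (exists s : time tf, val t - h < val s < val t).
    by exists (total (X s))%:R => s' s'P; rewrite (hP _ _ s'P sP).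
  by exists 0 => s sP; exfalso; apply: ns; exists s.
exists (Num.truncn B) => t; have := BP t => tB.
by rewrite truncn_ge_nat// (le_trans _ tB).
Qed.

Lemma measurable_path_conf a : measurable [set s : R | X (clamp tf s) = a].
Proof.
have mX t b : measurable [set _ : measurableTypeR R | X t = b].
  have [E|nE] := pselect (X t = b); first by rewrite (_ : mkset _ = setT)//; apply/seteqP; split.
  by rewrite (_ : mkset _ = set0)//; apply/seteqP; split.
have := measurable_xsection (0 : measurableTypeR R) (measurable_random_conf N0 chi0 (fun=> cu) mX a).
by congr measurable; apply/seteqP; split => s; rewrite /xsection/= inE.
Qed.

Definition path_fun_at (z : measurableTypeR R * torus_point R d) : R :=
  config_fun chi (X (clamp tf z.1)) z.2.

Lemma path_fun_atE s y : path_fun_at (s, y) = chi * (X (clamp tf s) (boxidx N0 y))%:R.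
Proof. by rewrite /path_fun_at (config_funE N0). Qed.

Lemma path_fun_at_ge0 z : 0 <= path_fun_at z.
Proof. by case: z => s y; rewrite path_fun_atE mulr_ge0// ltW. Qed.

Lemma measurable_path_pair k (k0 : (0 < k)%N) (F : config d N -> lattice d k -> R) :
  measurable_fun setT (fun z : measurableTypeR R * torus_point R d =>
    F (X (clamp tf z.1)) (boxidx k0 z.2)).
Proof.
pose g (z : measurableTypeR R * torus_point R d) : config d N * lattice d k :=
  (X (clamp tf z.1), boxidx k0 z.2).
have mg c : measurable (g @^-1` [set c]).
  rewrite (_ : _ @^-1` _ = [set s : R | X (clamp tf s) = c.1] `*` (boxidx k0 @^-1` [set c.2])).
    by apply: measurableX; [exact: measurable_path_conf|exact: measurable_boxidx].
  by case: c => a x; apply/seteqP; split => -[s y] /=; [case|move=> [<- <-]].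
exact: (measurable_countable_comp (C := ({ffun lattice d N -> nat} * lattice d k)%type) mg
  (fun c => F c.1 c.2)).
Qed.

Lemma measurable_path_fun : measurable_fun setT path_fun_at.
Proof.
rewrite (_ : path_fun_at = fun z => chi * (X (clamp tf z.1) (boxidx N0 z.2))%:R).
  exact: (measurable_path_pair N0 (fun a x => chi * (a x)%:R)).
by apply/funext => -[s y]; rewrite path_fun_atE.
Qed.

Lemma path_version : version u path_fun_at.
Proof.
split; first exact: measurable_path_fun.
apply: nearW => s t ts; apply: filterS (path_confP N0 chi0 t cu) => y H yD.
by rewrite (H I) /path_fun_at/= -ts clampK.
Qed.

End config_paths_in_time.

(** * Mass, jumps and energy of a good path *)

Section good_path.
Variables (R : realType) (d N : nat) (N0 : (0 < N)%N) (alpha chi : R) (chi0 : 0 < chi).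
Variables (tf : {posnum R}) (delta : weak_star_metric R d) (u : cadlag_path tf delta).
Variables (cu : config_path N chi u) (M0 M1 : R) (gu : good N alpha chi M0 M1 u).
Local Notation X t := (path_conf N chi u t).

Let good_fine (h : R) m : 0 < h -> exists n, [/\ (m < n)%N, tf%:num / n%:R < h & good_grid N alpha chi M1 n u].
Proof.
move=> h0; have [_ H] := gu.
have [n [mn gn]] := H (maxn m (Num.truncn (tf%:num / h))); exists n; split => //.
  by apply: leq_ltn_trans mn; exact: leq_maxl.
have th : (Num.truncn (tf%:num / h) < n)%N by apply: leq_ltn_trans mn; exact: leq_maxr.
have n0 : 0 < n%:R :> R by rewrite ltr0n (leq_ltn_trans _ th).
rewrite ltr_pdivrMr// mulrC -ltr_pdivrMr//; apply: lt_le_trans (_ : (Num.truncn (tf%:num / h)).+1%:R <= _).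
  by rewrite truncnS_gt.
by rewrite ler_nat.
Qed.

(** Single jumps conserve the total along a good grid, and a grid finer than the interval of
    constancy to the right of [t] has a point in that interval. *)
Lemma good_mass t : conf_mass chi (X t) <= M0 + expR 1.
Proof.
have [h h0 hP] := path_conf_right N0 chi0 t cu.
have [n [n0 nh [J _]]] := good_fine 0 h0.
have [k [kn tk kt _]] := grid_right t n0.
rewrite -(hP (grid tf n k)); last by rewrite tk (lt_trans kt)// ltrD2l.
have E : total (X (grid tf n k)) = total (X (time0 tf)).
  have -> : time0 tf = grid tf n 0 by apply/val_inj; rewrite val_grid// mul0r.
  elim: k kn {tk kt} => // k IHk kn; rewrite (total_adj (J k kn)).
  by apply: IHk; exact: ltnW.
rewrite conf_mass_total E -conf_mass_total.
have [H _] := gu; apply: (le_trans (conf_entropy_mass _ N0 chi0)); by rewrite lerD2r.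
Qed.

(** On a good grid finer than the intervals of constancy on both sides of [t], two consecutive grid
    points carry the left limit and the value at [t]. *)
Lemma good_jump t : exists2 h : R, 0 < h & forall s, val t - h < val s < val t ->
  adj (X s) (X t).
Proof.
have [h2 h20 hP2] := path_conf_right N0 chi0 t cu.
have [h1 h10 hP1] := path_conf_left N0 chi0 t cu; exists h1 => // s sP.
have h0 : 0 < Num.min h1 h2 by rewrite lt_min h10.
have [n [n0 nh [J _]]] := good_fine 0 h0.
move: nh; rewrite lt_min => /andP[nh1 nh2].
have [[|k] [kn tk kt kp]] := grid_right t n0.
  move: tk; rewrite val_grid// mul0r => t0; have := time_bounds s; case/andP: sP => _ st.
  by rewrite leNgt (lt_le_trans st t0).
have tk' : val (grid tf n k) < val t by exact: (kp isT).
rewrite -(hP2 (grid tf n k.+1)); last by rewrite tk (lt_trans kt)// ltrD2l.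
rewrite (hP1 s (grid tf n k) sP); first exact: J.
rewrite tk' andbT; move: tk; rewrite !val_grid ?(ltnW kn)// -natr1 mulrDl mul1r => tk.
by rewrite ltrBlDr (le_lt_trans tk)// ltrD2l.
Qed.

(** Step functions along finer and finer good grids are eventually equal to the energy at each time
    before [tf]; Fatou's lemma concludes. *)
Lemma good_energy :
  (\int[time_measure tf]_s (conf_energy alpha chi (X (clamp tf s)))%:E <= M1%:E)%E.
Proof.
pose D (a : config d N) := conf_energy alpha chi a.
have D0 a : 0 <= D a by exact: dirichlet_ge0.
have /choice[n nP] : forall m, exists n, [/\ (m < n)%N, tf%:num / n%:R < m.+1%:R^-1 &
    good_grid N alpha chi M1 n u].
  by move=> m; apply: good_fine; rewrite invr_gt0.
pose I m k : set R := `[k%:R * (tf%:num / (n m)%:R), k.+1%:R * (tf%:num / (n m)%:R)[%classic.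
(* Values are taken at the right end of each cell, in accordance with right continuity. The last
   cell is dropped, because its right end does not occur in the Riemann sum of [good_grid]. *)
pose f m (s : R) : R := \sum_(0 <= k < (n m).-1) D (X (grid tf (n m) k.+1)) * \1_(I m k) s.
have mI m k : measurable (I m k) by exact: measurable_itv.
have mX : measurable_fun setT (fun s : R => D (X (clamp tf s))).
  apply: (measurable_countable_comp (C := {ffun lattice d N -> nat}) _ D) => a.
  exact: measurable_path_conf.
apply: (@fatou_le _ _ _ (time_measure tf) f) => //.
- move=> m; apply: measurable_sum => k.
  by apply: measurable_funM; [exact: measurable_cst|exact: measurable_indic (mI m k)].
- by move=> m s; apply: sumr_ge0 => k _; rewrite mulr_ge0.
- apply: time_measure_ae => s /andP[s0 sT].
  have sv : val (clamp tf s) = s by rewrite val_clamp// s0 ltW.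
  have [h h0 hP] := path_conf_right N0 chi0 (clamp tf s) cu.
  have h'0 : 0 < Num.min h (tf%:num - s) by rewrite lt_min h0 subr_gt0.
  have [J _ JP] := near_infty_natSinv_lt (PosNum h'0).
  apply: cvg_near_cst; exists J => // m Jm.
  have [mn nm _] := nP m; have n0 : (0 < n m)%N by apply: leq_ltn_trans mn.
  have nh := lt_trans nm (JP m Jm); rewrite /= lt_min in nh; have /andP[nh1 nh2] := nh.
  set e := tf%:num / (n m)%:R in nh1 nh2 *.
  have e0 : 0 < e by rewrite divr_gt0// ltr0n.
  pose k := Num.truncn (s / e).
  have se0 : 0 <= s / e by rewrite divr_ge0// ltW.
  have /andP[k1 k2] := truncn_itv se0; rewrite -/k in k1 k2.
  have ks : k%:R * e <= s by rewrite -ler_pdivlMr.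
  have sk : s < k.+1%:R * e by rewrite -ltr_pdivrMr.
  have ke : k.+1%:R * e <= s + e by rewrite -natr1 mulrDl mul1r lerD2r.
  have kn : (k < (n m).-1)%N.
    have : k.+1%:R * e < (n m)%:R * e.
      apply: (le_lt_trans ke); rewrite /e mulrCA divff ?mulr1 -/e; last by rewrite pnatr_eq0 -lt0n.
      by rewrite -ltrBrDl.
    by rewrite ltr_pM2r// ltr_nat; case: (n m) n0.
  rewrite /f (big_rem k) ?mem_index_iota//= big1_seq ?addr0.
    rewrite indicE mem_set ?mulr1; last by rewrite /I/= in_itv/= ks sk.
    congr (D _); apply: hP; have kn' : (k.+1 <= n m)%N by rewrite (leq_trans kn)// leq_pred.
    by rewrite val_grid// sv (ltW sk)/= (le_lt_trans ke)// ltrD2l.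
  move=> i /andP[_ ki]; rewrite indicE memNset ?mulr0// /I/= in_itv/= -/e => /andP[i1 i2].
  move: ki; rewrite mem_rem_uniq ?iota_uniq// inE => /andP[/eqP ik _]; apply: ik; apply/eqP.
  have : i%:R * e < k.+1%:R * e by exact: le_lt_trans sk.
  have : k%:R * e < i.+1%:R * e by exact: le_lt_trans i2.
  by rewrite !ltr_pM2r// !ltr_nat !ltnS eqn_leq => -> ->.
- apply: nearW => m; have [mn nm [_ S]] := nP m.
  have n0 : (0 < n m)%N by apply: leq_ltn_trans mn.
  apply: (@le_trans _ _ (\sum_(0 <= k < (n m).-1) (D (X (grid tf (n m) k.+1)) * (tf%:num / (n m)%:R))%:E)%E).
    under eq_integral do rewrite /f -sumEFin.
    rewrite ge0_integral_sum//; last 2 first.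
    + move=> k; apply/measurable_EFinP.
      by apply: measurable_funM; [exact: measurable_cst|exact: measurable_indic (mI m k)].
    + by move=> k s _; rewrite lee_fin mulr_ge0.
    apply: lee_sum => k _; under eq_integral do rewrite EFinM.
    rewrite ge0_integralZl; [|exact: measurableT|
      by apply/measurable_EFinP; exact: measurable_indic (mI m k)|
      by move=> s _; rewrite lee_fin|by rewrite lee_fin].
    rewrite [leRHS]EFinM lee_pmul ?lee_fin//; first exact: integral_ge0.
    rewrite integral_indic ?setIT//; last exact: mI.
    apply: (le_trans (time_measure_le tf (mI m k))).
    rewrite lebesgue_measure_itv/= lte_fin ltr_pM2r ?divr_gt0 ?ltr0n// ltr_nat ltnSn.
    by rewrite -EFinB lee_fin -mulrBl -natr1 addrAC subrr add0r mul1r.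
  rewrite sumEFin lee_fin -mulr_suml mulrC; apply: le_trans (ltW S).
  apply: ler_wpM2l; first by rewrite divr_ge0.
  have shift (G : nat -> R) p : (forall k, 0 <= G k) -> (0 < p)%N ->
      \sum_(0 <= k < p.-1) G k.+1 <= \sum_(0 <= k < p) G k.
    by move=> G0; case: p => // p _; rewrite big_nat_recl//= lerDr.
  exact: (shift (fun k => D (X (grid tf (n m) k)))).
Qed.

End good_path.

(** * Versions of paths as functions on space-time *)

Section integral_facts.
Context d (T : measurableType d) (R : realType) (mu : {measure set T -> \bar R}).

Lemma ae_imp (P Q : T -> Prop) : {ae mu, forall x, P x} ->
  (forall x, P x -> Q x) -> {ae mu, forall x, Q x}.
Proof. by move=> + PQ; apply: filterS => x; exact: PQ. Qed.

Lemma ae_imp2 (P1 P2 Q : T -> Prop) : {ae mu, forall x, P1 x} -> {ae mu, forall x, P2 x} ->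
  (forall x, P1 x -> P2 x -> Q x) -> {ae mu, forall x, Q x}.
Proof. by move=> + + PQ; apply: filterS2 => x; exact: PQ. Qed.

Lemma integral_eq0_ae (f : T -> \bar R) : measurable_fun setT f -> (forall x, (0 <= f x)%E) ->
  (\int[mu]_x f x <= 0)%E -> {ae mu, forall x, f x = 0%E}.
Proof.
move=> mf f0 fle; have : (\int[mu]_x `|f x| = 0)%E.
  apply/eqP; rewrite eq_le integral_ge0// andbT (eq_integral f)// => x _.
  by rewrite gee0_abs.
by move=> /(ae_eq_integral_abs mu measurableT mf); apply: filterS => x /(_ I).
Qed.

Lemma ae_integral_eq0 (f : T -> \bar R) : measurable_fun setT f ->
  {ae mu, forall x, f x = 0%E} -> (\int[mu]_x f x = 0)%E.
Proof.
move=> mf f0; rewrite -(integral0 mu setT); apply: ae_eq_integral => //.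
by apply: filterS f0 => x /=.
Qed.

Lemma bounded_convergence (f : nat -> T -> \bar R) (B : R) : (mu setT < +oo)%E ->
  (forall n, measurable_fun setT (f n)) ->
  (forall n x, (0 <= f n x)%E) -> (forall n x, (f n x <= B%:E)%E) ->
  {ae mu, forall x, evanescent (f ^~ x)} -> evanescent (fun n => \int[mu]_x f n x)%E.
Proof.
move=> muT mf f0 fB fc.
have ig : mu.-integrable setT (cst (B%:E)).
  apply/integrableP; split => //=; rewrite integral_cst//.
  by rewrite lte_mul_pinfty// abse_ge0.
have [] := @dominated_convergence _ _ _ mu _ measurableT f (cst 0%E) (cst B%:E) mf _ _ ig.
- exact: measurable_cst.
- apply: filterS fc => x fx _; apply/fine_cvgP; split.
    have [J JP] := fx 1 ltr01; exists J => // n Jn /=.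
    by rewrite ge0_fin_numE// (le_lt_trans (JP n Jn)) ?ltry.
  apply/cvgrPdist_le => e e0; have [J JP] := fx e e0; exists J => // n Jn /=.
  have fn : f n x \is a fin_num by rewrite ge0_fin_numE// (le_lt_trans (JP n Jn)) ?ltry.
  by rewrite sub0r normrN ger0_norm ?fine_ge0// -lee_fin fineK// JP.
- by apply: nearW => x n _; rewrite gee0_abs.
- move=> _ + _; move=> /fine_cvgP[fn /cvgrPdist_le fc0] e e0.
  have [J1 _ H1] := fn; have [J2 _ H2] := fc0 e e0.
  exists (maxn J1 J2) => n; rewrite geq_max => /andP[n1 n2].
  have fk := fineK (H1 n n1 : (\int[mu]_x `|f n x - cst 0 x|)%E \is a fin_num).
  have E : (\int[mu]_x f n x = \int[mu]_x `|f n x - cst 0 x|)%E.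
    by apply: eq_integral => x _; rewrite sube0 gee0_abs.
  have := H2 n n2; rewrite sub0r normrN => H3.
  rewrite E -fk lee_fin; exact: le_trans (ler_norm _) H3.
Qed.

End integral_facts.

Section spacetime.
Variables (R : realType) (d : nat) (tf : {posnum R}).
Local Notation ST := (measurableTypeR R * torus_point R d)%type.
Local Notation nu := (spacetime_measure d tf).
Local Notation mu := (torus_measure R d).
Implicit Types f g : ST -> R.

Lemma spacetime_finite : (nu setT < +oo)%E.
Proof.
have : (\int[nu]_z (cst 1 z : R)%:E = (tf%:num)%:E)%E.
  rewrite spacetime_fubini//.
  rewrite (eq_integral (cst 1%E)) => [|s _].
    by rewrite integral_cst// mul1e time_measureT.
  by apply: eq_trans (integral_cst _ measurableT 1%E) _; rewrite mul1e; exact: probability_setT.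
by rewrite (integral_cst _ measurableT 1%E) mul1e => ->; rewrite ltry.
Qed.

Lemma spacetime_ae (Q : R -> Prop) : {ae time_measure tf, forall s, Q s} ->
  {ae nu, forall z : ST, Q z.1}.
Proof.
move=> [N [mN N0 QN]]; exists (N `*` setT); split.
- by apply: measurableX.
- apply: (eq_trans (@product_measure1E _ _ _ _ R (time_measure tf) mu N setT mN measurableT)).
  by rewrite (N0 : time_measure tf N = 0%E) mul0e.
- by move=> [s y] /= nQ; split => //; exact: QN.
Qed.

(** Tonelli for [|f - g|]: its integral vanishes exactly when almost every slice integral does. *)
Lemma spacetime_ae_eqP f g : measurable_fun setT f -> measurable_fun setT g ->
  (f = g %[ae nu] <->
   {ae time_measure tf, forall s, (fun y => f (s, y)) = (fun y => g (s, y)) %[ae mu]}).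
Proof.
move=> mf mg; pose h z := `|f z - g z|.
have mh : measurable_fun setT h by apply: measurableT_comp => //; exact: measurable_funB.
have h0 z : 0 <= h z by exact: normr_ge0.
have mhs : measurable_fun setT (fun s => \int[mu]_y (h (s, y))%:E)%E.
  exact: measurable_slice_integral.
have ih0 s : (0 <= \int[mu]_y (h (s, y))%:E)%E by apply: integral_ge0 => y _; rewrite lee_fin.
have eqE (x y : R) : `|x - y| = 0 -> x = y.
  by move/eqP; rewrite normr_eq0 subr_eq0 => /eqP.
split=> fg.
  have : (\int[nu]_z (h z)%:E = 0)%E.
    apply: ae_integral_eq0; first exact/measurable_EFinP.
    by apply: filterS fg => z /(_ I); rewrite /h => ->; rewrite subrr normr0.
  rewrite spacetime_fubini// => h00.
  have := @integral_eq0_ae _ _ _ (time_measure tf) _ mhs.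
  rewrite h00 => H; have {}H := H ih0 (lexx _).
  apply: ae_imp H _ => s hs.
  have mslice : measurable_fun setT (fun y => (h (s, y))%:E).
    by apply/measurable_EFinP; exact: measurable_slice.
  have := @integral_eq0_ae _ _ _ mu _ mslice.
  rewrite hs => H; have {}H := H (fun y => h0 _) (lexx _).
  by apply: filterS H => y hy _; apply: eqE; case: hy.
have : (\int[nu]_z (h z)%:E = 0)%E.
  rewrite spacetime_fubini//; apply: ae_integral_eq0 => //.
  apply: ae_imp fg _ => s fgs; apply: ae_integral_eq0.
    by apply/measurable_EFinP; exact: measurable_slice.
  by apply: filterS fgs => y /(_ I); rewrite /h => ->; rewrite subrr normr0.
move=> h00; have := @integral_eq0_ae _ _ _ nu (EFin \o h).
have mh' : measurable_fun setT (EFin \o h) by exact/measurable_EFinP.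
rewrite h00 => H; have {}H := H mh' (fun z => h0 z) (lexx _).
by apply: filterS H => z hz _; apply: eqE; case: hz.
Qed.

Lemma version_unique (u : time tf -> L1nn R d) f g :
  version u f -> version u g -> f = g %[ae nu].
Proof.
move=> [mf uf] [mg ug]; apply/spacetime_ae_eqP => //.
have b : {ae time_measure tf, forall s : R, 0 <= s <= tf%:num}.
  by apply: time_measure_ae => s /andP[-> /ltW].
have ugb := ae_imp2 ug b (fun s => @conj _ _).
apply: ae_imp2 uf ugb _ => s H1 [H2 sb]; pose t : time tf := exist _ s sb.
apply: filterS2 (H1 t erefl) (H2 t erefl) => y E1 E2 yD.
by rewrite E1// E2.
Qed.

Lemma version_ae_eq (u : time tf -> L1nn R d) f g : measurable_fun setT g ->
  version u f -> f = g %[ae nu] -> version u g.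
Proof.
move=> mg [mf uf] /spacetime_ae_eqP fg; split => //.
apply: ae_imp2 uf (fg mf mg) _ => s H1 H2 t ts.
by apply: filterS2 (H1 t ts) H2 => y <-// E yD; rewrite E.
Qed.

Section Lalpha.
Variables (alpha : R) (alpha1 : 1 < alpha).
Local Notation L := (Lalpha d tf alpha1).

Definition power_dist f g : \bar R := (\int[nu]_z (`|f z - g z| `^ alpha)%:E)%E.

Let a0 : 0 < alpha. Proof. by rewrite (lt_trans _ alpha1). Qed.

Lemma Lalpha_measurable (f : L) : measurable_fun setT (f : ST -> R).
Proof. exact: Lspace_measurable. Qed.

Lemma Lalpha_finite (f : L) : (\int[nu]_z (`|f z| `^ alpha)%:E < +oo)%E.
Proof. exact: (@Lspace_finite _ _ _ nu alpha (Lalpha_subproof alpha1) f). Qed.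

Lemma Lalpha_ex f : measurable_fun setT f -> (\int[nu]_z (`|f z| `^ alpha)%:E < +oo)%E ->
  exists w : L, w = f %[ae nu].
Proof. exact: (@Lspace_ex _ _ _ nu alpha (Lalpha_subproof alpha1)). Qed.

Lemma Lalpha_distE (f g : L) : Lalpha_dist f g = fine (power_dist f g) `^ alpha^-1.
Proof.
rewrite /Lalpha_dist /Lp_dist unlock /=.
have : (0 <= power_dist f g)%E by apply: integral_ge0 => z _; rewrite lee_fin powR_ge0.
rewrite -/(power_dist f g); case: (power_dist f g) => [s _|_|//] /=; first by [].
by rewrite invr_eq0 gt_eqF//= powR0// invr_eq0 gt_eqF.
Qed.

Lemma Lalpha_dist_le (f g : L) (e : R) : 0 <= e ->
  (power_dist f g <= (e `^ alpha)%:E)%E -> Lalpha_dist f g <= e.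
Proof.
move=> e0 fg; have p0 : (0 <= power_dist f g)%E.
  by apply: integral_ge0 => z _; rewrite lee_fin powR_ge0.
rewrite Lalpha_distE -[leRHS](powRr1)// -(@mulfV _ alpha) ?gt_eqF// powRrM.
rewrite ge0_ler_powR ?nnegrE ?powR_ge0 ?fine_ge0 ?invr_ge0 ?(ltW a0)//.
rewrite -lee_fin fineK// ge0_fin_numE//; apply: le_lt_trans fg _; exact: ltry.
Qed.

Lemma power_dist_ae_eq f g f' g' : measurable_fun setT f -> measurable_fun setT g ->
  measurable_fun setT f' -> measurable_fun setT g' ->
  f = f' %[ae nu] -> g = g' %[ae nu] -> power_dist f g = power_dist f' g'.
Proof.
move=> mf mg mf' mg' ff gg; apply: ae_eq_integral => //.
- exact: measurable_powR_normB.
- exact: measurable_powR_normB.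
- by apply: filterS2 ff gg => z E1 E2 zD; rewrite E1// E2.
Qed.

Section config_versions.
Variables (N : nat) (N0 : (0 < N)%N) (chi : R) (chi0 : 0 < chi) (delta : weak_star_metric R d).
Local Notation path := (cadlag_path tf delta).
Local Notation X u t := (path_conf N chi u t).

Lemma config_path_Lalpha (u : path) : config_path N chi u ->
  exists2 f : L, version u f & f = path_fun_at N chi u %[ae nu].
Proof.
move=> cu; have mP := measurable_path_fun N0 chi0 cu.
have [K KP] := config_path_total N0 chi0 cu.
have [|w wP] := @Lalpha_ex (path_fun_at N chi u) mP.
  apply: (@le_lt_trans _ _ (\int[nu]_z ((chi * K%:R) `^ alpha)%:E)%E).
    apply: ge0_le_integral => //.
    - exact: measurable_powR_norm.
    - move=> [s y] _; rewrite lee_fin ge0_ler_powR ?nnegrE ?(ltW a0)//.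
        by rewrite mulr_ge0// ltW.
      rewrite ger0_norm ?path_fun_at_ge0// (path_fun_atE N0) ler_wpM2l ?(ltW chi0)// ler_nat.
      by apply: leq_trans (KP (clamp tf s)); rewrite /total (bigD1 (boxidx N0 y))//= leq_addr.
  rewrite integral_cst//; have := spacetime_finite; rewrite -ge0_fin_numE// => h.
  by rewrite lte_mul_pinfty ?lee_fin ?powR_ge0// -ge0_fin_numE.
exists w => //; apply: version_ae_eq (Lalpha_measurable w) (path_version N0 chi0 cu) _.
by apply: filterS wP => z H zD; rewrite H.
Qed.

(* A jump time has a rational on its left up to which no other jump occurs. *)
Lemma countable_jump_times (u : path) : config_path N chi u ->
  countable [set s : R | 0 <= s <= tf%:num /\ ~ (exists2 h : R, 0 < h &
    forall t : time tf, `|val t - s| < h -> X u t = X u (clamp tf s))].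
Proof.
move=> cu; set J := [set _ | _].
have H s : J s -> exists q : rat, ratr q < s /\
    forall t t' : time tf, ratr q < val t < s -> ratr q < val t' < s -> X u t = X u t'.
  move=> [sb nh]; have [h h0 hP] := path_conf_left N0 chi0 (clamp tf s) cu.
  rewrite val_clamp// in hP.
  have shs : s - h < s by rewrite ltrBlDr ltrDl.
  have [q] := rat_in_itvoo shs.
  rewrite in_itv/= => /andP[q1 q2]; exists q; split => // t t' /andP[t1 t2] /andP[t3 t4].
  by apply: hP; rewrite ?t2 ?t4 andbT; apply: lt_trans q1 _.
have /choice[q qP] : forall s : R, exists q : rat, J s -> ratr q < s /\
    forall t t' : time tf, ratr q < val t < s -> ratr q < val t' < s -> X u t = X u t'.
  by move=> s; have [/H[q qP]|nJ] := pselect (J s); [exists q|exists 0].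
suff qinj : {in J &, injective q}.
  apply/countable_injP; exists (pickle \o q) => s s' sJ s'J /(pcan_inj pickleK).
  exact: qinj.
have jump s s' : J s -> J s' -> q s = q s' -> s < s' -> False.
  move=> Js Js' qq ss'; have [q1 H1] := qP s Js; have [q2 H2] := qP s' Js'.
  rewrite -qq in q2 H2; case: Js => sb nh; apply: nh.
  have m0 : 0 < Num.min (s - ratr (q s)) (s' - s) by rewrite lt_min !subr_gt0 q1.
  exists (Num.min (s - ratr (q s)) (s' - s)) => // t.
  rewrite lt_min !ltr_norml => /andP[/andP[h1 _] /andP[_ h2]].
  apply: H2; last by rewrite val_clamp// q1.
  by apply/andP; split; lra.
move=> s s' /[!inE] sJ s'J qq; have [ss'|ss'|//] := ltgtP s s'.
- by exfalso; exact: jump sJ s'J qq ss'.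
- by exfalso; exact: jump s'J sJ (esym qq) ss'.
Qed.

(* A cadlag path takes finitely many values in the discrete state space, so that
   J1-closeness forces the configurations to agree up to the time change. *)
Lemma uniform_isolated (u : path) : config_path N chi u ->
  exists2 r : R, 0 < r & forall (v : path) lam e, config_path N chi v -> e < r ->
    close_by lam e u v -> forall t, X v (lam t) = X u t.
Proof.
move=> cu; have [K KP] := config_path_total N0 chi0 cu.
have /choice[r rP] : forall f : {ffun lattice d N -> 'I_K.+1}, exists r : R, 0 < r /\ forall (t : time tf) v b,
    X u t = @bounded_conf d N K f -> is_config chi b v -> delta (u t) v < r -> b = X u t.
  move=> f; have [[t tf_]|nt] := pselect (exists t : time tf, X u t = @bounded_conf d N K f); last first.
    by exists 1; split=> // t v b tE; exfalso; apply: nt; exists t.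
  have [r r0 rP] := config_isolated N0 chi0 delta (path_confP N0 chi0 t cu).
  exists r; split => // t' v b t'E bv uv; rewrite t'E -tf_; apply: (rP v) => //.
  rewrite (is_config_inj N0 delta (path_confP N0 chi0 t cu) (_ : is_config chi _ (u t')))//.
  by rewrite tf_ -t'E; exact: path_confP.
exists (\big[Num.min/1]_f r f).
  by elim/big_ind: _ => // [x y x0 y0|f _]; [rewrite lt_min x0|exact: (rP f).1].
move=> v lam e cv er [_ _ H] t.
have [f fE] := bounded_conf_ex (KP t); have [r0 rf] := rP f.
apply: (rf t (v (lam t))) => //; first exact: path_confP.
apply: le_lt_trans (H t) _; apply: lt_le_trans er _.
by rewrite (bigD1 f)//= ge_min lexx.
Qed.

(** Below the isolation radius [v n] is [u] up to a small time change, so at a time that is not a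
    jump time of [u] the two eventually agree. Jump times are countable and the values bounded, so
    bounded convergence applies. *)
Lemma power_dist_cvg (u : path) (v : nat -> path) : config_path N chi u ->
  (forall n, config_path N chi (v n)) -> skorokhod_dist u (v n) @[n --> \oo] --> 0 ->
  evanescent (fun n => power_dist (path_fun_at N chi u) (path_fun_at N chi (v n))).
Proof.
move=> cu cv uv; have [r r0 rP] := uniform_isolated cu.
have [K KP] := config_path_total N0 chi0 cu.
have sk0 (e : R) : 0 < e -> \forall n \near \oo, skorokhod_dist u (v n) < e.
  move=> e0; move/cvgrPdist_lt : uv => /(_ _ e0); apply: filterS => n.
  by rewrite sub0r normrN; apply: le_lt_trans; exact: ler_norm.
have close n (e : R) : 0 < e -> e < r -> skorokhod_dist u (v n) < e -> forall t,
    exists t' : time tf, `|val t' - val t| <= e /\ X (v n) t = X u t'.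
  move=> e0 er /skorokhod_lt[lam cl] t; have Xlam := rP _ _ _ (cv n) er cl.
  have [lamc h1 _] := cl; have [g [_ lamK gK]] := time_change_inv lamc.
  by exists (g t); rewrite -Xlam gK; split => //; have := h1 (g t); rewrite gK distrC.
have r20 : 0 < r / 2 by rewrite divr_gt0.
have r2r : r / 2 < r by lra.
have [J _ JP] := sk0 _ r20.
have pK (w : path) (t : time tf) (y : torus_point R d) : (total (X w t) <= K)%N -> chi * (X w t (boxidx N0 y))%:R <= chi * K%:R.
  move=> wK; rewrite ler_wpM2l ?(ltW chi0)// ler_nat (leq_trans _ wK)//.
  by rewrite /total (bigD1 (boxidx N0 y))//= leq_addr.
have evS (h : nat -> \bar R) : evanescent (fun n => h (n + J)%N) -> evanescent h.
  move=> H e e0; have [J' J'P] := H e e0; exists (J' + J)%N => j jJ.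
  by rewrite -(subnK (leq_trans (leq_addl _ _) jJ)); apply: J'P; rewrite leq_subRL ?(leq_trans (leq_addl _ _) jJ)// addnC.
apply: evS; apply: (bounded_convergence (B := (chi * K%:R) `^ alpha) spacetime_finite).
- move=> n; apply: measurable_powR_norm; apply: measurable_funB; exact: measurable_path_fun.
- by move=> n z; rewrite lee_fin powR_ge0.
- move=> n [s y]; rewrite lee_fin ge0_ler_powR ?nnegrE ?(ltW a0)//.
    by rewrite mulr_ge0// ltW.
  have nJ : skorokhod_dist u (v (n + J)%N) < r / 2 by apply: JP; rewrite /= leq_addl.
  have [t' [_ E]] := close _ _ r20 r2r nJ (clamp tf s).
  have := pK u (clamp tf s) y (KP _); have := pK u t' y (KP _); rewrite -E.
  have := path_fun_at_ge0 N0 chi0 u (s, y).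
  have := path_fun_at_ge0 N0 chi0 (v (n + J)%N) (s, y).
  rewrite !(path_fun_atE N0) => ? ? ? ?; rewrite ler_norml; apply/andP; split; lra.
- pose good_time (s : R) := 0 <= s <= tf%:num /\ exists2 h : R, 0 < h &
    forall t : time tf, `|val t - s| < h -> X u t = X u (clamp tf s).
  have gt : {ae time_measure tf, forall s, good_time s}.
    have b : {ae time_measure tf, forall s : R, 0 <= s <= tf%:num}.
      by apply: time_measure_ae => s /andP[-> /ltW].
    have c : {ae time_measure tf, forall s : R, ~ (0 <= s <= tf%:num /\ ~ exists2 h : R, 0 < h &
      forall t : time tf, `|val t - s| < h -> X u t = X u (clamp tf s))}.
      set A := [set s : R | 0 <= s <= tf%:num /\ ~ exists2 h : R, 0 < h &
        forall t : time tf, `|val t - s| < h -> X u t = X u (clamp tf s)].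
      have cA : countable A by exact: countable_jump_times.
      have mA : measurable (A : set (measurableTypeR R)) by exact: countable_measurable.
      exists A; split => //.
        apply/eqP; rewrite eq_le measure_ge0 andbT.
        apply: le_trans (time_measure_le tf mA) _.
        by rewrite countable_lebesgue_measure0.
      by move=> s /= /contrapT.
    apply: ae_imp2 b c _ => s sb ns; split => //.
    by apply: contrapT => nh; apply: ns.
  apply: ae_imp (spacetime_ae gt) _ => -[s y] /= [sb [h h0 hP]] e e0.
  have m0 : 0 < Num.min (r / 2) (h / 2) by rewrite lt_min r20 divr_gt0.
  have [J' _ J'P] := sk0 _ m0; exists J' => n nJ'.
  have nJ : skorokhod_dist u (v (n + J)%N) < Num.min (r / 2) (h / 2).
    by apply: J'P; rewrite /= (leq_trans nJ')// leq_addr.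
  have mr : Num.min (r / 2) (h / 2) < r by rewrite gt_min r2r.
  have [t' [tt E]] := close _ _ m0 mr nJ (clamp tf s).
  rewrite !(path_fun_atE N0) E (hP t').
    by rewrite subrr normr0 powR0 ?lee_fin ?(ltW e0)// gt_eqF.
  rewrite val_clamp// in tt; apply: le_lt_trans tt _; rewrite gt_min; apply/orP; right; lra.
Qed.

(** For fixed [N] the L^alpha distance is Skorokhod continuous on configuration paths; this makes
    the event in part (i) measurable. *)
Lemma version_rel_open (V : set L) : Lalpha_open V ->
  rel_open N chi [set u : path | exists2 f : L, version u f & V f].
Proof.
move=> oV u cu [f uf Vf]; have [e e0 eP] := oV f Vf.
apply: contrapT => nH.
have /choice[v vP] : forall n, exists v : path, [/\ config_path N chi v,
    skorokhod_dist u v < n.+1%:R^-1 & ~ exists2 g : L, version v g & V g].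
  move=> n; apply: contrapT => nv; apply: nH; exists n.+1%:R^-1; first by rewrite invr_gt0.
  by move=> v cv uv; apply: contrapT => nV; apply: nv; exists v.
have cv n : config_path N chi (v n) by have [] := vP n.
have uv : skorokhod_dist u (v n) @[n --> \oo] --> 0.
  apply/cvgrPdist_le => e' e'0.
  have [m _ mP] := near_infty_natSinv_lt (PosNum e'0); exists m => // n mn.
  rewrite sub0r normrN ger0_norm ?skorokhod_ge0// ltW//.
  by have [_ h _] := vP n; apply: lt_trans h _; exact: mP.
have [n nP] := power_dist_cvg cu cv uv (powR_gt0 alpha (divr_gt0 e0 (ltr0Sn R 1))).
have [g vg gE] := config_path_Lalpha (cv n).
have [_ _] := vP n; apply; exists g => //; apply: eP.
apply: (@le_lt_trans _ _ (e / 2)); last by lra.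
apply: Lalpha_dist_le; first by rewrite divr_ge0// ltW.
have fE : f = path_fun_at N chi u %[ae nu].
  exact: version_unique uf (path_version N0 chi0 cu).
rewrite (power_dist_ae_eq (Lalpha_measurable f) (Lalpha_measurable g)
  (measurable_path_fun N0 chi0 cu) (measurable_path_fun N0 chi0 (cv n)) fE gE).
exact: nP.
Qed.

End config_versions.
End Lalpha.
End spacetime.

(** * Limits of sequences of configuration paths: continuity and averages *)

(** An average at scale [k] is a normalized pairing with a continuous function, hence passes to
    weak-star limits. *)
Lemma smoothing_pairing (R : realType) d N k (N0 : (0 < N)%N) (k0 : (0 < k)%N) (chi : R)
    (a : config d N) (u : L1nn R d) (b : lattice d k) : is_config chi a u ->
  smoothing (fun q => chi * (a q)%:R) b = pairing u (bump R b) / bump_mass R b.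
Proof.
move=> au; rewrite /smoothing (pairing_ae _ (measurable_config_fun N0 chi a) au); congr (_ / _).
have := @Rintegral_partition _ _ R (torus_measure R d) (lattice d N) (@boxidx R d N N0)
  (fun q => chi * (a q)%:R) (fun y => bump R b (row_of_point y)) (measurable_boxidx N0)
  (bump_integrable R b).
move=> H; rewrite (eq_bigr (fun i => chi * (a i)%:R * \int[torus_measure R d]_(x in boxidx N0 @^-1` [set i])
  bump R b (row_of_point x))).
  rewrite -H; apply: eq_Rintegral => y _; by rewrite (config_funE N0) mulrC.
by move=> q _; rewrite /bump_weight box_preimage.
Qed.

Lemma between_ex (R : realType) (a b h : R) : a < b -> 0 < h ->
  exists x, [/\ a < x, b - h < x & x < b].
Proof.
move=> ab h0; exists ((Num.max a (b - h) + b) / 2).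
have a1 : a <= Num.max a (b - h) by rewrite le_max lexx.
have a2 : b - h <= Num.max a (b - h) by rewrite le_max lexx orbT.
have a3 : Num.max a (b - h) < b by rewrite gt_max ab; lra.
by split; lra.
Qed.

Lemma norm_chain (R : realType) (a b c e' eta : R) : `|b - a| < eta / 3 ->
  `|b - c| <= eta / 3 -> `|c - e'| < eta / 3 -> `|a - e'| <= eta.
Proof.
rewrite !ltr_norml !ler_norml => /andP[? ?] /andP[? ?] /andP[? ?].
by apply/andP; split; lra.
Qed.

Section limits.
Variables (R : realType) (d : nat) (tf : {posnum R}) (delta : weak_star_metric R d).
Local Notation path := (cadlag_path tf delta).
Local Notation mu := (torus_measure R d).
Variables (N : nat -> nat) (N0 : forall j, (0 < N j)%N).
Variables (chi : nat -> R) (chi0 : forall j, 0 < chi j).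
Variables (e : nat -> path) (ce : forall j, config_path (N j) (chi j) (e j)).
Local Notation X j t := (path_conf (N j) (chi j) (e j) t).
Hypothesis jumps : forall j (t : time tf), exists2 h : R, 0 < h &
  forall s : time tf, val t - h < val s < val t -> adj (X j s) (X j t).
Hypothesis chi_small : forall r : R, 0 < r -> exists J, forall j, (J <= j)%N -> chi j <= r.
Variables (u : path) (eu : skorokhod_dist (e j) u @[j --> \oo] --> 0).

Lemma eventually_close (r : R) : 0 < r ->
  exists J, forall j, (J <= j)%N -> exists lam, close_by lam r u (e j).
Proof.
move=> r0; have /cvgrPdist_lt/(_ _ r0)[J _ JP] := eu.
exists J => j Jj; apply: skorokhod_lt; have := JP j Jj.
rewrite sub0r normrN skorokhod_sym; apply: le_lt_trans; exact: ler_norm.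
Qed.

(** At the time matched to [t] and just before it, the configurations of [e j] differ by at most one
    jump, which changes a pairing with [phi] by at most 2 B chi. As chi tends to 0, left limit and
    value have the same pairings. *)
Lemma limit_left (t : time tf) l : 0 < val t ->
  (forall r : R, 0 < r -> exists2 h : R, 0 < h &
    forall s : time tf, val t - h < val s < val t -> delta l (u s) < r) -> l = u t.
Proof.
move=> t0 Hl; apply: (pairing_inj delta) => phi.
apply/eqP; rewrite -subr_eq0 -normr_le0; apply/ler_addgt0Pr => eta eta0; rewrite add0r.
have [B B0 phiB] := torus_cont_bounded phi.
have eta3 : 0 < eta / 3 by rewrite divr_gt0.
have [r1 r10 P1] := delta_pairing delta l phi eta3.
have [r2 r20 P2] := delta_pairing delta (u t) phi eta3.
have [h h0 hP] := Hl (r1 / 2) (divr_gt0 r10 (ltr0Sn R 1)).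
have m0 : 0 < Num.min (r1 / 2) (r2 / 2) by rewrite lt_min !divr_gt0.
have [J1 H1] := eventually_close m0.
have [|J2 H2] := @chi_small (eta / 3 / (B * 2)); first by rewrite divr_gt0// mulr_gt0.
pose j := maxn J1 J2.
have [lam [lamc c1 c2]] := H1 j (leq_maxl _ _).
have chij := H2 j (leq_maxr _ _).
have [g [gc lamK gK]] := time_change_inv lamc.
have [_ lami] := lamc; have [_ gi] := gc.
have [y [y0 yh yt]] := between_ex t0 h0.
have tT := time_bounds t.
have s0v : val (clamp tf y) = y.
  by rewrite val_clamp// (ltW y0)/=; case/andP: tT => _; apply: le_trans; exact: ltW.
set s0 := clamp tf y in s0v.
have s0t : val s0 < val t by rewrite s0v.
have [h' h'0 jP] := jumps j (lam t).
have [x [xs xh xt]] := between_ex (lami _ _ s0t) h'0.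
have s'v : val (clamp tf x) = x.
  have /andP[l0 _] := time_bounds (lam s0); have /andP[_ lT] := time_bounds (lam t).
  by rewrite val_clamp// (le_trans l0 (ltW xs)) (le_trans (ltW xt) lT).
set s' := clamp tf x in s'v.
have gs'0 : val s0 < val (g s') by rewrite -(lamK s0); apply: gi; rewrite s'v.
have gs't : val (g s') < val t by rewrite -(lamK t); apply: gi; rewrite s'v.
have ad : adj (X j s') (X j (lam t)) by apply: jP; rewrite s'v xh xt.
have dd := config_fun_dist (N0 j) (chi0 j) phiB (path_confP (N0 j) (chi0 j) s' (ce j))
  (path_confP (N0 j) (chi0 j) (lam t) (ce j)).
have d2 : B * (chi j * (\sum_x `|(X j s' x)%:R - (X j (lam t) x)%:R|) / (N j)%:R ^+ d) <= eta / 3.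
  apply: (@le_trans _ _ (B * (chi j * 2))); last first.
    by rewrite mulrCA -ler_pdivlMr ?mulr_gt0.
  rewrite ler_wpM2l ?(ltW B0)// ler_pdivrMr ?exprn_gt0 ?ltr0n//.
  apply: (@le_trans _ _ (chi j * 2)).
    by rewrite ler_wpM2l ?(ltW (chi0 j))//; exact: adj_dist ad.
  by rewrite ler_peMr ?mulr_ge0 ?(ltW (chi0 j))// exprn_ege1// ler1n.
have D1 : delta l (e j s') < r1.
  have a1 : delta l (u (g s')) < r1 / 2 by apply: hP; rewrite gs't andbT (lt_trans _ gs'0)// s0v.
  have a2 := c2 (g s'); rewrite gK in a2.
  have a3 : Num.min (r1 / 2) (r2 / 2) <= r1 / 2 by rewrite ge_min lexx.
  apply: le_lt_trans (wdist_triangle delta l (u (g s')) (e j s')) _.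
  by rewrite [ltRHS]splitr ltr_leD// (le_trans a2 a3).
have D2 : delta (u t) (e j (lam t)) < r2.
  apply: (le_lt_trans (c2 t)); rewrite gt_min; apply/orP; right.
  by rewrite ltr_pdivrMr// ltr_pMr// ltr1n.
exact: norm_chain (P1 _ D1) (le_trans dd d2) (P2 _ D2).
Qed.

Lemma limit_continuous : continuous_path u.
Proof.
move=> t r r0; have [uR uL] := path_cadlag u.
have [h1 h10 P1] := uR t r r0; have [l Hl] := uL t.
have [h2 h20 P2] := Hl r r0.
exists (Num.min h1 h2); first by rewrite lt_min h10.
move=> s; rewrite lt_min !ltr_norml => /andP[/andP[a1 a2] /andP[a3 a4]].
have [ts|st] := leP (val t) (val s); first by apply: P1; rewrite ts/= -ltrBlDl.
have t0 : 0 < val t by have /andP[s0 _] := time_bounds s; exact: le_lt_trans st.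
by rewrite -(limit_left t0 Hl); apply: P2; rewrite st andbT -ltrBrDl.
Qed.

(** Continuity of the limit undoes the time change, so Skorokhod convergence becomes convergence at
    every time. *)
Lemma limit_pointwise (t : time tf) (r : R) : 0 < r ->
  exists J, forall j, (J <= j)%N -> delta (u t) (e j t) < r.
Proof.
move=> r0; have [h h0 hP] := limit_continuous t (divr_gt0 r0 (ltr0Sn R 1)).
have m0 : 0 < Num.min (h / 2) (r / 2) by rewrite lt_min !divr_gt0.
have [J JP] := eventually_close m0; exists J => j /JP[lam [lamc c1 c2]].
have [g [gc lamK gK]] := time_change_inv lamc.
have a1 : Num.min (h / 2) (r / 2) <= h / 2 by rewrite ge_min lexx.
have a2 : Num.min (h / 2) (r / 2) <= r / 2 by rewrite ge_min lexx orbT.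
have b1 : delta (u t) (u (g t)) < r / 2.
  by apply: hP; have := c1 (g t); rewrite gK distrC => ?; lra.
have b2 := c2 (g t); rewrite gK in b2.
have := wdist_triangle delta (u t) (u (g t)) (e j t); lra.
Qed.

Lemma limit_pairing (t : time tf) phi :
  pairing (e j t) phi @[j --> \oo] --> pairing (u t) phi.
Proof.
apply/cvgrPdist_le => eta eta0.
have [r r0 rP] := delta_pairing delta (u t) phi eta0.
have [J JP] := limit_pointwise t r0; exists J => // j /JP/rP/ltW.
by rewrite distrC.
Qed.

Variables (alpha : R) (alpha1 : 1 < alpha) (m M1 : R).
Hypothesis N_large : forall k, exists J, forall j, (J <= j)%N -> (k <= N j)%N.
Hypothesis mass : forall j t, conf_mass (chi j) (X j t) <= m.
Hypothesis energy : forall j,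
  (\int[time_measure tf]_s (conf_energy alpha (chi j) (X j (clamp tf s)))%:E <= M1%:E)%E.
Local Notation ST := (measurableTypeR R * torus_point R d)%type.
Local Notation nu := (spacetime_measure d tf).
Local Notation F j := (path_fun_at (N j) (chi j) (e j)).
Local Notation pdist := (@power_dist R d tf alpha).

Let a0 : 0 < alpha. Proof. by rewrite (lt_trans _ alpha1). Qed.

Let mass_ge0 j t : 0 <= conf_mass (chi j) (X j t).
Proof. by rewrite divr_ge0 ?exprn_ge0// sumr_ge0// => x _; rewrite mulr_ge0// ltW. Qed.

Let mF j : measurable_fun setT (F j).
Proof. exact: measurable_path_fun. Qed.

Definition smoothed k (k0 : (0 < k)%N) (z : ST) : R :=
  pairing (u (clamp tf z.1)) (bump R (boxidx k0 z.2)) / bump_mass R (boxidx k0 z.2).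

Definition smoothed_at k (k0 : (0 < k)%N) j (z : ST) : R :=
  smoothing (fun q => chi j * (X j (clamp tf z.1) q)%:R) (boxidx k0 z.2).

Lemma smoothed_atE k (k0 : (0 < k)%N) j z : smoothed_at k0 j z =
  pairing (e j (clamp tf z.1)) (bump R (boxidx k0 z.2)) / bump_mass R (boxidx k0 z.2).
Proof.
have aP := path_confP (N0 j) (chi0 j) (clamp tf z.1) (ce j).
exact: (smoothing_pairing (N0 j) k0 _ aP).
Qed.

Lemma smoothed_cvg k (k0 : (0 < k)%N) z : smoothed_at k0 j z @[j --> \oo] --> smoothed k0 z.
Proof.
under eq_fun do rewrite smoothed_atE.
by apply: cvgM; [exact: limit_pairing|exact: cvg_cst].
Qed.

Lemma measurable_smoothed_at k (k0 : (0 < k)%N) j : measurable_fun setT (smoothed_at k0 j).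
Proof.
exact: (measurable_path_pair (N0 j) (chi0 j) (ce j) k0
  (fun a b => smoothing (fun q => chi j * (a q)%:R) b)).
Qed.

Lemma measurable_smoothed k (k0 : (0 < k)%N) : measurable_fun setT (smoothed k0).
Proof.
apply: (@measurable_fun_cvg _ _ _ _ (smoothed_at k0)) => [j|z _].
  exact: measurable_smoothed_at.
exact: smoothed_cvg.
Qed.

(** A bump is at most 1 and its mass at least (2 k)^-d, so averages at scale [k] are bounded by the
    mass, uniformly in [j]. This is the dominating constant at fixed scale. *)
Lemma smoothed_at_bound k (k0 : (0 < k)%N) j z :
  `|smoothed_at k0 j z| <= m * (2 * k%:R) ^+ d.
Proof.
case: z => s y; rewrite smoothed_atE /=; set b := boxidx k0 y.
have aP := path_confP (N0 j) (chi0 j) (clamp tf s) (ce j).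
have b0 := bump_mass_gt0 R k0 b.
have k20 : 0 < (2 * k%:R) ^+ d :> R by rewrite exprn_gt0// mulr_gt0// ltr0n.
have m0 : 0 <= m by apply: le_trans (mass j (clamp tf s)).
rewrite normrM normfV (gtr0_norm b0) ler_pdivrMr//.
have mb : m <= m * (2 * k%:R) ^+ d * bump_mass R b.
  rewrite -mulrA ler_peMr// -ler_pdivrMl// mulr1; exact: bump_mass_ge.
apply: le_trans mb; apply: le_trans (mass j (clamp tf s)).
rewrite (pairing_ae _ (measurable_config_fun (N0 j) (chi j) _) aP).
have ic := config_fun_integrable (N0 j) (chi j) (X j (clamp tf s)).
have c0 y' : 0 <= config_fun (chi j) (X j (clamp tf s)) y' by rewrite (config_funE (N0 j)) mulr_ge0// ltW.
have ibc : integrableR mu (fun y => bump R b (row_of_point y) * config_fun (chi j) (X j (clamp tf s)) y).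
  apply: (@bounded_integrableM _ _ _ _ _ _ 1) => //; first exact: torus_cont_measurable.
  by move=> y'; have /andP[? ?] := bump01 b (row_of_point y'); rewrite ger0_norm.
rewrite ger0_norm; last first.
  by apply: Rintegral_ge0 => y' _; rewrite mulr_ge0//; have /andP[] := bump01 b (row_of_point y').
apply: (@le_trans _ _ (\int[mu]_y config_fun (chi j) (X j (clamp tf s)) y)).
  apply: le_Rintegral => // y' _; rewrite ler_piMl//.
  by have /andP[] := bump01 b (row_of_point y').
have := @ge0_integral_boxidx R d _ (N0 j) (fun p => chi j * (X j (clamp tf s) p)%:R)
  (fun p => mulr_ge0 (ltW (chi0 j)) (ler0n _ _)).
rewrite /Rintegral => H; apply: eq_ler; apply: (etrans (congr1 fine (etrans _ H))) => //.
by apply: eq_integral => y' _; rewrite (config_funE (N0 j)).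
Qed.

End limits.

(** * Strong convergence of the densities *)

Lemma eq_lee (R : realType) (x y : \bar R) : x = y -> (x <= y)%E.
Proof. by move=> ->. Qed.

(** Trivial for x <= eta, while otherwise (x / eta)^(r - 1) is at least 1. On a finite measure it
    bounds L^1 by L^r, in the role of Hoelder's inequality. *)
Lemma le_powR_interp (R : realType) (eta r x : R) : 0 < eta -> 1 <= r -> 0 <= x ->
  x <= eta + eta `^ (1 - r) * x `^ r.
Proof.
move=> eta0 r1 x0; have [xe|ex] := leP x eta.
  by rewrite ler_wpDr// mulr_ge0 ?powR_ge0.
have xp : 0 < x by exact: lt_trans ex.
apply: (@le_trans _ _ (eta `^ (1 - r) * x `^ r)); last by rewrite lerDr ltW.
have -> : x = x `^ (1 - r) * x `^ r.
  by rewrite -powRD ?subrK ?powRr1 ?(ltW xp)//; apply/implyP => _; rewrite gt_eqF.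
rewrite powRM ?powR_ge0// -!powRrM.
have -> : x `^ ((1 - r) * r) * x `^ (r * r) = x `^ r.
  by rewrite -powRD; [congr (_ `^ _); ring|apply/implyP => _; rewrite gt_eqF].
rewrite ler_wpM2r ?powR_ge0//; have [->|rn] := eqVneq r 1; first by rewrite subrr !powRr0.
have q0 : 0 < r - 1 by rewrite subr_gt0 lt_neqAle eq_sym rn.
rewrite -(opprB r 1) !powRN lef_pV2 ?posrE ?powR_gt0//.
by rewrite ge0_ler_powR ?nnegrE ?(ltW q0) ?(ltW eta0) ?(ltW xp)// ltW.
Qed.

Section torus_limits.
Context d (T : measurableType d) (R : realType).
Variable mu : {finite_measure set T -> \bar R}.
Variables (r : R) (r1 : 1 <= r).
Implicit Types f phi : T -> R.

Lemma Lp_integrable f : measurable_fun setT f -> (\int[mu]_x (`|f x| `^ r)%:E < +oo)%E ->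
  integrableR mu f.
Proof.
move=> mf fr; apply/integrableP; split; first exact/measurable_EFinP.
apply: (@le_lt_trans _ _ (\int[mu]_x (1%:E + (`|f x| `^ r)%:E))%E).
  apply: ge0_le_integral => //.
  - by apply: measurableT_comp => //; exact/measurable_EFinP.
  - by apply: emeasurable_funD => //; exact: measurable_powR_norm.
  - move=> x _ /=; rewrite lee_fin; have := le_powR_interp ltr01 r1 (normr_ge0 (f x)).
    by rewrite pow1R mul1r.
rewrite ge0_integralD//; [|exact: measurable_powR_norm].
by rewrite lte_add_pinfty// (integral_cst _ measurableT 1%E) mul1e -ge0_fin_numE// fin_num_measure.
Qed.

Lemma Lp_pairing_cvg (f : nat -> T -> R) g phi B : measurable_fun setT phi ->
  (forall x, `|phi x| <= B) ->
  (forall n, mu.-integrable setT (EFin \o f n)) -> integrableR mu g ->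
  evanescent (fun n => \int[mu]_x (`|f n x - g x| `^ r)%:E)%E ->
  \int[mu]_x (phi x * f n x) @[n --> \oo] --> \int[mu]_x (phi x * g x).
Proof.
move=> mphi phiB fi gi fg; apply/cvgrPdist_le => e e0.
have B0 : 0 <= B by apply: le_trans (phiB point).
have mg : measurable_fun setT g by apply/measurable_EFinP; exact: measurable_int gi.
have mf n : measurable_fun setT (f n) by apply/measurable_EFinP; exact: measurable_int (fi n).
pose M := fine (mu setT); have M0 : 0 <= M by exact: fine_ge0.
have muM : mu setT = M%:E by rewrite fineK// fin_num_measure.
pose eta := e / 2 / ((B + 1) * (M + 1)).
have BM : 0 < (B + 1) * (M + 1) by rewrite mulr_gt0// ltr_wpDl.
have eta0 : 0 < eta by rewrite !divr_gt0.
pose c := eta `^ (1 - r).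
have c0 : 0 < c by exact: powR_gt0.
have [J JP] := fg (e / 2 / ((B + 1) * c)) (divr_gt0 (divr_gt0 e0 (ltr0Sn R 1)) (mulr_gt0 (ltr_wpDl B0 ltr01) c0)).
exists J => // n /JP /= H.
have phifi n' : integrableR mu (fun x => phi x * f n' x).
  exact: bounded_integrableM.
have phigi : integrableR mu (fun x => phi x * g x).
  exact: bounded_integrableM.
rewrite -RintegralB//.
apply: le_trans (le_normr_Rintegral _ _) _ => //; first exact: integrableB_EFin.
have di : integrableR mu (fun x => `|f n x - g x|).
  exact: (integrable_norm (integrableB_EFin (fi n) gi)).
apply: (@le_trans _ _ (\int[mu]_x ((B + 1) * `|f n x - g x|))).
  apply: le_Rintegral => //.
  - exact: (integrable_norm (integrableB_EFin phigi (phifi n))).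
  - exact: integrableZ_EFin.
  - move=> x _; rewrite -mulrBr normrM distrC ler_wpM2r// (le_trans (phiB x))// lerDl//.
rewrite RintegralZl//.
have : (\int[mu]_x `|f n x - g x|%:E <= (eta * M + c * (e / 2 / ((B + 1) * c)))%:E)%E.
  apply: (@le_trans _ _ (\int[mu]_x (eta%:E + c%:E * (`|f n x - g x| `^ r)%:E))%E).
    apply: ge0_le_integral => //.
    - by apply/measurable_EFinP; apply: measurableT_comp => //; exact: measurable_funB.
    - apply: emeasurable_funD => //; apply: measurable_funeM.
      exact: measurable_powR_normB.
    - by move=> x _; rewrite -EFinM -EFinD lee_fin; exact: le_powR_interp.
  have mfg : measurable_fun setT (fun x => (`|f n x - g x| `^ r)%:E).
    exact: measurable_powR_normB.
  rewrite ge0_integralD//; last first.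
  - exact: measurable_funeM.
  - by move=> x _; rewrite mule_ge0 ?lee_fin ?powR_ge0 ?(ltW c0).
  - by move=> x _; rewrite lee_fin ltW.
  have ie : (\int[mu]_x eta%:E = (eta * M)%:E)%E.
    exact: eq_trans (integral_cst _ measurableT eta%:E) (congr1 (mule eta%:E) muM).
  rewrite ie ge0_integralZl//; last by rewrite lee_fin ltW.
  by rewrite EFinD EFinM [X in (_ <= _ + X)%E]EFinM leeD2l// lee_pmul ?lee_fin ?(ltW c0) ?integral_ge0// => x _; rewrite lee_fin powR_ge0.
move=> H2; have : \int[mu]_x `|f n x - g x| <= eta * M + c * (e / 2 / ((B + 1) * c)).
  rewrite -lee_fin /Rintegral fineK// ge0_fin_numE ?(le_lt_trans H2) ?ltry//.
  by apply: integral_ge0 => x _; rewrite lee_fin.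
move=> /(ler_wpM2l (ltW (ltr_wpDl B0 ltr01 : 0 < B + 1))) /le_trans; apply.
rewrite mulrDr; apply: (@le_trans _ _ (e / 2 + e / 2)); last by rewrite -splitr.
apply: lerD.
  rewrite /eta; have -> : (B + 1) * (e / 2 / ((B + 1) * (M + 1)) * M) = e / 2 * (M / (M + 1)).
    by field; rewrite !gt_eqF// ltr_wpDl.
  rewrite ler_piMr ?divr_ge0 ?(ltW e0)// ler_pdivrMr ?ltr_wpDl// mul1r lerDl//.
by apply: eq_ler; field; rewrite !gt_eqF// ltr_wpDl.
Qed.

End torus_limits.

Section limits.
Variables (R : realType) (d : nat) (tf : {posnum R}) (delta : weak_star_metric R d).
Local Notation path := (cadlag_path tf delta).
Local Notation mu := (torus_measure R d).
Variables (N : nat -> nat) (N0 : forall j, (0 < N j)%N).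
Variables (chi : nat -> R) (chi0 : forall j, 0 < chi j).
Variables (e : nat -> path) (ce : forall j, config_path (N j) (chi j) (e j)).
Local Notation X j t := (path_conf (N j) (chi j) (e j) t).
Hypothesis jumps : forall j (t : time tf), exists2 h : R, 0 < h &
  forall s : time tf, val t - h < val s < val t -> adj (X j s) (X j t).
Hypothesis chi_small : forall r : R, 0 < r -> exists J, forall j, (J <= j)%N -> chi j <= r.
Variables (u : path) (eu : skorokhod_dist (e j) u @[j --> \oo] --> 0).
Variables (alpha : R) (alpha1 : 1 < alpha) (m M1 : R).
Hypothesis N_large : forall k, exists J, forall j, (J <= j)%N -> (k <= N j)%N.
Hypothesis mass : forall j t, conf_mass (chi j) (X j t) <= m.
Hypothesis energy : forall j,
  (\int[time_measure tf]_s (conf_energy alpha (chi j) (X j (clamp tf s)))%:E <= M1%:E)%E.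
Local Notation ST := (measurableTypeR R * torus_point R d)%type.
Local Notation nu := (spacetime_measure d tf).
Local Notation F j := (path_fun_at (N j) (chi j) (e j)).
Local Notation D j s := (conf_energy alpha (chi j) (X j (clamp tf s))).
Local Notation pdist := (@power_dist R d tf alpha).
Local Notation Sat k0 j := (smoothed_at N chi e k0 j).

Let a0 : 0 < alpha. Proof. by rewrite (lt_trans _ alpha1). Qed.

Let mF j : measurable_fun setT (F j).
Proof. exact: measurable_path_fun. Qed.

Let D0 j s : 0 <= D j s. Proof. exact: dirichlet_ge0. Qed.

Let mDr j : measurable_fun setT (fun s : measurableTypeR R => D j s).
Proof.
exact: (measurable_countable_comp (measurable_path_conf (N0 j) (chi0 j) (ce j)) (conf_energy alpha (chi j))).
Qed.

Let mD j : measurable_fun setT (fun s : measurableTypeR R => (D j s)%:E).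
Proof. exact/measurable_EFinP. Qed.

Let m0 : 0 <= m.
Proof.
apply: le_trans (mass 0 (time0 tf)).
by rewrite divr_ge0 ?exprn_ge0// sumr_ge0// => x _; rewrite mulr_ge0// ltW.
Qed.

Let M10 : 0 <= M1.
Proof. by rewrite -lee_fin (le_trans _ (energy 0))// integral_ge0// => s _; rewrite lee_fin. Qed.

Lemma slice_power_bound : exists2 K, 0 <= K & forall j s,
  (\sum_p (chi j * (X j (clamp tf s) p)%:R) `^ alpha) / (N j)%:R ^+ d <= K * (D j s + m `^ alpha).
Proof.
have [K K0 KP] := lattice_poincare d alpha1; exists K => // j s.
have r0 p : 0 <= chi j * (X j (clamp tf s) p)%:R by rewrite mulr_ge0// ltW.
apply: (le_trans (KP (N j) _ (N0 j) r0)); rewrite ler_wpM2l// lerD2l.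
rewrite ge0_ler_powR ?nnegrE ?(ltW a0)//; last exact: mass.
by rewrite divr_ge0 ?exprn_ge0// sumr_ge0.
Qed.

Lemma time_integral_affine j (A B : R) : 0 <= A -> 0 <= B ->
  (\int[time_measure tf]_s (A * D j s + B)%:E <= (A * M1 + B * tf%:num)%:E)%E.
Proof.
move=> A0 B0; under eq_integral do rewrite EFinD EFinM.
rewrite ge0_integralD//; last 2 first.
- by move=> s _; rewrite mule_ge0 ?lee_fin.
- exact: measurable_funeM.
rewrite integral_cst// time_measureT ge0_integralZl//; last by move=> s _; rewrite lee_fin.
by rewrite EFinD EFinM leeD// lee_pmul ?lee_fin//; apply: integral_ge0 => s _; rewrite lee_fin.
Qed.

(** [e1] is chosen against the total bound [c] on the alpha-th powers, then [k] against [C * M1],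
    where [C] depends on [e1]; all that is asked of [j] is k <= N j. *)
Lemma smoothed_error (eta : R) : 0 < eta -> exists k (k0 : (0 < k)%N), exists J,
  forall j, (J <= j)%N -> (pdist (F j) (Sat k0 j) <= eta%:E)%E.
Proof.
move=> eta0; have [K K0 KP] := slice_power_bound.
pose c := K * (M1 + m `^ alpha * tf%:num).
have c0 : 0 <= c by rewrite mulr_ge0// addr_ge0// mulr_ge0 ?powR_ge0.
pose e1 := eta / 2 / (c + 1).
have e10 : 0 < e1 by rewrite !divr_gt0// ltr_wpDl.
have [C C0 CP] := @smoothing_error R d alpha e1 alpha1 e10.
pose k := (Num.truncn (2 * (C * M1) / eta)).+1.
have [J JP] := N_large k; exists k, (ltn0Sn _ : (0 < k)%N), J => j Jj.
have kN := JP j Jj.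
have kR : 1 <= k%:R :> R by rewrite ler1n.
have kk : C / k%:R ^+ 2 * M1 <= eta / 2.
  have : 2 * (C * M1) / eta < k%:R by exact: truncnS_gt.
  rewrite ltr_pdivrMr// => h; rewrite mulrAC ler_pdivrMr ?exprn_gt0 ?ltr0n//.
  have : eta / 2 * k%:R <= eta / 2 * k%:R ^+ 2.
    by rewrite ler_wpM2l ?divr_ge0 ?(ltW eta0)// expr2 ler_peMl.
  by apply: le_trans; rewrite mulrAC ler_pdivlMr// mulrC [eta * _]mulrC ltW.
have mS : measurable_fun setT (Sat (ltn0Sn _ : (0 < k)%N) j) by exact: measurable_smoothed_at.
rewrite /power_dist spacetime_fubini; [|by apply/measurable_EFinP; exact: measurable_powR_normB|by move=> z; exact: powR_ge0].
apply: (@le_trans _ _ (\int[time_measure tf]_s ((e1 * K + C / k%:R ^+ 2) * D j s + e1 * K * m `^ alpha)%:E)%E).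
  apply: ge0_le_integral => //.
  - by move=> s _; apply: integral_ge0 => y _; rewrite lee_fin powR_ge0.
  - apply: (@measurable_slice_integral _ _ (fun z => `|F j z - Sat (ltn0Sn _ : (0 < k)%N) j z| `^ alpha)).
      by apply/measurable_EFinP; exact: measurable_powR_normB.
    by move=> z; exact: powR_ge0.
  - apply/measurable_EFinP; apply: measurable_funD => //; apply: measurable_funM => //.
  - move=> s _; have r0 p : 0 <= chi j * (X j (clamp tf s) p)%:R by rewrite mulr_ge0// ltW.
    have := CP k (N j) (ltn0Sn _) (N0 j) (fun p => chi j * (X j (clamp tf s) p)%:R) kN r0.
    under [Z in (Z <= _)%E -> _]eq_integral do rewrite -(path_fun_atE (N0 j)).
    move/le_trans; apply; rewrite lee_fin.
    have := ler_wpM2l (ltW e10) (KP j s); rewrite -/(conf_energy alpha (chi j) _) => h.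
    apply: le_trans (lerD h (lexx _)) _; rewrite -/(root_conf alpha (chi j) (X j (clamp tf s))).
    rewrite -/(conf_energy alpha (chi j) (X j (clamp tf s))).
    by apply: eq_ler; ring.
apply: le_trans (time_integral_affine j _ _) _.
- by rewrite addr_ge0 ?divr_ge0 ?exprn_ge0// mulr_ge0// ltW.
- exact: mulr_ge0 (mulr_ge0 (ltW e10) K0) (powR_ge0 _ _).
rewrite lee_fin (_ : _ + _ = e1 * c + C / k%:R ^+ 2 * M1); last by rewrite /c; ring.
rewrite [leRHS]splitr lerD// /e1 mulrAC ler_pdivrMr ?ltr_wpDl//.
by rewrite ler_wpM2l ?divr_ge0 ?(ltW eta0)// lerDl.
Qed.

Lemma smoothed_evanescent k (k0 : (0 < k)%N) :
  evanescent (fun j => pdist (Sat k0 j) (smoothed u k0)).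
Proof.
have scvg z : Sat k0 j z @[j --> \oo] --> smoothed u k0 z.
  exact: (smoothed_cvg N0 chi0 ce jumps chi_small eu).
have mS j : measurable_fun setT (Sat k0 j) by exact: measurable_smoothed_at.
have mSu : measurable_fun setT (smoothed u k0).
  exact: (measurable_smoothed N0 chi0 ce jumps chi_small eu).
pose B := m * (2 * k%:R) ^+ d.
have SB j z : `|Sat k0 j z| <= B by exact: smoothed_at_bound.
have SuB z : `|smoothed u k0 z| <= B.
  have H : `|Sat k0 j z| @[j --> \oo] --> `|smoothed u k0 z| by exact: cvg_norm (scvg z).
  rewrite -(cvg_lim _ H)//.
  by apply: limr_le; [apply/cvg_ex; eexists; exact: H|exact: nearW].
apply: (bounded_convergence (B := (2 * B) `^ alpha) (spacetime_finite d tf)).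
- by move=> j; exact: measurable_powR_normB.
- by move=> j z; rewrite lee_fin powR_ge0.
- move=> j z; rewrite lee_fin ge0_ler_powR ?nnegrE ?(ltW a0) ?mulr_ge0//.
  by rewrite (le_trans (ler_normB _ _))// mulr_natl mulr2n lerD.
- apply: aeW => z eta eta0; have /cvgrPdist_le H := scvg z.
  have [J _ JP] := H (eta `^ alpha^-1) (powR_gt0 _ eta0); exists J => j Jj.
  rewrite lee_fin -[leRHS](powRr1 (ltW eta0)) -(@mulVf _ alpha) ?gt_eqF// powRrM.
  by rewrite ge0_ler_powR ?nnegrE ?powR_ge0 ?(ltW a0)// distrC; exact: JP.
Qed.

Lemma density_cauchy (eta : R) : 0 < eta -> exists J, forall i j, (J <= i)%N -> (J <= j)%N ->
  (pdist (F i) (F j) <= eta%:E)%E.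
Proof.
move=> eta0; pose c : R := 2 `^ alpha.
have c0 : 0 < c by rewrite powR_gt0.
(* Two quasi-triangle inequalities, each with a factor 2^alpha and two summands. *)
pose t := eta / c / 2 / c / 2.
have t0 : 0 < t by rewrite !divr_gt0.
have [k [k0 [J1 H1]]] := smoothed_error t0.
have [J2 H2] := smoothed_evanescent k0 t0.
have mS j : measurable_fun setT (Sat k0 j) by exact: measurable_smoothed_at.
have mSu : measurable_fun setT (smoothed u k0).
  exact: (measurable_smoothed N0 chi0 ce jumps chi_small eu).
have sym f g : pdist f g = pdist g f by apply: eq_integral => z _; rewrite distrC.
have near j : (maxn J1 J2 <= j)%N -> (pdist (F j) (smoothed u k0) <= (eta / c / 2)%:E)%E.
  rewrite geq_max => /andP[j1 j2].
  apply: le_trans (Lp_triangle nu a0 (mF j) (mS j) mSu) _.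
  apply: (@le_trans _ _ (c%:E * (t%:E + t%:E))%E).
    by apply: lee_wpmul2l; [rewrite lee_fin ltW|apply: leeD; [exact: H1|exact: H2]].
  rewrite -EFinD -EFinM lee_fin; apply: eq_ler; rewrite /t; field; exact: lt0r_neq0.
exists (maxn J1 J2) => i j /near ni /near nj.
apply: le_trans (Lp_triangle nu a0 (mF i) mSu (mF j)) _.
apply: (@le_trans _ _ (c%:E * ((eta / c / 2)%:E + (eta / c / 2)%:E))%E).
  rewrite sym in nj; apply: lee_wpmul2l; first by rewrite lee_fin ltW.
  by apply: leeD; [exact: ni|exact: nj].
rewrite -EFinD -EFinM lee_fin; apply: eq_ler; field; exact: lt0r_neq0.
Qed.

Lemma density_limit : exists w : ST -> R, [/\ measurable_fun setT w,
  (forall z, 0 <= w z), evanescent (fun j => pdist (F j) w) &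
  (\int[nu]_z (`|w z| `^ alpha)%:E < +oo)%E].
Proof.
have [w mw wP] := Lp_complete a0 mF density_cauchy.
(* The positive part is no farther from the nonnegative [F j] than [w] is. *)
pose w' z := Num.max (w z) 0.
have mw' : measurable_fun setT w' by exact: measurable_maxr.
have w'P : evanescent (fun j => pdist (F j) w').
  move=> eta eta0; have [J JP] := wP eta eta0; exists J => j /JP; apply: le_trans.
  apply: ge0_le_integral => //.
  - exact: measurable_powR_normB.
  - exact: measurable_powR_normB.
  - move=> z _; rewrite lee_fin ge0_ler_powR ?nnegrE ?(ltW a0)//.
    have F0 := path_fun_at_ge0 (N0 j) (chi0 j) (e j) z.
    rewrite /w'; have [w0|w0] := leP (w z) 0 => //.
    rewrite subr0 ger0_norm// (le_trans _ (ler_norm _))//; lra.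
exists w'; split => // [z|]; first by rewrite le_max lexx orbT.
have [J JP] := w'P 1 ltr01.
have [f _ fE] := config_path_Lalpha alpha1 (N0 J) (chi0 J) (ce J).
have cst0 : measurable_fun setT (fun _ : ST => 0 : R) by exact: measurable_cst.
have := Lp_triangle nu a0 mw' (mF J) cst0.
have -> : (\int[nu]_z (`|w' z - 0| `^ alpha)%:E = \int[nu]_z (`|w' z| `^ alpha)%:E)%E.
  by apply: eq_integral => z _; rewrite subr0.
move/le_lt_trans; apply; rewrite lte_mul_pinfty ?lee_fin ?powR_ge0//.
rewrite lte_add_pinfty//.
  apply: le_lt_trans (_ : (_ <= 1%:E)%E) (ltry _); apply: le_trans (JP J (leqnn _)).
  by rewrite /power_dist; apply: eq_lee; apply: eq_integral => z _; rewrite distrC.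
have <- : (\int[nu]_z (`|f z| `^ alpha)%:E = \int[nu]_z (`|F J z - 0| `^ alpha)%:E)%E.
  apply: ae_eq_integral => //.
  - by apply: measurable_powR_norm; exact: Lalpha_measurable.
  - exact: measurable_powR_normB.
  - by apply: filterS fE => z H zD; rewrite H// subr0.
exact: Lalpha_finite.
Qed.

Lemma slice_power_finite (w : ST -> R) (r : R) : measurable_fun setT w ->
  (\int[nu]_z (`|w z| `^ r)%:E < +oo)%E ->
  {ae time_measure tf, forall s, (\int[mu]_y (`|w (s, y)| `^ r)%:E < +oo)%E}.
Proof.
move=> mw wfin; have mp : measurable_fun setT (fun z => `|w z| `^ r).
  by apply/measurable_EFinP; exact: measurable_powR_norm.
rewrite spacetime_fubini// in wfin.
have mi : measurable_fun setT (fun s => \int[mu]_y (`|w (s, y)| `^ r)%:E)%E.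
  by apply: (@measurable_slice_integral _ _ (fun z => `|w z| `^ r)) => // z; exact: powR_ge0.
have i0 s : (0 <= \int[mu]_y (`|w (s, y)| `^ r)%:E)%E.
  by apply: integral_ge0 => y _; rewrite lee_fin powR_ge0.
have ii : (time_measure tf).-integrable setT (fun s => \int[mu]_y (`|w (s, y)| `^ r)%:E)%E.
  apply/integrableP; split => //; apply: le_lt_trans wfin; apply: eq_lee.
  by apply: eq_integral => s _; rewrite gee0_abs.
by apply: ae_imp (integrable_ae measurableT ii) _ => s /(_ I); rewrite ge0_fin_numE.
Qed.

(** For almost every time the slices converge in L^alpha along a subsequence, so their pairings tend
    to those of [w]; by [limit_pairing] they also tend to those of [u]. *)
Lemma density_limit_version (w : ST -> R) : measurable_fun setT w -> (forall z, 0 <= w z) ->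
  evanescent (fun j => pdist (F j) w) -> (\int[nu]_z (`|w z| `^ alpha)%:E < +oo)%E ->
  version u w.
Proof.
move=> mw w0 wP wfin; split => //.
pose h j s := (\int[mu]_y (`|F j (s, y) - w (s, y)| `^ alpha)%:E)%E.
have mh j : measurable_fun setT (h j).
  apply: (@measurable_slice_integral _ _ (fun z => `|F j z - w z| `^ alpha)).
    by apply/measurable_EFinP; exact: measurable_powR_normB.
  by move=> z; exact: powR_ge0.
have h0 j s : (0 <= h j s)%E by apply: integral_ge0 => y _; rewrite lee_fin powR_ge0.
have hP : evanescent (fun j => \int[time_measure tf]_s h j s)%E.
  move=> eta eta0; have [J JP] := wP eta eta0; exists J => j /JP; rewrite /power_dist spacetime_fubini//.
  by apply/measurable_EFinP; exact: measurable_powR_normB.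
have [k kh kP] := evanescent_ae_subsequence mh h0 hP.
apply: ae_imp2 kP (slice_power_finite mw wfin) _ => s hs ws t ts.
have mws : measurable_fun setT (fun y => w (s, y)) by exact: measurable_slice.
have iw : integrableR mu (fun y => w (s, y)).
  exact: (Lp_integrable (ltW alpha1) mws ws).
have [v vE] := L1nn_ex iw (fun y => w0 (s, y)).
suff -> : u t = v by apply: filterS vE => y H yD; rewrite H.
apply: (pairing_inj delta) => phi; have [B B0 phiB] := torus_cont_bounded phi.
have kn n : (n <= k n)%N.
  by elim: n => // n IHn; apply: (leq_ltn_trans IHn); exact: kh.
have c1 : pairing (e (k n) t) phi @[n --> \oo] --> pairing (u t) phi.
  apply: (cvg_comp k (fun j => pairing (e j t) phi)); last exact: (limit_pairing N0 chi0 ce jumps chi_small eu).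
  by move=> A [J _ JA]; exists J => // n Jn; apply: JA; exact: leq_trans (kn n).
have Fi j : integrableR mu (fun y => F j (s, y)).
  exact: (config_fun_integrable (N0 j) (chi j) (X j (clamp tf s))).
have phiB' y : `|phi (row_of_point y)| <= B by exact: phiB.
have := Lp_pairing_cvg (ltW alpha1) (torus_cont_measurable phi) phiB' (fun n => Fi (k n)) iw hs.
have -> : (fun n => \int[mu]_x (phi (row_of_point x) * F (k n) (s, x))) =
          (fun n => pairing (e (k n) t) phi).
  apply/funext => n; have aP := path_confP (N0 (k n)) (chi0 (k n)) t (ce (k n)).
  rewrite (pairing_ae phi (measurable_config_fun (N0 _) _ _) aP).
  by apply: eq_Rintegral => y _; rewrite /path_fun_at/= -ts clampK.
move=> c2; rewrite (pairing_ae phi mws vE).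
by rewrite -(cvg_lim _ c1)// -(cvg_lim _ c2).
Qed.

End limits.

(** * Taylor expansion and discrete integration by parts *)

Section directional.
Variables (R : realType) (d : nat).
Local Notation V := 'rV[R]_d.
Implicit Types (phi : V -> R) (x : V).
Local Notation e i := (delta_mx 0 i : V).

Lemma line_derive phi (v x : V) (t : R) : (forall y, derivable phi y v) ->
  is_derive t 1 (fun s : R => phi (x + s *: v)) ('D_v phi (x + t *: v)).
Proof.
move=> dphi.
have E : (fun h : R => h^-1 *: (phi (x + (h *: (1 : R) + t) *: v) - phi (x + t *: v))) =
    (fun h => h^-1 *: (phi (h *: v + (x + t *: v)) - phi (x + t *: v))).
  apply/funext => h /=; congr (_ *: (phi _ - _)).
  by rewrite [h *: 1]mulr1 scalerDl addrCA.
apply: DeriveDef; first by move: (dphi (x + t *: v)); rewrite /derivable/= -E.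
by rewrite /derive/= -E.
Qed.

Lemma line_lip phi (v : V) (B : R) : (forall y, derivable phi y v) ->
  (forall y, `|'D_v phi y| <= B) -> forall x (a b : R), a <= b ->
  exists2 c, a <= c <= b & phi (x + b *: v) - phi (x + a *: v) = 'D_v phi (x + c *: v) * (b - a).
Proof.
move=> dphi DB x a b ab.
have cont : {within `[a, b], continuous (fun s : R => phi (x + s *: v))}.
  apply: derivable_within_continuous => s _.
  by have [] := line_derive x s dphi.
have [c cP E] := @MVT_segment R (fun s => phi (x + s *: v)) (fun s => 'D_v phi (x + s *: v)) a b ab
  (fun s _ => line_derive x s dphi) cont.
by exists c => //; rewrite in_itv/= in cP.
Qed.

(** The mean value theorem, for [phi] and then for its derivative; the factor 1/2 of Taylor's
    formula is given up. *)
Lemma line_taylor phi (v : V) (B : R) : (forall y, derivable phi y v) ->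
  (forall y, derivable ('D_v phi) y v) -> (forall y, `|'D_v phi y| <= B) ->
  (forall y, `|'D_v ('D_v phi) y| <= B) -> forall x (h : R), 0 <= h ->
  `|phi (x - h *: v) - phi x + h * 'D_v phi x| <= B * h ^+ 2.
Proof.
move=> d1 d2 B1 B2 x h h0; have h0' : - h <= 0 by rewrite oppr_le0.
have swap (a b D D0 k : R) : a - b = D * k -> b - a + k * D0 = k * (D0 - D).
  by move=> Eab; rewrite mulrBr [k * D]mulrC -Eab opprB addrC.
have [c /andP[c1 c2] E] := line_lip d1 B1 x h0'.
rewrite scale0r addr0 scaleNr sub0r opprK in E.
have [c' _ E'] := line_lip d2 B2 x c2; rewrite scale0r addr0 sub0r in E'.
have -> : phi (x - h *: v) - phi x + h * 'D_v phi x = h * ('D_v phi x - 'D_v phi (x + c *: v)).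
  exact: swap E.
rewrite E' normrM normrM (ger0_norm h0) normrN expr2 mulrCA.
apply: ler_pM => //; first exact: mulr_ge0.
by rewrite ler_wpM2l// ler0_norm// lerNl.
Qed.

Lemma derive_periodic phi (v : V) : periodic phi -> periodic ('D_v phi).
Proof.
move=> pphi x i; rewrite /derive/=.
suff -> : (fun h : R => h^-1 *: (phi (h *: v + (x + delta_mx 0 i)) - phi (x + delta_mx 0 i))) =
    (fun h => h^-1 *: (phi (h *: v + x) - phi x)) by [].
by apply/funext => h; rewrite addrA !pphi.
Qed.

Lemma smooth_taylor phi i : smooth phi -> periodic phi -> exists2 B : R, 0 < B &
  [/\ forall x, `|phi x| <= B, forall x, `|'D_(e i) phi x| <= B &
      forall x (h : R), 0 <= h ->
        `|phi (x - h *: e i) - phi x + h * 'D_(e i) phi x| <= B * h ^+ 2].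
Proof.
move=> sphi pphi.
have [c0 d0] := sphi [::]; have [c1 d1] := sphi [:: i]; have [c2 _] := sphi [:: i; i].
have p1 := derive_periodic (e i) pphi; have p2 := derive_periodic (e i) p1.
have [B0 B00 H0] := periodic_bounded c0 pphi.
have [B1 B10 H1] := periodic_bounded c1 p1.
have [B2 B20 H2] := periodic_bounded c2 p2.
exists (B0 + B1 + B2); first by rewrite !addr_gt0.
have h0 x : `|phi x| <= B0 + B1 + B2.
  by apply: le_trans (H0 x) _; rewrite -addrA lerDl addr_ge0// ltW.
have h1 x : `|'D_(e i) phi x| <= B0 + B1 + B2.
  by apply: le_trans (H1 x) _; rewrite addrAC lerDr addr_ge0// ltW.
split; [exact: h0|exact: h1|].
apply: (@line_taylor phi (e i) (B0 + B1 + B2) _ _ h1).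
- by move=> y; exact: d0.
- by move=> y; exact: d1.
- by move=> y; apply: le_trans (H2 y) _; rewrite lerDr addr_ge0// ltW.
Qed.

End directional.

Section torus_translation.
Variables (R : realType) (d : nat).
Local Notation mu := (torus_measure R d).
Local Notation point := (torus_point R d).
Implicit Types (f : point -> R) (phi : 'rV[R]_d -> R).
Local Notation e i := (delta_mx 0 i : 'rV[R]_d).

Lemma Rintegral_shift i (t B : R) f : 0 <= t <= 1 -> measurable_fun setT f ->
  (forall y, `|f y| <= B) -> (forall y, f (shift i 1 y) = f y) ->
  \int[mu]_y f (shift i t y) = \int[mu]_y f y.
Proof.
move=> t01 mf fB fp; have fi := bounded_integrable mu mf fB.
have mfs : measurable_fun setT (fun y => f (shift i t y)).
  by apply: measurableT_comp => //; exact: measurable_shift.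
have fsi : integrableR mu (fun y => f (shift i t y)).
  exact: bounded_integrable mfs (fun y => fB _).
have ci : integrableR mu (fun _ : point => B).
  by apply: (@bounded_integrable _ _ _ _ _ `|B|).
suff : \int[mu]_y (f (shift i t y) + B) = \int[mu]_y (f y + B).
  by rewrite !RintegralD// => /addIr.
rewrite /Rintegral; congr fine.
apply: (@torus_shift R d i t (fun y => (f y + B)%:E)) => //.
- by apply/measurable_EFinP; exact: measurable_funD.
- by move=> y; rewrite lee_fin; have := fB y; rewrite ler_norml => /andP[? _]; lra.
- by move=> y; rewrite fp.
Qed.

Lemma row_shift_back (y : point) i (t : R) :
  row_of_point y = row_of_point (shift i t y) - t *: e i.
Proof. by rewrite row_shift addrK. Qed.

(** Translation invariance moves the difference quotient from [V] to [phi]. What remains is the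
    Taylor remainder of [phi] divided by [h], integrated against [|V|]. *)
Lemma discrete_ibp i phi (h BV B : R) (V : point -> R) : 0 < h <= 1 ->
  continuous phi -> periodic phi -> continuous ('D_(e i) phi) ->
  (forall x, `|phi x| <= B) -> (forall x, `|'D_(e i) phi x| <= B) ->
  (forall x (h : R), 0 <= h -> `|phi (x - h *: e i) - phi x + h * 'D_(e i) phi x| <= B * h ^+ 2) ->
  measurable_fun setT V -> (forall y, `|V y| <= BV) -> (forall y, V (shift i 1 y) = V y) ->
  `|\int[mu]_y (V y * 'D_(e i) phi (row_of_point y)) +
    \int[mu]_y (h^-1 * (V (shift i h y) - V y) * phi (row_of_point y))| <=
  B * h * \int[mu]_y `|V y|.
Proof.
move=> /andP[h0 h1] cphi pphi cD phiB DB TB mV VB Vp.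
have mphi : measurable_fun setT (fun y : point => phi (row_of_point y)) by exact: measurable_row_comp.
have mDphi : measurable_fun setT (fun y : point => 'D_(e i) phi (row_of_point y)).
  exact: (@measurable_row_comp R d ('D_(e i) phi)).
have cpsi : continuous (fun x : 'rV[R]_d => phi (x - h *: e i)).
  by move=> x; apply: continuous_comp; [exact: cvgB cvg_id (cvg_cst _)|exact: cphi].
have mpsi : measurable_fun setT (fun y : point => phi (row_of_point y - h *: e i)).
  exact: (@measurable_row_comp R d (fun x => phi (x - h *: e i))).
have mVs : measurable_fun setT (fun y => V (shift i h y)).
  by apply: measurableT_comp => //; exact: measurable_shift.
have int (f g : point -> R) B1 B2 : measurable_fun setT f -> measurable_fun setT g ->
    (forall y, `|f y| <= B1) -> (forall y, `|g y| <= B2) ->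
    integrableR mu (fun y => f y * g y).
  move=> mf mg fB gB; apply: (@bounded_integrable _ _ _ _ _ (B1 * B2)).
    exact: measurable_funM.
  by move=> y; rewrite normrM ler_pM.
have E1 : \int[mu]_y (V (shift i h y) * phi (row_of_point y)) =
    \int[mu]_y (V y * phi (row_of_point y - h *: e i)).
  rewrite -(@Rintegral_shift i h (BV * B) (fun y => V y * phi (row_of_point y - h *: e i))).
  - by apply: eq_Rintegral => y _; rewrite -row_shift_back.
  - by rewrite (ltW h0).
  - exact: measurable_funM.
  - by move=> y; rewrite normrM ler_pM.
  - by move=> y; rewrite Vp row_shift addrAC scale1r pphi.
have E2 : \int[mu]_y (h^-1 * (V (shift i h y) - V y) * phi (row_of_point y)) =
    h^-1 * \int[mu]_y (V y * (phi (row_of_point y - h *: e i) - phi (row_of_point y))).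
  rewrite (eq_Rintegral _ _ (g := fun y => h^-1 *
      (V (shift i h y) * phi (row_of_point y) - V y * phi (row_of_point y)))); last first.
    by move=> y _; ring.
  rewrite RintegralZl//; last by apply: integrableB_EFin; apply: int.
  congr (_ * _); rewrite RintegralB//; [|by apply: int..].
  rewrite E1 -RintegralB//; [|by apply: (int _ _ BV B)..].
  by apply: eq_Rintegral => y _; rewrite mulrBr.
have mdiff : measurable_fun setT (fun y : point => phi (row_of_point y - h *: e i) - phi (row_of_point y)).
  exact: measurable_funB.
have dB (y : point) : `|phi (row_of_point y - h *: e i) - phi (row_of_point y)| <= B + B.
  by apply: le_trans (ler_normB _ _) _; rewrite lerD.
rewrite E2 -(RintegralZl _ measurableT (int _ _ _ _ mV mdiff VB dB)).
rewrite -RintegralD//; last 2 first.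
- exact: int _ _ _ _ mV mDphi VB (fun y => DB _).
- by apply: integrableZ_EFin; exact: int _ _ _ _ mV mdiff VB dB.
have iV : integrableR mu (fun y => `|V y|).
  by apply: (@bounded_integrable _ _ _ _ _ BV) => [|y]; [exact: measurableT_comp|rewrite normr_id].
rewrite -RintegralZl//.
have isum : integrableR mu (fun y => V y * 'D_(e i) phi (row_of_point y) +
    h^-1 * (V y * (phi (row_of_point y - h *: e i) - phi (row_of_point y)))).
  apply: integrableD_EFin; first exact: int _ _ _ _ mV mDphi VB (fun y => DB _).
  by apply: integrableZ_EFin; exact: int _ _ _ _ mV mdiff VB dB.
apply: le_trans (le_normr_Rintegral _ _) _ => //.
apply: le_Rintegral => //; [exact: integrable_norm|exact: integrableZ_EFin|].
move=> y _; set x := row_of_point y.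
have -> : V y * 'D_(e i) phi x + h^-1 * (V y * (phi (x - h *: e i) - phi x)) =
    V y * (h^-1 * (phi (x - h *: e i) - phi x + h * 'D_(e i) phi x)).
  by field; rewrite gt_eqF.
rewrite normrM mulrC ler_wpM2r// normrM normfV (gtr0_norm h0) ler_pdivrMl//.
by apply: le_trans (TB x h (ltW h0)) _; apply: eq_ler; ring.
Qed.

End torus_translation.

(** * Weak gradients by minimization of the energy *)

Lemma norm_powR2 (R : realType) (x : R) : `|x| `^ 2 = x ^+ 2.
Proof. by rewrite -[2]/(2%:R) powR_mulrn// real_normK// num_real. Qed.

Section weak_gradient.
Variables (R : realType) (d : nat) (tf : {posnum R}).
Local Notation ST := (measurableTypeR R * torus_point R d)%type.
Local Notation nu := (spacetime_measure d tf).
Local Notation mu := (torus_measure R d).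
Local Notation e i := (delta_mx 0 i : 'rV[R]_d).
Implicit Types (V W : ST -> R) (G : 'I_d -> ST -> R) (ep : measurableTypeR R -> R).

Definition bounded_mfun V := measurable_fun setT V /\ exists B : R, forall z, `|V z| <= B.

Lemma bounded_mfun_mid V V' : bounded_mfun V -> bounded_mfun V' ->
  bounded_mfun (fun z => (V z + V' z) / 2).
Proof.
move=> [mV [B VB]] [mV' [B' VB']]; split.
  by apply: measurable_funM => //; exact: measurable_funD.
exists (B + B') => z; rewrite normrM normfV (ger0_norm (ler0n _ 2)) ler_pdivrMr//.
apply: le_trans (ler_normD _ _) _; apply: (@le_trans _ _ (B + B')); first exact: lerD.
have : 0 <= B + B' by rewrite addr_ge0 ?(le_trans (normr_ge0 _) (VB z)) ?(le_trans (normr_ge0 _) (VB' z)).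
by move=> BB; rewrite mulr_natr mulr2n lerDl.
Qed.

Definition grad_energy G : \bar R := (\int[nu]_z (\sum_i (G i z) ^+ 2)%:E)%E.

Lemma measurable_grad_energy G : (forall i, measurable_fun setT (G i)) ->
  measurable_fun setT (fun z => (\sum_i (G i z) ^+ 2)%:E).
Proof.
move=> mG; apply/measurable_EFinP; apply: measurable_sum => i.
exact: measurable_funX.
Qed.

Lemma grad_energy_fin G : (forall i, bounded_mfun (G i)) -> grad_energy G \is a fin_num.
Proof.
move=> bG; have mG i : measurable_fun setT (G i) by have [] := bG i.
have /choice[B GB] : forall i, exists B : R, forall z, `|G i z| <= B by move=> i; have [] := bG i.
rewrite ge0_fin_numE; last by apply: integral_ge0 => z _; rewrite lee_fin sumr_ge0// => i _; exact: sqr_ge0.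
apply: (@le_lt_trans _ _ (\int[nu]_z ((\sum_i (B i) ^+ 2)%:E))%E).
  apply: ge0_le_integral => //.
  - by move=> z _; rewrite lee_fin sumr_ge0// => i _; exact: sqr_ge0.
  - exact: measurable_grad_energy.
  - move=> z _; rewrite lee_fin ler_sum// => i _.
    by rewrite -(real_normK (num_real (G i z))) lerXn2r ?nnegrE// (le_trans _ (GB i z)).
rewrite (integral_cst _ measurableT (\sum_i (B i) ^+ 2)%:E).
have := spacetime_finite d tf; rewrite -ge0_fin_numE// => /fineK <-.
by rewrite -EFinM ltry.
Qed.

Lemma grad_parallelogram G G' : (forall i, bounded_mfun (G i)) -> (forall i, bounded_mfun (G' i)) ->
  fine (grad_energy (fun i z => (G i z + G' i z) / 2)) +
  fine (grad_energy (fun i z => (G i z - G' i z) / 2)) =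
  (fine (grad_energy G) + fine (grad_energy G')) / 2.
Proof.
move=> bG bG'.
have mG i : measurable_fun setT (G i) by have [] := bG i.
have mG' i : measurable_fun setT (G' i) by have [] := bG' i.
have bN i : bounded_mfun (fun z => - G' i z).
  have [_ [B GB]] := bG' i; split; first exact: measurableT_comp.
  by exists B => z; rewrite normrN.
have bp i := bounded_mfun_mid (bG i) (bG' i).
have bm i := bounded_mfun_mid (bG i) (bN i).
have mp i : measurable_fun setT (fun z => (G i z + G' i z) / 2) by have [] := bp i.
have mm i : measurable_fun setT (fun z => (G i z - G' i z) / 2) by have [] := bm i.
have p0 H z : setT z -> (0 <= (\sum_i (H i z) ^+ 2)%:E :> \bar R)%E.
  by move=> _; rewrite lee_fin sumr_ge0// => i _; exact: sqr_ge0.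
apply: EFin_inj; rewrite EFinM !EFinD !fineK//; [|exact: grad_energy_fin..].
rewrite /grad_energy -ge0_integralD//; [|exact: p0|exact: measurable_grad_energy
  |exact: p0|exact: measurable_grad_energy].
rewrite -[X in (X * _)%E]ge0_integralD//; [|exact: p0|exact: measurable_grad_energy
  |exact: p0|exact: measurable_grad_energy].
rewrite muleC -ge0_integralZl//; last 2 first.
- by apply: emeasurable_funD; exact: measurable_grad_energy.
- by move=> z _; rewrite adde_ge0//; exact: p0.
apply: eq_integral => z _; rewrite -!EFinD -EFinM; congr (_%:E).
rewrite -!big_split/= mulr_sumr; apply: eq_bigr => i _.
by field.
Qed.

Variable (W : ST -> R).
Hypothesis mW : measurable_fun setT W.
Variable Bd : 'I_d -> ('rV[R]_d -> R) -> R.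

(** [G] is a weak gradient of [V] up to a defect that factors into a constant of the test function
    and a function of time with small integral. All clauses are convex, so midpoints of approximants
    are approximants, as the parallelogram argument requires. *)
Definition approximant (t : R) V G ep : Prop :=
  [/\ bounded_mfun V, forall i, bounded_mfun (G i),
      measurable_fun setT ep /\ (forall s, 0 <= ep s),
      (\int[nu]_z ((V z - W z) ^+ 2)%:E <= t%:E)%E /\
      (\int[time_measure tf]_s (ep s)%:E <= t%:E)%E &
      forall i phi s, smooth phi -> periodic phi ->
        `|\int[mu]_y (V (s, y) * 'D_(e i) phi (row_of_point y)) +
          \int[mu]_y (G i (s, y) * phi (row_of_point y))| <= Bd i phi * ep s].

Lemma approximant_le t t' V G ep : t <= t' -> approximant t V G ep -> approximant t' V G ep.
Proof.
move=> tt [? ? ? [H1 H2] ?]; split => //; split.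
- by apply: le_trans H1 _; rewrite lee_fin.
- by apply: le_trans H2 _; rewrite lee_fin.
Qed.

Lemma slice_integrable V phi s : bounded_mfun V -> continuous phi -> periodic phi ->
  integrableR mu (fun y => V (s, y) * phi (row_of_point y)).
Proof.
move=> [mV [B VB]] cphi pphi; have [C C0 HC] := periodic_bounded cphi pphi.
apply: (@bounded_integrable _ _ _ mu _ (B * C)).
  by apply: measurable_funM; [exact: measurable_slice|exact: measurable_row_comp].
by move=> y; rewrite normrM ler_pM.
Qed.

Lemma approximant_mid t V G ep V' G' ep' : approximant t V G ep -> approximant t V' G' ep' ->
  approximant t (fun z => (V z + V' z) / 2) (fun i z => (G i z + G' i z) / 2)
    (fun s => (ep s + ep' s) / 2).
Proof.
move=> [bV bG [mep ep0] [HV Hep] IB] [bV' bG' [mep' ep0'] [HV' Hep'] IB'].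
have [mV _] := bV; have [mV' _] := bV'.
have mVW (U : ST -> R) : measurable_fun setT U -> measurable_fun setT (fun z => ((U z - W z) ^+ 2)%:E).
  by move=> mU; apply/measurable_EFinP; apply: measurable_funX; exact: measurable_funB.
have halfnorm (a b a' b' k x x' : R) : `|a' + b'| <= k * x' -> `|a + b| <= k * x ->
    `|2^-1 * (a + a') + 2^-1 * (b + b')| <= k * ((x + x') / 2).
  move=> H1 H2; rewrite -mulrDr addrACA normrM ger0_norm// [leRHS]mulrA mulrC.
  rewrite ler_wpM2r// mulrDr.
  by apply: le_trans (ler_normD _ _) _; rewrite lerD.
have half (a b : \bar R) : (a <= t%:E -> b <= t%:E -> 2^-1%:E * (a + b) <= t%:E)%E.
  move=> ta tb; apply: (@le_trans _ _ (2^-1%:E * (t%:E + t%:E)))%E.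
    by rewrite lee_wpmul2l ?lee_fin// leeD.
  by rewrite -EFinD -EFinM lee_fin; lra.
split; [exact: bounded_mfun_mid|by move=> i; exact: bounded_mfun_mid| | |].
- split; first by apply: measurable_funM => //; exact: measurable_funD.
  by move=> s; rewrite divr_ge0// addr_ge0.
- split.
  + apply: le_trans (half _ _ HV HV'); rewrite -ge0_integralD//;
      [|by move=> *; rewrite lee_fin sqr_ge0|exact: mVW|by move=> *; rewrite lee_fin sqr_ge0|exact: mVW].
    rewrite -ge0_integralZl//; last 2 first.
    * by apply: emeasurable_funD; exact: mVW.
    * by move=> z _; rewrite -EFinD lee_fin addr_ge0// sqr_ge0.
    apply: ge0_le_integral => //.
    * by move=> z _; rewrite lee_fin sqr_ge0.
    * by apply: (mVW (fun z => (V z + V' z) / 2)); have [] := bounded_mfun_mid bV bV'.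
    * by apply: measurable_funeM; apply: emeasurable_funD; exact: mVW.
    * move=> z _; rewrite -EFinD -EFinM lee_fin.
      have := sqr_ge0 (V z - V' z); rewrite !expr2; lra.
  + apply: le_trans (half _ _ Hep Hep'); rewrite -ge0_integralD//;
      [|by move=> *; rewrite lee_fin|exact/measurable_EFinP|by move=> *; rewrite lee_fin|exact/measurable_EFinP].
    rewrite -ge0_integralZl//; last 2 first.
    * by apply: emeasurable_funD; exact/measurable_EFinP.
    * by move=> z _; rewrite -EFinD lee_fin addr_ge0.
    by apply: eq_lee; apply: eq_integral => s _; rewrite -EFinD -EFinM mulrC.
- move=> i phi s sphi pphi; have := IB i phi s sphi pphi; have := IB' i phi s sphi pphi.
  have [c0 _] := sphi [::]; have [c1 _] := sphi [:: i].
  have pD := derive_periodic (e i) pphi.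
  have mid U U' psi : bounded_mfun U -> bounded_mfun U' -> continuous psi -> periodic psi ->
      \int[mu]_y ((U (s, y) + U' (s, y)) / 2 * psi (row_of_point y)) =
      2^-1 * (\int[mu]_y (U (s, y) * psi (row_of_point y)) +
              \int[mu]_y (U' (s, y) * psi (row_of_point y))).
    move=> bU bU' cpsi ppsi; rewrite -RintegralD//; [|exact: slice_integrable..].
    rewrite -RintegralZl//; last by apply: integrableD_EFin; exact: slice_integrable.
    by apply: eq_Rintegral => y _; ring.
  rewrite (mid _ _ _ bV bV' c1 pD) (mid _ _ _ (bG i) (bG' i) c0 pphi); exact: halfnorm.
Qed.

Lemma minimizing_cauchy (c : nat -> R) (M eta : R) : {homo c : m n / (m <= n)%N >-> m <= n} ->
  (forall n, c n <= M) -> 0 < eta -> exists J, forall n, (J <= n)%N -> c n <= c J + eta.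
Proof.
move=> ch cM eta0.
have hs : has_sup (range c) by split; [exists (c 0%N), 0%N|exists M => _ [n _ <-]].
have [_ [J _ <-] HJ] := sup_adherent eta0 hs; exists J => n _.
have : c n <= sup (range c) by apply: ub_le_sup; [exact: hs.2|exists n].
by move=> H; apply: le_trans H _; rewrite -lerBlDr ltW.
Qed.

Hypothesis Bd0 : forall i phi, 0 <= Bd i phi.
Variable M1 : R.
Hypothesis approximants : forall t : R, 0 < t -> exists V G ep, approximant t V G ep /\
  (grad_energy G <= M1%:E)%E.

Let inv n : R := n.+1%:R^-1.
Let inv0 n : 0 < inv n. Proof. by rewrite invr_gt0. Qed.
Let inv_le m n : (m <= n)%N -> inv n <= inv m.
Proof. by move=> mn; rewrite lef_pV2 ?posrE// ler_nat. Qed.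

Let E n := [set r : R | exists V G ep, approximant (inv n) V G ep /\ fine (grad_energy G) = r].

Let hinf n : has_inf (E n).
Proof.
split.
  have [V [G [ep [H _]]]] := approximants (inv0 n).
  by exists (fine (grad_energy G)), V, G, ep.
by exists 0 => _ [V [G [ep [_ <-]]]]; apply: fine_ge0; apply: integral_ge0 => z _; rewrite lee_fin sumr_ge0// => i _; exact: sqr_ge0.
Qed.

(* A sequence minimizing the gradient energy among approximants of [W] is
   Cauchy in L^2 by the parallelogram identity. *)
Lemma gradient_minimizers : exists (V : nat -> ST -> R) (G : nat -> 'I_d -> ST -> R)
    (ep : nat -> measurableTypeR R -> R),
  (forall n, approximant (inv n) (V n) (G n) (ep n)) /\
  forall i (eta : R), 0 < eta -> exists J, forall m n, (J <= m)%N -> (J <= n)%N ->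
    (\int[nu]_z (`|G m i z - G n i z| `^ 2)%:E <= eta%:E)%E.
Proof.
have close_sum (qm qn cm cn cJ im jn q q' t : R) : qm <= cm + im -> qn <= cn + jn ->
    cn <= cJ + t / 8 -> cm <= cJ + t / 8 -> jn <= t / 8 -> im <= t / 8 ->
    q' + q = (qm + qn) / 2 -> cJ <= q' -> q <= t / 4 by lra.
(* [c] increases, since the classes of approximants shrink with [inv n], and it is bounded by
   [M1]. *)
pose c n := inf (E n).
have cle n V G ep : approximant (inv n) V G ep -> c n <= fine (grad_energy G).
  by move=> H; apply: ge_inf; [exact: (hinf n).2|exists V, G, ep].
have ch : {homo c : m n / (m <= n)%N >-> m <= n}.
  move=> m n mn; apply: lb_le_inf; first exact: (hinf n).1.
  by move=> _ [V [G [ep [H <-]]]]; apply: cle; exact: approximant_le (inv_le mn) H.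
have cM n : c n <= M1.
  have [V [G [ep [H HG]]]] := approximants (inv0 n); apply: le_trans (cle _ _ _ _ H) _.
  by rewrite -lee_fin fineK//; apply: grad_energy_fin; case: H.
have /choice[z zP] : forall n, exists z : (ST -> R) * ('I_d -> ST -> R) * (measurableTypeR R -> R),
    approximant (inv n) z.1.1 z.1.2 z.2 /\ fine (grad_energy z.1.2) <= c n + inv n.
  move=> n; have [_ [V [G [ep [H <-]]]] HE] := inf_adherent (inv0 n) (hinf n).
  by exists (V, G, ep); split => //; exact: ltW.
exists (fun n => (z n).1.1), (fun n => (z n).1.2), (fun n => (z n).2).
split; first by move=> n; have [] := zP n.
move=> i eta eta0; have eta8 : 0 < eta / 8 by rewrite divr_gt0.
have [J1 HJ1] := minimizing_cauchy ch cM eta8.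
pose J := maxn J1 (Num.truncn (eta / 8)^-1); exists J => m n Jm Jn.
have invJ k : (J <= k)%N -> inv k <= eta / 8.
  move=> Jk; rewrite /inv -[leRHS]invrK lef_pV2 ?posrE ?invr_gt0//.
  apply: ltW; apply: lt_le_trans (truncnS_gt _) _; rewrite ler_nat ltnS.
  by apply: leq_trans Jk; exact: leq_maxr.
have cJ k : (J <= k)%N -> c k <= c J + eta / 8.
  move=> Jk; apply: le_trans (HJ1 _ (leq_trans (leq_maxl _ _) Jk)) _.
  by rewrite lerD2r ch// leq_maxl.
have [Hm qm] := zP m; have [Hn qn] := zP n.
have := cle J _ _ _ (approximant_mid (approximant_le (inv_le Jm) Hm) (approximant_le (inv_le Jn) Hn)).
have bm : forall i, bounded_mfun ((z m).1.2 i) by case: Hm.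
have bn : forall i, bounded_mfun ((z n).1.2 i) by case: Hn.
have := grad_parallelogram bm bn; have := invJ m Jm; have := invJ n Jn.
have := cJ m Jm; have := cJ n Jn; move: qm qn.
set q := fine (grad_energy (fun i z => (_ - _) / 2)).
set q' := fine (grad_energy (fun i z => (_ + _) / 2)).
set qm := fine _; set qn := fine _ => a1 a2 a3 a4 a5 a6 a7 a8.
have qle : q <= eta / 4 by exact: (close_sum _ _ _ _ _ _ _ _ _ _ a1 a2 a3 a4 a5 a6 a7 a8).
have bd k : bounded_mfun (fun w => ((z m).1.2 k w - (z n).1.2 k w) / 2).
  apply: (@bounded_mfun_mid _ (fun w => - (z n).1.2 k w)) => //.
  have [mG [B GB]] := bn k; split; first exact: measurableT_comp.
  by exists B => w; rewrite normrN.
apply: (@le_trans _ _ (4%:E * grad_energy (fun i w => ((z m).1.2 i w - (z n).1.2 i w) / 2)%R)%E).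
  rewrite /grad_energy -ge0_integralZl//; last 2 first.
  - by apply: measurable_grad_energy => k; have [] := bd k.
  - by move=> w _; rewrite lee_fin sumr_ge0// => k _; exact: sqr_ge0.
  apply: ge0_le_integral => //.
  - by apply: measurable_powR_norm; apply: measurable_funB; [have [] := bm i|have [] := bn i].
  - by apply: measurable_funeM; apply: measurable_grad_energy => k; have [] := bd k.
  - move=> w _; rewrite norm_powR2 -EFinM lee_fin (bigD1 i)//= mulrDr.
    rewrite ler_wpDr ?mulr_ge0 ?sumr_ge0// => [k _|]; first exact: sqr_ge0.
    by apply: eq_ler; field.
rewrite -(fineK (grad_energy_fin bd)) -EFinM lee_fin -/q.
by rewrite mulrC -ler_pdivlMr.
Qed.

End weak_gradient.

Lemma evanescentD (R : realType) (a b : nat -> \bar R) :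
  evanescent a -> evanescent b -> evanescent (fun n => a n + b n)%E.
Proof.
move=> ha hb eta eta0; have e2 : 0 < eta / 2 by rewrite divr_gt0.
have [J1 H1] := ha _ e2; have [J2 H2] := hb _ e2; exists (maxn J1 J2) => n.
rewrite geq_max => /andP[/H1 h1 /H2 h2]; apply: (le_trans (leeD h1 h2)).
by rewrite -EFinD lee_fin -splitr.
Qed.

Lemma evanescent_sum (R : realType) (I : finType) (a : I -> nat -> \bar R) :
  (forall i, evanescent (a i)) -> evanescent (fun n => \sum_i a i n)%E.
Proof.
move=> ha; rewrite /index_enum; elim: (Finite.enum I) => [|i s IHs].
  by move=> eta eta0; exists 0%N => n _; rewrite big_nil lee_fin ltW.
rewrite (_ : (fun n => _) = (fun n => a i n + \sum_(i <- s) a i n)%E); first exact: evanescentD.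
by apply/funext => n; rewrite big_cons.
Qed.

Lemma evanescent_le (R : realType) (a b : nat -> \bar R) :
  (forall n, (a n <= b n)%E) -> evanescent b -> evanescent a.
Proof.
by move=> ab hb eta /hb[J HJ]; exists J => n /HJ; exact: le_trans (ab n).
Qed.

Lemma evanescent_cvg (R : realType) (a : nat -> R) :
  (forall n, 0 <= a n) -> evanescent (fun n => (a n)%:E) -> a n @[n --> \oo] --> 0.
Proof.
move=> a0 ha; apply/cvgrPdist_le => eta /ha[J HJ]; exists J => // n /HJ.
by rewrite lee_fin sub0r normrN ger0_norm.
Qed.

Lemma Lp_limit_finite d (T : measurableType d) (R : realType) (mu : {measure set T -> \bar R})
    (r : R) (f : nat -> T -> R) (g : T -> R) : 0 < r ->
  (forall n, measurable_fun setT (f n)) -> measurable_fun setT g ->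
  (forall n, (\int[mu]_x (`|f n x| `^ r)%:E < +oo)%E) ->
  evanescent (fun n => \int[mu]_x (`|f n x - g x| `^ r)%:E)%E ->
  (\int[mu]_x (`|g x| `^ r)%:E < +oo)%E.
Proof.
move=> r0 mf mg ff fg; have [J HJ] := fg 1 ltr01.
have m0 : measurable_fun setT (fun _ : T => 0 : R) by exact: measurable_cst.
have := Lp_triangle mu r0 mg (mf J) m0.
under eq_integral do rewrite subr0; move/le_lt_trans; apply.
rewrite lte_mul_pinfty ?lee_fin ?powR_ge0// lte_add_pinfty//.
  apply: le_lt_trans (_ : (_ <= 1%:E)%E) (ltry _); apply: le_trans (HJ J (leqnn _)).
  by apply: eq_lee; apply: eq_integral => x _; rewrite distrC.
by under eq_integral do rewrite subr0.
Qed.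

Section weak_gradient_limit.
Variables (R : realType) (d : nat) (tf : {posnum R}).
Local Notation ST := (measurableTypeR R * torus_point R d)%type.
Local Notation nu := (spacetime_measure d tf).
Local Notation mu := (torus_measure R d).
Local Notation e i := (delta_mx 0 i : 'rV[R]_d).
Variables (W : ST -> R) (mW : measurable_fun setT W).
Variables (Bd : 'I_d -> ('rV[R]_d -> R) -> R) (Bd0 : forall i phi, 0 <= Bd i phi) (M1 : R).
Hypothesis approximants : forall t : R, 0 < t -> exists V G ep,
  approximant tf W Bd t V G ep /\ (grad_energy tf G <= M1%:E)%E.

Let bounded_Lp (V : ST -> R) : bounded_mfun V -> (\int[nu]_z (`|V z| `^ 2)%:E < +oo)%E.
Proof.
move=> [mV [B VB]]; apply: (@le_lt_trans _ _ (\int[nu]_z ((B ^+ 2)%:E))%E).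
  apply: ge0_le_integral.
  - exact: measurableT.
  - by move=> z _; rewrite lee_fin powR_ge0.
  - exact: measurable_powR_norm.
  - exact: measurable_cst.
  move=> z _; rewrite lee_fin norm_powR2 -(real_normK (num_real (V z))).
  by rewrite lerXn2r ?nnegrE// (le_trans _ (VB z)).
rewrite (integral_cst _ measurableT (B ^+ 2)%:E).
have := spacetime_finite d tf; rewrite -ge0_fin_numE// => /fineK <-.
by rewrite -EFinM ltry.
Qed.

Lemma weak_gradient_limit : exists g : 'I_d -> ST -> R,
  [/\ forall i, measurable_fun setT (g i),
      forall i, (\int[nu]_z (`|g i z| `^ 2)%:E < +oo)%E &
      {ae time_measure tf, forall s,
        integrableR mu (fun y => W (s, y)) /\
        forall i, weak_partial i (fun y => W (s, y)) (fun y => g i (s, y))}].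
Proof.
have [V [G [ep [VP GC]]]] := gradient_minimizers mW approximants.
have bV n : bounded_mfun (V n) by have [] := VP n.
have bG n i : bounded_mfun (G n i) by have [] := VP n.
have mV n : measurable_fun setT (V n) by have [] := bV n.
have mG n i : measurable_fun setT (G n i) by have [] := bG n i.
have p2 : 0 < 2 :> R by [].
have /choice[g gP] : forall i, exists g : ST -> R, measurable_fun setT g /\
    evanescent (fun n => \int[nu]_z (`|G n i z - g z| `^ 2)%:E)%E.
  by move=> i; have [g mg gP] := Lp_complete p2 (fun n => mG n i) (GC i); exists g.
have mg i : measurable_fun setT (g i) by have [] := gP i.
have small n : \forall k \near \oo, k.+1%:R^-1 <= (n.+1%:R^-1 : R).
  by exists n => // k nk; rewrite lef_pV2 ?posrE// ler_nat.
have inv_ev (a : nat -> \bar R) : (forall n, (a n <= (n.+1%:R^-1)%:E)%E) -> evanescent a.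
  move=> an eta eta0; exists (Num.truncn eta^-1) => k Jk; apply: le_trans (an k) _.
  rewrite lee_fin -[leRHS]invrK lef_pV2 ?posrE ?invr_gt0//.
  by apply: ltW; apply: lt_le_trans (truncnS_gt _) _; rewrite ler_nat ltnS.
have VW : evanescent (fun n => \int[nu]_z (`|V n z - W z| `^ 2)%:E)%E.
  apply: inv_ev => n; under eq_integral do rewrite norm_powR2.
  by have [_ _ _ []] := VP n.
have epev : evanescent (fun n => \int[time_measure tf]_s (ep n s)%:E)%E.
  by apply: inv_ev => n; have [_ _ _ []] := VP n.
have Wfin := Lp_limit_finite p2 mV mW (fun n => bounded_Lp (bV n)) VW.
have gfin i := Lp_limit_finite p2 (fun n => mG n i) (mg i) (fun n => bounded_Lp (bG n i)) (gP i).2.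
exists g; split => //.
pose D (U U' : ST -> R) s := (\int[mu]_y (`|U (s, y) - U' (s, y)| `^ 2)%:E)%E.
have D0 U U' s : (0 <= D U U' s)%E by apply: integral_ge0 => y _; rewrite lee_fin powR_ge0.
have mdiff (U U' : ST -> R) : measurable_fun setT U -> measurable_fun setT U' ->
    measurable_fun setT (fun z : ST => `|U z - U' z| `^ 2).
  by move=> mU mU'; apply/measurable_EFinP; exact: measurable_powR_normB.
have mD (U U' : ST -> R) : measurable_fun setT U -> measurable_fun setT U' -> measurable_fun setT (D U U').
  move=> mU mU'; apply: (@measurable_slice_integral _ _ (fun z => `|U z - U' z| `^ 2)).
    exact: mdiff.
  by move=> z; exact: powR_ge0.
(* All L^2 errors of the slices and the defect are gathered in one function of time, so that one
   subsequence and one null set of times serve all directions and all test functions. *)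
pose h n s := (D (V n) W s + (\sum_i D (G n i) (g i) s + (ep n s)%:E))%E.
have ep0 n s : (0 <= (ep n s)%:E :> \bar R)%E by have [_ _ [_ H] _ _] := VP n; rewrite lee_fin.
have mep n : measurable_fun setT (fun s => (ep n s)%:E).
  by apply/measurable_EFinP; have [_ _ []] := VP n.
have s0 n s : (0 <= \sum_i D (G n i) (g i) s)%E by apply: sume_ge0 => i _; exact: D0.
have h0 n s : (0 <= h n s)%E by rewrite /h adde_ge0 ?D0// adde_ge0 ?s0 ?ep0.
have mS n : measurable_fun setT (fun s => \sum_i D (G n i) (g i) s)%E.
  by apply: emeasurable_sum => i; exact: mD.
have mh n : measurable_fun setT (h n).
  by apply: emeasurable_funD; [exact: mD|exact: emeasurable_funD].
have hP : evanescent (fun n => \int[time_measure tf]_s h n s)%E.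
  have E n : (\int[time_measure tf]_s h n s =
      \int[nu]_z (`|V n z - W z| `^ 2)%:E + (\sum_i \int[nu]_z (`|G n i z - g i z| `^ 2)%:E +
      \int[time_measure tf]_s (ep n s)%:E))%E.
    rewrite /h ge0_integralD//; [|exact: mD|by move=> s _; rewrite adde_ge0|exact: emeasurable_funD].
    have -> : (\int[time_measure tf]_s (\sum_i D (G n i) (g i) s + (ep n s)%:E) =
        \int[time_measure tf]_s (\sum_i D (G n i) (g i) s) + \int[time_measure tf]_s (ep n s)%:E)%E.
      by rewrite ge0_integralD.
    have -> : (\int[time_measure tf]_s (\sum_i D (G n i) (g i) s) =
        \sum_i \int[time_measure tf]_s D (G n i) (g i) s)%E.
      by rewrite ge0_integral_sum// => i; exact: mD.
    rewrite spacetime_fubini//; last exact: mdiff.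
    congr (_ + (_ + _))%E; apply: eq_bigr => i _.
    by rewrite spacetime_fubini//; exact: mdiff.
  under [fun n => _]eq_fun do rewrite E.
  by apply: evanescentD => //; apply: evanescentD => //; apply: evanescent_sum => i; have [] := gP i.
have [k kh kP] := evanescent_ae_subsequence mh h0 hP.
have gae : {ae time_measure tf, forall s, forall i, (\int[mu]_y (`|g i (s, y)| `^ 2)%:E < +oo)%E}.
  apply: filter_forall => i.
  exact: slice_power_finite.
have Wae := slice_power_finite mW Wfin.
have two : 1 <= 2 :> R by rewrite ler1n.
apply: ae_imp2 kP (filterI gae Wae) _ => s hs [gs Ws].
have mslice (U : ST -> R) : measurable_fun setT U -> measurable_fun setT (fun y => U (s, y)) by exact: measurable_slice.
have Wi : integrableR mu (fun y => W (s, y)) := Lp_integrable two (mslice _ mW) Ws.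
split => // i phi sphi pphi.
have gi : integrableR mu (fun y => g i (s, y)) := Lp_integrable two (mslice _ (mg i)) (gs i).
have bi (U : ST -> R) : bounded_mfun U -> integrableR mu (fun y => U (s, y)).
  by move=> [mU [B UB]]; apply: (@bounded_integrable _ _ _ mu _ B) => // y; exact: mslice.
have ev (a : nat -> \bar R) : (forall n, (0 <= a n)%E) -> (forall n, (a n <= h (k n) s)%E) -> evanescent a.
  by move=> _ ah; exact: evanescent_le hs.
have hV : evanescent (fun n => D (V (k n)) W s).
  by apply: ev => // n; rewrite /h leeDl// adde_ge0.
have hG : evanescent (fun n => D (G (k n) i) (g i) s).
  apply: ev => // n; rewrite /h; apply: le_trans (leeDr _ (D0 _ _ _)).
  by apply: le_trans (leeDl _ (ep0 _ _)); rewrite (bigD1 i)//= leeDl// sume_ge0.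
have hep : evanescent (fun n => (ep (k n) s)%:E).
  apply: ev => // n; rewrite /h; apply: le_trans (leeDr _ (D0 _ _ _)).
  exact: leeDr.
have [c0 _] := sphi [::]; have [c1 _] := sphi [:: i]; have pD := derive_periodic (e i) pphi.
have [B B0 HB] := periodic_bounded c0 pphi; have [B' B'0 HB'] := periodic_bounded c1 pD.
have C1 := Lp_pairing_cvg two (measurable_row_comp c1) (fun y => HB' _)
  (fun n => bi _ (bV (k n))) Wi hV.
have C2 := Lp_pairing_cvg two (measurable_row_comp c0) (fun y => HB _)
  (fun n => bi _ (bG (k n) i)) gi hG.
have C := cvgD C1 C2.
have C0 : (\int[mu]_x ((iter_partial [:: i] phi \o @row_of_point R d) x * V (k n) (s, x)) +
    \int[mu]_x ((phi \o @row_of_point R d) x * G (k n) i (s, x))) @[n --> \oo] --> 0.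
  apply/norm_cvg0P; apply: (@squeeze_cvgr _ _ _ _ (fun=> 0) (fun n => Bd i phi * ep (k n) s)).
  - apply: nearW => n; rewrite normr_ge0/=; have [_ _ _ _ /(_ i phi s sphi pphi)] := VP (k n).
    by under eq_Rintegral do rewrite mulrC; under [X in _ + X]eq_Rintegral do rewrite mulrC.
  - exact: cvg_cst.
  - rewrite -(mulr0 (Bd i phi)); apply: cvgM; first exact: cvg_cst.
    by apply: evanescent_cvg => // n; have [_ _ [_ H] _ _] := VP (k n).
have H0 : \int[mu]_x ((iter_partial [:: i] phi \o @row_of_point R d) x * W (s, x)) +
    \int[mu]_x ((phi \o @row_of_point R d) x * g i (s, x)) = 0.
  have hR : hausdorff_space R by exact: Rhausdorff.
  have L1 := cvg_lim hR (C _); have L2 := cvg_lim hR C0.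
  by rewrite -L1 -[RHS]L2.
move/eqP : H0; rewrite addr_eq0 => /eqP H.
under eq_Rintegral do rewrite mulrC; rewrite H; congr (- _).
by apply: eq_Rintegral => y _; rewrite mulrC.
Qed.

End weak_gradient_limit.

(** * Regularity of the limit *)

Lemma Lfun2P d (T : measurableType d) (R : realType) (mu : {measure set T -> \bar R}) (f : T -> R) :
  (f \in Lfun mu 2%:E) <-> measurable_fun setT f /\ (\int[mu]_x (`|f x| `^ 2)%:E < +oo)%E.
Proof.
have E : ('N[mu]_2%:E [EFin \o f])%E = ((\int[mu]_x (`|f x| `^ 2)%:E) `^ 2^-1)%E.
  by rewrite unlock /=; congr (_ `^ _)%E.
have fin : (('N[mu]_2%:E [EFin \o f])%E < +oo)%E <-> (\int[mu]_x (`|f x| `^ 2)%:E < +oo)%E.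
  rewrite E; split => [h|h]; last by rewrite poweR_lty.
  rewrite ltey; apply: contraTneq h => ->.
  by rewrite /poweR/= invr_eq0 pnatr_eq0.
rewrite inE/=; split.
  by move=> /andP[/set_mem mf /set_mem ff]; split; [exact: mf|exact/fin].
by move=> [mf /fin ff]; apply/andP; split; apply/mem_set.
Qed.

Lemma integral_le_combination d (T : measurableType d) (R : realType)
    (mu : {measure set T -> \bar R}) (f0 f g h : T -> R) (q C : R) : 0 <= q -> 0 <= C ->
  measurable_fun setT f0 -> measurable_fun setT f -> measurable_fun setT g -> measurable_fun setT h ->
  (forall x, 0 <= f0 x) -> (forall x, 0 <= f x) -> (forall x, 0 <= g x) -> (forall x, 0 <= h x) ->
  (forall x, f0 x <= q * (f x + g x) + C * h x) ->
  (\int[mu]_x (f0 x)%:E <= q%:E * (\int[mu]_x (f x)%:E + \int[mu]_x (g x)%:E) +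
    C%:E * \int[mu]_x (h x)%:E)%E.
Proof.
move=> q0 C0 m0 mf mg mh p0 pf pg ph H.
have mfE (k : T -> R) : measurable_fun setT k -> measurable_fun setT (fun x => (k x)%:E : \bar R).
  by move=> mk; exact/measurable_EFinP.
rewrite -ge0_integralD; [|exact: measurableT|by move=> x _; rewrite lee_fin|exact: mfE
  |by move=> x _; rewrite lee_fin|exact: mfE].
have mS : measurable_fun setT (fun x => (f x)%:E + (g x)%:E)%E by apply: emeasurable_funD; exact: mfE.
have pS x : (0 <= (f x)%:E + (g x)%:E)%E by rewrite -EFinD lee_fin addr_ge0.
rewrite -ge0_integralZl; [|exact: measurableT|exact: mS|by move=> x _; exact: pS|by rewrite lee_fin].
rewrite -ge0_integralZl; [|exact: measurableT|exact: mfE|by move=> x _; rewrite lee_fin|by rewrite lee_fin].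
have mqS : measurable_fun setT (fun x => q%:E * ((f x)%:E + (g x)%:E))%E by exact: measurable_funeM.
have mCh : measurable_fun setT (fun x => C%:E * (h x)%:E)%E by apply: measurable_funeM; exact: mfE.
rewrite -ge0_integralD; [|exact: measurableT|by move=> x _; apply: mule_ge0; [rewrite lee_fin|exact: pS]|exact: mqS
  |by move=> x _; rewrite mule_ge0 ?lee_fin|exact: mCh].
apply: ge0_le_integral; [exact: measurableT|by move=> x _; rewrite lee_fin|exact: mfE
  |exact: emeasurable_funD|].
by move=> x _; rewrite [leRHS](_ : _ = (q * (f x + g x) + C * h x)%:E)// lee_fin.
Qed.

Section config_limits.
Variables (R : realType) (d : nat) (tf : {posnum R}) (delta : weak_star_metric R d).
Local Notation path := (cadlag_path tf delta).
Local Notation mu := (torus_measure R d).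
Variables (N : nat -> nat) (N0 : forall j, (0 < N j)%N).
Variables (chi : nat -> R) (chi0 : forall j, 0 < chi j).
Variables (e : nat -> path) (ce : forall j, config_path (N j) (chi j) (e j)).
Local Notation X j t := (path_conf (N j) (chi j) (e j) t).
Hypothesis jumps : forall j (t : time tf), exists2 h : R, 0 < h &
  forall s : time tf, val t - h < val s < val t -> adj (X j s) (X j t).
Hypothesis chi_small : forall r : R, 0 < r -> exists J, forall j, (J <= j)%N -> chi j <= r.
Variables (u : path) (eu : skorokhod_dist (e j) u @[j --> \oo] --> 0).
Variables (alpha : R) (alpha1 : 1 < alpha) (m M1 : R).
Hypothesis N_large : forall k, exists J, forall j, (J <= j)%N -> (k <= N j)%N.
Hypothesis mass : forall j t, conf_mass (chi j) (X j t) <= m.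
Hypothesis energy : forall j,
  (\int[time_measure tf]_s (conf_energy alpha (chi j) (X j (clamp tf s)))%:E <= M1%:E)%E.
Local Notation ST := (measurableTypeR R * torus_point R d)%type.
Local Notation nu := (spacetime_measure d tf).
Local Notation F j := (path_fun_at (N j) (chi j) (e j)).
Local Notation D j s := (conf_energy alpha (chi j) (X j (clamp tf s))).
Local Notation pdist := (@power_dist R d tf alpha).
Local Notation root j s p := (root_conf alpha (chi j) (X j (clamp tf s)) p).
Local Notation dir i := (delta_mx 0 i : 'rV[R]_d).

Let a0 : 0 < alpha. Proof. by rewrite (lt_trans _ alpha1). Qed.
Let a20 : 0 < alpha / 2. Proof. by rewrite divr_gt0. Qed.

Let mF j : measurable_fun setT (F j).
Proof. exact: measurable_path_fun. Qed.

Let root0 j s p : 0 <= root j s p. Proof. exact: powR_ge0. Qed.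

Let path_measurable (f : forall j, config d (N j) -> R) j :
  measurable_fun setT (fun s : measurableTypeR R => f j (X j (clamp tf s))).
Proof.
apply: (measurable_countable_comp (C := {ffun lattice d (N j) -> nat}) _ (f j)) => a.
exact: measurable_path_conf.
Qed.

(** [V] is eta^(alpha/2) and [G] its forward difference quotient, constant on boxes, whose energy is
    exactly the integrated [conf_energy]. [ep] is the mean of [V] divided by N, the size of the
    defect that [discrete_ibp] leaves at mesh 1/N. *)
Let V j (z : ST) : R := root j z.1 (boxidx (N0 j) z.2).
Let G j (i : 'I_d) (z : ST) : R := (N j)%:R * (root j z.1 (step_up i (boxidx (N0 j) z.2)) -
  root j z.1 (boxidx (N0 j) z.2)).
Let ep j (s : measurableTypeR R) : R := (N j)%:R^-1 * ((\sum_p root j s p) / (N j)%:R ^+ d).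

Let VE j z : V j z = F j z `^ (alpha / 2).
Proof. by case: z => s y; rewrite (path_fun_atE (N0 j)). Qed.

Let root_bound j : exists2 B, 0 <= B & forall s p, root j s p <= B.
Proof.
have [K KP] := config_path_total (N0 j) (chi0 j) (ce j).
exists ((chi j * K%:R) `^ (alpha / 2)) => [|s p]; first exact: powR_ge0.
rewrite ge0_ler_powR ?nnegrE ?mulr_ge0 ?(ltW (chi0 j))//; first exact: ltW.
rewrite ler_wpM2l ?(ltW (chi0 j))// ler_nat (leq_trans _ (KP (clamp tf s)))//.
by rewrite /total (bigD1 p)//= leq_addr.
Qed.

Let bV j : bounded_mfun (V j).
Proof.
split; first exact: (measurable_path_pair (N0 j) (chi0 j) (ce j) (N0 j) (fun a p => root_conf alpha (chi j) a p)).
by have [B B0 BP] := root_bound j; exists B => z; rewrite /V ger0_norm.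
Qed.

Let bG j i : bounded_mfun (G j i).
Proof.
split.
  exact: (measurable_path_pair (N0 j) (chi0 j) (ce j) (N0 j)
    (fun a p => (N j)%:R * (root_conf alpha (chi j) a (step_up i p) - root_conf alpha (chi j) a p))).
have [B B0 BP] := root_bound j; exists ((N j)%:R * (B + B)) => z.
rewrite normrM ger0_norm// ler_wpM2l//; apply: le_trans (ler_normB _ _) _.
by rewrite !ger0_norm ?root0// lerD.
Qed.

Let mep j : measurable_fun setT (ep j).
Proof.
exact: (path_measurable (fun j a => (N j)%:R^-1 * ((\sum_p root_conf alpha (chi j) a p) / (N j)%:R ^+ d))).
Qed.

Let ep0 j s : 0 <= ep j s.
Proof. by rewrite mulr_ge0// divr_ge0 ?exprn_ge0// sumr_ge0. Qed.

Let gradient_energy j : (grad_energy tf (G j) <= M1%:E)%E.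
Proof.
rewrite /grad_energy spacetime_fubini; last 2 first.
- by apply/measurable_EFinP; apply: measurable_grad_energy => i; have [] := bG j i.
- by move=> z; rewrite sumr_ge0// => i _; exact: sqr_ge0.
apply: le_trans (energy j); apply: eq_lee; apply: eq_integral => s _ /=.
rewrite (@ge0_integral_boxidx R d (N j) (N0 j) (fun p => \sum_i ((N j)%:R *
  (root j s (step_up i p) - root j s p)) ^+ 2)); last first.
  by move=> p; rewrite sumr_ge0// => i _; exact: sqr_ge0.
congr (_%:E); rewrite /conf_energy /dirichlet /bond_energy exchange_big/=.
under eq_bigr do (under eq_bigr do rewrite exprMn; rewrite -mulr_sumr).
by rewrite -mulr_sumr mulrAC.
Qed.

(** The power alpha/2 is at most 1 plus the power alpha, whose integral is bounded through energy
    and mass; the factor 1/N does the rest. *)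
Let ep_small (t : R) : 0 < t -> exists J, forall j, (J <= j)%N ->
  (\int[time_measure tf]_s (ep j s)%:E <= t%:E)%E.
Proof.
move=> t0; have [K K0 KP] := slice_power_bound N0 chi0 alpha1 mass.
pose c := K * M1 + (1 + K * m `^ alpha) * tf%:num.
have [J JP] := N_large (Num.truncn (c / t)).+1; exists J => j /JP Jj.
have n0 : 0 < (N j)%:R :> R by rewrite ltr0n.
pose A := (N j)%:R^-1 * K; pose B := (N j)%:R^-1 * (1 + K * m `^ alpha).
have B0 : 0 <= B by rewrite mulr_ge0 ?invr_ge0 ?(ltW n0)// addr_ge0// mulr_ge0 ?powR_ge0.
apply: (@le_trans _ _ (\int[time_measure tf]_s (A * D j s + B)%:E)%E).
  apply: ge0_le_integral => //.
  - by move=> s _; rewrite lee_fin.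
  - by apply/measurable_EFinP.
  - apply/measurable_EFinP; apply: measurable_funD => //; apply: measurable_funM => //.
    exact: (path_measurable (fun j a => conf_energy alpha (chi j) a)).
  - move=> s _; rewrite lee_fin /A /B -mulrA -mulrDr ler_wpM2l ?invr_ge0 ?(ltW n0)//.
    apply: (@le_trans _ _ (1 + (\sum_p (chi j * (X j (clamp tf s) p)%:R) `^ alpha) / (N j)%:R ^+ d)).
      rewrite ler_pdivrMr ?exprn_gt0// mulrDl mul1r divfK ?gt_eqF ?exprn_gt0//.
      have -> : (N j)%:R ^+ d = \sum_(p : lattice d (N j)) (1 : R) by rewrite sumr_const_lattice mul1r.
      rewrite -big_split/= ler_sum// => p _.
      have -> : (chi j * (X j (clamp tf s) p)%:R) `^ alpha = root j s p ^+ 2.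
        by rewrite -powR_mulrn ?powR_ge0// /root_conf -powRrM divfK.
      have := sqr_ge0 (root j s p - 1); have := sqr_ge0 (root j s p); rewrite !expr2.
      by move: (root j s p) => q; nra.
    by have := KP j s; rewrite mulrDr; lra.
apply: le_trans (time_integral_affine N0 chi0 ce energy j _ B0) _.
  by rewrite mulr_ge0// invr_ge0 ltW.
rewrite lee_fin /A /B -!mulrA -mulrDr -/c mulrC ler_pdivrMr// -ler_pdivrMl// mulrC.
by apply: ltW; apply: lt_le_trans (truncnS_gt _) _; rewrite ler_nat.
Qed.

Section limit.
Variables (w : ST -> R) (mw : measurable_fun setT w) (w0 : forall z, 0 <= w z).
Hypothesis Fw : evanescent (fun j => pdist (F j) w).
Hypothesis wfin : (\int[nu]_z (`|w z| `^ alpha)%:E < +oo)%E.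
Local Notation W := (fun z => w z `^ (alpha / 2)).

Let mW : measurable_fun setT W.
Proof. exact: (@measurableT_comp _ _ _ _ _ _ (@powR R ^~ (alpha / 2))). Qed.

(** [powR_dist_interp] with p = alpha / 2 and q = 1 carries the L^alpha convergence of the densities
    over to L^2 convergence of their alpha/2-th powers. *)
Let VW (t : R) : 0 < t -> exists J, forall j, (J <= j)%N ->
  (\int[nu]_z ((V j z - W z) ^+ 2)%:E <= t%:E)%E.
Proof.
move=> t0; pose I := fine (\int[nu]_z (`|w z| `^ alpha)%:E)%E.
have I0 : 0 <= I by rewrite fine_ge0// integral_ge0// => z _; rewrite lee_fin powR_ge0.
have IE : (\int[nu]_z (`|w z| `^ alpha)%:E = I%:E)%E.
  by rewrite fineK// ge0_fin_numE// integral_ge0// => z _; rewrite lee_fin powR_ge0.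
pose c := 2 `^ alpha * (1 + I) + I; have c0 : 0 <= c by rewrite addr_ge0// mulr_ge0 ?powR_ge0// addr_ge0.
have c1 : 0 < c + 1 by rewrite ltr_wpDl.
have [C C0 CP] := powR_dist_interp a20 ltr01 a0 (divr_gt0 (divr_gt0 t0 (ltr0Sn R 1)) c1).
pose eta := Num.min 1 (t / 2 / (C + 1)).
have C1 : 0 < C + 1 by rewrite ltr_wpDl.
have eta0 : 0 < eta by rewrite lt_min ltr01 divr_gt0// divr_gt0.
have [J JP] := Fw eta0; exists J => j /JP Hj.
have m0 : measurable_fun setT (fun _ : ST => 0 : R) by exact: measurable_cst.
have mp (f : ST -> R) : measurable_fun setT f -> measurable_fun setT (fun z => (`|f z| `^ alpha)%:E) by exact: measurable_powR_norm.
have mFw : measurable_fun setT (fun z => (`|F j z - w z| `^ alpha)%:E).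
  exact: measurable_powR_normB.
have FI : (\int[nu]_z (`|F j z| `^ alpha)%:E <= (2 `^ alpha * (1 + I))%:E)%E.
  have := Lp_triangle nu a0 (mF j) mw m0.
  under eq_integral do rewrite subr0; move/le_trans; apply.
  under [Z in (_ * (_ + Z))%E]eq_integral do rewrite subr0.
  rewrite IE EFinM lee_wpmul2l ?lee_fin ?powR_ge0// EFinD leeD2r//.
  by apply: le_trans Hj _; rewrite lee_fin ge_min lexx.
pose q := t / 2 / (c + 1); have q0 : 0 <= q by rewrite !divr_ge0 ?(ltW t0) ?(ltW c1).
apply: (@le_trans _ _ (q%:E * (\int[nu]_z (`|F j z| `^ alpha)%:E + \int[nu]_z (`|w z| `^ alpha)%:E) +
    C%:E * \int[nu]_z (`|F j z - w z| `^ alpha)%:E)%E).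
  apply: integral_le_combination.
  - exact: q0.
  - exact: C0.
  - apply: measurable_funX; apply: measurable_funB => //; by have [] := bV j.
  - by apply/measurable_EFinP; apply: mp.
  - by apply/measurable_EFinP; apply: mp.
  - exact/measurable_EFinP.
  - by move=> z; exact: sqr_ge0.
  - by move=> z; exact: powR_ge0.
  - by move=> z; exact: powR_ge0.
  - by move=> z; exact: powR_ge0.
  - move=> z; rewrite VE -norm_powR2.
    have F0 := path_fun_at_ge0 (N0 j) (chi0 j) (e j) z.
    have := CP (F j z) (w z) F0 (w0 z).
    have -> : alpha / (alpha / 2) = 2 by field; rewrite gt_eqF.
    by rewrite divr1 !powRr1// (ger0_norm F0) (ger0_norm (w0 z)).
rewrite IE; apply: (@le_trans _ _ (q%:E * ((2 `^ alpha * (1 + I))%:E + I%:E) + C%:E * eta%:E)%E).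
  by apply: leeD; rewrite lee_wpmul2l ?lee_fin//; apply: leeD.
rewrite [leLHS](_ : _ = (q * c + C * eta)%:E)// lee_fin [leRHS]splitr lerD//.
  by rewrite /q mulrAC ler_pdivrMr// ler_wpM2l ?divr_ge0 ?(ltW t0)// lerDl.
apply: (@le_trans _ _ (C * (t / 2 / (C + 1)))); first by rewrite ler_wpM2l// ge_min lexx orbT.
by rewrite mulrA ler_pdivrMr// mulrC ler_wpM2l ?divr_ge0 ?(ltW t0)// lerDl.
Qed.

(** The Taylor constant depends on the direction and the test function, but neither on [j] nor on
    time, as [approximant] demands. *)
Let test_bound : exists2 Bd : 'I_d -> ('rV[R]_d -> R) -> R, forall i phi, 0 <= Bd i phi &
  forall i phi j s, smooth phi -> periodic phi ->
    `|\int[mu]_y (V j (s, y) * 'D_(dir i) phi (row_of_point y)) +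
      \int[mu]_y (G j i (s, y) * phi (row_of_point y))| <= Bd i phi * ep j s.
Proof.
have /choice[B BP] : forall z : 'I_d * ('rV[R]_d -> R), exists B : R, 0 <= B /\
    (smooth z.2 -> periodic z.2 -> [/\ forall x, `|z.2 x| <= B, forall x, `|'D_(dir z.1) z.2 x| <= B &
      forall x (h : R), 0 <= h ->
        `|z.2 (x - h *: dir z.1) - z.2 x + h * 'D_(dir z.1) z.2 x| <= B * h ^+ 2]).
  move=> [i phi]; have [[sphi pphi]|n] := pselect (smooth phi /\ periodic phi).
    by have [B B0 [H1 H2 H3]] := smooth_taylor i sphi pphi; exists B; split => //; exact: ltW.
  by exists 0; split => // s p; case: n.
exists (fun i phi => B (i, phi)) => [i phi|i phi j s sphi pphi]; first by have [] := BP (i, phi).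
have [_ /(_ sphi pphi)[/= H1 H2 H3]] := BP (i, phi).
have [c0 _] := sphi [::]; have [c1 _] := sphi [:: i].
have [mV [BV VB]] := bV j.
have n1 : (1 : R) <= (N j)%:R by rewrite ler1n.
have h01 : 0 < ((N j)%:R^-1 : R) <= 1 by rewrite invr_gt0 (lt_le_trans ltr01 n1)/= invf_le1// (lt_le_trans ltr01 n1).
have := @discrete_ibp R d i phi (N j)%:R^-1 BV (B (i, phi)) (fun y => V j (s, y)) h01 c0 pphi c1 H1 H2 H3
  (measurable_slice s mV) (fun y => VB _).
rewrite invrK => H; have {H} := H _; rewrite /V/= => H.
have E : (N j)%:R^-1 * \int[mu]_y `|V j (s, y)| = ep j s.
  rewrite /ep /Rintegral; congr (_ * _).
  rewrite (eq_integral (fun y => (root j s (boxidx (N0 j) y))%:E)); last by move=> y _; rewrite /V/= ger0_norm.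
  by rewrite ge0_integral_boxidx.
rewrite -E mulrA; apply: le_trans (H _) => [|y]; last by rewrite boxidx_shift1.
by under [Z in _ <= `|_ + Z|]eq_Rintegral do rewrite boxidx_shift.
Qed.

Lemma limit_weak_gradient : exists g : 'I_d -> ST -> R,
  (forall i, g i \in Lfun nu 2%:E) /\
  {ae time_measure tf, forall s,
    mu.-integrable setT (fun y => (w (s, y) `^ (alpha / 2))%:E) /\
    forall i, weak_partial i (fun y => w (s, y) `^ (alpha / 2)) (fun y => g i (s, y))}.
Proof.
have [Bd Bd0 BdP] := test_bound.
have [|g [mg gfin gP]] := @weak_gradient_limit R d tf W mW Bd M1; last first.
  by exists g; split => // i; apply/Lfun2P.
move=> t t0; have [J1 H1] := VW t0; have [J2 H2] := ep_small t0.
pose j := maxn J1 J2; exists (V j), (G j), (ep j); split; last exact: gradient_energy.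
split.
- exact: bV.
- exact: bG.
- by split; [exact: mep|exact: ep0].
- by split; [apply: H1; exact: leq_maxl|apply: H2; exact: leq_maxr].
- by move=> i phi s sphi pphi; exact: BdP.
Qed.

End limit.

Theorem config_limit : regular_path alpha u /\
  exists w : ST -> R, [/\ version u w, (\int[nu]_z (`|w z| `^ alpha)%:E < +oo)%E &
    evanescent (fun j => pdist (F j) w)].
Proof.
have [w [mw w0 Fw wfin]] := density_limit N0 chi0 ce jumps chi_small eu alpha1 N_large mass energy.
have vw := density_limit_version N0 chi0 ce jumps chi_small eu alpha1 mw w0 Fw wfin.
split; last by exists w.
split; first exact: (limit_continuous N0 chi0 ce jumps chi_small eu).
have [g [gL gP]] := limit_weak_gradient mw w0 Fw wfin.
by exists w, g.
Qed.

Lemma config_limit_Lalpha (f : nat -> Lalpha d tf alpha1) (w : Lalpha d tf alpha1) :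
  (forall j, version (e j) (f j)) -> version u w ->
  Lalpha_dist (f j) w @[j --> \oo] --> 0.
Proof.
move=> vf vw; have [_ [w' [vw' w'fin H]]] := config_limit.
apply: evanescent_cvg => [j|]; first by rewrite Lalpha_distE powR_ge0.
move=> eta eta0; have [|J JP] := H (eta `^ alpha); first exact: powR_gt0.
exists J => j /JP Hj; rewrite lee_fin; apply: Lalpha_dist_le; first exact: ltW.
apply: le_trans Hj; apply: eq_lee; apply: power_dist_ae_eq => //.
- exact: Lalpha_measurable.
- exact: Lalpha_measurable.
- by have [] := vw'.
- exact: version_unique (vf j) (path_version (N0 j) (chi0 j) (ce j)).
- exact: version_unique vw vw'.
Qed.

End config_limits.

(** * Trigonometric polynomials *)

Section trigonometric.
Variables (R : realType) (d : nat).
Local Notation V := 'rV[R]_d.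
Implicit Types (phi psi : V -> R) (x : V).
Local Notation e i := (delta_mx 0 i : V).

(** The phase [c] makes the algebra stable under translations and under differentiation, sines being
    shifted cosines. *)
Inductive trig : (V -> R) -> Prop :=
| trig_cst c : trig (fun=> c)
| trig_cos i c : trig (fun x => cos (2 * pi * x 0 i + c))
| trigD phi psi : trig phi -> trig psi -> trig (fun x => phi x + psi x)
| trigM phi psi : trig phi -> trig psi -> trig (fun x => phi x * psi x).

Lemma trigX phi n : trig phi -> trig (fun x => phi x ^+ n).
Proof.
move=> tphi; elim: n => [|n IHn]; first exact: trig_cst.
have -> : (fun x => phi x ^+ n.+1) = (fun x => phi x * phi x ^+ n) by apply/funext => x; rewrite exprS.
exact: trigM.
Qed.

Lemma trigZ (c : R) phi : trig phi -> trig (fun x => c * phi x).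
Proof. by apply: trigM; exact: trig_cst. Qed.

Lemma trig_continuous phi : trig phi -> continuous phi.
Proof.
elim => [c|i c|f g _ cf _ cg|f g _ cf _ cg].
- exact: cst_continuous.
- move=> x; apply: (@continuous_comp _ _ _ (fun x : V => x 0 i) (fun s : R => cos (2 * pi * s + c))).
    exact: coord_continuous.
  apply: (@continuous_comp _ _ _ (fun s : R => 2 * pi * s + c) (@cos R)); last exact: continuous_cos.
  apply: (@continuousD _ _ _ (fun s : R => 2 * pi * s) (fun=> c)); last exact: cst_continuous.
  exact: mulrl_continuous.
- by move=> x; apply: continuousD; [exact: cf|exact: cg].
- by move=> x; apply: continuousM; [exact: cf|exact: cg].
Qed.

Lemma trig_periodic phi : trig phi -> periodic phi.
Proof.
elim => [c|j c|f g _ pf _ pg|f g _ pf _ pg] x i //; rewrite ?pf ?pg//.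
rewrite !mxE eqxx/=; case: eqP => _; last by rewrite addr0.
have -> : 2 * pi * (x 0 j + true%:R) + c = 2 * pi * x 0 j + c + pi *+ 2 by rewrite mulr2n /=; ring.
exact: cosD2pi.
Qed.

Lemma trig_translate phi (t : V) : trig phi -> trig (fun x => phi (x + t)).
Proof.
elim => [c|j c|f g _ pf _ pg|f g _ pf _ pg]; [exact: trig_cst| |exact: trigD|exact: trigM].
rewrite (_ : (fun x => _) = (fun x => cos (2 * pi * x 0 j + (2 * pi * t 0 j + c)))); first exact: trig_cos.
by apply/funext => x; rewrite mxE mulrDr addrA.
Qed.

Lemma trig_derive phi i : trig phi -> (forall x, derivable phi x (e i)) /\ trig ('D_(e i) phi).
Proof.
elim => [c|j c|f g _ [df tdf] _ [dg tdg]|f g tf [df tdf] tg [dg tdg]].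
- split; first by move=> x; exact: derivable_cst.
  rewrite (_ : 'D_(e i) _ = fun=> 0); first exact: trig_cst.
  by apply/funext => x; exact: derive_cst.
- pose q : R := (i == j)%:R.
  pose k (t : R) : R := cos (2 * pi * t + c).
  have dk (t : R) : is_derive t (1 : R) k (2 * pi * cos (2 * pi * t + c + pi / 2)).
    have H : is_derive t (1 : R) k (- sin (2 * pi * t + c) * (2 * pi)).
      apply: (@is_derive1_comp _ (@cos R) (fun t => 2 * pi * t + c)).
      have -> : (fun t : R => 2 * pi * t + c) = ((2 * pi) \*: id) + cst c by [].
      by apply: is_derive_eq; rewrite addr0; exact: mulr1.
    by apply: is_derive_eq H _; rewrite cosDpihalf mulrC.
  have E x : (fun h : R => h^-1 *: (cos (2 * pi * (h *: e i + x) 0 j + c) - cos (2 * pi * x 0 j + c))) =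
      if i == j then (fun h => h^-1 *: (k (h *: 1 + x 0 j) - k (x 0 j))) else (fun=> 0).
    have [->|ij] := eqVneq i j; apply/funext => h; rewrite !mxE ?eqxx/= ?[h *: 1]mulr1 ?mulr1 //.
    by rewrite eq_sym (negbTE ij) mulr0 add0r subrr scaler0.
  have D x : is_derive x (e i) (fun x : V => cos (2 * pi * x 0 j + c))
      (if i == j then 2 * pi * cos (2 * pi * x 0 j + c + pi / 2) else 0).
    apply: DeriveDef; rewrite ?/derivable ?/derive/= E; case: (i == j).
    + by have [] := dk (x 0 j).
    + exact: is_cvg_cst.
    + by have [_] := dk (x 0 j).
    + exact: lim_cst.
  split; first by move=> x; have [] := D x.
  rewrite (_ : 'D_(e i) _ = fun x => (if i == j then 2 * pi else 0) * cos (2 * pi * x 0 j + (c + pi / 2))).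
    by apply: trigM; [exact: trig_cst|exact: trig_cos].
  apply/funext => x; have [_ ->] := D x.
  by case: (i == j); rewrite ?mul0r// addrA.
- split; first by move=> x; exact: derivableD.
  rewrite (_ : 'D_(e i) _ = fun x => 'D_(e i) f x + 'D_(e i) g x); first exact: trigD.
  by apply/funext => x; exact: deriveD.
- split; first by move=> x; exact: derivableM.
  rewrite (_ : 'D_(e i) _ = fun x => f x * 'D_(e i) g x + g x * 'D_(e i) f x).
    by apply: trigD; exact: trigM.
  by apply/funext => x; exact: deriveM.
Qed.

Lemma trig_smooth phi : trig phi -> smooth phi.
Proof.
move=> tphi; suff H s : trig (iter_partial s phi).
  by move=> s; split; [exact: trig_continuous|move=> i x; have [] := trig_derive i (H s)].
elim: s => [//|i s IHs]; exact: (trig_derive i IHs).2.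
Qed.

Lemma derive_translate phi (v t x : V) : 'D_v (fun y => phi (y + t)) x = 'D_v phi (x + t).
Proof.
rewrite /derive/=.
suff -> : (fun h : R => h^-1 *: (phi (h *: v + x + t) - phi (x + t))) =
    (fun h => h^-1 *: (phi (h *: v + (x + t)) - phi (x + t))) by [].
by apply/funext => h; rewrite addrA.
Qed.

End trigonometric.

(** * A Poincare inequality on the torus, in dual form *)

Section cube.
Variable R : realType.

Lemma torus_coord_null d (i : 'I_d) (A : set (measurableTypeR R)) : measurable A ->
  uniform_prob (@ltr01 R) A = 0%E -> torus_measure R d ((fun y => tnth y i) @^-1` A) = 0%E.
Proof.
move=> mA A0; elim: d i => [[]//|d IHd] i.
have mB k (j : 'I_k) : measurable ((fun y : torus_point R k => tnth y j) @^-1` A).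
  by rewrite -[_ @^-1` _]setTI; exact: (@measurable_tnth _ _ k j).
rewrite [LHS](_ : _ = (uniform_prob (@ltr01 R) \x torus_measure R d)%E
  (@cons_point R d @^-1` ((fun y => tnth y i) @^-1` A)))//.
case: (unliftP ord0 i) => [j|] ->.
  rewrite (_ : _ @^-1` _ = setT `*` ((fun y => tnth y j) @^-1` A)).
    rewrite product_measure1E//; last exact: mB.
    by apply: eq_trans (congr1 _ (IHd j)) _; exact: mule0.
  apply/seteqP; split => -[s y] /=; rewrite tnth_cons_lift//.
  by case.
rewrite (_ : _ @^-1` _ = A `*` setT).
  by rewrite product_measure1E//; apply: eq_trans (congr1 (fun x => x * _)%E A0) _; exact: mul0e.
by apply/seteqP; split => -[s y] //=; rewrite (tnth_nth 0)//=; case.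
Qed.

End cube.

Lemma integral_Rintegral d (T : measurableType d) (R : realType) (mu : {measure set T -> \bar R})
    (f : T -> R) : integrableR mu f ->
  (\int[mu]_x (f x)%:E = (\int[mu]_x f x)%:E)%E.
Proof. by move=> fi; apply/esym/fineK; exact: (integrable_fin_num measurableT fi). Qed.

Section translations.
Variables (R : realType) (d : nat).
Local Notation V := 'rV[R]_d.
Local Notation point := (torus_point R d).
Local Notation mu := (torus_measure R d).
Local Notation e i := (delta_mx 0 i : V).
Local Notation row := (@row_of_point R d).
Implicit Types (psi : V -> R).

Lemma torus_ae_cube : {ae mu, forall y : point, forall i, 0 < tnth y i < 1}.
Proof.
apply: filter_forall => i; exists ((fun y => tnth y i) @^-1` (~` `]0, 1[%classic)); split.
- by rewrite -[_ @^-1` _]setTI; apply: (@measurable_tnth _ _ d i) => //; exact: measurableC.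
- apply: torus_coord_null; first exact: measurableC.
  have := @ge0_integral_unif R (fun x => (\1_(~` `]0, 1[%classic) x)%:E).
  rewrite integral_indic//; last exact: measurableC.
  rewrite setIT => -> //; last by apply/measurable_EFinP; apply: measurable_indic; exact: measurableC.
  rewrite integral_indic//; last exact: measurableC.
  rewrite (_ : _ `&` _ = [set 1]); first exact: lebesgue_measure_set1.
  apply/seteqP; split => x /=; rewrite !in_itv/=; last by move=> ->; rewrite ltxx andbF ltr01 lexx.
  by move=> [/negP]; rewrite negb_and -!leNgt => /orP[h1|h1] /andP[h2 h3]; apply/eqP; rewrite eq_le ?h1 ?h3//; move: h1; rewrite leNgt h2.
- by move=> y /= ny; rewrite in_itv.
Qed.

Lemma trig_measurable psi : trig psi -> measurable_fun setT (fun y : point => psi (row y)).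
Proof. by move=> tpsi; exact: measurable_row_comp (trig_continuous tpsi). Qed.

Lemma trig_measurable2 psi : trig psi ->
  measurable_fun setT (fun w : point * point => psi (row w.1 + row w.2)).
Proof.
move=> tpsi; pose k (w : point * point) : point := [tuple tnth w.1 i + tnth w.2 i | i < d].
have -> : (fun w : point * point => psi (row w.1 + row w.2)) = (fun y => psi (row y)) \o k.
  apply/funext => w /=; congr psi; apply/rowP => i.
  by rewrite !mxE tnth_mktuple.
apply: measurableT_comp; first exact: trig_measurable.
apply/measurable_fun_tnthP => i.
rewrite (_ : _ \o _ = fun w : point * point => tnth w.1 i + tnth w.2 i).
  apply: measurable_funD; first exact: (measurableT_comp (measurable_tnth i) measurable_fst).
  exact: (measurableT_comp (measurable_tnth i) measurable_snd).
by apply/funext => w /=; rewrite tnth_mktuple.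
Qed.

Lemma trig_bounded psi : trig psi -> exists2 B, 0 < B & forall x, `|psi x| <= B.
Proof. by move=> tpsi; exact: periodic_bounded (trig_continuous tpsi) (trig_periodic tpsi). Qed.

Lemma Rintegral_translate_coord psi i (t : R) : trig psi -> 0 <= t <= 1 ->
  \int[mu]_y psi (row y + t *: e i) = \int[mu]_y psi (row y).
Proof.
move=> tpsi t01; have [B B0 HB] := trig_bounded tpsi.
rewrite -(@Rintegral_shift R d i t B (fun y => psi (row y)))//.
- by apply: eq_Rintegral => y _; rewrite row_shift.
- exact: trig_measurable.
- by move=> y; rewrite row_shift scale1r trig_periodic.
Qed.

Lemma Rintegral_translate psi (s : seq 'I_d) (z : 'I_d -> R) : trig psi ->
  (forall i, 0 <= z i <= 1) ->
  \int[mu]_y psi (row y + \sum_(i <- s) z i *: e i) = \int[mu]_y psi (row y).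
Proof.
move=> tpsi z01; elim: s => [|i s IHs].
  by apply: eq_Rintegral => y _; rewrite big_nil addr0.
rewrite -IHs -(Rintegral_translate_coord i (trig_translate (\sum_(i <- s) z i *: e i) tpsi) (z01 i)).
by apply: eq_Rintegral => y _; rewrite big_cons addrA.
Qed.

Lemma row_sum (z : point) : row z = \sum_(i <- index_enum 'I_d) tnth z i *: e i.
Proof. by rewrite [LHS]row_sum_delta; apply: eq_bigr => i _; rewrite mxE. Qed.

Variables (v : point -> R) (g : 'I_d -> point -> R).
Hypothesis v0 : forall y, 0 <= v y.
Hypothesis iv : integrableR mu v.
Hypothesis mg : forall i, measurable_fun setT (g i).
Hypothesis g2 : forall i, (\int[mu]_y (`|g i y| `^ 2)%:E < +oo)%E.
Hypothesis vg : forall i, weak_partial i v (g i).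
Let Gi i := \int[mu]_y (g i y ^+ 2).
Let m := \int[mu]_y v y.

Let ig i : mu.-integrable setT (EFin \o g i).
Proof. by apply: (@Lp_integrable _ _ _ mu 2) => //; rewrite ler1n. Qed.

Let ig2 i : integrableR mu (fun y => g i y ^+ 2).
Proof.
apply/integrableP; split; first by apply/measurable_EFinP; exact: measurable_funX.
apply: le_lt_trans (g2 i); apply: eq_lee; apply: eq_integral => y _.
by rewrite /= normrX powR_mulrn.
Qed.

Let mv : measurable_fun setT v.
Proof. by apply/measurable_EFinP; exact: measurable_int iv. Qed.

Let ivp psi : trig psi -> integrableR mu (fun y => v y * psi (row y)).
Proof.
move=> tpsi; have [B B0 HB] := trig_bounded tpsi.
have := @bounded_integrableM _ _ _ mu (fun y => psi (row y)) v B (trig_measurable tpsi) (fun y => HB _) iv.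
by under [fun x => _ * v x]eq_fun do rewrite mulrC.
Qed.

Let ip psi : trig psi -> integrableR mu (fun y => psi (row y)).
Proof.
move=> tpsi; have [B B0 HB] := trig_bounded tpsi.
exact: bounded_integrable (trig_measurable tpsi) (fun y => HB _).
Qed.

Local Notation S psi := (\int[mu]_y (psi (row y) ^+ 2)).

Let trig2 psi : trig psi -> trig (fun x => psi x ^+ 2).
Proof. exact: trigX. Qed.

(** The definition of a weak derivative followed by a b <= tau a^2 + b^2 / (4 tau); the parameter
    [tau] stays free to be balanced later. *)
Lemma weak_partial_le psi i (tau : R) : trig psi -> 0 < tau ->
  `|\int[mu]_y (v y * 'D_(e i) psi (row y))| <= tau * Gi i + (4 * tau)^-1 * S psi.
Proof.
move=> tpsi tau0; rewrite (vg i (trig_smooth tpsi) (trig_periodic tpsi)) normrN.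
have [B B0 HB] := trig_bounded tpsi.
have igp : integrableR mu (fun y => g i y * psi (row y)).
  have := @bounded_integrableM _ _ _ mu (fun y => psi (row y)) (g i) B (trig_measurable tpsi) (fun y => HB _) (ig i).
  by under [fun x => _ * g i x]eq_fun do rewrite mulrC.
apply: le_trans (le_normr_Rintegral _ igp) _ => //.
have iS := ip (trig2 tpsi).
rewrite -RintegralZl// -RintegralZl// -RintegralD//; last 2 first.
- exact: integrableZ_EFin.
- exact: integrableZ_EFin.
apply: le_Rintegral => //; first exact: integrable_norm.
  by apply: integrableD_EFin; exact: integrableZ_EFin.
move=> y _; rewrite ler_norml.
have H (a b : R) : - (a * b) <= tau * a ^+ 2 + (4 * tau)^-1 * b ^+ 2.
  rewrite -[leRHS]opprK lerN2 -subr_ge0 opprK.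
  have -> : a * b + (tau * a ^+ 2 + (4 * tau)^-1 * b ^+ 2) = tau * (a + b / (2 * tau)) ^+ 2.
    by field; rewrite gt_eqF.
  by rewrite mulr_ge0 ?sqr_ge0// ltW.
by rewrite lerNl H/= -[leLHS]opprK -mulrN (le_trans (H _ _))// sqrrN.
Qed.

(** Instead of integrating a derivative, the translation by [h] is cut into [n] small ones. Each is
    bounded by [weak_partial_le] up to a Taylor error; these errors sum to at most B m / n, and [n]
    is arbitrary. *)
Lemma translate_step psi i (h tau : R) : trig psi -> 0 <= h <= 1 -> 0 < tau ->
  `|\int[mu]_y (v y * psi (row y + h *: e i)) - \int[mu]_y (v y * psi (row y))| <=
    tau * Gi i + (4 * tau)^-1 * S psi.
Proof.
move=> tpsi /andP[h0 h1] tau0; set E := (X in _ <= X).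
have E0 : 0 <= E.
  by rewrite addr_ge0// mulr_ge0 ?invr_ge0 ?mulr_ge0 ?(ltW tau0)// Rintegral_ge0// => y _; exact: sqr_ge0.
have m0 : 0 <= m by apply: Rintegral_ge0 => y _; exact: v0.
have [B B0 [_ _ TB]] := smooth_taylor i (trig_smooth tpsi) (trig_periodic tpsi).
suff H n : (0 < n)%N -> `|\int[mu]_y (v y * psi (row y + h *: e i)) - \int[mu]_y (v y * psi (row y))| <= E + B * m / n%:R.
  apply/ler_addgt0Pr => r r0; pose n := (Num.truncn (B * m / r)).+1.
  apply: le_trans (H n _) _ => //; rewrite lerD2l ler_pdivrMr ?ltr0n// -ler_pdivrMl// mulrC.
  by apply: ltW; exact: truncnS_gt.
move=> n0; have nR : 0 < n%:R :> R by rewrite ltr0n.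
pose t := h / n%:R; have t0 : 0 <= t by rewrite divr_ge0// ltW.
pose a k := \int[mu]_y (v y * psi (row y + (k%:R * t) *: e i)).
have -> : \int[mu]_y (v y * psi (row y + h *: e i)) = a n by rewrite /a /t mulrCA divff ?mulr1// gt_eqF.
have -> : \int[mu]_y (v y * psi (row y)) = a 0%N.
  by apply: eq_Rintegral => y _; rewrite mul0r scale0r addr0.
have tk (k : nat) j : trig (fun x => psi (x + (k%:R * t) *: e j)) by exact: trig_translate.
have step k : (k < n)%N -> `|a k.+1 - a k| <= t * E + B * t ^+ 2 * m.
  move=> kn; pose psi1 x := psi (x + (k.+1%:R * t) *: e i).
  have tp1 : trig psi1 by exact: tk.
  have k1 : 0 <= k.+1%:R * t <= 1.
    rewrite mulr_ge0//= /t mulrA ler_pdivrMr// mul1r.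
    by apply: le_trans (_ : k.+1%:R <= _); rewrite ?ler_piMr// ler_nat.
  have D1 := weak_partial_le i tp1 tau0.
  rewrite (_ : S psi1 = S psi) in D1; last exact: (Rintegral_translate_coord i (trig2 tpsi) k1).
  have tD1 := (trig_derive i tp1).2.
  have iD := ivp tD1; have i1 := ivp tp1; have i0 := ivp (tk k i).
  have -> : a k.+1 - a k = t * \int[mu]_y (v y * 'D_(e i) psi1 (row y)) -
      \int[mu]_y (v y * (psi (row y + (k%:R * t) *: e i) - psi1 (row y) + t * 'D_(e i) psi1 (row y))).
    have -> : (fun y => v y * (psi (row y + (k%:R * t) *: e i) - psi1 (row y) + t * 'D_(e i) psi1 (row y))) =
        (fun y => v y * psi (row y + (k%:R * t) *: e i) - v y * psi1 (row y) + t * (v y * 'D_(e i) psi1 (row y))).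
      by apply/funext => y; ring.
    rewrite RintegralD//; last 2 first.
    - exact: integrableB_EFin.
    - exact: integrableZ_EFin.
    rewrite RintegralB// RintegralZl// -/(a k) -/(a k.+1); ring.
  apply: le_trans (ler_normB _ _) _; apply: lerD.
    by rewrite normrM ger0_norm// ler_wpM2l.
  have ir : integrableR mu (fun y => v y * (psi (row y + (k%:R * t) *: e i) - psi1 (row y) + t * 'D_(e i) psi1 (row y))).
    have tneg : trig (fun x => psi (x + (k%:R * t) *: e i) + (-1) * psi1 x + t * 'D_(e i) psi1 x).
      by apply: trigD; [apply: trigD; [exact: tk|exact: trigZ]|exact: trigZ].
    by have := ivp tneg; under [fun x => _ * _]eq_fun do rewrite mulN1r.
  apply: le_trans (le_normr_Rintegral _ ir) _ => //.
  rewrite /m -RintegralZl//; apply: le_Rintegral => //; [exact: integrable_norm|exact: integrableZ_EFin|].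
  move=> y _; rewrite normrM ger0_norm// [leRHS]mulrC ler_wpM2l//.
  have := TB (row y + (k.+1%:R * t) *: e i) t t0; rewrite /psi1 derive_translate.
  have -> : row y + (k.+1%:R * t) *: e i - t *: e i = row y + (k%:R * t) *: e i.
    by rewrite -addrA -scalerBl -natr1 mulrDl mul1r addrK.
  by [].
rewrite -(telescope_sumr a (leq0n n)); apply: le_trans (ler_norm_sum _ _ _) _.
apply: (@le_trans _ _ (\sum_(0 <= k < n) (t * E + B * t ^+ 2 * m))).
  by rewrite !big_mkord; apply: ler_sum => k _; exact: step.
rewrite big_mkord sumr_const card_ord -[leLHS]mulr_natl mulrDr mulrA /t.
have -> : n%:R * (h / n%:R) = h by rewrite mulrCA divff ?mulr1// gt_eqF.
have -> : n%:R * (B * (h / n%:R) ^+ 2 * m) = h ^+ 2 * (B * m / n%:R) by field; rewrite gt_eqF.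
apply: lerD; first by rewrite ler_piMl.
by rewrite ler_piMl ?divr_ge0 ?mulr_ge0 ?(ltW B0) ?(ltW nR)// expr_le1.
Qed.

Lemma translate_le psi (s : seq 'I_d) (z : 'I_d -> R) (tau : R) : trig psi ->
  (forall i, 0 <= z i <= 1) -> 0 < tau ->
  `|\int[mu]_y (v y * psi (row y + \sum_(i <- s) z i *: e i)) - \int[mu]_y (v y * psi (row y))| <=
    \sum_(i <- s) (tau * Gi i + (4 * tau)^-1 * S psi).
Proof.
move=> tpsi z01 tau0; elim: s => [|i s IHs].
  rewrite !big_nil; have -> : (fun y => v y * psi (row y + 0)) = (fun y => v y * psi (row y)).
    by apply/funext => y; rewrite addr0.
  by rewrite subrr normr0.
rewrite big_cons; set w := \sum_(j <- s) z j *: e j in IHs *.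
have tw := trig_translate w tpsi.
have := translate_step i tw (z01 i) tau0.
rewrite (_ : S (fun x => psi (x + w)) = S psi); last exact: (Rintegral_translate s (trig2 tpsi) z01).
have -> : (fun y => v y * psi (row y + z i *: e i + w)) =
    (fun y => v y * psi (row y + (z i *: e i + w))).
  by apply/funext => y; rewrite addrA.
move=> H; rewrite big_cons -(subrKA (\int[mu]_y (v y * psi (row y + w)))).
by apply: le_trans (ler_normD _ _) _; rewrite lerD.
Qed.

(** Averaging [translate_le] over all shifts replaces the translated test function by its mean [c],
    so the pairing is at most [m * c] plus the cost of translating along [d] directions; the last of
    the [d.+1] terms comes from [m * c]. At this stage [v] is only known to be integrable, hence the
    dual form. *)
Lemma trig_duality psi (tau : R) : trig psi -> 0 < tau ->
  \int[mu]_y (v y * psi (row y)) <=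
    tau * (\sum_i Gi i + m ^+ 2) + (d.+1)%:R * ((4 * tau)^-1 * S psi).
Proof.
move=> tpsi tau0; have [B B0 HB] := trig_bounded tpsi.
pose c := \int[mu]_y psi (row y).
pose J := \int[mu]_y (v y * psi (row y)).
pose E := \sum_i (tau * Gi i + (4 * tau)^-1 * S psi).
(* Adding [B] makes the integrand nonnegative, for Tonelli's theorem; the contribution [m * B]
   cancels at the end. *)
pose f (w : point * point) : R := v w.1 * (psi (row w.1 + row w.2) + B).
have f0 w : 0 <= f w.
  by rewrite mulr_ge0// -lerBlDr sub0r; have := HB (row w.1 + row w.2); rewrite ler_norml => /andP[].
have mf : measurable_fun setT f.
  apply: measurable_funM; first exact: (measurableT_comp mv measurable_fst).
  by apply: measurable_funD => //; exact: trig_measurable2.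
have ic (k : R) : integrableR mu (fun _ : point => k) := ip (@trig_cst R d k).
have cS : c ^+ 2 <= S psi.
  have H : \int[mu]_y (2 * c * psi (row y) - c ^+ 2) <= S psi.
    apply: le_Rintegral => //.
    - by apply: integrableB_EFin; [apply: integrableZ_EFin; exact: ip|exact: ic].
    - exact: (ip (trig2 tpsi)).
    - by move=> y _; have := sqr_ge0 (psi (row y) - c); rewrite sqrrB -mulr_natl; lra.
  move: H; rewrite RintegralB; [|exact: measurableT|by apply: integrableZ_EFin; exact: ip|exact: ic].
  rewrite RintegralZl//; last exact: ip.
  by rewrite Rintegral_cst// [fine _]/= probability_setT mulr1 -/c -mulrA -expr2 mulr_natl mulr2n addrK.
have mc : m * c <= tau * m ^+ 2 + (4 * tau)^-1 * S psi.
  apply: (@le_trans _ _ (tau * m ^+ 2 + (4 * tau)^-1 * c ^+ 2)); last first.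
    by rewrite lerD2l ler_wpM2l// invr_ge0 mulr_ge0// ltW.
  rewrite -subr_ge0.
  have -> : tau * m ^+ 2 + (4 * tau)^-1 * c ^+ 2 - m * c = tau * (m - c / (2 * tau)) ^+ 2.
    by field; rewrite gt_eqF.
  by rewrite mulr_ge0 ?sqr_ge0// ltW.
have tB w : trig (fun x => psi (x + w) + B) by apply: trigD; [exact: trig_translate|exact: trig_cst].
have RE := @integral_Rintegral _ _ _ mu.
have inner z : (forall i, 0 < tnth z i < 1) -> ((J - E + m * B)%:E <= \int[mu]_y (f (y, z))%:E)%E.
  move=> zc; have z01 i : 0 <= tnth z i <= 1 by have /andP[? ?] := zc i; rewrite !ltW.
  have itz := ivp (tB (row z)); rewrite (RE _ itz) lee_fin.
  have -> : (fun y => v y * (psi (row y + row z) + B)) = (fun y => v y * psi (row y + row z) + B * v y).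
    by apply/funext => y; rewrite mulrDr [v y * B]mulrC.
  rewrite RintegralD; [|exact: measurableT|exact: ivp (trig_translate (row z) tpsi)|exact: integrableZ_EFin].
  rewrite RintegralZl// [B * _]mulrC lerD2r.
  have := translate_le (index_enum 'I_d) tpsi z01 tau0; rewrite -row_sum -/J -/E.
  by rewrite ler_norml => /andP[H _]; rewrite lerBlDr -lerBlDl -opprB lerNl.
have low : ((Num.max 0 (J - E + m * B))%:E <= \int[mu]_z \int[mu]_y (f (y, z))%:E)%E.
  have -> : (Num.max 0 (J - E + m * B))%:E = (\int[mu]_z (Num.max 0 (J - E + m * B))%:E)%E :> \bar R.
    by rewrite (integral_cst _ measurableT (Num.max 0 (J - E + m * B))%:E) [Z in (_ * Z)%E]probability_setT mule1.
  have i0 z : (0 <= \int[mu]_y (f (y, z))%:E)%E by apply: integral_ge0 => y _; rewrite lee_fin.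
  apply: ae_ge0_le_integral => //.
  - by move=> z _; rewrite lee_fin le_max lexx.
  - have mF : measurable_fun setT (EFin \o f) by exact/measurable_EFinP.
    exact: (@measurable_fun_fubini_tonelli_G _ _ _ _ _ mu (EFin \o f) mF (fun w => f0 w)).
  - apply: ae_imp torus_ae_cube _ => z zc _; have := inner z zc.
    by have [h|h] := leP (J - E + m * B) 0 => H.
have high : (\int[mu]_y \int[mu]_z (f (y, z))%:E = (m * (c + B))%:E)%E.
  have -> : (m * (c + B))%:E = (\int[mu]_y (v y * (c + B))%:E)%E.
    rewrite (RE (fun y => v y * (c + B))); last exact: (ivp (@trig_cst R d (c + B))).
    by congr (_%:E); rewrite -RintegralZr.
  apply: ae_eq_integral => //.
  - have mF : measurable_fun setT (EFin \o f) by exact/measurable_EFinP.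
    exact: (@measurable_fun_fubini_tonelli_F _ _ _ _ _ mu (EFin \o f) mF (fun w => f0 w)).
  - by apply/measurable_EFinP; apply: measurable_funM.
  apply: ae_imp torus_ae_cube _ => y yc _.
  have y01 i : 0 <= tnth y i <= 1 by have /andP[? ?] := yc i; rewrite !ltW.
  have tBy : trig (fun x => v y * (psi (x + row y) + B)) by exact: trigZ.
  have -> : (fun z => (f (y, z))%:E) = (fun z => (v y * (psi (row z + row y) + B))%:E).
    by apply/funext => z; rewrite /f/= [row y + _]addrC.
  rewrite (RE _ (ip tBy)) RintegralZl//; last exact: (ip (tB _)).
  rewrite RintegralD; [|exact: measurableT|exact: ip (trig_translate (row y) tpsi)|exact: ic].
  have := Rintegral_translate (index_enum 'I_d) tpsi y01; rewrite -row_sum => ->.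
  by rewrite Rintegral_cst// [fine _]/= probability_setT mulr1.
have mix : (\int[mu]_z \int[mu]_y (f (y, z))%:E = \int[mu]_y \int[mu]_z (f (y, z))%:E)%E.
  have mF : measurable_fun setT (EFin \o f) by exact/measurable_EFinP.
  have F0 w : (0 <= (EFin \o f) w)%E by rewrite lee_fin.
  have H1 := @fubini_tonelli1 _ _ _ _ _ mu mu (EFin \o f) mF F0.
  by rewrite (@fubini_tonelli2 _ _ _ _ _ mu mu (EFin \o f) mF F0) in H1.
have JE : J <= E + m * c.
  move: low; rewrite mix high lee_fin ge_max => /andP[_].
  by rewrite mulrDr lerD2r lerBlDl.
apply: le_trans JE _; apply: le_trans (lerD (lexx E) mc) _.
rewrite /E big_split/= sumr_const card_ord -mulr_sumr -[X in _ + X + _]mulr_natl.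
clear low high mix inner; apply: eq_ler; rewrite -[d.+1]addn1 natrD; ring.
Qed.

End translations.

(** * Density of trigonometric polynomials *)

Section threshold.
Variable R : realType.

Lemma bernoulli_le (x : R) n : 0 <= x <= 1 -> 1 - n%:R * x <= (1 - x) ^+ n.
Proof.
move=> /andP[x0 x1]; elim: n => [|n IHn]; first by rewrite mul0r subr0 expr0.
rewrite exprS; apply: (@le_trans _ _ ((1 - x) * (1 - n%:R * x))); last by rewrite ler_wpM2l// subr_ge0.
rewrite -subr_ge0 -[n.+1]addn1 natrD.
have -> : (1 - x) * (1 - n%:R * x) - (1 - (n%:R + 1%:R) * x) = n%:R * (x * x) by ring.
by rewrite !mulr_ge0.
Qed.

Lemma bernoulli_ge (x : R) n : 0 <= x <= 1 -> (1 - x) ^+ n * (1 + n%:R * x) <= 1.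
Proof.
move=> /andP[x0 x1]; elim: n => [|n IHn]; first by rewrite mul0r addr0 expr0 mul1r.
apply: le_trans IHn; rewrite exprSr -mulrA ler_wpM2l ?exprn_ge0 ?subr_ge0//.
rewrite -subr_ge0 -[n.+1]addn1 natrD.
have -> : 1 + n%:R * x - (1 - x) * (1 + (n%:R + 1%:R) * x) = (n%:R + 1) * (x * x) by ring.
by rewrite !mulr_ge0// addr_ge0.
Qed.

(* Turns a trigonometric polynomial with values in [0, 1] into an indicator. *)
Lemma expr_threshold_cvg (z : R) : 0 <= z <= 1 -> z != 2^-1 ->
  (1 - z ^+ n) ^+ (2 ^ n) @[n --> \oo] --> ((z < 2^-1)%R%:R : R).
Proof.
move=> /andP[z0 z1] zn2.
have zn n : 0 <= z ^+ n <= 1 by rewrite exprn_ge0//= exprn_ile1.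
have E n : (2 ^ n)%:R * z ^+ n = (2 * z) ^+ n by rewrite natrX exprMn.
have [zl|zg|ze] := ltgtP z 2^-1; last by rewrite ze eqxx in zn2.
  apply: (@squeeze_cvgr _ _ _ _ (fun n => 1 - (2 * z) ^+ n) (fun=> 1)).
  - apply: nearW => n; rewrite -E bernoulli_le//= exprn_ile1// ?subr_ge0 ?lerBlDr ?lerDl;
      by have /andP[] := zn n.
  - rewrite -[X in _ --> X]subr0; apply: cvgB; first exact: cvg_cst.
    apply: cvg_expr; rewrite ger0_norm ?mulr_ge0//.
    by rewrite -ltr_pdivlMl// mulr1.
  - exact: cvg_cst.
apply: (@squeeze_cvgr _ _ _ _ (fun=> 0) (fun n => (2 * z)^-1 ^+ n)).
- apply: nearW => n; have /andP[n0 n1] := zn n.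
  have z2 : 0 < (2 * z) ^+ n by rewrite exprn_gt0// mulr_gt0// (lt_trans _ zg).
  rewrite exprn_ge0 ?subr_ge0//= exprVn -[leRHS]mul1r ler_pdivlMr//.
  apply: le_trans (bernoulli_ge (2 ^ n) (zn n)); rewrite E ler_wpM2l ?exprn_ge0 ?subr_ge0//.
  by rewrite lerDr.
- exact: cvg_cst.
- apply: cvg_expr; have z2 : 1 < 2 * z by rewrite -ltr_pdivrMl// mulr1.
  by rewrite ger0_norm ?invr_ge0 ?(ltW (lt_trans ltr01 z2))// invf_lt1// (lt_trans ltr01 z2).
Qed.

End threshold.

Section density.
Variables (R : realType) (d : nat).
Local Notation V := 'rV[R]_d.
Local Notation point := (torus_point R d).
Local Notation mu := (torus_measure R d).
Local Notation row := (@row_of_point R d).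
Variables (v : point -> R) (v0 : forall y, 0 <= v y) (iv : integrableR mu v).
Implicit Types (f h : point -> R) (psi : V -> R).

Let mv : measurable_fun setT v.
Proof. by apply/measurable_EFinP; exact: measurable_int iv. Qed.

(** The weight 1 + v controls at once the errors in the two integrals of [trig_duality]: against
    [v], and of the square of the test function. *)
Let wdist f h : \bar R := (\int[mu]_y ((1 + v y) * `|f y - h y|)%:E)%E.

Let w0 y : 0 <= 1 + v y. Proof. by rewrite addr_ge0. Qed.

Let mw f h : measurable_fun setT f -> measurable_fun setT h ->
  measurable_fun setT (fun y => (1 + v y) * `|f y - h y|).
Proof.
move=> mf mh; apply: measurable_funM; first exact: measurable_funD.
by apply: measurableT_comp => //; exact: measurable_funB.
Qed.

Let wdist_add f1 h1 f2 h2 f3 h3 : measurable_fun setT f1 -> measurable_fun setT h1 ->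
  measurable_fun setT f2 -> measurable_fun setT h2 -> measurable_fun setT f3 -> measurable_fun setT h3 ->
  (forall y, `|f1 y - h1 y| <= `|f2 y - h2 y| + `|f3 y - h3 y|) ->
  (wdist f1 h1 <= wdist f2 h2 + wdist f3 h3)%E.
Proof.
move=> *; have -> : (wdist f2 h2 + wdist f3 h3 = 1%:E * (wdist f2 h2 + wdist f3 h3) + 0%:E * wdist f2 h2)%E.
  by rewrite mul1e mul0e adde0.
apply: integral_le_combination; [exact: ler01|exact: lexx|exact: mw..| | | | |].
- by move=> y; exact: mulr_ge0.
- by move=> y; exact: mulr_ge0.
- by move=> y; exact: mulr_ge0.
- by move=> y; exact: mulr_ge0.
- by move=> y; rewrite mul0r addr0 mul1r -mulrDr ler_wpM2l.
Qed.

Definition approximable f := [/\ measurable_fun setT f, forall y, 0 <= f y <= 1 &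
  forall r : R, 0 < r -> exists psi, [/\ trig psi, forall x, 0 <= psi x <= 1 &
    (wdist f (fun y => psi (row y)) <= r%:E)%E]].

Lemma approximable_trig psi : trig psi -> (forall x, 0 <= psi x <= 1) ->
  approximable (fun y => psi (row y)).
Proof.
move=> tp p01; split; [exact: trig_measurable|by move=> y|].
move=> r r0; exists psi; split => //; rewrite /wdist.
rewrite (eq_integral (cst 0%E)); first by rewrite integral0 lee_fin ltW.
by move=> y _; rewrite subrr normr0 mulr0.
Qed.

Lemma approximableC f : approximable f -> approximable (fun y => 1 - f y).
Proof.
move=> [mf f01 fP]; split; first exact: measurable_funB.
  by move=> y; have /andP[h1 h2] := f01 y; rewrite subr_ge0 h2 lerBlDr lerDl.
move=> r /fP[psi [tp p01 H]]; exists (fun x => 1 + (-1) * psi x); split.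
- by apply: trigD; [exact: trig_cst|exact: trigZ].
- by move=> x; have /andP[h1 h2] := p01 x; rewrite mulN1r subr_ge0 h2 lerBlDr lerDl.
- apply: le_trans H; apply: eq_lee; apply: eq_integral => y _; congr (_%:E); congr (_ * _).
  have -> : 1 - f y - (1 + -1 * psi (row y)) = psi (row y) - f y by ring.
  exact: distrC.
Qed.

Lemma approximableM f h : approximable f -> approximable h -> approximable (fun y => f y * h y).
Proof.
move=> [mf f01 fP] [mh h01 hP]; split; first exact: measurable_funM.
  move=> y; have /andP[a1 a2] := f01 y; have /andP[b1 b2] := h01 y.
  by rewrite mulr_ge0//= -[leRHS]mul1r ler_pM.
move=> r r0; have r2 : 0 < r / 2 by rewrite divr_gt0.
have [psi [tp p01 H]] := fP _ r2; have [phi [tq q01 H']] := hP _ r2.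
exists (fun x => psi x * phi x); split; first exact: trigM.
  move=> y; have /andP[a1 a2] := p01 y; have /andP[b1 b2] := q01 y.
  by rewrite mulr_ge0//= -[leRHS]mul1r ler_pM.
have mp := trig_measurable tp; have mq := trig_measurable tq.
have pq := trig_measurable (trigM tp tq).
apply: (@le_trans _ _ ((r / 2)%:E + (r / 2)%:E)%E); last by rewrite -EFinD lee_fin -splitr.
apply: le_trans (leeD H H'); apply: wdist_add => //; first exact: measurable_funM.
move=> y; have /andP[a1 a2] := f01 y; have /andP[b1 b2] := q01 (row y).
have -> : f y * h y - psi (row y) * phi (row y) =
  phi (row y) * (f y - psi (row y)) + f y * (h y - phi (row y)) by ring.
apply: le_trans (ler_normD _ _) _; rewrite !normrM (ger0_norm a1) (ger0_norm b1).
by rewrite lerD// ler_piMl.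
Qed.

Lemma approximable_mean f h (t : R) : 0 <= t <= 1 -> approximable f -> approximable h ->
  approximable (fun y => t * f y + (1 - t) * h y).
Proof.
move=> /andP[t0 t1] [mf f01 fP] [mh h01 hP].
have s0 : 0 <= 1 - t by rewrite subr_ge0.
have mean (a b : R) : 0 <= a <= 1 -> 0 <= b <= 1 -> 0 <= t * a + (1 - t) * b <= 1.
  move=> /andP[a1 a2] /andP[b1 b2]; rewrite addr_ge0 ?mulr_ge0//=.
  apply: (@le_trans _ _ (t * 1 + (1 - t) * 1)); last by rewrite !mulr1 addrC subrK.
  by apply: lerD; exact: ler_wpM2l.
split; first by apply: measurable_funD; exact: measurable_funM.
  by move=> y; exact: mean.
move=> r r0; have r2 : 0 < r / 2 by rewrite divr_gt0.
have [psi [tp p01 H]] := fP _ r2; have [phi [tq q01 H']] := hP _ r2.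
have tm := trigD (trigZ t tp) (trigZ (1 - t) tq).
exists (fun x => t * psi x + (1 - t) * phi x); split => //; first by move=> x; exact: mean.
have mp := trig_measurable tp; have mq := trig_measurable tq.
have mm := trig_measurable tm.
apply: (@le_trans _ _ ((r / 2)%:E + (r / 2)%:E)%E); last by rewrite -EFinD lee_fin -splitr.
apply: le_trans (leeD H H'); apply: wdist_add => //.
  by apply: measurable_funD; exact: measurable_funM.
move=> y.
have -> : t * f y + (1 - t) * h y - (t * psi (row y) + (1 - t) * phi (row y)) =
  t * (f y - psi (row y)) + (1 - t) * (h y - phi (row y)) by ring.
apply: le_trans (ler_normD _ _) _; rewrite !normrM (ger0_norm t0) (ger0_norm s0).
by rewrite lerD// ler_piMl// lerBlDr lerDl.
Qed.

Lemma approximable_limit (f : nat -> point -> R) h : (forall n, approximable (f n)) ->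
  measurable_fun setT h -> (forall y, 0 <= h y <= 1) ->
  {ae mu, forall y, f n y @[n --> \oo] --> h y} -> approximable h.
Proof.
move=> fA mh h01 fh; split => // r r0; have r2 : 0 < r / 2 by rewrite divr_gt0.
have mf n : measurable_fun setT (f n) by have [] := fA n.
have f01 n y : 0 <= f n y <= 1 by have [] := fA n.
have d1 n y : `|h y - f n y| <= 1.
  have /andP[a1 a2] := h01 y; have /andP[b1 b2] := f01 n y.
  by rewrite ler_norml; apply/andP; split; lra.
have ig : integrableR mu (fun y => 1 + v y).
  by apply: integrableD_EFin => //; apply: (@bounded_integrable _ _ _ mu _ 1) => // y; rewrite normr1.
pose k n y := ((1 + v y) * `|h y - f n y|)%:E.
have mk n : measurable_fun setT (k n) by apply/measurable_EFinP; exact: mw.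
have k0 n y : (0 <= k n y)%E by rewrite lee_fin mulr_ge0.
have [|||| _ H _] := @dominated_convergence _ _ _ mu setT measurableT k (cst 0%E) (fun y => (1 + v y)%:E) mk.
- exact: measurable_cst.
- apply: ae_imp fh _ => y fy _; apply/fine_cvgP; split; first exact: nearW.
  rewrite -[X in _ --> X](mulr0 (1 + v y)); apply: cvgM; first exact: cvg_cst.
  rewrite -(normr0 R) -(subrr (h y)); apply: cvg_norm; apply: cvgB => //; exact: cvg_cst.
- exact: ig.
- apply: nearW => y n _; rewrite gee0_abs ?k0// lee_fin -[leRHS]mulr1 ler_wpM2l//.
have kE n : (\int[mu]_y `|k n y - cst 0 y| = wdist h (f n))%E.
  by apply: eq_integral => y _; rewrite /cst/= oppr0 addr0 ger0_norm// mulr_ge0.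
have [n Hn] : exists n, (wdist h (f n) <= (r / 2)%:E)%E.
  have /fine_cvgP[[J1 _ F1] /cvgrPdist_le/(_ _ r2)[J2 _ F2]] := H.
  exists (maxn J1 J2); have := F2 _ (leq_maxr J1 J2); have := F1 _ (leq_maxl J1 J2).
  rewrite /= kE sub0r normrN => fn; rewrite -lee_fin => {}H; rewrite -(fineK fn).
  by apply: le_trans H; rewrite lee_fin ler_norm.
have [_ _ /(_ _ r2)[psi [tp p01 Hp]]] := fA n.
exists psi; split => //.
have mp := trig_measurable tp.
apply: (@le_trans _ _ ((r / 2)%:E + (r / 2)%:E)%E); last by rewrite -EFinD lee_fin -splitr.
apply: le_trans (leeD Hn Hp); apply: wdist_add => //.
by move=> y; rewrite -(subrKA (f n y)) ler_normD.
Qed.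

Lemma approximable_ae f h : approximable f -> measurable_fun setT h -> (forall y, 0 <= h y <= 1) ->
  {ae mu, forall y, f y = h y} -> approximable h.
Proof.
move=> fA mh h01 fh; apply: (@approximable_limit (fun=> f)) => //.
by apply: ae_imp fh _ => y ->; exact: cvg_cst.
Qed.

Lemma approximable_cst (c : R) : 0 <= c <= 1 -> approximable (fun=> c).
Proof. by move=> c01; have H := @approximable_trig (fun=> c) (@trig_cst R d c) (fun=> c01); exact: H. Qed.

Definition approximable_set (A : set point) := measurable A /\ approximable \1_A.

Let indic01 (A : set point) y : 0 <= (\1_A y : R) <= 1.
Proof. by rewrite indicE; case: (_ \in _); rewrite ?lexx ler01. Qed.

Lemma approximable_setC A : approximable_set A -> approximable_set (~` A).
Proof.
move=> [mA HA]; split; first exact: measurableC.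
have := approximableC HA; congr approximable; apply/funext => y; rewrite !indicE.
by have [Ay|nA] := pselect (A y); [rewrite (mem_set Ay) memNset ?subrr//= => /(_ Ay)
  |rewrite (memNset nA) mem_set ?subr0].
Qed.

Lemma approximable_bigcap (A : nat -> set point) : (forall n, approximable_set (A n)) ->
  approximable_set (\bigcap_n A n).
Proof.
move=> HA; have mA : measurable (\bigcap_n A n) by apply: bigcapT_measurable => n; have [] := HA n.
split => //; apply: (@approximable_limit (fun n y => \prod_(k < n) \1_(A k) y)).
- elim => [|n IHn].
    have := @approximable_cst 1; rewrite ler01 lexx => /(_ isT); congr approximable.
    by apply/funext => y; rewrite big_ord0.
  have := approximableM IHn (HA n).2; congr approximable.
  by apply/funext => y; rewrite big_ord_recr.
- exact: measurable_indic.
- exact: indic01.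
- apply: nearW => y; have [Ay|nA] := pselect ((\bigcap_n A n) y).
    rewrite indicE mem_set// (_ : (fun n => _) = fun=> 1); first exact: cvg_cst.
    by apply/funext => n; rewrite big1// => k _; rewrite indicE mem_set//; exact: Ay.
  rewrite indicE memNset//; have [k nk] : exists k, ~ A k y.
    by apply: contrapT => H; apply: nA => k _; apply: contrapT => nk; apply: H; exists k.
  apply: cvg_near_cst; exists k.+1 => // n kn /=.
  by rewrite (bigD1 (Ordinal kn))//= indicE memNset// mul0r.
Qed.

(** Complements correspond to 1 - f, countable intersections to limits of products; it remains to
    treat half-spaces, which generate the product sigma-algebra. *)
Lemma approximable_sigma_algebra : sigma_algebra setT approximable_set.
Proof.
split.
- split => //; have := @approximable_cst 0; rewrite ler01 lexx => /(_ isT); congr approximable.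
  by apply/funext => y; rewrite indic0.
- by move=> A HA; rewrite setTD; exact: approximable_setC.
- move=> A HA; rewrite -[\bigcup_k _]setCK setC_bigcup.
  by apply: approximable_setC; apply: approximable_bigcap => n; exact: approximable_setC.
Qed.

Lemma torus_ae_neq i (q : R) : {ae mu, forall y : point, tnth y i <> q}.
Proof.
exists ((fun y => tnth y i) @^-1` [set q]); split.
- by rewrite -[_ @^-1` _]setTI; apply: (@measurable_tnth _ _ d i).
- apply: torus_coord_null; first exact: measurable_set1.
  have := @ge0_integral_unif R (fun x => (\1_([set q]) x)%:E).
  rewrite integral_indic// setIT => -> //; last by apply/measurable_EFinP; exact: measurable_indic.
  rewrite integral_indic//; apply/eqP; rewrite eq_le measure_ge0 andbT.
  rewrite -[X in (_ <= X)%E](lebesgue_measure_set1 q); apply: le_measure; rewrite ?inE//.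
  exact: measurableI.
- by move=> y /= /contrapT.
Qed.

Lemma approximable_ray i (q : R) : approximable_set ((fun y => tnth y i) @^-1` `]-oo, q[).
Proof.
have mA : measurable ((fun y : point => tnth y i) @^-1` `]-oo, q[).
  by rewrite -[_ @^-1` _]setTI; apply: (@measurable_tnth _ _ d i) => //.
split => //; set A := _ @^-1` _.
have AE y : (\1_A y : R) = (tnth y i < q)%R%:R.
  by rewrite indicE; congr (_%:R); congr nat_of_bool; apply/idP/idP; rewrite inE /A/= in_itv.
have [q0|q0] := leP q 0.
  apply: (@approximable_ae (fun=> 0)) => //; first by apply: approximable_cst; rewrite lexx ler01.
  by apply: ae_imp (torus_ae_cube _ _) _ => y /(_ i)/andP[y0 y1]; rewrite AE ltNge (le_trans q0 (ltW y0)).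
have [q1|q1] := leP 1 q.
  apply: (@approximable_ae (fun=> 1)) => //; first by apply: approximable_cst; rewrite lexx ler01.
  by apply: ae_imp (torus_ae_cube _ _) _ => y /(_ i)/andP[y0 y1]; rewrite AE (lt_le_trans y1 q1).
(* This equals 1/2 plus half of sin(pi y) sin(pi (y - q)), where y is the [i]-th coordinate: both
   sines change sign under y + 1, so [z] is periodic, and for y in (0, 1) it is below 1/2 exactly
   when y < q. Powers then sharpen it to the indicator. *)
pose z (x : V) := 4^-1 * (2 + cos (pi * q)) + (- 4^-1) * cos (2 * pi * x 0 i + (- (pi * q))).
have tz : trig z by apply: trigD; [exact: trig_cst|apply: trigZ; exact: trig_cos].
have z01 x : 0 <= z x <= 1.
  rewrite /z; have := cos_geN1 (pi * q); have := cos_le1 (pi * q).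
  have := cos_geN1 (2 * pi * x 0 i + (- (pi * q))); have := cos_le1 (2 * pi * x 0 i + (- (pi * q))).
  by move: (cos _) (cos _) => a b h1 h2 h3 h4; apply/andP; split; lra.
have zE (y : point) : z (row y) = 2^-1 + 2^-1 * (sin (pi * tnth y i) * sin (pi * tnth y i - pi * q)).
  rewrite /z row_of_pointE.
  have -> : 2 * pi * tnth y i + - (pi * q) = pi * tnth y i + (pi * tnth y i - pi * q) by ring.
  have {1}-> : pi * q = pi * tnth y i - (pi * tnth y i - pi * q) by ring.
  have gen (a b : R) : 4^-1 * (2 + cos (a - b)) + - 4^-1 * cos (a + b) = 2^-1 + 2^-1 * (sin a * sin b).
    by rewrite cosB cosD; field.
  exact: gen.
have tm n : trig (fun x => (1 + (-1) * z x ^+ n) ^+ (2 ^ n)).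
  by apply: trigX; apply: trigD; [exact: trig_cst|apply: trigZ; exact: trigX].
apply: (@approximable_limit (fun n y => (1 + (-1) * z (row y) ^+ n) ^+ (2 ^ n))) => //.
- move=> n; apply: approximable_trig (tm n) _ => x; have /andP[a1 a2] := z01 x.
  have zn : 0 <= 1 - z x ^+ n <= 1 by rewrite subr_ge0 exprn_ile1//= lerBlDr lerDl exprn_ge0.
  by rewrite mulN1r; have /andP[b1 b2] := zn; rewrite exprn_ge0//= exprn_ile1.
apply: ae_imp2 (torus_ae_cube _ _) (torus_ae_neq i q) _ => y /(_ i)/andP[y0 y1] yq.
have s1 : 0 < sin (pi * tnth y i).
  by apply: sin_gt0_pi; rewrite mulr_gt0 ?pi_gt0//= -[ltRHS]mulr1 ltr_pM2l ?pi_gt0.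
have zy : (z (row y) < 2^-1) = (tnth y i < q) /\ z (row y) != 2^-1.
  rewrite zE -mulrBr; have [yl|yg|ye] := ltgtP (tnth y i) q; last by case: yq.
    have s2 : 0 < sin (pi * (q - tnth y i)).
      apply: sin_gt0_pi; rewrite mulr_gt0 ?pi_gt0 ?subr_gt0//= -[ltRHS]mulr1 ltr_pM2l ?pi_gt0//; lra.
    have : sin (pi * tnth y i) * sin (pi * (tnth y i - q)) < 0.
      by rewrite -opprB mulrN sinN mulrN oppr_lt0 mulr_gt0.
    move: (sin _ * sin _) => a a0; split; first by apply/idP; lra.
    by rewrite lt_eqF//; lra.
  have s2 : 0 < sin (pi * (tnth y i - q)).
    apply: sin_gt0_pi; rewrite mulr_gt0 ?pi_gt0 ?subr_gt0//= -[ltRHS]mulr1 ltr_pM2l ?pi_gt0//; lra.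
  have := mulr_gt0 s1 s2; move: (sin _ * sin _) => a a0; split; first by apply/negbTE; rewrite -leNgt; lra.
  by rewrite gt_eqF//; lra.
rewrite AE -zy.1; under [fun n => _]eq_fun do rewrite mulN1r.
exact: (expr_threshold_cvg (z01 _) zy.2).
Qed.

Lemma approximable_measurable (A : set point) : measurable A -> approximable_set A.
Proof.
move=> mA; have SA := approximable_sigma_algebra.
apply: (smallest_sub SA _ mA); apply: (big_ind (fun G => G `<=` approximable_set)) => [//|B C HB HC D [/HB|/HC]//|i _].
move=> _ [B mB <-]; rewrite setTI.
pose H := [set B : set R | approximable_set ((fun y : point => tnth y i) @^-1` B)].
have SH : sigma_algebra setT H.
  have [S0 SC SU] := SA; split; first exact: S0.
    by move=> C HC; rewrite /H/= setTD preimage_setC -setTD; exact: SC.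
  by move=> C HC; rewrite /H/= preimage_bigcup; exact: SU.
have mB' : <<s @RGenInftyO.G R >> B by change ((@RGenInftyO.G R).-sigma.-measurable B); rewrite -RGenInftyO.measurableE; exact: mB.
by apply: (smallest_sub SH _ mB') => _ [q ->]; exact: approximable_ray.
Qed.

Lemma approximable_fun f : measurable_fun setT f -> (forall y, 0 <= f y <= 1) -> approximable f.
Proof.
move=> mf f01.
(* The average over k < M of the indicators of k / M < f approximates [f] to within 1 / M. *)
pose I k M y : R := (k%:R / M%:R < f y)%R%:R.
have IA k M : approximable (I k M).
  have mA : measurable [set y | k%:R / M%:R < f y] by exact: measurable_gt_set.
  have := (approximable_measurable mA).2; congr approximable; apply/funext => y.
  by rewrite indicE /I; congr (_%:R); congr nat_of_bool; apply/idP/idP; rewrite inE.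
have mean M n : approximable (fun y => (\sum_(k < n.+1) I k M y) / n.+1%:R).
  elim: n => [|n IHn].
    by have := IA 0%N M; congr approximable; apply/funext => y; rewrite big_ord1 divr1.
  pose t : R := n.+2%:R^-1.
  have t01 : 0 <= t <= 1 by rewrite invr_ge0 ler0n/= invf_le1// ler1n.
  have := approximable_mean t01 (IA n.+1 M) IHn; congr approximable; apply/funext => y.
  rewrite [in RHS]big_ord_recr/= /t [RHS]mulrDl addrC; congr (_ + _); last by rewrite mulrC.
  have E2 : n.+2%:R = n.+1%:R + 1 :> R by rewrite -[n.+2]addn1 natrD.
  rewrite E2.
  have gen (a S : R) : a != 0 -> a + 1 != 0 -> (1 - (a + 1)^-1) * (S / a) = S / (a + 1).
    by move=> a0 a1; field; rewrite a0 a1.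
  by apply: gen => //; rewrite pnatr_eq0.
apply: (@approximable_limit (fun n y => (\sum_(k < n.+1) I k n.+1 y) / n.+1%:R)) => //.
apply: nearW => y; apply/cvgrPdist_le => r r0; exists (Num.truncn r^-1) => // n /= rn.
apply: (@le_trans _ _ n.+1%:R^-1); last first.
  rewrite -[leRHS]invrK lef_pV2 ?posrE ?invr_gt0//.
  by apply: ltW; apply: lt_le_trans (truncnS_gt _) _; rewrite ler_nat ltnS.
have /andP[y0 y1] := f01 y.
(* The sum is the least integer above [(n + 1) f y], capped by [m]. *)
have count m : (m <= n.+1)%N -> let s := \sum_(k < m) I k n.+1 y in
   s <= n.+1%:R * f y + 1 /\ (n.+1%:R * f y <= s \/ s = m%:R).
  elim: m => [|m IHm] mn /=.
    by rewrite big_ord0; split; [rewrite addr_ge0// mulr_ge0|right].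
  have [h1 h2] := IHm (ltnW mn); rewrite big_ord_recr/= {2 4 6}/I ltr_pdivrMr// [f y * _]mulrC.
  case: ltP => hm; last by rewrite addr0; split => //; left; case: h2 => // ->.
  split.
    case: h2 => [h2|->]; last by rewrite lerD2r ltW.
    have hs : \sum_(k < m) I k n.+1 y <= m%:R.
      rewrite -[leRHS]mulr1 mulrC -[m in leRHS]card_ord mulr_natr -sumr_const; apply: ler_sum => k _.
      by rewrite /I; case: (_ < _); rewrite ?ler01.
    by rewrite lerD2r (le_trans hs)// ltW.
  case: h2 => [h2|->]; last by right; rewrite -natr1.
  by left; rewrite (le_trans h2)// lerDl.
have [h1 h2] := count n.+1 (leqnn _).
rewrite -[leRHS]mul1r -[f y](@mulfK _ n.+1%:R) ?gt_eqF// -mulrBl normrM [`|_^-1|]ger0_norm ?invr_ge0//.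
rewrite ler_wpM2r ?invr_ge0// ler_norml [f y * _]mulrC; apply/andP; split.
  by rewrite lerBrDl -lerBrDr opprK.
rewrite lerBlDl; case: h2 => [h2|->]; first by rewrite (le_trans h2)// lerDl.
by apply: (@le_trans _ _ n.+1%:R); rewrite ?lerDl// -[leRHS]mulr1 ler_wpM2l.
Qed.

End density.

(** * From a weak gradient to an L^alpha bound on a time slice *)

(** The optimal value is t = x / (2 p). For p = 0 the value t = (q + 1) / x contradicts x > 0. *)
Lemma discriminant_le (R : realType) (x p q : R) : 0 <= p -> 0 <= q ->
  (forall t : R, 0 < t -> x <= t * p + q / (4 * t)) -> 0 <= x -> x ^+ 2 <= p * q.
Proof.
move=> p0 q0 H; rewrite le_eqVlt => /predU1P[<-|x0]; first by rewrite expr0n mulr_ge0.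
have [pp|pn] := ltP 0 p.
  have t0 : 0 < x / (2 * p) by rewrite divr_gt0// mulr_gt0.
  have := H _ t0.
  have -> : x / (2 * p) * p + q / (4 * (x / (2 * p))) = x / 2 + p * q / (2 * x).
    by field; rewrite !gt_eqF.
  rewrite {1}[x]splitr lerD2l ler_pdivlMr ?mulr_gt0//.
  by rewrite (_ : x / 2 * (2 * x) = x ^+ 2)//; field.
have pE : p = 0 by apply/eqP; rewrite eq_le p0 pn.
have t0 : 0 < (q + 1) / x by rewrite divr_gt0// ltr_wpDl.
have := H _ t0; rewrite pE mulr0 add0r.
have -> : q / (4 * ((q + 1) / x)) = q * x / (4 * (q + 1)) by field; rewrite !gt_eqF// ltr_wpDl.
rewrite ler_pdivlMr ?mulr_gt0 ?ltr_wpDl// [q * x]mulrC ler_pM2l//; lra.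
Qed.

Section slice.
Variables (R : realType) (d : nat).
Local Notation point := (torus_point R d).
Local Notation mu := (torus_measure R d).
Local Notation row := (@row_of_point R d).
Variables (v : point -> R) (g : 'I_d -> point -> R).
Hypothesis v0 : forall y, 0 <= v y.
Hypothesis iv : integrableR mu v.
Hypothesis mg : forall i, measurable_fun setT (g i).
Hypothesis g2 : forall i, (\int[mu]_y (`|g i y| `^ 2)%:E < +oo)%E.
Hypothesis vg : forall i, weak_partial i v (g i).
Local Notation A := (\sum_i \int[mu]_y (g i y ^+ 2) + (\int[mu]_y v y) ^+ 2).
Local Notation D := (d.+1%:R : R).

Let mv : measurable_fun setT v.
Proof. by apply/measurable_EFinP; exact: measurable_int iv. Qed.

(** [trig_duality] extended by density: replacing [f] by [psi] costs at most [r] in the integral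
    against [v] and [2 * r] in that of the square. *)
Lemma duality_bound (f : point -> R) (tau : R) : measurable_fun setT f -> (forall y, 0 <= f y <= 1) -> 0 < tau ->
  \int[mu]_y (v y * f y) <= tau * A + D * ((4 * tau)^-1 * \int[mu]_y (f y ^+ 2)).
Proof.
move=> mf f01 tau0; have q0 : 0 < (4 * tau)^-1 by rewrite invr_gt0 mulr_gt0.
pose q := (4 * tau)^-1; rewrite -/q.
apply/ler_addgt0Pr => e e0; have c0 : 0 < 1 + D * q * 2 by rewrite ltr_wpDr// !mulr_ge0// ltW.
pose r := e / (1 + D * q * 2); have r0 : 0 < r by rewrite divr_gt0.
have [_ _ /(_ _ r0)[psi [tp p01 H]]] := approximable_fun v0 iv mf f01.
have mp := trig_measurable tp.
have f1 y : `|f y| <= 1 by have /andP[a1 a2] := f01 y; rewrite ger0_norm.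
have p1 y : `|psi (row y)| <= 1 by have /andP[a1 a2] := p01 (row y); rewrite ger0_norm.
have i1 : integrableR mu (fun y => 1 + v y).
  by apply: integrableD_EFin => //; apply: (@bounded_integrable _ _ _ mu _ 1) => // y; rewrite normr1.
have mdiff : measurable_fun setT (fun y => `|f y - psi (row y)|).
  by apply: measurableT_comp => //; exact: measurable_funB.
have iw : integrableR mu (fun y => (1 + v y) * `|f y - psi (row y)|).
  have := @bounded_integrableM _ _ _ mu _ _ 2 mdiff _ i1.
  under [fun x => _ * (1 + v x)]eq_fun do rewrite mulrC; apply => y.
  by rewrite normr_id (le_trans (ler_normB _ _))//; have := f1 y; have := p1 y; lra.
have W : \int[mu]_y ((1 + v y) * `|f y - psi (row y)|) <= r.
  by rewrite -lee_fin -integral_Rintegral.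
have ivf (h : point -> R) : measurable_fun setT h -> (forall y, `|h y| <= 1) -> integrableR mu (fun y => v y * h y).
  move=> mh h1; have := @bounded_integrableM _ _ _ mu _ _ 1 mh h1 iv.
  by under [fun x => _ * v x]eq_fun do rewrite mulrC.
have i2 (h : point -> R) : measurable_fun setT h -> (forall y, `|h y| <= 1) -> integrableR mu (fun y => h y ^+ 2).
  move=> mh h1; apply: (@bounded_integrable _ _ _ mu _ 1); first exact: measurable_funX.
  by move=> y; rewrite normrX exprn_ile1.
have H1 : \int[mu]_y (v y * f y) <= \int[mu]_y (v y * psi (row y)) + r.
  rewrite -lerBlDl -RintegralB//; [|exact: ivf..].
  apply: le_trans W; apply: le_Rintegral => //; first by apply: integrableB_EFin; exact: ivf.
  move=> y _; rewrite -mulrBr; apply: (@le_trans _ _ (v y * `|f y - psi (row y)|)).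
    by rewrite ler_wpM2l// ler_norm.
  by rewrite ler_wpM2r// lerDr.
have H2 : \int[mu]_y (psi (row y) ^+ 2) <= \int[mu]_y (f y ^+ 2) + 2 * r.
  rewrite -lerBlDl -RintegralB//; [|exact: i2..].
  apply: (@le_trans _ _ (2 * \int[mu]_y ((1 + v y) * `|f y - psi (row y)|))); last by rewrite ler_wpM2l.
  rewrite -RintegralZl//; apply: le_Rintegral => //.
  - by apply: integrableB_EFin; exact: i2.
  - exact: integrableZ_EFin.
  - move=> y _; rewrite subr_sqr; apply: (@le_trans _ _ (`|f y - psi (row y)| * 2)).
      apply: le_trans (ler_norm _) _; rewrite normrM distrC ler_wpM2l//.
      by apply: le_trans (ler_normD _ _) _; have := f1 y; have := p1 y; lra.
    by rewrite [leLHS]mulrC ler_wpM2l// -[leLHS]mul1r ler_wpM2r// lerDl.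
apply: le_trans H1 _.
apply: le_trans (lerD (trig_duality v0 iv mg g2 vg tp tau0) (lexx r)) _; rewrite -/q.
have := ler_wpM2l (mulr_ge0 (ler0n R d.+1) (ltW q0)) H2; rewrite -/q -!mulrA -!addrA lerD2l => H3.
apply: le_trans (lerD H3 (lexx r)) _; rewrite !mulrDr -addrA lerD2l.
rewrite (_ : D * (q * (2 * r)) + r = r * (1 + D * q * 2)); last by ring.
by rewrite /r divfK// gt_eqF.
Qed.

(** The duality is tested with [v] itself, truncated at n + 1 and scaled into [0, 1]. The square
    integral [P] of the truncation is finite and occurs on both sides, so half of it can be
    absorbed; Fatou's lemma removes the truncation. *)
Lemma weak_gradient_square : (\int[mu]_y (v y ^+ 2)%:E <= (D * A)%:E)%E.
Proof.
pose f n y := Num.min (v y) n.+1%:R.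
have f0 n y : 0 <= f n y by rewrite le_min v0/=.
have fn n y : f n y <= n.+1%:R by rewrite ge_min lexx orbT.
have mf n : measurable_fun setT (f n) by exact: measurable_minr.
apply: (@fatou_le _ _ _ mu (fun n y => f n y ^+ 2)).
- by move=> n; exact: measurable_funX.
- exact: measurable_funX.
- by move=> n y; exact: sqr_ge0.
- apply: nearW => y; apply: cvg_near_cst; exists (Num.truncn (v y)) => // n /= vn.
  rewrite /f (_ : Num.min _ _ = v y)//; apply/min_idPl/ltW.
  by apply: lt_le_trans (truncnS_gt _) _; rewrite ler_nat ltnS.
apply: nearW => n; have n0 : 0 < n.+1%:R :> R by [].
set c : R := n.+1%:R in n0 fn.
have i2 : integrableR mu (fun y => f n y ^+ 2).
  apply: (@bounded_integrable _ _ _ mu _ (c ^+ 2)); first exact: measurable_funX.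
  by move=> y; rewrite ger0_norm ?sqr_ge0// lerXn2r ?nnegrE// ltW.
rewrite integral_Rintegral// lee_fin; set P := \int[mu]_y _.
(* For this value of [tau] the quadratic term is P / (2 c), half of the lower bound P / c for the
   left side. *)
have t0 : 0 < D / (2 * c) by rewrite divr_gt0// mulr_gt0.
have m1 : measurable_fun setT (fun y => f n y / c) by exact: measurable_funM.
have b1 y : 0 <= f n y / c <= 1.
  by rewrite divr_ge0 ?f0 ?(ltW n0)//= ler_pdivrMr// mul1r fn.
have := duality_bound m1 b1 t0.
have -> : \int[mu]_y ((f n y / c) ^+ 2) = c^-1 ^+ 2 * P.
  rewrite -RintegralZl//; apply: eq_Rintegral => y _; ring.
have iv1 : integrableR mu (fun y => v y * (f n y / c)).
  have := @bounded_integrableM _ _ _ mu _ _ 1 m1 _ iv.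
  under [fun x => _ * v x]eq_fun do rewrite mulrC; apply => y.
  by have /andP[h1 h2] := b1 y; rewrite ger0_norm.
have low : c^-1 * P <= \int[mu]_y (v y * (f n y / c)).
  rewrite -RintegralZl//; apply: le_Rintegral => //; first exact: integrableZ_EFin.
  move=> y _; rewrite [v y * _]mulrA [v y * f n y * _]mulrC ler_wpM2l ?invr_ge0 ?(ltW n0)// expr2 ler_wpM2r//.
  by rewrite ge_min lexx.
move=> /(le_trans low) H.
have E : D / (2 * c) * A + D * ((4 * (D / (2 * c)))^-1 * (c^-1 ^+ 2 * P)) = c^-1 * (D * A / 2 + P / 2).
  by field; rewrite !gt_eqF.
move: H; rewrite E ler_pM2l ?invr_gt0// => H.
by move: H; move: (D * A) => x H; lra.
Qed.

(** The mean of v = w^(alpha/2) is replaced by the mass of [w]: above the level [L], Cauchy-Schwarz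
    and Markov bound the square of the mean by P M / L, and L = 4 D M + 1 makes this cost at most
    half of [P]. *)
Lemma weak_gradient_power (alpha M L : R) (w : point -> R) : 0 < alpha ->
  (forall y, 0 <= w y) -> integrableR mu w -> \int[mu]_y w y <= M -> 0 <= M ->
  v = (fun y => w y `^ (alpha / 2)) -> L = 4 * D * M + 1 ->
  (\int[mu]_y (w y `^ alpha)%:E <= (2 * D * (\sum_i \int[mu]_y (g i y ^+ 2)) + 4 * D * L `^ alpha)%:E)%E.
Proof.
move=> al0 w0 iw wM M0 vE LE; have mw : measurable_fun setT w by apply/measurable_EFinP; exact: measurable_int iw.
have L1 : 1 <= L by rewrite LE lerDr !mulr_ge0.
have L0 : 0 < L by exact: lt_le_trans L1.
have sq y : v y ^+ 2 = w y `^ alpha by rewrite vE -powR_mulrn ?powR_ge0// -powRrM divfK.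
have i2 : integrableR mu (fun y => v y ^+ 2).
  apply/integrableP; split; first by apply/measurable_EFinP; exact: measurable_funX.
  apply: le_lt_trans (_ : (_ <= (D * A)%:E)%E) (ltry _); apply: le_trans weak_gradient_square.
  by apply: eq_lee; apply: eq_integral => y _; rewrite /= ger0_norm ?sqr_ge0.
have <- : (\int[mu]_y (v y ^+ 2)%:E = \int[mu]_y (w y `^ alpha)%:E)%E by apply: eq_integral => y _; rewrite sq.
have := weak_gradient_square; rewrite integral_Rintegral// !lee_fin.
set P := \int[mu]_y _; set G := \sum_i _; set m := \int[mu]_y v y => PA.
have P0 : 0 <= P by apply: Rintegral_ge0 => y _; exact: sqr_ge0.
have m0 : 0 <= m by apply: Rintegral_ge0 => y _; exact: v0.
pose I y : R := (L < w y)%R%:R.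
have mI : measurable_fun setT I.
  have mA : measurable [set y | L < w y] by exact: measurable_gt_set.
  have : measurable_fun setT (\1_[set y | L < w y] : point -> R) by exact: measurable_indic.
  by congr (measurable_fun _ _); apply/funext => y; rewrite indicE /I; congr (_%:R);
    congr nat_of_bool; apply/idP/idP; rewrite inE.
have I01 y : `|I y| <= 1 by rewrite /I; case: (_ < _); rewrite ?normr1 ?normr0 ?ler01.
have iI : integrableR mu I by exact: bounded_integrable mI I01.
have ivI : integrableR mu (fun y => v y * I y).
  have := @bounded_integrableM _ _ _ mu _ _ 1 mI I01 iv.
  by under [fun x => _ * v x]eq_fun do rewrite mulrC.
pose x := \int[mu]_y (v y * I y).
have x0 : 0 <= x by apply: Rintegral_ge0 => y _; exact: mulr_ge0.
have IM : \int[mu]_y I y <= M / L.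
  rewrite ler_pdivlMr// mulrC; apply: le_trans wM; rewrite -RintegralZl//; apply: le_Rintegral => //.
    exact: integrableZ_EFin.
  by move=> y _; rewrite /I; case: ltP => h; rewrite ?mulr1 ?mulr0// ltW.
have xP : x ^+ 2 <= P * (M / L).
  apply: discriminant_le => // [|t t0]; first by rewrite divr_ge0// ltW.
  apply: (@le_trans _ _ (\int[mu]_y (t * v y ^+ 2 + (4 * t)^-1 * I y))).
    apply: le_Rintegral => //; first by apply: integrableD_EFin; exact: integrableZ_EFin.
    move=> y _; rewrite /I; case: (_ < _); rewrite ?mulr0 ?addr0 ?mulr1; last by rewrite mulr_ge0 ?sqr_ge0// ltW.
    rewrite -subr_ge0 (_ : _ - _ = t * (v y - (2 * t)^-1) ^+ 2); last by field; rewrite gt_eqF.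
    by rewrite mulr_ge0 ?sqr_ge0// ltW.
  rewrite RintegralD; [|exact: measurableT|exact: integrableZ_EFin|exact: integrableZ_EFin].
  rewrite RintegralZl// RintegralZl// lerD2l mulrC ler_wpM2r// invr_ge0 mulr_ge0// ltW//.
have mx : m <= L `^ (alpha / 2) + x.
  have ic : integrableR mu (fun _ : point => L `^ (alpha / 2)).
    by apply: (@bounded_integrable _ _ _ mu _ (L `^ (alpha / 2))) => // y; rewrite ger0_norm ?powR_ge0.
  apply: (@le_trans _ _ (\int[mu]_y (L `^ (alpha / 2) + v y * I y))).
    apply: le_Rintegral => //; first exact: integrableD_EFin.
    move=> y _; rewrite /I; case: ltP => h; rewrite ?mulr1 ?mulr0 ?addr0; first by rewrite lerDr powR_ge0.
    by rewrite vE ge0_ler_powR ?nnegrE ?divr_ge0 ?(ltW al0) ?(ltW L0).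
  rewrite RintegralD; [|exact: measurableT|exact: ic|exact: ivI].
  by rewrite Rintegral_cst// [fine _]/= probability_setT mulr1.
have m2 : m ^+ 2 <= 2 * L `^ alpha + 2 * x ^+ 2.
  have -> : L `^ alpha = (L `^ (alpha / 2)) ^+ 2 by rewrite -powR_mulrn ?powR_ge0// -powRrM divfK.
  apply: (@le_trans _ _ ((L `^ (alpha / 2) + x) ^+ 2)).
    by rewrite lerXn2r ?nnegrE ?addr_ge0 ?powR_ge0.
  by have := sqr_ge0 (L `^ (alpha / 2) - x); move: (L `^ _) => a; rewrite !expr2; nra.
have ML : D * (M / L) <= 4^-1.
  rewrite mulrA ler_pdivrMr// LE -!mulrA; move: (D * M) => a; lra.
have : D * (G + m ^+ 2) <= D * G + (2 * (D * L `^ alpha) + P / 2).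
  rewrite mulrDr lerD2l; apply: (@le_trans _ _ (D * (2 * L `^ alpha + 2 * (P * (M / L))))).
    by rewrite ler_wpM2l// (le_trans m2)// lerD2l ler_wpM2l.
  rewrite mulrDr [D * (2 * _)]mulrCA lerD2l.
  rewrite (_ : D * (2 * (P * (M / L))) = 2 * P * (D * (M / L))); last by ring.
  apply: le_trans (ler_wpM2l _ ML) _; first exact: mulr_ge0.
  by apply: eq_ler; field.
move=> /(le_trans PA); rewrite -!mulrA; move: (D * G) (D * L `^ alpha) => a b; lra.
Qed.

End slice.

(** * Regular paths lie in L^alpha *)

Section regular_paths.
Variables (R : realType) (d : nat) (tf : {posnum R}) (delta : weak_star_metric R d).
Local Notation path := (cadlag_path tf delta).
Local Notation point := (torus_point R d).
Local Notation mu := (torus_measure R d).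
Local Notation nu := (spacetime_measure d tf).
Local Notation ST := (measurableTypeR R * torus_point R d)%type.
Implicit Types (u : path).

Lemma one_continuous : continuous (fun _ : 'rV[R]_d => 1 : R).
Proof. exact: cst_continuous. Qed.

Lemma one_periodic : periodic (fun _ : 'rV[R]_d => 1 : R).
Proof. by []. Qed.

Definition one_test : torus_cont R d := TorusCont one_continuous one_periodic.

Lemma path_mass_bounded u : exists2 M : R, 0 <= M & forall t, pairing (u t) one_test <= M.
Proof.
have [uR uL] := path_cadlag u.
have [|t|B HB] := @locally_bounded_time _ tf (fun t => pairing (u t) one_test).
- move=> t; have [r r0 rP] := delta_pairing delta (u t) one_test ltr01.
  have [h h0 H] := uR t r r0; exists h => //; exists (pairing (u t) one_test + 1) => s /H /rP.
  by rewrite ltr_norml => /andP[? ?]; lra.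
- have [l Hl] := uL t; have [r r0 rP] := delta_pairing delta l one_test ltr01.
  have [h h0 H] := Hl r r0; exists h => //; exists (pairing l one_test + 1) => s /H /rP.
  by rewrite ltr_norml => /andP[? ?]; lra.
by exists `|B| => // t; apply: le_trans (HB t) (ler_norm _).
Qed.

Variables (alpha : R) (alpha1 : 1 < alpha).
Let al0 : 0 < alpha. Proof. by rewrite (lt_trans _ alpha1). Qed.

(** [weak_gradient_power] applies to almost every slice with one mass bound for all times; the
    resulting bound is integrable because the weak gradient is square integrable in space-time. *)
Lemma regular_finite_version u : regular_path alpha u -> exists w : ST -> R,
  version u w /\ (\int[nu]_z (`|w z| `^ alpha)%:E < +oo)%E.
Proof.
move=> [_ [v [g [[mv uv] gL rP]]]].
have mg i : measurable_fun setT (g i) by have /Lfun2P[] := gL i.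
have g2 i : (\int[nu]_z (`|g i z| `^ 2)%:E < +oo)%E by have /Lfun2P[] := gL i.
(* The given version is nonnegative only almost everywhere on almost every slice. *)
pose w z := Num.max (v z) 0.
have mw : measurable_fun setT w by exact: measurable_maxr.
have w0 z : 0 <= w z by rewrite le_max lexx orbT.
have b : {ae time_measure tf, forall s : R, 0 <= s <= tf%:num}.
  by apply: time_measure_ae => s /andP[-> /ltW].
have slice : {ae time_measure tf, forall s : R, forall t : time tf, val t = s ->
    (fun y => w (s, y)) = u t %[ae mu] /\ (fun y => w (s, y)) = (fun y => v (s, y)) %[ae mu]}.
  apply: ae_imp uv _ => s H t ts; have vu := H t ts; have u0 := L1nn_ge0 (u t); split.
    by apply: filterS2 vu u0 => y E p yD; rewrite /w E// (max_idPl p).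
  by apply: filterS2 vu u0 => y E p yD; rewrite /w E// (max_idPl p).
have vw : version u w by split => //; apply: ae_imp slice _ => s H t ts; have [] := H t ts.
exists w; split => //.
have [M M0 HM] := path_mass_bounded u.
pose D : R := d.+1%:R; pose L := 4 * D * M + 1.
pose K := 4 * D * L `^ alpha.
have K0 : 0 <= K by rewrite !mulr_ge0 ?powR_ge0.
rewrite spacetime_fubini; last 2 first.
- by apply/measurable_EFinP; exact: measurable_powR_norm.
- by move=> z; exact: powR_ge0.
pose G i s := (\int[mu]_y (`|g i (s, y)| `^ 2)%:E)%E.
have G0 i s : (0 <= G i s)%E by apply: integral_ge0 => y _; rewrite lee_fin powR_ge0.
have mpow (f : ST -> R) r : measurable_fun setT f -> measurable_fun setT (fun z => `|f z| `^ r).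
  by move=> mf; apply/measurable_EFinP; exact: measurable_powR_norm.
have mG i : measurable_fun setT (G i).
  by apply: (@measurable_slice_integral _ _ (fun z => `|g i z| `^ 2)); [exact: mpow|move=> z; exact: powR_ge0].
have gae : {ae time_measure tf, forall s, forall i, (G i s < +oo)%E}.
  by apply: filter_forall => i; exact: slice_power_finite.
apply: (@le_lt_trans _ _ (\int[time_measure tf]_s ((2 * D)%:E * \sum_i G i s + K%:E))%E).
  have mS : measurable_fun setT (fun s => \sum_i G i s)%E by apply: emeasurable_sum => i; exact: mG.
  apply: ae_ge0_le_integral => //.
  - by move=> s _; apply: integral_ge0 => y _; rewrite lee_fin powR_ge0.
  - apply: (@measurable_slice_integral _ _ (fun z => `|w z| `^ alpha)); first exact: mpow.
    by move=> z; exact: powR_ge0.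
  - by move=> s _; rewrite adde_ge0 ?lee_fin// mule_ge0 ?lee_fin ?mulr_ge0// sume_ge0.
  - by apply: emeasurable_funD => //; exact: measurable_funeM.
  have c0 := ae_imp2 slice b (fun s => @conj _ _).
  have c := ae_imp2 c0 gae (fun s => @conj _ _).
  apply: ae_imp2 rP c _ => s [iv wg] [[sl sb] gfin] _; pose t : time tf := exist _ s sb.
  have [wu wv] := sl t erefl.
  have mws : measurable_fun setT (fun y => w (s, y)) by exact: measurable_slice.
  have mvs : measurable_fun setT (fun y => v (s, y)) by exact: measurable_slice.
  have mp (f : point -> R) : measurable_fun setT f -> measurable_fun setT (fun y => f y `^ (alpha / 2)).
    by move=> mf; exact: (@measurableT_comp _ _ _ _ _ _ (@powR R ^~ (alpha / 2))).
  have pE : (fun y => w (s, y) `^ (alpha / 2)) = (fun y => v (s, y) `^ (alpha / 2)) %[ae mu].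
    by apply: filterS wv => y E yD; rewrite E.
  have ivw : integrableR mu (fun y => w (s, y) `^ (alpha / 2)).
    apply/integrableP; split; first by apply/measurable_EFinP; exact: mp.
    have /integrableP[_] := iv; apply: le_lt_trans; apply: eq_lee; apply: ae_eq_integral => //.
    - by apply: measurableT_comp => //; apply/measurable_EFinP; exact: mp.
    - by apply: measurableT_comp => //; apply/measurable_EFinP; exact: mp.
    - by apply: filterS pE => y E yD /=; rewrite E.
  have wgw i : weak_partial i (fun y => w (s, y) `^ (alpha / 2)) (fun y => g i (s, y)).
    move=> phi sphi pphi; rewrite -(wg i phi sphi pphi).
    have [c1 _] := sphi [:: i].
    have mD : measurable_fun setT (fun y : point => 'D_(delta_mx 0 i) phi (row_of_point y)).
      exact: (measurable_row_comp c1).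
    apply: Rintegral_ae_eq; [by apply: measurable_funM => //; exact: mp|by apply: measurable_funM => //; exact: mp|].
    by apply: filterS pE => y E yD; rewrite E.
  have iw : integrableR mu (fun y => w (s, y)).
    have /integrableP[_ ufin] := L1nn_integrable (u t).
    apply/integrableP; split; first exact/measurable_EFinP.
    apply: le_lt_trans ufin; apply: eq_lee; apply: ae_eq_integral => //.
    - by apply: measurableT_comp => //; exact/measurable_EFinP.
    - by apply: measurableT_comp => //; apply/measurable_EFinP; exact: L1nn_measurable.
    - by apply: filterS wu => y E yD /=; rewrite E.
  have wM : \int[mu]_y w (s, y) <= M.
    apply: le_trans (HM t); rewrite (pairing_ae one_test mws); last first.
      by apply: filterS wu => y E yD; rewrite E.
    by apply: eq_ler; apply: eq_Rintegral => y _; rewrite /= mul1r.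
  have := @weak_gradient_power R d (fun y => w (s, y) `^ (alpha / 2)) (fun i y => g i (s, y))
    (fun y => powR_ge0 _ _) ivw (fun i => measurable_slice s (mg i)) gfin wgw
    alpha M L (fun y => w (s, y)) al0 (fun y => w0 _) iw wM M0 erefl erefl.
  rewrite -/D -/K => H.
  under eq_integral do rewrite ger0_norm//.
  apply: le_trans H _; rewrite EFinD leeD2r// EFinM lee_wpmul2l ?lee_fin ?mulr_ge0//.
  rewrite -sumEFin lee_sum// => i _; apply: eq_lee.
  rewrite -integral_Rintegral; first by apply: eq_integral => y _; rewrite norm_powR2.
  apply/integrableP; split; first by apply/measurable_EFinP; apply: measurable_funX; exact: measurable_slice.
  apply: le_lt_trans (gfin i); apply: eq_lee; apply: eq_integral => y _.
  by rewrite /= norm_powR2 ger0_norm ?sqr_ge0.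
have mS : measurable_fun setT (fun s => \sum_i G i s)%E by apply: emeasurable_sum => i; exact: mG.
have S0 s : (0 <= \sum_i G i s)%E by exact: sume_ge0.
rewrite ge0_integralD//; last 2 first.
- by move=> s _; rewrite mule_ge0 ?lee_fin ?mulr_ge0.
- exact: measurable_funeM.
rewrite ge0_integralZl// ?lee_fin ?mulr_ge0// ge0_integral_sum//.
rewrite (integral_cst _ measurableT K%:E) time_measureT lte_add_pinfty//; last by rewrite -EFinM ltry.
rewrite lte_mul_pinfty ?lee_fin ?mulr_ge0// lte_sum_pinfty// => i _.
by have := g2 i; rewrite (spacetime_fubini tf (mpow _ 2 (mg i)) (fun z => powR_ge0 _ _)).
Qed.

Lemma regular_Lalpha u : regular_path alpha u ->
  exists w : Lalpha d tf alpha1, version u w.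
Proof.
move=> /regular_finite_version[f [vf ff]].
have [w wf] := Lalpha_ex alpha1 vf.1 ff.
exists w; apply: (version_ae_eq (Lalpha_measurable w) vf).
by apply: filterS wf => z E zD; rewrite E.
Qed.

End regular_paths.

(** * The entropy inequality *)

Section relative_entropy.
Context d (T : measurableType d) (R : realType) (nu mu : probability T R).
Hypothesis numu : nu `<< mu.
Local Notation f := (Radon_Nikodym (charge_of_finite_measure nu) mu).
Let F x : R := fine (f x).

Let fE x : f x = (F x)%:E.
Proof. by rewrite /F fineK//; exact: Radon_Nikodym_fin_num. Qed.

Let fi : mu.-integrable setT f.
Proof. exact: Radon_Nikodym_integrable. Qed.

Let Fi : integrableR mu F.
Proof. by rewrite (_ : EFin \o F = f)//; apply/funext => x; rewrite fE. Qed.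

Let mF : measurable_fun setT F.
Proof. by apply/measurable_EFinP; exact: measurable_int Fi. Qed.

Let mle (r : R) : measurable [set x | F x <= r].
Proof.
rewrite -[[set _ | _]]setTI; have -> : setT `&` [set x | F x <= r] = setT `&` F @^-1` `]-oo, r].
  by apply/seteqP; split => x /=; rewrite in_itv.
exact: mF.
Qed.

Lemma density_le_measure (r : R) (B : set T) : 0 <= r -> measurable B -> (forall x, B x -> F x <= r) ->
  (nu B <= r%:E * mu B)%E.
Proof.
move=> r0 mB FB; have -> : nu B = (\int[mu]_(x in B) f x)%E.
  exact: (@Radon_Nikodym_integral _ _ _ (charge_of_finite_measure nu) mu B numu mB).
rewrite -integral_cst//; apply: le_integral => //.
- exact: (integrableS measurableT).
- exact: finite_measure_integrable_cst.
- by move=> x /set_mem/FB; rewrite fE lee_fin.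
Qed.

Let Fpos : {ae nu, forall x, 0 < F x}.
Proof.
exists [set x | F x <= 0]; split; first exact: mle.
- apply/eqP; rewrite eq_le measure_ge0 andbT.
  by apply: le_trans (density_le_measure (lexx 0) (mle 0) _) _ => //; rewrite mul0e.
- by move=> x /= /negP; rewrite -leNgt.
Qed.

Let neg x : R := Num.max 0 (- ln (F x)).
Let pos x : R := Num.max 0 (ln (F x)).

Let mln : measurable_fun setT (fun x => ln (F x)).
Proof. exact: measurableT_comp. Qed.

Let mneg : measurable_fun setT neg.
Proof. by apply: measurable_maxr => //; exact: measurableT_comp. Qed.

Let mpos : measurable_fun setT pos.
Proof. exact: measurable_maxr. Qed.

(** Under [mu] the integrand becomes F max(0, - ln F), at most 1 because - ln F <= 1 / F. The
    truncation at [m] makes it integrable under [nu] for the change of variables. *)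
Lemma negative_log_integral : (\int[nu]_x (neg x)%:E <= 1%:E)%E.
Proof.
pose h m x : R := if 0 < F x then Num.min (neg x) m%:R else 0.
have neg0 x : 0 <= neg x by rewrite le_max lexx.
have h0 m x : 0 <= h m x by rewrite /h; case: ifP => // _; rewrite le_min neg0/=.
have hm m x : h m x <= m%:R by rewrite /h; case: ifP => // _; rewrite ge_min lexx orbT.
have mh m : measurable_fun setT (h m).
  apply: measurable_fun_ifT => //; last exact: measurable_minr.
  by apply: measurable_fun_ltr => //; exact: measurable_cst.
apply: (@fatou_le _ _ _ nu h) => //.
  apply: ae_imp Fpos _ => x Fx; apply: cvg_near_cst; exists (Num.truncn (neg x)).+1 => // m /= nm.
  rewrite /h Fx; apply/min_idPl/ltW; apply: lt_le_trans (truncnS_gt _) _.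
  by rewrite ler_nat.
apply: nearW => m.
have hi : nu.-integrable setT (EFin \o h m).
  by apply: (@bounded_integrable _ _ _ nu _ m%:R) => // x; rewrite ger0_norm.
have H := Radon_Nikodym_change_of_variables numu measurableT hi.
rewrite -H; have hFi : integrableR mu (fun x => h m x * F x).
  by apply: (@bounded_integrableM _ _ _ mu _ _ m%:R) => // x; rewrite ger0_norm.
rewrite (eq_integral (EFin \o (fun x => h m x * F x))); last by move=> x _; rewrite /= fE -EFinM.
apply: (@le_trans _ _ (\int[mu]_x (cst 1%E x))%E); last by rewrite (integral_cst _ measurableT 1%E) mul1e; apply: probability_le1.
apply: le_integral => //; first by apply: (finite_measure_integrable_cst mu 1).
move=> x _; rewrite lee_fin /h; case: ltP => Fx; last by rewrite mul0r ler01.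
have neg1 : neg x <= (F x)^-1.
  rewrite ge_max invr_ge0 (ltW Fx)/= -lnV ?posrE//.
  by apply: ltW; apply: ln_sublinear; rewrite invr_gt0.
rewrite -ler_pdivlMr// mul1r ge_min neg1//.
Qed.

(** Where the density is at most [K], [nu] is at most K times [mu]. On the rest Markov's inequality
    is applied to the positive part of ln F, whose integral exceeds the relative entropy by at most
    1. *)
Lemma relative_entropy_bound (H K : R) (B : set T) : (relative_entropy nu mu <= H%:E)%E -> 1 < K ->
  measurable B -> (nu B <= K%:E * mu B + ((H + 1) / ln K)%:E)%E.
Proof.
move=> HH K1 mB; have K0 : 0 < K by exact: lt_trans K1.
have lK : 0 < ln K by rewrite ln_gt0.
have posH : (\int[nu]_x (pos x)%:E <= (H + 1)%:E)%E.
  have {}HH : (\int[nu]_x lne (f x) <= H%:E)%E.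
    by move: HH; rewrite /relative_entropy; case: (pselect _) => [q|/(_ numu) []]; exact.
  move: HH.
  have -> : (\int[nu]_x lne (f x) = \int[nu]_x (ln (F x))%:E)%E.
    apply: ae_eq_integral => //.
    - rewrite (_ : (fun x => _) = (fun x => if F x <= 0 then -oo%E else (ln (F x))%:E)).
        apply: measurable_fun_ifT; [|exact: measurable_cst|exact/measurable_EFinP].
        by apply: measurable_fun_ler => //; exact: measurable_cst.
      by apply/funext => x; rewrite fE.
    - exact/measurable_EFinP.
    - by apply: ae_imp Fpos _ => x Fx _; rewrite fE lne_EFin.
  rewrite integralE.
  have -> : (\int[nu]_x ((fun x => (ln (F x))%:E)^\+)%E x = \int[nu]_x (pos x)%:E)%E.
    by apply: eq_integral => x _; rewrite funeposE /pos maxC EFin_max.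
  have -> : (\int[nu]_x ((fun x => (ln (F x))%:E)^\-)%E x = \int[nu]_x (neg x)%:E)%E.
    by apply: eq_integral => x _; rewrite funenegE /neg maxC EFin_max.
  have n1 := negative_log_integral.
  have n0 : (0 <= \int[nu]_x (neg x)%:E)%E by apply: integral_ge0 => x _; rewrite lee_fin le_max lexx.
  have nf : (\int[nu]_x (neg x)%:E)%E \is a fin_num.
    by rewrite ge0_fin_numE//; apply: le_lt_trans n1 (ltry _).
  by rewrite leeBlDr// => h; apply: le_trans h _; rewrite EFinD leeD2l.
pose L := [set x | F x <= K].
have mL : measurable L by exact: mle.
have big : (nu (~` L) <= ((H + 1) / ln K)%:E)%E.
  have p0 x : 0 <= pos x by rewrite le_max lexx.
  have : (\int[nu]_x (ln K * \1_(~` L) x)%:E <= (H + 1)%:E)%E.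
    apply: le_trans posH; apply: ge0_le_integral => //.
    - by move=> x _; rewrite lee_fin mulr_ge0// ltW.
    - apply/measurable_EFinP; apply: measurable_funM => //; apply: measurable_indic; exact: measurableC.
    - exact/measurable_EFinP.
    - move=> x _; rewrite lee_fin indicE; have [xL|xL] := pselect (L x).
        by rewrite memNset ?mulr0.
      rewrite mem_set// mulr1 /pos le_max; apply/orP; right.
      by move/negP : xL; rewrite -ltNge => xL; rewrite ler_ln ?posrE// ?ltW// (lt_trans K0).
  under eq_integral do rewrite EFinM.
  rewrite ge0_integralZl//; last 2 first.
  - by apply/measurable_EFinP; apply: measurable_indic; exact: measurableC.
  - by rewrite lee_fin ltW.
  rewrite integral_indic//; last exact: measurableC.
  rewrite setIT => h; rewrite EFinM muleC -(@lee_pmul2l _ (ln K)%:E)//.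
  have -> : ((ln K)%:E * ((ln K)^-1%:E * (H + 1)%:E) = (H + 1)%:E)%E.
    by rewrite -!EFinM mulrA divff ?mul1r// gt_eqF.
  exact: h.
apply: (@le_trans _ _ (nu (B `&` L) + nu (~` L)))%E.
  rewrite -measureU//; last 3 first.
  - exact: measurableI.
  - exact: measurableC.
  - by apply/seteqP; split => x // [[_ xL] nL].
  apply: le_measure; rewrite ?inE//; last by move=> x Bx; have [xL|xL] := pselect (L x); [left|right].
  by apply: measurableU; [exact: measurableI|exact: measurableC].
apply: leeD => //; apply: le_trans (density_le_measure (ltW K0) (measurableI _ _ mB mL) _) _.
  by move=> x [].
by rewrite lee_wpmul2l ?lee_fin ?(ltW K0)//; apply: le_measure; rewrite ?inE//; exact: measurableI.
Qed.

End relative_entropy.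

(** * Measurability of distances between random paths *)

Section random_paths.
Variables (R : realType) (d : nat) (tf : {posnum R}) (delta : weak_star_metric R d).
Variables (disp : measure_display) (Omega : measurableType disp).
Local Notation path := (cadlag_path tf delta).
Local Notation mu := (torus_measure R d).

Section one_path.
Variables (N : nat) (N0 : (0 < N)%N) (chi : R) (chi0 : 0 < chi).
Variables (eta : {mfun Omega >-> skorokhod_space tf delta} ).
Hypothesis ceta : forall o, config_path N chi (eta o).
Local Notation X o t := (path_conf N chi (eta o) t).

Let mX t a : measurable [set o | X o t = a].
Proof.
by apply: (rel_measurable_preimage ceta (A := [set u | path_conf N chi u t = a])); exact: eval_measurable.
Qed.

Lemma measurable_random_path :
  measurable_fun setT (fun w : (Omega * measurableTypeR R) * torus_point R d =>
    path_fun_at N chi (eta w.1.1) (w.1.2, w.2)).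
Proof.
rewrite (_ : (fun w => _) = fun w : (Omega * measurableTypeR R) * torus_point R d =>
    chi * (X w.1.1 (clamp tf w.1.2) (boxidx N0 w.2))%:R); last first.
  by apply/funext => w; rewrite (path_fun_atE N0).
pose g (w : (Omega * measurableTypeR R) * torus_point R d) : config d N * lattice d N :=
  (X w.1.1 (clamp tf w.1.2), boxidx N0 w.2).
have mg c : measurable (g @^-1` [set c]).
  rewrite (_ : _ @^-1` _ = [set w : Omega * measurableTypeR R | X w.1 (clamp tf w.2) = c.1] `*`
      (boxidx N0 @^-1` [set c.2])).
    by apply: measurableX; [exact: (measurable_random_conf N0 chi0 ceta)|exact: measurable_boxidx].
  apply/seteqP; split => -[[om s] y] /=; rewrite /g/=; first by move=> <-.
  by case: c => c1 c2 /= [-> ->].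
exact: (measurable_countable_comp (C := ({ffun lattice d N -> nat} * lattice d N)%type) mg
  (fun c => chi * (c.1 c.2)%:R)).
Qed.

End one_path.

Lemma measurable_power_dist (alpha : R) N N' (N0 : (0 < N)%N) (N0' : (0 < N')%N) (chi chi' : R)
    (chi0 : 0 < chi) (chi0' : 0 < chi') (eta eta' : {mfun Omega >-> skorokhod_space tf delta} ) :
  (forall o, config_path N chi (eta o)) -> (forall o, config_path N' chi' (eta' o)) ->
  measurable_fun setT (fun o => power_dist tf alpha (path_fun_at N chi (eta o)) (path_fun_at N' chi' (eta' o))).
Proof.
move=> ceta ceta'.
pose f (w : (Omega * measurableTypeR R) * torus_point R d) : R :=
  `|path_fun_at N chi (eta w.1.1) (w.1.2, w.2) - path_fun_at N' chi' (eta' w.1.1) (w.1.2, w.2)| `^ alpha.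
have mf : measurable_fun setT (EFin \o f).
  apply: measurable_powR_norm; apply: measurable_funB.
    exact: (measurable_random_path N0 chi0 ceta).
  exact: (measurable_random_path N0' chi0' ceta').
have f0 w : (0 <= (EFin \o f) w)%E by rewrite lee_fin powR_ge0.
have m1 := @measurable_fun_fubini_tonelli_F _ _ _ _ _ mu (EFin \o f) mf f0.
have g0 w : (0 <= fubini_F mu (EFin \o f) w)%E by apply: integral_ge0 => y _; exact: f0.
have m2 := @measurable_fun_fubini_tonelli_F _ _ _ _ _ (time_fin tf) (fubini_F mu (EFin \o f)) m1 g0.
rewrite (_ : (fun o => _) = fubini_F (time_fin tf) (fubini_F mu (EFin \o f))) //.
apply/funext => o; rewrite /power_dist spacetime_fubini//.
  apply/measurable_EFinP; apply: measurable_powR_norm; apply: measurable_funB.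
    exact: (measurable_path_fun N0 chi0 (ceta o)).
  exact: (measurable_path_fun N0' chi0' (ceta' o)).
Qed.

End random_paths.

Lemma power_dist_sym (R : realType) (d : nat) (tf : {posnum R}) (alpha : R)
    (f g : measurableTypeR R * torus_point R d -> R) :
  power_dist tf alpha f g = power_dist tf alpha g f.
Proof. by apply: eq_integral => z _; rewrite distrC. Qed.

Lemma Lalpha_dist_sym (R : realType) (d : nat) (tf : {posnum R}) (alpha : R) (alpha1 : 1 < alpha)
  (f g : Lalpha d tf alpha1) : Lalpha_dist f g = Lalpha_dist g f.
Proof. by rewrite !Lalpha_distE power_dist_sym. Qed.

(** * From sequences of good paths to neighbourhoods *)

Section compactness.
Variables (R : realType) (d : nat) (alpha : R) (alpha1 : 1 < alpha) (tf : {posnum R}).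
Variables (delta : weak_star_metric R d) (chi : nat -> R) (chi0 : forall N, 0 < chi N).
Variables (Mchi : R) (chi_le : forall N, N%:R ^+ 2 * chi N `^ Num.min 1 (alpha / 2) <= Mchi).
Local Notation path := (cadlag_path tf delta).
Local Notation nu := (spacetime_measure d tf).
Local Notation L := (Lalpha d tf alpha1).
Local Notation goodp M0 M1 N := (@good R d N alpha (chi N) tf delta M0 M1).

Let p0 : 0 < Num.min 1 (alpha / 2).
Proof. by rewrite lt_min ltr01/= divr_gt0// (lt_trans _ alpha1). Qed.

(** The exponent of chi is positive, so boundedness of N^2 chi^min(1, alpha/2) forces chi to 0. *)
Lemma chi_vanishes (r : R) : 0 < r -> exists J, forall N, (J <= N)%N -> chi N <= r.
Proof.
move=> r0; pose p := Num.min 1 (alpha / 2); have rp : 0 < r `^ p by exact: powR_gt0.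
exists (Num.truncn (`|Mchi| / r `^ p)).+1 => N JN.
have N1 : 1 <= N%:R :> R by rewrite ler1n (leq_trans _ JN).
rewrite leNgt; apply/negP => rN.
have rc : r `^ p < chi N `^ p by apply: gt0_ltr_powR => //; rewrite nnegrE ltW.
have : `|Mchi| / r `^ p < N%:R by apply: lt_le_trans (truncnS_gt _) _; rewrite ler_nat.
rewrite ltr_pdivrMr// ltNge => /negP; apply.
apply: le_trans (le_trans (chi_le N) (ler_norm _)).
apply: (@le_trans _ _ (N%:R ^+ 2 * r `^ p)); last by rewrite ler_wpM2l ?exprn_ge0// ltW.
by rewrite ler_wpM2r ?(ltW rp)// expr2 ler_peMl// (le_trans ler01).
Qed.

Section sequence.
Variables (N : nat -> nat) (N0 : forall j, (0 < N j)%N).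
Variables (NJ : forall k, exists J, forall j, (J <= j)%N -> (k <= N j)%N).
Variables (e : nat -> path) (ce : forall j, config_path (N j) (chi (N j)) (e j)).
Variables (M0 M1 : R) (ge : forall j, goodp M0 M1 (N j) (e j)).
Variables (u : path) (eu : skorokhod_dist (e j) u @[j --> \oo] --> 0).

Let small (r : R) : 0 < r -> exists J, forall j, (J <= j)%N -> chi (N j) <= r.
Proof.
move=> /chi_vanishes[k Hk]; have [J HJ] := NJ k; exists J => j /HJ; exact: Hk.
Qed.

Let jumps j t := @good_jump R d (N j) (N0 j) alpha (chi (N j)) (chi0 (N j)) tf delta (e j) (ce j) M0 M1 (ge j) t.
Let mass j t := @good_mass R d (N j) (N0 j) alpha (chi (N j)) (chi0 (N j)) tf delta (e j) (ce j) M0 M1 (ge j) t.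
Let energy j := @good_energy R d (N j) (N0 j) alpha (chi (N j)) (chi0 (N j)) tf delta (e j) (ce j) M0 M1 (ge j).

Lemma good_limit : regular_path alpha u /\
  exists w : measurableTypeR R * torus_point R d -> R, [/\ version u w, (\int[nu]_z (`|w z| `^ alpha)%:E < +oo)%E &
    evanescent (fun j => power_dist tf alpha (path_fun_at (N j) (chi (N j)) (e j)) w)].
Proof. exact: (config_limit N0 (fun j => chi0 (N j)) ce jumps small eu alpha1 NJ mass energy). Qed.

Lemma good_limit_Lalpha (f : nat -> L) (w : L) : (forall j, version (e j) (f j)) -> version u w ->
  Lalpha_dist (f j) w @[j --> \oo] --> 0.
Proof. exact: (config_limit_Lalpha N0 (fun j => chi0 (N j)) ce jumps small eu NJ mass energy). Qed.

End sequence.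

Lemma good_le N (M0 M1 M0' M1' : R) (u : path) : M0 <= M0' -> M1 <= M1' ->
  goodp M0 M1 N u -> goodp M0' M1' N u.
Proof.
move=> h0 h1 [H1 H2]; split; first exact: le_trans h0.
move=> m; have [n [mn [J E]]] := H2 m; exists n; split => //; split => //.
exact: lt_le_trans h1.
Qed.

(** If every radius and every threshold failed, radii 1 / (j + 1) would give a sequence converging
    to [u] with N j > j. *)
Lemma sequential_nbhd (A : nat -> path -> Prop) (u : path) :
  (forall (N : nat -> nat) (e : nat -> path), (forall j, (j < N j)%N) ->
     skorokhod_dist (e j) u @[j --> \oo] --> 0 -> (forall j, A (N j) (e j)) -> False) ->
  exists2 r : R, 0 < r & exists J, forall N e, (J <= N)%N -> skorokhod_dist u e < r -> ~ A N e.
Proof.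
move=> H; apply: contrapT => nH.
have /choice[z zP] : forall j : nat, exists z : nat * path, [/\ (j < z.1)%N,
    skorokhod_dist u z.2 < j.+1%:R^-1 & A z.1 z.2].
  move=> j; apply: contrapT => nj; apply: nH; exists j.+1%:R^-1; first by rewrite invr_gt0.
  by exists j.+1 => N e jN ue AN; apply: nj; exists (N, e).
apply: (H (fun j => (z j).1) (fun j => (z j).2)) => [j||j]; [by have [] := zP j| |by have [] := zP j].
apply/cvgrPdist_le => r r0; exists (Num.truncn r^-1) => // j /= rj.
rewrite sub0r normrN ger0_norm ?skorokhod_ge0// skorokhod_sym.
have [_ /ltW/le_trans + _] := zP j; apply.
rewrite -[leRHS]invrK lef_pV2 ?posrE ?invr_gt0//.
by apply: ltW; apply: lt_le_trans (truncnS_gt _) _; rewrite ler_nat ltnS.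
Qed.

Let tends (N : nat -> nat) : (forall j, (j < N j)%N) -> forall k, exists J, forall j, (J <= j)%N -> (k <= N j)%N.
Proof. by move=> jN k; exists k => j kj; apply: leq_trans kj _; exact: ltnW. Qed.

Lemma good_nbhd_version (u : path) (w : L) (V : set L) (M0 M1 : R) : version u w -> Lalpha_open V -> V w ->
  exists2 r : R, 0 < r & exists J, forall N e, (J <= N)%N -> skorokhod_dist u e < r ->
    (0 < N)%N -> config_path N (chi N) e -> goodp M0 M1 N e ->
    exists2 f : L, version e f & V f.
Proof.
move=> uw oV Vw.
have [|r r0 [J HJ]] := @sequential_nbhd (fun N e => [/\ (0 < N)%N, config_path N (chi N) e,
    goodp M0 M1 N e & ~ exists2 f : L, version e f & V f]) u; last first.
  exists r => //; exists J => N e JN ue N0 ce ge; apply: contrapT => nV.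
  by apply: (HJ N e JN ue).
move=> N e jN eu H.
have N0 j : (0 < N j)%N by have [] := H j.
have ce j : config_path (N j) (chi (N j)) (e j) by have [] := H j.
have ge j : goodp M0 M1 (N j) (e j) by have [] := H j.
have /choice[f fP] : forall j, exists f : L, version (e j) f.
  by move=> j; have [f vf _] := config_path_Lalpha alpha1 (N0 j) (chi0 (N j)) (ce j); exists f.
have := good_limit_Lalpha N0 (tends jN) ce ge eu fP uw.
have [r r0 rV] := oV w Vw; move/cvgrPdist_lt => /(_ r r0)[J _ HJ].
have [_ _ _ nV] := H J; apply: nV; exists (f J) => //; apply: rV.
have := HJ J (leqnn J); rewrite sub0r normrN.
have -> : Lalpha_dist w (f J) = Lalpha_dist (f J) w.
  exact: Lalpha_dist_sym.
by rewrite ger0_norm// Lalpha_distE powR_ge0.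
Qed.

Lemma good_nbhd_irregular (u : path) (M0 M1 : R) : ~ regular_path alpha u ->
  exists2 r : R, 0 < r & exists J, forall N e, (J <= N)%N -> skorokhod_dist u e < r ->
    (0 < N)%N -> config_path N (chi N) e -> ~ goodp M0 M1 N e.
Proof.
move=> nu_; have [|r r0 [J HJ]] := @sequential_nbhd (fun N e => [/\ (0 < N)%N, config_path N (chi N) e &
    goodp M0 M1 N e]) u; last first.
  by exists r => //; exists J => N e JN ue N0 ce ge; exact: (HJ N e JN ue).
move=> N e jN eu H; apply: nu_.
have N0 j : (0 < N j)%N by have [] := H j.
have ce j : config_path (N j) (chi (N j)) (e j) by have [] := H j.
have ge j : goodp M0 M1 (N j) (e j) by have [] := H j.
by have [] := good_limit N0 (tends jN) ce ge eu.
Qed.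

Lemma intensity_large (A : R) (d0 : (0 < d)%N) : exists J, forall N, (J <= N)%N ->
  (0 < N)%N /\ A <= N%:R ^+ d / chi N.
Proof.
have [J HJ] : exists J, forall N, (J <= N)%N -> chi N <= (`|A| + 1)^-1.
  by apply: chi_vanishes; rewrite invr_gt0.
exists J.+1 => N JN; have N0 : (0 < N)%N by exact: leq_trans JN.
split => //; apply: le_trans (ler_norm A) _; apply: (@le_trans _ _ (`|A| + 1)); first by rewrite lerDl.
rewrite ler_pdivlMr//; apply: (@le_trans _ _ 1).
  by rewrite mulrC -ler_pdivlMr// mul1r HJ// ltnW.
by rewrite exprn_ege1// ler1n.
Qed.
End compactness.

(** * Exponential estimates and their transfer to the second measure *)

Section large_deviations.
Variables (R : realType) (d : nat) (d0 : (0 < d)%N) (alpha : R) (alpha1 : 1 < alpha) (tf : {posnum R}).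
Variables (delta : weak_star_metric R d) (chi : nat -> R) (chi0 : forall N, 0 < chi N).
Variables (Mchi : R) (chi_le : forall N, N%:R ^+ 2 * chi N `^ Num.min 1 (alpha / 2) <= Mchi).
Variables (disp : measure_display) (Omega : measurableType disp) (P : probability Omega R).
Variable eta : nat -> {mfun Omega >-> skorokhod_space tf delta}.
Hypothesis zrp : forall N, (0 < N)%N -> zero_range_process N alpha (chi N) P (eta N).
Hypothesis initial : forall gamma : R, gamma < alpha ->
  (limn_esup (fun N => (chi N / N%:R ^+ d)%:E *
     lne (\int[P]_omega expeR ((N%:R ^+ d / chi N * gamma)%:E *
       entropy ((eta N omega : cadlag_path tf delta) (time0 tf))))) < +oo)%E.
Local Notation path := (cadlag_path tf delta).
Local Notation L := (Lalpha d tf alpha1).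
Local Notation goodp M0 M1 N := (@good R d N alpha (chi N) tf delta M0 M1).
Local Notation lam N := (N%:R ^+ d / chi N).

Let ceta N : (0 < N)%N -> forall o, config_path N (chi N) (eta N o).
Proof. by move=> N0; exact: config_path_zrp (zrp N0). Qed.

Let lam0 N : (0 < N)%N -> 0 < lam N.
Proof. by move=> N0; rewrite divr_gt0// exprn_gt0// ltr0n. Qed.

Let lamV N : (0 < N)%N -> lam N * (chi N / N%:R ^+ d) = 1.
Proof.
move=> N0; rewrite mulrA divfK ?gt_eqF// divff// gt_eqF// exprn_gt0// ltr0n//.
Qed.

Let mbad M0 M1 N : (0 < N)%N -> measurable [set o | ~ goodp M0 M1 N (eta N o)].
Proof.
move=> N0; have H := rel_measurableC (good_measurable alpha tf delta N0 (chi0 N) M0 M1).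
exact: (rel_measurable_preimage (ceta N0) H).
Qed.

Let mball u (r : R) N : measurable [set o | skorokhod_dist u (eta N o) < r].
Proof.
rewrite (_ : mkset _ = eta N @^-1` [set v : path | skorokhod_dist u v < r])//.
have mB : measurable ([set v : path | skorokhod_dist u v < r] : set (skorokhod_space tf delta)).
  by apply: sub_sigma_algebra; exact: skorokhod_ball_open.
by rewrite -[X in measurable X]setTI; exact: measurable_funPT.
Qed.

Lemma ltey_real (x : \bar R) : (x < +oo)%E -> exists r : R, (x < r%:E)%E.
Proof.
case: x => [r| |]//; first by exists (r + 1); rewrite lte_fin ltrDl.
by exists 0; rewrite ltNyr.
Qed.

Lemma scaled_le N (x : \bar R) (l : R) : (0 < N)%N -> ((chi N / N%:R ^+ d)%:E * x <= l%:E)%E ->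
  (x <= (lam N * l)%:E)%E.
Proof.
move=> N0 H; have n0 := lam0 N0.
have -> : x = ((lam N)%:E * ((chi N / N%:R ^+ d)%:E * x))%E.
  by rewrite muleA -EFinM lamV// mul1e.
by rewrite [leRHS]EFinM; apply: lee_wpmul2l => //; rewrite lee_fin; exact: ltW.
Qed.

(** The hypothesis on the initial data at gamma = alpha / 2, freed of the limit superior and the
    logarithm. *)
Lemma initial_bound : exists (C : R) (J : nat), forall N, (J <= N)%N -> (0 < N)%N ->
  (\int[P]_omega expeR ((lam N * (alpha / 2))%:E *
     entropy ((eta N omega : path) (time0 tf))) <= (expR (lam N * C))%:E)%E.
Proof.
have a2 : alpha / 2 < alpha by rewrite ltr_pdivrMr// ltr_pMr// ?ltr1n// (lt_trans _ alpha1).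
have [C HC] := ltey_real (initial a2); have [J _ HJ] := limn_esup_lt HC.
exists C, J => N JN N0; have := scaled_le N0 (HJ N JN).
set I := (\int[P]_omega _)%E => H.
have I0 : (0 <= I)%E by apply: integral_ge0 => o _; exact: expeR_ge0.
rewrite -[I]lneK ?in_itv/= ?I0 ?leey//.
by rewrite -[(expR _)%:E]/(expeR (_%:E)) lee_expeR.
Qed.

Lemma bad_probability (z : R) : exists M0 M1 : R, exists J, forall N, (J <= N)%N ->
  (0 < N)%N /\ pr P [set o | ~ goodp M0 M1 N (eta N o)] <= expR (- (lam N * z)).
Proof.
have [C0 [J1 H1]] := initial_bound.
have a20 : 0 < alpha / 2 by rewrite divr_gt0// (lt_trans _ alpha1).
(* [M0] and later [M1] make the entropy tail and the energy term both at most exp(- lam (z + 1));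
   the surplus exp(- lam) absorbs the factor 2 once lam >= 1. *)
pose M0 := Num.max 0 ((C0 + z + 1) / (alpha / 2)).
have M00 : 0 <= M0 by rewrite le_max lexx.
have [c c0 [C gP]] := good_probability d0 alpha1 tf delta P Mchi M00.
pose M1 := (C + z + 1) / c; exists M0, M1.
have [J2 H2] := intensity_large alpha1 chi0 chi_le 1 d0.
exists (maxn J1 J2) => N; rewrite geq_max => /andP[N1 N2]; have [N0 l1] := H2 N N2; split => //.
apply: le_trans (gP N (chi N) (eta N) M1 N0 (chi0 N) (chi_le N) (zrp N0)) _.
have -> : C - c * M1 = - (z + 1) by rewrite /M1 mulrCA divff ?gt_eqF// mulr1; ring.
have tail : pr P [set o | M0 < conf_entropy (chi N) (path_conf N (chi N) (eta N o) (time0 tf))] <=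
    expR (lam N * - (z + 1)).
  have g0 : 0 <= lam N * (alpha / 2) by rewrite mulr_ge0 ?ltW ?lam0.
  have := entropy_tail M0 N0 (chi0 N) (zrp N0) g0.
  move=> /le_trans/(_ (H1 N N1 N0)); rewrite lee_fin mulrC -ler_pdivlMr ?expR_gt0// -expRN -expRD.
  move=> /le_trans; apply; rewrite ler_expR.
  have -> : lam N * C0 - lam N * (alpha / 2) * M0 = lam N * (C0 - alpha / 2 * M0) by ring.
  apply: ler_wpM2l; first exact/ltW/lam0.
  have : C0 + z + 1 <= alpha / 2 * M0.
    by rewrite mulrC -ler_pdivrMr// le_max lexx orbT.
  lra.
apply: le_trans (lerD tail (lexx _)) _.
have -> : expR (lam N * - (z + 1)) = expR (- (lam N * z)) * expR (- lam N).
  by rewrite -expRD; congr expR; ring.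
rewrite -mulrDr ler_piMr ?expR_ge0// -mulr2n -[_ *+ 2]mulr_natl expRN ler_pdivrMr ?expR_gt0// mul1r.
apply: le_trans (expR_ge1Dx _); lra.
Qed.

Lemma scaled_log_le N (E : set Omega) (z : R) : (0 < N)%N -> measurable E ->
  pr P E <= expR (- (lam N * z)) -> ((chi N / N%:R ^+ d)%:E * lne (P E) <= (- z)%:E)%E.
Proof.
move=> N0 mE H; have c0 : 0 < chi N / N%:R ^+ d by rewrite divr_gt0// exprn_gt0// ltr0n.
rewrite pr_fin// /lne; case: ifPn => [_|]; first by rewrite gt0_muleNy ?leNye// lte_fin.
rewrite -ltNge => p0; rewrite -EFinM lee_fin.
have : ln (pr P E) <= - (lam N * z) by rewrite -[leRHS]expRK ler_ln ?posrE ?expR_gt0.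
move=> /(ler_wpM2l (ltW c0))/le_trans; apply; rewrite mulrN lerN2.
by rewrite mulrA [_ / _ * lam N]mulrC lamV// mul1r.
Qed.

(** Good paths close to [u] have a version in [V], so the event is contained in the bad one. Its
    measurability, from [version_rel_open], is what allows the comparison. *)
Lemma regular_estimate (u : path) : regular_path alpha u ->
  exists2 w : L, version u w & forall V : set L, Lalpha_open V -> V w -> forall z : R,
    exists U : set path, [/\ skorokhod_open U, U u &
      (limn_esup (fun N => (chi N / N%:R ^+ d)%:E *
         lne (P [set omega | U (eta N omega) /\
           ~ (exists2 f : L, version (eta N omega : path) f & V f)])) <= (- z)%:E)%E].
Proof.
move=> ru; have [w uw] := regular_Lalpha alpha1 ru; exists w => // V oV Vw z.
have [M0 [M1 [J1 H1]]] := bad_probability z.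
have [r r0 [J2 H2]] := good_nbhd_version chi0 chi_le M0 M1 uw oV Vw.
exists [set v | skorokhod_dist u v < r]; split; [exact: skorokhod_ball_open|by rewrite /= skorokhod_refl|].
apply: limn_esup_le; exists (maxn J1 J2) => // N /=; rewrite geq_max => /andP[N1 N2].
have [N0 HN] := H1 N N1; have cN := ceta N0.
have mg := mbad M0 M1 N0.
have mU := mball u r N.
have mV : measurable [set o | exists2 f : L, version (eta N o : path) f & V f].
  apply: (rel_measurable_preimage cN (A := [set v : path | exists2 f : L, version v f & V f])).
  by apply: rel_open_measurable => //; exact: version_rel_open.
have mE := measurableI _ _ mU (measurableC mV).
apply: scaled_log_le => //; apply: le_trans HN; apply: le_pr => //.
by move=> o [uo nV] go; apply: nV; exact: (H2 N _ N2 uo N0 (cN o) go).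
Qed.

Lemma irregular_estimate (u : path) : ~ regular_path alpha u -> forall z : R,
  exists U : set path, [/\ skorokhod_open U, U u &
    (limn_esup (fun N => (chi N / N%:R ^+ d)%:E * lne (P [set omega | U (eta N omega)])) <= (- z)%:E)%E].
Proof.
move=> nu_ z; have [M0 [M1 [J1 H1]]] := bad_probability z.
have [r r0 [J2 H2]] := good_nbhd_irregular alpha1 chi0 chi_le M0 M1 nu_.
exists [set v | skorokhod_dist u v < r]; split; [exact: skorokhod_ball_open|by rewrite /= skorokhod_refl|].
apply: limn_esup_le; exists (maxn J1 J2) => // N /=; rewrite geq_max => /andP[N1 N2].
have [N0 HN] := H1 N N1; have cN := ceta N0.
have mg := mbad M0 M1 N0.
apply: scaled_log_le => //; apply: le_trans HN; apply: le_pr => //.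
by move=> o uo go; exact: (H2 N _ N2 uo N0 (cN o) go).
Qed.

Variable Q : probability Omega R.
Hypothesis entropy_bound : (limn_esup (fun N => (chi N / N%:R ^+ d)%:E *
  relative_entropy (distribution Q (eta N)) (distribution P (eta N))) < +oo)%E.

(** Bad events have [P]-probability at most exp(- lam (y + 1)). In the entropy inequality with K =
    exp(lam y) the first term is at most exp(- lam), and the second at most (h + 1) / y = r / 2. *)
Lemma entropy_bad_probability (r : R) : 0 < r -> exists M0 M1 : R, exists J, forall N, (J <= N)%N ->
  (0 < N)%N /\ (Q [set o | ~ goodp M0 M1 N (eta N o)] <= r%:E)%E.
Proof.
move=> r0; have [h' Hh'] := ltey_real entropy_bound; have [J0 _ H0] := limn_esup_lt Hh'.
pose h := `|h'|; pose y := 2 * (h + 1) / r.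
have h0 : 0 <= h by exact: normr_ge0.
have y0 : 0 < y by rewrite divr_gt0// mulr_gt0// ltr_wpDl.
have [M0 [M1 [J1 H1]]] := bad_probability (y + 1).
have [J2 H2] := intensity_large alpha1 chi0 chi_le (Num.max 1 (2 / r)) d0.
exists M0, M1, (maxn J0 (maxn J1 J2)) => N; rewrite !geq_max => /and3P[N0' N1 N2].
have [N0] := H2 N N2; rewrite ge_max => /andP[l1 l2]; split => //.
have l0 := lam0 N0; have cN := ceta N0; have [_ HP] := H1 N N1.
have ent : (relative_entropy (distribution Q (eta N)) (distribution P (eta N)) <= (lam N * h)%:E)%E.
  apply: le_trans (scaled_le N0 (H0 N N0')) _.
  by rewrite lee_fin; apply: ler_wpM2l; [exact: ltW|exact: ler_norm].
have numu : distribution Q (eta N) `<< distribution P (eta N).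
  by move: ent; rewrite /relative_entropy; case: (pselect _).
have [B mB BP] := rel_measurableC (good_measurable alpha tf delta N0 (chi0 N) M0 M1).
have E : [set o | ~ goodp M0 M1 N (eta N o)] = eta N @^-1` B.
  apply/seteqP; split => om /=; first by move=> H; apply/(BP _ (cN om)).
  by move=> /(BP _ (cN om)).
have mE := mbad M0 M1 N0.
have K1 : 1 < expR (lam N * y) by rewrite expR_gt1; exact: mulr_gt0.
have H : (Q (eta N @^-1` B) <= (expR (lam N * y))%:E * P (eta N @^-1` B) +
  ((lam N * h + 1) / ln (expR (lam N * y)))%:E)%E := relative_entropy_bound numu ent K1 mB.
rewrite -E in H; apply: le_trans H _; rewrite (pr_fin P mE) expRK -EFinM -EFinD lee_fin [leRHS]splitr lerD//.
  apply: (@le_trans _ _ (expR (lam N * y) * expR (- (lam N * (y + 1))))); first by rewrite ler_wpM2l ?expR_ge0.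
  rewrite -expRD mulrDr mulr1 opprD addNKr expRN -[leRHS]invf_div lef_pV2 ?posrE ?expR_gt0 ?divr_gt0//.
  by apply: le_trans l2 (le_trans _ (expR_ge1Dx _)); rewrite lerDr.
rewrite ler_pdivrMr; last exact: mulr_gt0.
have -> : r / 2 * (lam N * y) = lam N * (h + 1) by rewrite mulrCA; congr (_ * _); rewrite /y; field; rewrite gt_eqF.
by rewrite mulrDr mulr1 lerD2l.
Qed.

End large_deviations.

(** * Almost sure convergence along a subsequence *)

Section almost_sure_convergence.
Variables (R : realType) (d : nat) (alpha : R) (alpha1 : 1 < alpha) (tf : {posnum R}).
Variables (delta : weak_star_metric R d) (chi : nat -> R) (chi0 : forall N, 0 < chi N).
Variables (Mchi : R) (chi_le : forall N, N%:R ^+ 2 * chi N `^ Num.min 1 (alpha / 2) <= Mchi).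
Variables (disp : measure_display) (Omega : measurableType disp) (Q : probability Omega R).
Variable eta : nat -> {mfun Omega >-> skorokhod_space tf delta}.
Local Notation path := (cadlag_path tf delta).
Local Notation L := (Lalpha d tf alpha1).
Local Notation goodp M0 M1 N := (@good R d N alpha (chi N) tf delta M0 M1).
Local Notation pdist := (@power_dist R d tf alpha).
Local Notation F N o := (path_fun_at N (chi N) (eta N o : path)).
Hypothesis ceta : forall N, (0 < N)%N -> forall o, config_path N (chi N) (eta N o).
Hypothesis bad : forall r : R, 0 < r -> exists M0 M1 : R, exists J, forall N, (J <= N)%N ->
  (0 < N)%N /\ (Q [set o | ~ goodp M0 M1 N (eta N o)] <= r%:E)%E.
Variables (k : nat -> nat) (xi : {mfun Omega >-> skorokhod_space tf delta}).
Hypothesis kh : {homo k : m n / (m < n)%N}.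
Hypothesis conv : {ae Q, forall o, skorokhod_dist (eta (k n) o) (xi o) @[n --> \oo] --> (0 : R)}.

Local Notation almost_sure_limit := (exists2 j : nat -> nat, {homo j : m n / (m < n)%N} &
  {ae Q, forall omega, exists (f : nat -> L) (w : L),
    [/\ forall n, version (eta (k (j n)) omega : path) (f n),
        version (xi omega : path) w & Lalpha_dist (f n) w @[n --> \oo] --> (0 : R)]}).

Let kn n : (n <= k n)%N.
Proof. by elim: n => // n IHn; apply: (leq_ltn_trans IHn); exact: kh. Qed.

Let k0 n : (0 < n)%N -> (0 < k n)%N. Proof. by move=> n0; exact: leq_trans (kn n). Qed.

Let half p : R := 1 / (2 ^ p.+1)%:R.
Let half0 p : 0 < half p. Proof. by rewrite divr_gt0// ltr0n expn_gt0. Qed.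

Let half_le p (r : R) : 0 < r -> (Num.truncn r^-1 <= p)%N -> half p <= r.
Proof.
move=> r0 rp; rewrite /half mul1r -[leRHS]invrK lef_pV2 ?posrE ?invr_gt0 ?ltr0n ?expn_gt0//.
apply: ltW; apply: lt_le_trans (truncnS_gt _) _; rewrite ler_nat.
by apply: leq_ltn_trans rp _; apply: ltn_trans (ltnSn p) _; exact: ltn_expl.
Qed.

Section levels.
Variables (m0 m1 : nat -> R) (J0 : nat -> nat).
Hypothesis m0_le : forall p q, (p <= q)%N -> m0 p <= m0 q.
Hypothesis m1_le : forall p q, (p <= q)%N -> m1 p <= m1 q.
Hypothesis bad_le : forall p N, (J0 p <= N)%N ->
  (Q [set o | ~ goodp (m0 p) (m1 p) N (eta N o)] <= (half p)%:E)%E.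
Local Notation G p n := [set o | goodp (m0 p) (m1 p) (k n) (eta (k n) o)].

Let mG p n : (0 < n)%N -> measurable (G p n).
Proof.
move=> n0; have H := good_measurable alpha tf delta (k0 n0) (chi0 (k n)) (m0 p) (m1 p).
exact: (rel_measurable_preimage (ceta (k0 n0)) H).
Qed.

Let G_le p q n : (p <= q)%N -> G p n `<=` G q n.
Proof. by move=> pq o; apply: good_le; [exact: m0_le|exact: m1_le]. Qed.

Let D n m o : \bar R := pdist (F (k n) o) (F (k m) o).

Let mD n m : (0 < n)%N -> (0 < m)%N -> measurable_fun setT (D n m).
Proof.
move=> n0 m_0; exact: (measurable_power_dist alpha (k0 n0) (k0 m_0) (chi0 _) (chi0 _)
  (ceta (k0 n0)) (ceta (k0 m_0))).
Qed.

(** Two indices, both good at level [p], whose paths are far apart in L^alpha. Compactness excludes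
    this for late indices, but how late depends on [omega]. *)
Let pair p n m : set Omega := [set o | [/\ (0 < n)%N, (0 < m)%N, G p n o, G p m o & ((half p)%:E < D n m o)%E]].

Let mpair p n m : measurable (pair p n m).
Proof.
have [n0|] := ltnP 0 n; last first.
  rewrite leqn0 => /eqP n0; rewrite (_ : pair p n m = set0)//; apply/seteqP; split => om // [].
  by rewrite n0.
have [m_0|] := ltnP 0 m; last first.
  rewrite leqn0 => /eqP m_0; rewrite (_ : pair p n m = set0)//; apply/seteqP; split => om // [].
  by rewrite m_0.
rewrite (_ : pair p n m = (G p n `&` G p m) `&` [set o | ((half p)%:E < D n m o)%E]).
  apply: measurableI; first by apply: measurableI; exact: mG.
  rewrite -[X in measurable X]setTI; apply: emeasurable_fun_o_infty => //; exact: mD.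
by apply/seteqP; split => om /=; [case|move=> [[]]].
Qed.

Let B p J : set Omega := \bigcup_(z : nat * nat) (if (J <= z.1)%N && (J <= z.2)%N then pair p z.1 z.2 else set0).

Let mB p J : measurable (B p J).
Proof.
apply: (countable_bigcupT_measurable (countableP _)) => z.
by case: ifP => _ //; exact: mpair.
Qed.

Let B_le p J J' : (J <= J')%N -> B p J' `<=` B p J.
Proof.
move=> JJ om [z _]; case: ifP => // /andP[z1 z2] H; exists z => //.
by rewrite (leq_trans JJ z1) (leq_trans JJ z2).
Qed.

Let along (n : nat -> nat) (nj : forall j, (j < n j)%N) :
  (forall j, (0 < k (n j))%N) /\ (forall l, exists J, forall j, (J <= j)%N -> (l <= k (n j))%N).
Proof.
split=> [j|l]; first by apply: k0; exact: leq_ltn_trans (nj j).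
by exists l => j lj; apply: leq_trans lj (leq_trans (ltnW (nj j)) (kn _)).
Qed.

Let along_cvg (n : nat -> nat) om : (forall j, (j < n j)%N) ->
  skorokhod_dist (eta (k n) om) (xi om) @[n --> \oo] --> (0 : R) ->
  skorokhod_dist (eta (k (n j)) om) (xi om) @[j --> \oo] --> (0 : R).
Proof.
move=> nj H; apply: (cvg_comp n (fun n => skorokhod_dist (eta (k n) om) (xi om))); last exact: H.
by move=> A [J _ JA]; exists J => // j Jj; apply: JA; exact: leq_trans Jj (ltnW (nj j)).
Qed.

(** Arbitrarily late pairs would form two good sequences with the same Skorokhod limit, hence with
    the same L^alpha limit, against their distance. *)
Let leaves p om : skorokhod_dist (eta (k n) om) (xi om) @[n --> \oo] --> (0 : R) -> exists J, ~ B p J om.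
Proof.
move=> cv; apply: contrapT => nJ.
have /choice[z zP] : forall j : nat, exists z : nat * nat, [/\ (j < z.1)%N, (j < z.2)%N & pair p z.1 z.2 om].
  move=> j; have : B p j.+1 om by apply: contrapT => H; apply: nJ; exists j.+1.
  by move=> [z _]; case: ifP => // /andP[z1 z2] H; exists z.
pose n j := (z j).1; pose m j := (z j).2.
have nj j : (j < n j)%N by have [] := zP j.
have mj j : (j < m j)%N by have [] := zP j.
have [n0 nJ'] := along nj; have [m_0 mJ'] := along mj.
have cn j := ceta (n0 j) om; have cm j := ceta (m_0 j) om.
have gn j : goodp (m0 p) (m1 p) (k (n j)) (eta (k (n j)) om) by have [_ _ []] := zP j.
have gm j : goodp (m0 p) (m1 p) (k (m j)) (eta (k (m j)) om) by have [_ _ []] := zP j.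
have [_ [w [vw wfin Hw]]] := good_limit alpha1 chi0 chi_le n0 nJ' cn gn (along_cvg nj cv).
have [_ [w' [vw' _ Hw']]] := good_limit alpha1 chi0 chi_le m_0 mJ' cm gm (along_cvg mj cv).
pose c : R := 2 `^ alpha; have c0 : 0 < c by rewrite powR_gt0.
have r0 : 0 < half p / c / 2 by rewrite !divr_gt0.
have [J1 H1] := Hw _ r0; have [J2 H2] := Hw' _ r0; pose j := maxn J1 J2.
have [_ _ [_ _ _ _ ]] := zP j; rewrite ltNge => /negP; apply.
have mw := vw.1; have mw' := vw'.1.
have mFn := measurable_path_fun (n0 j) (chi0 (k (n j))) (cn j).
have mFm := measurable_path_fun (m_0 j) (chi0 (k (m j))) (cm j).
have al0 : 0 < alpha by rewrite (lt_trans _ alpha1).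
apply: le_trans (Lp_triangle (spacetime_measure d tf) al0 mFn mw mFm) _.
have E : (\int[spacetime_measure d tf]_z (`|w z - F (k (m j)) om z| `^ alpha)%:E =
    pdist (F (k (m j)) om) w')%E.
  rewrite power_dist_sym; apply: (power_dist_ae_eq (R := R)) => //; first exact: version_unique vw vw'.
  exact: ae_eq_refl.
rewrite E; apply: (@le_trans _ _ (c%:E * ((half p / c / 2)%:E + (half p / c / 2)%:E))%E).
  rewrite lee_wpmul2l ?lee_fin ?(ltW c0)//; apply: leeD.
    exact: (H1 j (leq_maxl _ _)).
  exact: (H2 j (leq_maxr _ _)).
by rewrite -EFinD -splitr -EFinM mulrC divfK ?gt_eqF.
Qed.

Let indic_integral (A : set Omega) : measurable A -> (\int[Q]_o (\1_A o)%:E = Q A)%E.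
Proof. by move=> mA; rewrite integral_indic// setIT. Qed.

Let mI (A : set Omega) : measurable A -> measurable_fun setT (fun o => (\1_A o)%:E : \bar R).
Proof. by move=> mA; apply/measurable_EFinP; exact: measurable_indic. Qed.

Let I0 (A : set Omega) om : (0 <= (\1_A om)%:E :> \bar R)%E. Proof. by rewrite lee_fin. Qed.

Let eventually_out (A : nat -> set Omega) om : evanescent (fun n => (\1_(A n) om)%:E : \bar R) ->
  exists J, forall n, (J <= n)%N -> ~ A n om.
Proof.
move=> H; have [J HJ] := H (2^-1) ltac:(by rewrite invr_gt0); exists J => n /HJ + An.
by rewrite indicE mem_set//= lee_fin leNgt invf_lt1// ltr1n.
Qed.

Let B_small p (r : R) : 0 < r -> exists J, forall j, (J <= j)%N -> (Q (B p j) <= r%:E)%E.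
Proof.
move=> r0; have Qfin : (Q setT < +oo)%E by rewrite probability_setT ltry.
have [|||J HJ] := @bounded_convergence _ _ _ Q (fun j o => (\1_(B p j) o)%:E) 1 Qfin (fun j => mI (mB p j)) _ _ _ r r0.
- by move=> j om; exact: I0.
- by move=> j om; rewrite lee_fin indicE; case: (_ \in _).
- apply: ae_imp conv _ => om cv e e0; have [J HJ] := leaves p cv; exists J => j Jj.
  by rewrite indicE memNset ?lee_fin ?(ltW e0)// => /(B_le Jj).
- by exists J => j /HJ; rewrite indic_integral.
Qed.

(** [good_limit] asks for one level along the whole sequence. Outside [C q] infinitely many indices
    are good at level [q], which provides such a sequence. *)
Let C q : set Omega := \bigcup_n \bigcap_(m in [set m | (n <= m)%N]) ~` G q m.+1.

Let mC q : measurable (C q).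
Proof.
apply: bigcupT_measurable => n; apply: bigcap_measurable; first by exists n => /=.
by move=> m _; apply: measurableC; exact: mG.
Qed.

Let C_small q : (Q (C q) <= (half q)%:E)%E.
Proof.
pose I n : set Omega := \bigcap_(m in [set m | (n <= m)%N]) ~` G q m.+1.
have mIn n : measurable (I n).
  apply: bigcap_measurable; first by exists n => /=.
  by move=> m _; apply: measurableC; exact: mG.
rewrite -indic_integral//.
apply: (@fatou_le _ _ _ Q (fun n => \1_(I n))).
- by move=> n; exact: measurable_indic.
- exact: measurable_indic.
- by move=> n om.
- apply: nearW => om; have [Co|nC] := pselect (C q om).
    have [n _ In] := Co; apply: cvg_near_cst; exists n => // m /= nm.
    rewrite !indicE !mem_set// => l /= ml; apply: In => /=; exact: leq_trans ml.
  apply: cvg_near_cst; apply: nearW => n; rewrite !indicE !memNset//.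
  by move=> In; apply: nC; exists n.
- apply: nearW => n; rewrite indic_integral//.
  pose m := maxn n (J0 q).
  apply: (@le_trans _ _ (Q (~` G q m.+1))).
    apply: le_measure; rewrite ?inE//; first by apply: measurableC; exact: mG.
    by move=> om In; apply: In => /=; exact: leq_maxl.
  apply: bad_le; apply: leq_trans (kn _); apply: leq_trans (leq_maxr n _) _; exact: leqnSn.
Qed.

(** Along [j] the [p]-th path is good at the varying level [p], so [good_limit] does not apply to
    it. For p >= q it is compared with a far index that is good at a fixed level [q]: outside
    [B p (j p)] the two are close, and the paths of level [q] converge. *)
Lemma subsequence_converges : almost_sure_limit.
Proof.
have [|j jh jP] := @strict_subsequence (fun p j => [/\ (0 < j)%N, (J0 p <= j)%N & (Q (B p j) <= (half p)%:E)%E]).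
  move=> p; have [J HJ] := B_small p (half0 p); exists (maxn 1 (maxn J (J0 p))) => i.
  by rewrite !geq_max => /and3P[h1 h2 h3]; split => //; exact: HJ.
exists j => //.
have j0 p : (0 < j p)%N by have [] := jP p (j p) (leqnn _).
have aeB := summable_ae (mu := Q) (fun p => mI (mB p (j p))) (fun p om => I0 (B p (j p)) om).
have {}aeB := aeB (fun p => ltac:(rewrite indic_integral//; by have [] := jP p (j p) (leqnn _))).
have mGc p : measurable (~` G p (j p)) by apply: measurableC; exact: mG.
have aeG := summable_ae (mu := Q) (fun p => mI (mGc p)) (fun p om => I0 (~` G p (j p)) om).
have {}aeG := aeG (fun p => ltac:(rewrite indic_integral//; apply: bad_le; have [_ h _] := jP p (j p) (leqnn _);
  exact: leq_trans h (kn _))).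
have aeC := summable_ae (mu := Q) (fun q => mI (mC q)) (fun q om => I0 (C q) om).
have {}aeC := aeC (fun q => ltac:(rewrite indic_integral//; exact: C_small)).
have ae1 := ae_imp2 aeB aeG (fun o => @conj _ _); have ae2 := ae_imp2 aeC conv (fun o => @conj _ _).
apply: ae_imp2 ae1 ae2 _ => om [hB hG] [hC cv].
have [pB HB] := eventually_out hB; have [pG HG] := eventually_out hG.
have [q Hq] := eventually_out hC; have {}Hq := Hq q (leqnn q).
have /choice[n nP] : forall i : nat, exists n, (i < n)%N /\ G q n om.
  move=> i; apply: contrapT => ni; apply: Hq; exists i => // m /= im Gm.
  by apply: ni; exists m.+1; split => //; rewrite ltnS.
have ni i : (i < n i)%N by have [] := nP i.
have [n0 nJ] := along ni.
have cn i := ceta (n0 i) om.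
have gn i : goodp (m0 q) (m1 q) (k (n i)) (eta (k (n i)) om) by have [] := nP i.
have [_ [w0 [vw0 w0fin Hw]]] := good_limit alpha1 chi0 chi_le n0 nJ cn gn (along_cvg ni cv).
have cj p := ceta (k0 (j0 p)) om.
have /choice[f fP] : forall p, exists f : L, version (eta (k (j p)) om : path) f.
  by move=> p; have [f vf _] := config_path_Lalpha alpha1 (k0 (j0 p)) (chi0 _) (cj p); exists f.
have [w wE] := Lalpha_ex alpha1 vw0.1 w0fin.
have vw : version (xi om : path) w.
  apply: (version_ae_eq (Lalpha_measurable w) vw0).
  by apply: filterS wE => z E zD; rewrite E.
exists f, w; split => //.
have al0 : 0 < alpha by rewrite (lt_trans _ alpha1).
pose c : R := 2 `^ alpha; have c0 : 0 < c by rewrite powR_gt0.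
have mF p := measurable_path_fun (k0 (j0 p)) (chi0 (k (j p))) (cj p).
have close p : (pB <= p)%N -> (pG <= p)%N -> (q <= p)%N ->
    (pdist (F (k (j p)) om) w0 <= (c * (half p + half p))%:E)%E.
  move=> Bp Gp qp; have [I HI] := Hw _ (half0 p); pose i := maxn I (j p).
  have mFi := measurable_path_fun (n0 i) (chi0 (k (n i))) (cn i).
  apply: le_trans (Lp_triangle (spacetime_measure d tf) al0 (mF p) mFi vw0.1) _.
  rewrite EFinM lee_wpmul2l ?lee_fin ?(ltW c0)// EFinD; apply: leeD; last exact: (HI i (leq_maxl _ _)).
  rewrite leNgt; apply/negP => H; apply: (HB p Bp); exists (j p, n i) => //=.
  rewrite leqnn (leq_trans (leq_maxr I _) (ltnW (ni i)))/=; split => //.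
  - exact: leq_ltn_trans (ni i).
  - by apply: contrapT => nG; exact: (HG p Gp).
  - by apply: (G_le qp); exact: gn.
apply: evanescent_cvg => [p|e e0]; first by rewrite Lalpha_distE powR_ge0.
have r0 : 0 < e `^ alpha / c / 2 by rewrite !divr_gt0// powR_gt0.
exists (maxn (maxn pB pG) (maxn q (Num.truncn (e `^ alpha / c / 2)^-1))) => p.
rewrite !geq_max => /andP[/andP[h1 h2] /andP[h3 h4]].
rewrite lee_fin; apply: Lalpha_dist_le; first exact: ltW.
have -> : power_dist tf alpha (f p) w = pdist (F (k (j p)) om) w0.
  apply: (power_dist_ae_eq (R := R)) => //; [exact: Lalpha_measurable|exact: Lalpha_measurable|exact: vw0.1|].
  exact: version_unique (fP p) (path_version (k0 (j0 p)) (chi0 _) (cj p)).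
apply: le_trans (close p h1 h2 h3) _; rewrite lee_fin mulrC -ler_pdivlMr//.
by have := half_le r0 h4; lra.
Qed.

End levels.

Lemma almost_sure_subsequence : almost_sure_limit.
Proof.
have /choice[M MP] : forall p, exists M : R * R * nat, forall N, (M.2 <= N)%N ->
    (0 < N)%N /\ (Q [set o | ~ goodp M.1.1 M.1.2 N (eta N o)] <= (half p)%:E)%E.
  by move=> p; have [M0 [M1 [J H]]] := bad (half0 p); exists (M0, M1, J).
(* Partial sums of absolute values make the levels increase with [p]. *)
pose m0 p : R := \sum_(i < p.+1) `|(M i).1.1|; pose m1 p : R := \sum_(i < p.+1) `|(M i).1.2|.
have mono (h : nat -> R) : (forall i, 0 <= h i) -> forall p q, (p <= q)%N ->
    \sum_(i < p.+1) h i <= \sum_(i < q.+1) h i.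
  move=> h0 p q pq; rewrite -(subnK pq) addnC -addSn big_split_ord/= lerDl sumr_ge0//.
have le1 (h : nat -> R) p : h p <= \sum_(i < p.+1) `|h i|.
  by rewrite big_ord_recr/= ler_wpDl ?sumr_ge0// ler_norm.
apply: (@subsequence_converges m0 m1 (fun p => (M p).2)).
- by move=> p q pq; exact: (mono (fun i => `|(M i).1.1|)).
- by move=> p q pq; exact: (mono (fun i => `|(M i).1.2|)).
move=> p N JN; have [N0 H] := MP p N JN; apply: le_trans H; apply: le_measure; rewrite ?inE.
- have H := rel_measurableC (good_measurable alpha tf delta N0 (chi0 N) (m0 p) (m1 p)).
  exact: (rel_measurable_preimage (ceta N0) H).
- have H := rel_measurableC (good_measurable alpha tf delta N0 (chi0 N) (M p).1.1 (M p).1.2).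
  exact: (rel_measurable_preimage (ceta N0) H).
move=> om; apply: contra_not; apply: good_le.
- exact: (le1 (fun i => (M i).1.1)).
- exact: (le1 (fun i => (M i).1.2)).
Qed.

End almost_sure_convergence.

Theorem theorem3 (R : realType) (d : nat) (d_gt0 : (0 < d)%N)
    (alpha : R) (alpha_gt1 : 1 < alpha) (tf : {posnum R})
    (chi : nat -> R) (chi_gt0 : forall N, 0 < chi N)
    (delta : weak_star_metric R d)
    (disp : measure_display) (Omega : measurableType disp)
    (P : probability Omega R)
    (eta : nat -> {mfun Omega >-> skorokhod_space tf delta})
    (chi_bounded : exists M : R, forall N,
      N%:R ^+ 2 * chi N `^ Num.min 1 (alpha / 2) <= M)
    (eta_zrp : forall N, (0 < N)%N ->
      zero_range_process N alpha (chi N) P (eta N))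
    (eta_initial : forall gamma : R, gamma < alpha ->
      (limn_esup (fun N => (chi N / N%:R ^+ d)%:E *
        lne (\int[P]_omega expeR ((N%:R ^+ d / chi N * gamma)%:E *
               entropy ((eta N omega : cadlag_path tf delta) (time0 tf)))))
       < +oo)%E) :
  [/\ forall u : cadlag_path tf delta, regular_path alpha u ->
        exists2 w : Lalpha d tf alpha_gt1, version u w &
          forall V : set (Lalpha d tf alpha_gt1), Lalpha_open V -> V w ->
          forall z : R, exists U : set (cadlag_path tf delta),
            [/\ skorokhod_open U, U u &
              (limn_esup (fun N => (chi N / N%:R ^+ d)%:E *
                 lne (P [set omega | U (eta N omega) /\
                           ~ (exists2 f : Lalpha d tf alpha_gt1,
                                version (eta N omega : cadlag_path tf delta) f &
                                V f)]))
               <= (- z)%:E)%E],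
      forall u : cadlag_path tf delta, ~ regular_path alpha u ->
        forall z : R, exists U : set (cadlag_path tf delta),
          [/\ skorokhod_open U, U u &
            (limn_esup (fun N => (chi N / N%:R ^+ d)%:E *
               lne (P [set omega | U (eta N omega)])) <= (- z)%:E)%E] &
      forall Q : probability Omega R,
        (limn_esup (fun N => (chi N / N%:R ^+ d)%:E *
           relative_entropy (distribution Q (eta N)) (distribution P (eta N)))
         < +oo)%E ->
        forall (k : nat -> nat)
               (xi : {mfun Omega >-> skorokhod_space tf delta}),
          {homo k : m n / (m < n)%N} ->
          {ae Q, forall omega,
            skorokhod_dist (eta (k n) omega) (xi omega) @[n --> \oo]
              --> (0 : R)} ->
          exists2 j : nat -> nat, {homo j : m n / (m < n)%N} &
            {ae Q, forall omega,
              exists (f : nat -> Lalpha d tf alpha_gt1)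
                     (w : Lalpha d tf alpha_gt1),
                [/\ forall n,
                      version (eta (k (j n)) omega : cadlag_path tf delta) (f n),
                    version (xi omega : cadlag_path tf delta) w &
                    Lalpha_dist (f n) w @[n --> \oo] --> (0 : R)]}].
Proof.
have [Mchi chi_le] := chi_bounded; split.
- exact: (regular_estimate d_gt0 alpha_gt1 chi_gt0 chi_le eta_zrp eta_initial).
- exact: (irregular_estimate d_gt0 alpha_gt1 chi_gt0 chi_le eta_zrp eta_initial).
move=> Q HQ k xi kh conv.
have ceta N (N0 : (0 < N)%N) := config_path_zrp (eta_zrp N N0).
have bad := entropy_bad_probability d_gt0 alpha_gt1 chi_gt0 chi_le eta_zrp eta_initial HQ.
exact: (almost_sure_subsequence alpha_gt1 chi_gt0 chi_le ceta bad kh conv).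
Qed.
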